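(* Let $\lambda\ge 0$ be real, let $L\ge 0$ be an integer, and let $\beta\in\mathbb{C}$ with $\operatorname{Re}\beta>0$ and $\beta\notin\{\lambda+1,\lambda+2,\lambda+3,\dots\}$. Let $\widetilde{\Phi}^{(\beta)}_L(z,\bar z;\lambda)$ be the normalized conformal $L$-loop four-point ladder function in dimension $D=2\lambda+2$ (given by the series representation in the context), and let $R_d=\frac{1}{z-\bar z}\left(z\partial_z-\bar z\partial_{\bar z}\right)$. Then for all $z\in\mathbb{C}$ with $z\neq\bar z$ and $|z|\neq 1$, $$R_d\,\widetilde{\Phi}^{(\beta)}_L(z,\bar z;\lambda)=\widetilde{\Phi}^{(\beta)}_L(z,\bar z;\lambda+1).$$ That is, $R_d$ maps the expression for the conformal $L$-loop four-point ladder integral in dimension $D$ to the one in dimension $D+2$.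
   Context: Here $\bar z$ is the complex conjugate of $z$, and $\partial_z,\partial_{\bar z}$ are the Wirtinger derivatives (i.e. $z,\bar z$ are treated as independent variables under differentiation). For integers $n\ge0$ put $$\tau_{n,\nu}(\beta;\lambda)=4^\beta\,\frac{\Gamma\left(\frac{\lambda+n+1}{2}+\beta-i\nu\right)}{\Gamma\left(\frac{\lambda+n+1}{2}-\beta+i\nu\right)}\,\frac{\Gamma\left(\frac{\lambda+n+1}{2}+i\nu\right)}{\Gamma\left(\frac{\lambda+n+1}{2}-i\nu\right)} .$$ $C_n^{(\lambda)}$ denotes the Gegenbauer polynomial, $\sum_{n\ge0}C_n^{(\lambda)}(r)t^n=(1-2rt+t^2)^{-\lambda}$ for $\lambda>0$. The ladder function is defined, for $\lambda>0$, by $$\widetilde{\Phi}^{(\beta)}_L(z,\bar z;\lambda)=\frac{\Gamma(\lambda)}{(z\bar z)^{\lambda/2}}\sum_{n=0}^\infty (n+\lambda)\,C_n^{(\lambda)}\!\left(\frac{z+\bar z}{2\sqrt{z\bar z}}\right)\int_{\mathcal{C}_n}d\nu\,\frac{(z\bar z)^{i\nu}}{[\tau_{n,\nu}(\beta;\lambda)]^{L+1}},$$ and for $\lambda=0$ by $$\widetilde{\Phi}^{(\beta)}_L(z,\bar z;0)=\int_{\mathcal{C}_0}d\nu\,\frac{(z\bar z)^{i\nu}}{[\tau_{0,\nu}(\beta;0)]^{L+1}}+\sum_{n=1}^\infty(z^n+\bar z^n)\int_{\mathcal{C}_n}d\nu\,\frac{(z\bar z)^{i\nu-n/2}}{[\tau_{n,\nu}(\beta;0)]^{L+1}}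 .$$ The contour $\mathcal{C}_n$ runs from $-\infty$ to $+\infty$, coincides with the real axis outside a compact set, and separates the two series of points $\nu=i\left(\frac{\lambda+n+1}{2}-\beta\right)+ik$ (which lie above it) and $\nu=-i\,\frac{\lambda+n+1}{2}-ik$ (which lie below it), $k=0,1,2,\dots$; for small $\operatorname{Re}\beta$ (with $\lambda+1>2\operatorname{Re}\beta$) it is the real line itself. Integrals that are not absolutely convergent are understood as improper integrals. *)

(* Defs.v *)
From Stdlib Require Import Reals Factorial List.
From Coquelicot Require Import Coquelicot.
Open Scope R_scope.

(* [C] is [R * R], with [(x, y) : C] denoting x + i y; division by zero yields
   zero in both [R] and [C]. *)

Definition Cexp (z : C) : C := (exp (Re z) * cos (Im z), exp (Re z) * sin (Im z)).

(* x ^ s for a base x > 0 and a complex exponent s. *)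
Definition Rcpow (x : R) (s : C) : C := Cexp (s * RtoC (ln x)).

Definition CLim_seq (u : nat -> C) : C :=
  (real (Lim_seq (fun n => Re (u n))), real (Lim_seq (fun n => Im (u n)))).

Definition CSeries (a : nat -> C) : C :=
  (Series (fun n => Re (a n)), Series (fun n => Im (a n))).

(* s (s + 1) ... (s + n) *)
Fixpoint rising (s : C) (n : nat) : C :=
  match n with
  | O => s
  | S m => Cmult (rising s m) (Cplus s (RtoC (INR n)))
  end.

(* Gauss's product for the Gamma function on the whole plane.  At the poles
   0, -1, -2, ... the denominators eventually vanish, so that CGamma and
   1 / CGamma are both 0 there; the latter is the true value of 1 / Gamma. *)
Definition CGamma (s : C) : C :=
  CLim_seq (fun n => (RtoC (INR (fact n)) * Rcpow (INR n) s / rising s n)%C).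

(* C_n^(lambda)(r), the coefficient of t^n in (1 - 2 r t + t^2)^(-lambda). *)
Definition gegenbauer (lambda : R) (n : nat) (r : R) : R :=
  Derive_n (fun t => Rpower (1 - 2 * r * t + t ^ 2) (- lambda)) n 0 / INR (fact n).

Definition tau (beta : C) (lambda : R) (n : nat) (nu : C) : C :=
  let a := RtoC ((lambda + INR n + 1) / 2) in
  (Rcpow 4 beta
   * (CGamma (a + beta - Ci * nu) / CGamma (a - beta + Ci * nu))
   * (CGamma (a + Ci * nu) / CGamma (a - Ci * nu)))%C.

Definition C1_path (g : R -> C) : Prop :=
  (forall t, ex_derive (V := C_R_NormedModule) g t) /\
  (forall t, continuous (Derive (fun s => Re (g s))) t) /\
  (forall t, continuous (Derive (fun s => Im (g s))) t).

(* Finitely many breakpoints; on each closed interval without breakpoints in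
   its interior the path is the restriction of a C^1 path. *)
Definition piecewise_C1 (g : R -> C) : Prop :=
  (forall t, continuous (U := C_UniformSpace) g t) /\
  exists l : list R, forall a b : R, a < b ->
    (forall c, In c l -> ~ (a < c < b)) ->
    exists h, C1_path h /\ (forall t, a <= t <= b -> g t = h t).

Definition path_velocity (g : R -> C) (t : R) : C :=
  (Derive (fun s => Re (g s)) t, Derive (fun s => Im (g s)) t).

(* A contour from -oo to +oo coinciding with the real axis outside a compact
   set, parametrized there by the real part. *)
Definition is_contour (g : R -> C) : Prop :=
  piecewise_C1 g /\ exists M : R, forall t, M <= Rabs t -> g t = RtoC t.

Definition joined_off (g : R -> C) (p q : C) : Prop :=
  exists s : R -> C,
    (forall u, continuous (U := C_UniformSpace) s u) /\ s 0 = p /\ s 1 = q /\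
    forall u t, 0 <= u <= 1 -> s u <> g t.

(* The point lies in the component of the complement of the contour that
   contains a whole upper, resp. lower, half-plane. *)
Definition lies_above (g : R -> C) (p : C) : Prop :=
  exists y : R, (forall t, Im (g t) < y) /\ joined_off g p (0, y).

Definition lies_below (g : R -> C) (p : C) : Prop :=
  exists y : R, (forall t, y < Im (g t)) /\ joined_off g p (0, y).

Definition admissible (beta : C) (lambda : R) (n : nat) (g : R -> C) : Prop :=
  let a := RtoC ((lambda + INR n + 1) / 2) in
  is_contour g /\
  (forall k : nat, lies_above g (Ci * (a - beta) + Ci * RtoC (INR k))%C) /\
  (forall k : nat, lies_below g (- (Ci * a) - Ci * RtoC (INR k))%C).

Definition along (g : R -> C) (f : C -> C) (t : R) : C :=
  (f (g t) * path_velocity g t)%C.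

(* Improper Riemann integrals: both ends tend to infinity independently. *)
Definition contour_integral (g : R -> C) (f : C -> C) : C :=
  RInt_gen (V := C_R_CompleteNormedModule) (along g f)
    (Rbar_locally m_infty) (Rbar_locally p_infty).

Definition ex_contour_integral (g : R -> C) (f : C -> C) : Prop :=
  ex_RInt_gen (V := C_R_NormedModule) (along g f)
    (Rbar_locally m_infty) (Rbar_locally p_infty).

Definition zzbar (z : C) : R := Re (z * Cconj z)%C.

(* The exponent of z zbar is i nu for lambda <> 0 and i nu - n/2 for lambda = 0. *)
Definition ladder_integrand (beta : C) (L : nat) (lambda : R) (n : nat) (z nu : C) : C :=
  let e := if Req_EM_T lambda 0 then (Ci * nu - RtoC (INR n / 2))%C else (Ci * nu)%C in
  (Rcpow (zzbar z) e / Cpow (tau beta lambda n nu) (L + 1))%C.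

Definition ladder_term (beta : C) (L : nat) (lambda : R) (c : nat -> R -> C)
    (z : C) (n : nat) : C :=
  let J := contour_integral (c n) (ladder_integrand beta L lambda n z) in
  if Req_EM_T lambda 0 then
    match n with
    | O => J
    | S _ => ((Cpow z n + Cpow (Cconj z) n) * J)%C
    end
  else
    let r := Re (z + Cconj z)%C / (2 * sqrt (zzbar z)) in
    (RtoC (INR n + lambda) * RtoC (gegenbauer lambda n r) * J)%C.

Definition ladder (beta : C) (L : nat) (lambda : R) (c : nat -> R -> C) (z : C) : C :=
  if Req_EM_T lambda 0 then
    (ladder_term beta L lambda c z 0
     + CSeries (fun m => ladder_term beta L lambda c z (S m)))%C
  else
    (CGamma (RtoC lambda) / RtoC (Rpower (zzbar z) (lambda / 2))
     * CSeries (ladder_term beta L lambda c z))%C.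

(* All the integrals and the series defining [ladder] converge at z. *)
Definition ladder_converges (beta : C) (L : nat) (lambda : R) (c : nat -> R -> C)
    (z : C) : Prop :=
  (forall n, ex_contour_integral (c n) (ladder_integrand beta L lambda n z)) /\
  ex_series (V := C_R_NormedModule) (ladder_term beta L lambda c z).

Definition Dx (f : C -> C) (z : C) : C :=
  (Derive (fun x => Re (f (x, Im z))) (Re z), Derive (fun x => Im (f (x, Im z))) (Re z)).

Definition Dy (f : C -> C) (z : C) : C :=
  (Derive (fun y => Re (f (Re z, y))) (Im z), Derive (fun y => Im (f (Re z, y))) (Im z)).

Definition ex_partials (f : C -> C) (z : C) : Prop :=
  ex_derive (V := C_R_NormedModule) (fun x : R => f (x, Im z)) (Re z) /\
  ex_derive (V := C_R_NormedModule) (fun y : R => f (Re z, y)) (Im z).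

Definition wirtinger_z (f : C -> C) (z : C) : C := ((Dx f z - Ci * Dy f z) / 2)%C.

Definition wirtinger_zbar (f : C -> C) (z : C) : C := ((Dx f z + Ci * Dy f z) / 2)%C.

Definition Rd (f : C -> C) (z : C) : C :=
  (/ (z - Cconj z) * (z * wirtinger_z f z - Cconj z * wirtinger_zbar f z))%C.

(* Main.v *)
(* Write l = ln (z zbar) and z = |z| u.  The n-th term of the ladder function is a factor depending
   on u only times an integral J_n(l).  The operator z d/dz - zbar d/dzbar annihilates every function
   of z zbar, and on the angular factor (a Gegenbauer polynomial, or u^n + ubar^n when lambda = 0) it
   gives (u - ubar) times a constant times the Gegenbauer polynomial of parameter lambda + 1 and degree
   n - 1.  Since tau depends on lambda and n only through lambda + n, this is term by term the ladder
   function for lambda + 1, once J_n is known not to depend on the contour.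

   For independence of the contour, Gamma (s) / Gamma (s + beta) is a locally uniform limit of rational
   functions of s, by Gauss's product.  The integral of a rational function over the difference of two
   contours vanishes by partial fractions, because both contours have the same winding number around
   every pole.

   For termwise differentiation, one lifts the real line to a contour of slope 1/4, or -1/4, according
   to the sign of l.  The Gamma quotients grow at most polynomially in the sector that is swept, so the
   integrand decays exponentially, and J_n together with its second-order remainder in l is O(r^n) with
   r < 1, while the angular factors grow subexponentially. *)
Require Import Defs.
From Stdlib Require Import Reals Lra Lia List Factorial FunctionalExtensionality IndefiniteDescription.
From Coquelicot Require Import Coquelicot.
Open Scope R_scope.
Set Bullet Behavior "Strict Subproofs".

(** * Complex-valued functions and integrals of a real variable *)

(** Cauchy's theorem is replaced by [balanced]: rational functions are compared by partial
    fractions, everything else by uniform limits. A route by which a pole escapes from one contour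
    may cross the other contour, so neither route shows directly that the winding numbers agree.
    Each contour is compared with a tent far out on the opposite side, which avoids both routes.

    The contours c n are arbitrary for each n, so no bound uniform in n can come from them. For
    large n the real line separates the poles and replaces c n; it is lifted by a/4 already at the
    origin, a = (lambda + n + 1)/2, and this produces r^n. The remaining n keep their own contours,
    lifted only where they are real.

    On the real axis the integrals may converge only conditionally. A contour and its lift are
    compared through a cut lift that descends at both ends; the descents contribute O(T^(-Re beta)).

    Limits are never interchanged: value, derivative and second-order remainder of each term share
    one constant ([quad_at]), and these constants are summed. *)

Notation Ccontinuous := (continuous (U := C_UniformSpace)).
Notation is_Cderive := (is_derive (V := C_R_NormedModule)).
Notation is_CRInt := (is_RInt (V := C_R_NormedModule)).
Notation ex_CRInt := (ex_RInt (V := C_R_NormedModule)).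

Lemma C_ext (a b : C) : Re a = Re b -> Im a = Im b -> a = b.
Proof. destruct a, b; simpl; intros; subst; reflexivity. Qed.

Lemma Cinv_0 : (/ 0)%C = 0%C.
Proof. apply C_ext; simpl; unfold Rdiv; ring. Qed.

(** Since / 0 = 0, inversion is multiplicative without side conditions. [inv_tau] needs this at
    points where a factor of [tau] is 0. *)
Lemma Cinv_mult_total (a b : C) : (/ (a * b))%C = (/ a * / b)%C.
Proof.
  destruct (Ceq_dec a 0) as [->|Ha].
  { rewrite Cmult_0_l, Cinv_0; ring. }
  destruct (Ceq_dec b 0) as [->|Hb].
  { rewrite Cmult_0_r, Cinv_0; ring. }
  field; split; assumption.
Qed.

Lemma Cinv_inv_total (a : C) : (/ / a)%C = a.
Proof.
  destruct (Ceq_dec a 0) as [->|Ha]; [now rewrite !Cinv_0|].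
  field. assumption.
Qed.

Lemma Cpow_inv_total (a : C) (n : nat) : (/ (a ^ n))%C = ((/ a) ^ n)%C.
Proof.
  induction n as [|n IH]; simpl.
  - field.
  - now rewrite Cinv_mult_total, IH.
Qed.

Lemma Cmod_inv_total (a : C) : Cmod (/ a) = / Cmod a.
Proof.
  destruct (Ceq_dec a 0) as [->|Ha]; [rewrite Cinv_0, Cmod_0, Rinv_0; reflexivity|].
  now apply Cmod_inv.
Qed.

Lemma Cmod_sub_sym (a b : C) : Cmod (a - b) = Cmod (b - a).
Proof. rewrite <- Cmod_opp. f_equal. ring. Qed.

Lemma Cmod_sub_triangle (a b c : C) : Cmod (a - c) <= Cmod (a - b) + Cmod (b - c).
Proof. replace (a - c)%C with ((a - b) + (b - c))%C by ring. apply Cmod_triangle. Qed.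

Lemma Cmod_sub_ge (a b : C) : Cmod a - Cmod b <= Cmod (a - b).
Proof.
  pose proof (Cmod_triangle (a - b) b). replace (a - b + b)%C with a in H by ring. lra.
Qed.

Lemma Cmod_add_ge (a b : C) : Cmod a - Cmod b <= Cmod (a + b).
Proof.
  pose proof (Cmod_sub_ge a (- b)). rewrite Cmod_opp in H.
  replace (a - - b)%C with (a + b)%C in H by ring. lra.
Qed.

Lemma Cmod_sub_eq_0 (a b : C) : Cmod (a - b) = 0 -> a = b.
Proof.
  intros H. apply Cmod_eq_0 in H. replace a with ((a - b) + b)%C by ring. rewrite H. ring.
Qed.

Lemma C_le_eq (a b : C) : (forall eps, 0 < eps -> Cmod (a - b) <= eps) -> a = b.
Proof.
  intros H. apply Cmod_sub_eq_0. apply Rle_antisym; [|apply Cmod_ge_0].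
  apply le_epsilon. intros e He. rewrite Rplus_0_l. now apply H.
Qed.

Lemma Im_le_Cmod (c : C) : Rabs (Im c) <= Cmod c.
Proof. apply (Rle_trans _ _ _ (Rmax_r _ _) (Rmax_Cmod c)). Qed.

Lemma Re_le_Cmod' (c : C) : Rabs (Re c) <= Cmod c.
Proof. apply (Rle_trans _ _ _ (Rmax_l _ _) (Rmax_Cmod c)). Qed.

Lemma Cmod_le_abs (c : C) : Cmod c <= Rabs (Re c) + Rabs (Im c).
Proof.
  assert (E : c = (RtoC (Re c) + Ci * RtoC (Im c))%C)
    by (apply C_ext; unfold Re, Im; simpl; ring).
  rewrite E at 1.
  eapply Rle_trans; [apply Cmod_triangle|].
  rewrite Cmod_mult, Cmod_Ci, !Cmod_R. lra.
Qed.

Lemma Cmod_sqr (c : C) : Cmod c * Cmod c = Re c * Re c + Im c * Im c.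
Proof. pose proof (Cmod2_alt c). simpl in H. nra. Qed.

Lemma norm_Cmod (x : C) : norm (V := C_R_NormedModule) x = Cmod x.
Proof.
  unfold norm, Cmod; simpl. unfold prod_norm, norm; simpl. unfold abs; simpl.
  f_equal. rewrite !Rmult_1_r, <- !Rabs_mult.
  rewrite !Rabs_pos_eq; [reflexivity| |]; apply Rle_0_sqr.
Qed.

Lemma Cexp_add (a b : C) : Cexp (a + b) = (Cexp a * Cexp b)%C.
Proof.
  apply C_ext; unfold Cexp, Re, Im; simpl; rewrite exp_plus;
  [rewrite cos_plus | rewrite sin_plus]; ring.
Qed.

Lemma Cexp_0 : Cexp 0 = 1%C.
Proof. apply C_ext; unfold Cexp, Re, Im; simpl; rewrite exp_0, ?cos_0, ?sin_0; ring. Qed.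

Lemma Cmod_Cexp (a : C) : Cmod (Cexp a) = exp (Re a).
Proof.
  pose proof (exp_pos (Re a)).
  assert (E : Cmod (Cexp a) * Cmod (Cexp a) = exp (Re a) * exp (Re a)).
  { rewrite Cmod_sqr. unfold Cexp, Re, Im; simpl.
    transitivity (exp (fst a) * exp (fst a) * (Rsqr (sin (snd a)) + Rsqr (cos (snd a)))).
    - unfold Rsqr; ring.
    - rewrite sin2_cos2; ring. }
  pose proof (Cmod_ge_0 (Cexp a)). nra.
Qed.

Lemma Cexp_neq_0 (a : C) : Cexp a <> 0%C.
Proof.
  intros H. pose proof (Cmod_Cexp a). rewrite H, Cmod_0 in H0.
  pose proof (exp_pos (Re a)). lra.
Qed.

Lemma Cexp_opp (a : C) : Cexp (- a) = (/ Cexp a)%C.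
Proof.
  assert (H : (Cexp (- a) * Cexp a)%C = 1%C).
  { rewrite <- Cexp_add. replace (- a + a)%C with (RtoC 0) by ring. apply Cexp_0. }
  transitivity (Cexp (- a) * (Cexp a * / Cexp a))%C.
  - rewrite Cinv_r by apply Cexp_neq_0. ring.
  - rewrite Cmult_assoc, H. ring.
Qed.

Lemma Cexp_R (x : R) : Cexp (RtoC x) = RtoC (exp x).
Proof. apply C_ext; unfold Cexp, Re, Im; simpl; rewrite ?cos_0, ?sin_0; ring. Qed.

Lemma Cexp_INR_mult (n : nat) (a : C) : Cexp (RtoC (INR n) * a) = (Cexp a ^ n)%C.
Proof.
  induction n as [|n IH].
  - simpl. replace (0 * a)%C with (RtoC 0) by ring. apply Cexp_0.
  - rewrite S_INR, RtoC_plus. replace ((RtoC (INR n) + 1) * a)%C with (a + RtoC (INR n) * a)%C by ring.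
    now rewrite Cexp_add, IH.
Qed.

Lemma is_derive_C (f : R -> C) (t : R) (l : C) :
  is_Cderive f t l <->
  is_derive (fun s => Re (f s)) t (Re l) /\ is_derive (fun s => Im (f s)) t (Im l).
Proof.
  split.
  - intros H. split.
    + apply (filterdiff_comp' (K:=R_AbsRing) (V:=C_R_NormedModule) (W:=R_NormedModule) f fst t (fun y => scal y l) fst H).
      apply filterdiff_linear. apply is_linear_fst.
    + apply (filterdiff_comp' (K:=R_AbsRing) (V:=C_R_NormedModule) (W:=R_NormedModule) f snd t (fun y => scal y l) snd H).
      apply filterdiff_linear. apply is_linear_snd.
  - intros [H1 H2].
    assert (E := filterdiff_comp'_2 (K:=R_AbsRing) (T:=R_NormedModule) (U:=R_NormedModule) (V:=R_NormedModule) (W:=C_R_NormedModule) (fun s => Re (f s)) (fun s => Im (f s)) (fun a b => (a, b)) t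
       (fun y => scal y (Re l)) (fun y => scal y (Im l)) (fun a b => (a,b)) H1 H2).
    eapply filterdiff_ext_lin.
    eapply filterdiff_ext. 2: apply E.
    intros; simpl. unfold Re, Im; now destruct (f y).
    2: intros; reflexivity.
    eapply filterdiff_ext_lin.
    + eapply filterdiff_ext. 2: apply filterdiff_id. now intros [].
    + now intros [].
Qed.

Lemma continuous_C {U : UniformSpace} (f : U -> C) (t : U) :
  Ccontinuous f t <->
  continuous (fun s => Re (f s)) t /\ continuous (fun s => Im (f s)) t.
Proof.
  split.
  - intros H; split.
    + apply (continuous_comp f fst t H). apply continuous_fst.
    + apply (continuous_comp f snd t H). apply continuous_snd.
  - intros [H1 H2].
    apply (continuous_ext (fun s => (Re (f s), Im (f s)))).
    intros; unfold Re, Im; now destruct (f x).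
    apply (continuous_comp_2 (fun s => Re (f s)) (fun s => Im (f s)) (fun a b => (a,b)) t H1 H2).
    apply (continuous_ext (fun x => x)); [now intros []|]. apply continuous_id.
Qed.

Lemma continuous_C_eps (f : R -> C) (t : R) :
  Ccontinuous f t <->
  (forall eps, 0 < eps -> exists d, 0 < d /\ forall s, Rabs (s - t) < d -> Cmod (f s - f t) < eps).
Proof.
  split.
  - intros H eps He.
    assert (H' := proj1 (filterlim_locally (F := locally t) f (f t)) H (mkposreal (eps/2) ltac:(lra))).
    destruct H' as [d Hd]. exists d; split; [apply cond_pos|].
    intros s Hs. specialize (Hd s Hs). destruct Hd as [Hd1 Hd2].
    eapply Rle_lt_trans; [apply Cmod_le_abs|].
    unfold ball in Hd1, Hd2; simpl in Hd1, Hd2; unfold AbsRing_ball, abs, minus, plus, opp in Hd1, Hd2; simpl in Hd1, Hd2.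
    unfold Re, Im, Cminus, Cplus, Copp; simpl. lra.
  - intros H. apply (proj2 (filterlim_locally (F := locally t) f (f t))).
    intros eps. destruct (H eps (cond_pos eps)) as [d [Hd Hs]].
    exists (mkposreal d Hd). intros s Hb.
    assert (Hb' : Cmod (f s - f t) < eps) by (apply Hs; exact Hb).
    split; unfold ball; simpl; unfold AbsRing_ball, abs, minus, plus, opp; simpl;
      eapply Rle_lt_trans; try apply Hb'.
    + apply (Re_le_Cmod' (f s - f t)).
    + apply (Im_le_Cmod (f s - f t)).
Qed.

Lemma continuous_Cplus {U : UniformSpace} (f g : U -> C) (t : U) :
  Ccontinuous f t -> Ccontinuous g t ->
  Ccontinuous (fun s => f s + g s)%C t.
Proof.
  rewrite !continuous_C. intros [H1 H2] [H3 H4]; split; simpl.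
  - now apply (continuous_plus (V := R_NormedModule)).
  - now apply (continuous_plus (V := R_NormedModule)).
Qed.

Lemma continuous_Copp {U : UniformSpace} (f : U -> C) (t : U) :
  Ccontinuous f t ->
  Ccontinuous (fun s => - f s)%C t.
Proof.
  rewrite !continuous_C. intros [H1 H2]; split; simpl;
  now apply (continuous_opp (V := R_NormedModule)).
Qed.

Lemma continuous_Cminus {U : UniformSpace} (f g : U -> C) (t : U) :
  Ccontinuous f t -> Ccontinuous g t ->
  Ccontinuous (fun s => f s - g s)%C t.
Proof. intros. apply continuous_Cplus; [assumption|]. now apply continuous_Copp. Qed.

Lemma continuous_Cmult {U : UniformSpace} (f g : U -> C) (t : U) :
  Ccontinuous f t -> Ccontinuous g t ->
  Ccontinuous (fun s => f s * g s)%C t.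
Proof.
  rewrite !continuous_C. intros [H1 H2] [H3 H4]; split; simpl.
  - apply (continuous_minus (V := R_NormedModule)); now apply (continuous_mult (K := R_AbsRing)).
  - apply (continuous_plus (V := R_NormedModule)); now apply (continuous_mult (K := R_AbsRing)).
Qed.

Lemma continuous_Cinv {U : UniformSpace} (f : U -> C) (t : U) :
  Ccontinuous f t -> f t <> 0%C ->
  Ccontinuous (fun s => / f s)%C t.
Proof.
  rewrite !continuous_C. intros [H1 H2] H0.
  assert (Hn : Re (f t) ^ 2 + Im (f t) ^ 2 <> 0).
  { intros E. apply H0. apply Cmod_eq_0. pose proof (Cmod2_alt (f t)). rewrite E in H.
    pose proof (Cmod_ge_0 (f t)). nra. }
  assert (Hd : continuous (fun s => / (Re (f s) ^ 2 + Im (f s) ^ 2)) t).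
  { apply (continuous_comp (fun s => (Re (f s) ^ 2 + Im (f s) ^ 2)) Rinv).
    - assert (Hsq : forall h : U -> R, continuous h t -> continuous (fun s => h s ^ 2) t).
      { intros h Hh. apply (continuous_ext (fun s => mult (h s) (h s))).
        - intros s. unfold mult; simpl. ring.
        - now apply (continuous_mult (K := R_AbsRing) h h). }
      exact (continuous_plus (V := R_NormedModule) _ _ t (Hsq _ H1) (Hsq _ H2)).
    - now apply continuous_Rinv. }
  split; simpl.
  - now apply (continuous_mult (K := R_AbsRing)).
  - apply (continuous_mult (K := R_AbsRing)); [|assumption].
    now apply (continuous_opp (V := R_NormedModule)).
Qed.

Lemma continuous_Cpow {U : UniformSpace} (f : U -> C) (n : nat) (t : U) :
  Ccontinuous f t ->
  Ccontinuous (fun s => f s ^ n)%C t.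
Proof.
  intros H; induction n; simpl.
  - apply continuous_const.
  - now apply continuous_Cmult.
Qed.

Lemma continuous_Cexp {U : UniformSpace} (f : U -> C) (t : U) :
  Ccontinuous f t ->
  Ccontinuous (fun s => Cexp (f s)) t.
Proof.
  rewrite !continuous_C. intros [H1 H2].
  assert (HE : continuous (fun s => exp (Re (f s))) t).
  { exact (continuous_comp (fun s => Re (f s)) exp t H1 (continuous_exp _)). }
  split.
  - exact (continuous_mult (K := R_AbsRing) (fun s => exp (Re (f s))) (fun s => cos (Im (f s))) t HE
      (continuous_comp (fun s => Im (f s)) cos t H2 (continuous_cos _))).
  - exact (continuous_mult (K := R_AbsRing) (fun s => exp (Re (f s))) (fun s => sin (Im (f s))) t HE
      (continuous_comp (fun s => Im (f s)) sin t H2 (continuous_sin _))).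
Qed.

Lemma is_derive_Cmult (f g : R -> C) (t : R) (df dg : C) :
  is_Cderive f t df -> is_Cderive g t dg ->
  is_Cderive (fun s => f s * g s)%C t (df * g t + f t * dg)%C.
Proof.
  rewrite !is_derive_C. intros [H1 H2] [H3 H4]; split; simpl.
  - eapply is_derive_ext; [intros; reflexivity|].
    evar_last.
    + apply (is_derive_minus (V := R_NormedModule)); apply (is_derive_mult (K := R_AbsRing)); try eassumption; intros; apply Rmult_comm.
    + unfold minus, plus, opp, mult; simpl. unfold Re, Im. ring.
  - evar_last.
    + apply (is_derive_plus (V := R_NormedModule)); apply (is_derive_mult (K := R_AbsRing)); try eassumption; intros; apply Rmult_comm.
    + unfold minus, plus, opp, mult; simpl. unfold Re, Im. ring.
Qed.

Lemma is_CRInt_components (f : R -> C) (a b : R) (l : C) :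
  is_CRInt f a b l <->
  is_RInt (fun t => Re (f t)) a b (Re l) /\ is_RInt (fun t => Im (f t)) a b (Im l).
Proof.
  split.
  - intros H; split.
    + apply (is_RInt_fct_extend_fst f a b l H).
    + apply (is_RInt_fct_extend_snd f a b l H).
  - intros [H1 H2]. destruct l as [lu lv].
    now apply (is_RInt_fct_extend_pair f a b lu lv).
Qed.

Lemma is_CRInt_plus (f g : R -> C) (a b : R) (lf lg : C) :
  is_CRInt f a b lf -> is_CRInt g a b lg ->
  is_CRInt (fun t => f t + g t)%C a b (lf + lg)%C.
Proof. apply (is_RInt_plus (V := C_R_NormedModule)). Qed.

Lemma is_CRInt_minus (f g : R -> C) (a b : R) (lf lg : C) :
  is_CRInt f a b lf -> is_CRInt g a b lg ->
  is_CRInt (fun t => f t - g t)%C a b (lf - lg)%C.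
Proof. apply (is_RInt_minus (V := C_R_NormedModule)). Qed.

Lemma is_CRInt_mult (c : C) (f : R -> C) (a b : R) (l : C) :
  is_CRInt f a b l -> is_CRInt (fun t => c * f t)%C a b (c * l)%C.
Proof.
  rewrite !is_CRInt_components. intros [H1 H2]. split; simpl.
  - apply (is_RInt_minus (V := R_NormedModule));
    now apply (is_RInt_scal (V := R_NormedModule)).
  - apply (is_RInt_plus (V := R_NormedModule));
    now apply (is_RInt_scal (V := R_NormedModule)).
Qed.

Lemma is_CRInt_Cmod_le (f : R -> C) (g : R -> R) (a b : R) (l : C) (m : R) :
  a <= b -> is_CRInt f a b l -> is_RInt g a b m ->
  (forall t, a <= t <= b -> Cmod (f t) <= g t) -> Cmod l <= m.
Proof.
  intros Hab Hf Hg Hle. rewrite <- norm_Cmod.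
  apply (norm_RInt_le (V := C_R_NormedModule) f g a b l m Hab); try assumption.
  intros t Ht. rewrite norm_Cmod. now apply Hle.
Qed.

Lemma is_CRInt_Cmod_le_const (f : R -> C) (a b : R) (l : C) (m : R) :
  a <= b -> is_CRInt f a b l ->
  (forall t, a <= t <= b -> Cmod (f t) <= m) -> Cmod l <= (b - a) * m.
Proof.
  intros Hab Hf Hle. rewrite <- norm_Cmod.
  apply (norm_RInt_le_const (V := C_R_NormedModule) f a b l m Hab); try assumption.
  intros t Ht. rewrite norm_Cmod. now apply Hle.
Qed.

Lemma is_CRInt_unique (f : R -> C) (a b : R) (l l' : C) :
  is_CRInt f a b l -> is_CRInt f a b l' -> l = l'.
Proof.
  intros H H'.
  rewrite <- (is_RInt_unique (V := C_R_CompleteNormedModule) f a b l H).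
  now apply (is_RInt_unique (V := C_R_CompleteNormedModule)).
Qed.

Lemma is_CRInt_Chasles (f : R -> C) (a b c : R) (l l' : C) :
  is_CRInt f a b l -> is_CRInt f b c l' -> is_CRInt f a c (l + l')%C.
Proof. apply (is_RInt_Chasles (V := C_R_NormedModule)). Qed.

Lemma is_CRInt_ext (f g : R -> C) (a b : R) (l : C) :
  a <= b -> (forall t, a < t < b -> f t = g t) -> is_CRInt f a b l -> is_CRInt g a b l.
Proof.
  intros Hab H. apply (is_RInt_ext (V := C_R_NormedModule)).
  rewrite Rmin_left, Rmax_right by assumption. assumption.
Qed.

Lemma is_CRInt_point (f : R -> C) (a : R) : is_CRInt f a a (RtoC 0).
Proof. apply (is_RInt_point (V := C_R_NormedModule)). Qed.

Lemma ex_CRInt_continuous (f : R -> C) (a b : R) :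
  a <= b -> (forall t, a <= t <= b -> Ccontinuous f t) -> ex_CRInt f a b.
Proof.
  intros Hab H. apply (ex_RInt_continuous (V := C_R_CompleteNormedModule)).
  rewrite Rmin_left, Rmax_right by assumption. assumption.
Qed.

Lemma is_CRInt_derive (F f : R -> C) (a b : R) :
  a <= b -> (forall t, a <= t <= b -> is_Cderive F t (f t)) ->
  (forall t, a <= t <= b -> Ccontinuous f t) ->
  is_CRInt f a b (F b - F a)%C.
Proof.
  intros Hab H1 H2. apply (is_RInt_derive (V := C_R_CompleteNormedModule) F f a b);
  rewrite Rmin_left, Rmax_right by assumption; assumption.
Qed.

Lemma is_Cderive_continuous (f : R -> C) (t : R) (l : C) :
  is_Cderive f t l -> Ccontinuous f t.
Proof.
  intros H. apply (ex_derive_continuous (K := R_AbsRing) (V := C_R_NormedModule)).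
  now exists l.
Qed.

(** * Taylor estimates for the complex exponential *)

Lemma exp_le (x y : R) : x <= y -> exp x <= exp y.
Proof. intros [H| ->]; [left; now apply exp_increasing|apply Rle_refl]. Qed.

Lemma is_derive_Cexp_line (w : C) (u : R) :
  is_Cderive (fun u => Cexp (RtoC u * w)) u (w * Cexp (RtoC u * w))%C.
Proof.
  apply is_derive_C. split; simpl; auto_derive; trivial; unfold Re, Im; simpl; unfold Rminus; ring.
Qed.

Lemma exp_Re_le (w : C) (u : R) : 0 <= u <= 1 -> exp (Re (RtoC u * w)) <= exp (Cmod w).
Proof.
  intros Hu. apply exp_le. simpl. pose proof (Re_le_Cmod' w).
  pose proof (Rle_abs (Re w)). pose proof (Cmod_ge_0 w). unfold Re in *. nra.
Qed.

(** exp w - 1 is the integral of w exp (u w) over 0 <= u <= 1, and |exp (u w)| <= exp |w| there. *)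
Lemma Cexp_sub_1_le (w : C) : Cmod (Cexp w - 1) <= Cmod w * exp (Cmod w).
Proof.
  assert (H : is_CRInt (fun u => w * Cexp (RtoC u * w))%C 0 1 (Cexp w - 1)%C).
  { replace (Cexp w - 1)%C with (Cexp (RtoC 1 * w) - Cexp (RtoC 0 * w))%C.
    2:{ rewrite Cmult_1_l, Cmult_0_l, Cexp_0. reflexivity. }
    apply (is_CRInt_derive (fun u => Cexp (RtoC u * w))); [lra| |].
    - intros; apply is_derive_Cexp_line.
    - intros. apply continuous_Cmult; [apply continuous_const|].
      eapply is_Cderive_continuous, is_derive_Cexp_line. }
  replace (Cmod w * exp (Cmod w)) with ((1 - 0) * (Cmod w * exp (Cmod w))) by ring.
  apply (is_CRInt_Cmod_le_const _ 0 1 _ _ ltac:(lra) H).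
  intros t Ht. rewrite Cmod_mult, Cmod_Cexp.
  apply Rmult_le_compat_l; [apply Cmod_ge_0|]. now apply exp_Re_le.
Qed.

(** The same integral representation with the integrand w (exp (u w) - 1), which [Cexp_sub_1_le]
    bounds. The factor 1/2 of Taylor's formula is given up. *)
Lemma Cexp_sub_1_sub_le (w : C) : Cmod (Cexp w - 1 - w) <= Cmod w ^ 2 * exp (Cmod w).
Proof.
  assert (H : is_CRInt (fun u => w * Cexp (RtoC u * w) - w)%C 0 1 (Cexp w - 1 - w)%C).
  { replace (Cexp w - 1 - w)%C with
      ((Cexp (RtoC 1 * w) - RtoC 1 * w) - (Cexp (RtoC 0 * w) - RtoC 0 * w))%C.
    2:{ rewrite Cmult_1_l, Cmult_0_l, Cexp_0. ring. }
    apply (is_CRInt_derive (fun u => Cexp (RtoC u * w) - RtoC u * w)%C); [lra| |].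
    - intros. apply (is_derive_minus (V := C_R_NormedModule)).
      + apply is_derive_Cexp_line.
      + apply is_derive_C; split; simpl; auto_derive; trivial; unfold Re, Im; simpl; unfold Rminus; ring.
    - intros. apply continuous_Cminus; [|apply continuous_const].
      apply continuous_Cmult; [apply continuous_const|].
      eapply is_Cderive_continuous, is_derive_Cexp_line. }
  replace (Cmod w ^ 2 * exp (Cmod w)) with ((1 - 0) * (Cmod w * (Cmod w * exp (Cmod w)))) by ring.
  apply (is_CRInt_Cmod_le_const _ 0 1 _ _ ltac:(lra) H).
  intros t Ht. replace (w * Cexp (t * w) - w)%C with (w * (Cexp (t * w) - 1))%C by ring.
  rewrite Cmod_mult.
  apply Rmult_le_compat_l; [apply Cmod_ge_0|].
  eapply Rle_trans; [apply Cexp_sub_1_le|].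
  assert (Cmod (t * w) <= Cmod w).
  { rewrite Cmod_mult, Cmod_R, Rabs_pos_eq by lra. pose proof (Cmod_ge_0 w). nra. }
  apply Rmult_le_compat; try apply Cmod_ge_0; try assumption.
  - left; apply exp_pos.
  - now apply exp_le.
Qed.

(** a^(n+1) - b^(n+1) = a (a^n - b^n) + (a - b) b^n. With 1 <= r the exponent n may stand in place
    of n - 1. *)
Lemma Cpow_sub_le (a b : C) (r : R) (n : nat) :
  1 <= r -> Cmod a <= r -> Cmod b <= r ->
  Cmod (a ^ n - b ^ n) <= INR n * r ^ n * Cmod (a - b).
Proof.
  intros Hr Ha Hb. induction n as [|n IH].
  - simpl. replace (1 - 1)%C with (RtoC 0) by ring. rewrite Cmod_0. lra.
  - rewrite S_INR. simpl.
    replace (a * a ^ n - b * b ^ n)%C with (a * (a ^ n - b ^ n) + (a - b) * b ^ n)%C by ring.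
    eapply Rle_trans; [apply Cmod_triangle|]. rewrite !Cmod_mult, Cmod_pow.
    assert (Cmod b ^ n <= r ^ n) by (apply pow_incr; split; [apply Cmod_ge_0|assumption]).
    pose proof (Cmod_ge_0 a). pose proof (Cmod_ge_0 (a - b)). pose proof (pos_INR n).
    assert (0 <= r ^ n) by (apply pow_le; lra).
    assert (Cmod a * Cmod (a ^ n - b ^ n) <= r * (INR n * r ^ n * Cmod (a - b))).
    { apply Rmult_le_compat; try assumption. apply Cmod_ge_0. }
    assert (Cmod (a - b) * Cmod b ^ n <= Cmod (a - b) * (r * r ^ n)).
    { apply Rmult_le_compat_l; [assumption|]. nra. }
    nra.
Qed.

Lemma exp_pow_INR (x : R) (n : nat) : exp x ^ n = exp (INR n * x).
Proof.
  induction n as [|n IH]; [simpl; now rewrite Rmult_0_l, exp_0|].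
  rewrite S_INR. simpl. rewrite IH, <- exp_plus. f_equal. ring.
Qed.

(** With N = n + 1 and v = w/N, this compares the N-th powers of 1 + v and exp v, which differ by
    O(|v|^2). The explicit rate makes the convergence uniform on bounded sets, as [uconv_Cexp]
    requires. *)
Lemma Cexp_limit (w : C) (n : nat) :
  Cmod (Cpow (1 + w / RtoC (INR (S n))) (S n) - Cexp w) <= Cmod w ^ 2 * exp (2 * Cmod w) / INR (S n).
Proof.
  set (N := INR (S n)). assert (HN : 1 <= N) by (unfold N; rewrite S_INR; pose proof (pos_INR n); lra).
  assert (HN' : RtoC N <> 0%C) by (intros E; inversion E; lra).
  set (v := (w / RtoC N)%C).
  assert (Hv : Cmod v = Cmod w / N).
  { unfold v. rewrite Cmod_div, Cmod_R, Rabs_pos_eq by (lra || assumption). reflexivity. }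
  replace (Cexp w) with (Cexp v ^ (S n))%C.
  2:{ rewrite <- Cexp_INR_mult. f_equal. unfold v. fold N. field. assumption. }
  pose proof (Cmod_ge_0 w) as Hw. pose proof (Cmod_ge_0 v) as Hv0.
  assert (H1 : 1 <= exp (Cmod v)) by (rewrite <- exp_0; now apply exp_le).
  assert (Hinv : 0 < / N <= 1).
  { split; [apply Rinv_0_lt_compat; lra|]. rewrite <- Rinv_1. apply Rinv_le_contravar; lra. }
  eapply Rle_trans. apply (Cpow_sub_le _ _ (exp (Cmod v))); [assumption| |].
  - eapply Rle_trans; [apply Cmod_triangle|]. rewrite Cmod_1. pose proof (exp_ineq1_le (Cmod v)). lra.
  - rewrite Cmod_Cexp. apply exp_le. eapply Rle_trans; [apply Rle_abs|apply Re_le_Cmod'].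
  - fold N. replace (exp (Cmod v) ^ S n) with (exp (Cmod w)).
    2:{ rewrite exp_pow_INR. f_equal. fold N. rewrite Hv. field. lra. }
    assert (H2 : Cmod (1 + v - Cexp v) <= Cmod v ^ 2 * exp (Cmod v)).
    { rewrite Cmod_sub_sym. replace (Cexp v - (1 + v))%C with (Cexp v - 1 - v)%C by ring.
      apply Cexp_sub_1_sub_le. }
    assert (H3 : exp (Cmod v) <= exp (Cmod w)).
    { apply exp_le. rewrite Hv. unfold Rdiv. nra. }
    pose proof (exp_pos (Cmod w)).
    apply Rle_trans with (N * exp (Cmod w) * (Cmod v ^ 2 * exp (Cmod w))).
    + apply Rmult_le_compat_l; [nra|]. eapply Rle_trans; [apply H2|].
      apply Rmult_le_compat_l; [apply pow_le; assumption|assumption].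
    + right. rewrite Hv. replace (2 * Cmod w) with (Cmod w + Cmod w) by ring.
      rewrite exp_plus. field. lra.
Qed.

(** * Limits and product convergence *)

Definition is_Clim (u : nat -> C) (l : C) : Prop :=
  forall eps, 0 < eps -> exists N, forall n, (N <= n)%nat -> Cmod (u n - l) < eps.

Lemma is_Clim_components (u : nat -> C) (l : C) :
  is_Clim u l <->
  is_lim_seq (fun n => Re (u n)) (Re l) /\ is_lim_seq (fun n => Im (u n)) (Im l).
Proof.
  rewrite <- !is_lim_seq_spec. split.
  - intros H; split; intros eps; destruct (H eps (cond_pos eps)) as [N HN]; exists N; intros n Hn;
      (eapply Rle_lt_trans; [|apply (HN n Hn)]).
    + apply (Re_le_Cmod' (u n - l)).
    + apply (Im_le_Cmod (u n - l)).
  - intros [H1 H2] eps Heps.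
    destruct (H1 (mkposreal (eps / 2) ltac:(lra))) as [N1 HN1].
    destruct (H2 (mkposreal (eps / 2) ltac:(lra))) as [N2 HN2].
    exists (max N1 N2). intros n Hn. specialize (HN1 n ltac:(lia)). specialize (HN2 n ltac:(lia)).
    simpl in HN1, HN2.
    eapply Rle_lt_trans; [apply Cmod_le_abs|]. unfold Re, Im in *; simpl. unfold Rminus in *. lra.
Qed.

Lemma is_Clim_unique (u : nat -> C) (l : C) : is_Clim u l -> CLim_seq u = l.
Proof.
  rewrite is_Clim_components. intros [H1 H2]. unfold CLim_seq.
  rewrite (is_lim_seq_unique _ _ H1), (is_lim_seq_unique _ _ H2).
  apply C_ext; reflexivity.
Qed.

Lemma is_Clim_ext_loc (u v : nat -> C) (l : C) (N : nat) :
  (forall n, (N <= n)%nat -> u n = v n) -> is_Clim u l -> is_Clim v l.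
Proof.
  intros E H eps He. destruct (H eps He) as [N' HN']. exists (max N N').
  intros n Hn. rewrite <- E by lia. apply HN'. lia.
Qed.

Lemma is_Clim_const (l : C) : is_Clim (fun _ => l) l.
Proof.
  intros eps He. exists 0%nat. intros. replace (l - l)%C with (RtoC 0) by ring. now rewrite Cmod_0.
Qed.

Lemma is_Clim_mult (u v : nat -> C) (l m : C) :
  is_Clim u l -> is_Clim v m -> is_Clim (fun n => u n * v n)%C (l * m)%C.
Proof.
  rewrite !is_Clim_components. intros [H1 H2] [H3 H4]; split; simpl.
  - apply is_lim_seq_minus'; now apply is_lim_seq_mult'.
  - apply is_lim_seq_plus'; now apply is_lim_seq_mult'.
Qed.

Lemma is_Clim_inv (u : nat -> C) (l : C) :
  l <> 0%C -> is_Clim u l -> is_Clim (fun n => / u n)%C (/ l)%C.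
Proof.
  intros Hl. rewrite !is_Clim_components. intros [H1 H2].
  assert (Hn : Re l ^ 2 + Im l ^ 2 <> 0).
  { intros E. apply Hl. apply Cmod_eq_0. pose proof (Cmod2_alt l). rewrite E in H.
    pose proof (Cmod_ge_0 l). nra. }
  assert (Hd : is_lim_seq (fun n => / (Re (u n) ^ 2 + Im (u n) ^ 2)) (/ (Re l ^ 2 + Im l ^ 2))).
  { apply (is_lim_seq_inv _ (Re l ^ 2 + Im l ^ 2)).
    - assert (Hsq : forall (x : nat -> R) (y : R), is_lim_seq x y -> is_lim_seq (fun n => x n ^ 2) (y ^ 2)).
      { intros x y Hx. replace (y ^ 2) with (y * y) by ring.
        apply (is_lim_seq_ext (fun n => x n * x n)); [intros; ring|]. now apply is_lim_seq_mult'. }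
      exact (is_lim_seq_plus' _ _ _ _ (Hsq _ _ H1) (Hsq _ _ H2)).
    - intros E; inversion E; contradiction. }
  split; simpl; apply is_lim_seq_mult'; try assumption.
  apply (is_lim_seq_opp _ (Im l)). assumption.
Qed.

Lemma is_Clim_cauchy (u : nat -> C) :
  (forall eps, 0 < eps -> exists N, forall n m, (N <= n)%nat -> (n <= m)%nat -> Cmod (u m - u n) < eps) ->
  exists l, is_Clim u l.
Proof.
  intros H.
  assert (HR : ex_finite_lim_seq (fun n => Re (u n))).
  { apply ex_lim_seq_cauchy_corr. intros eps. destruct (H eps (cond_pos eps)) as [N HN]. exists N.
    intros n m Hn Hm. destruct (Nat.le_ge_cases n m).
    - rewrite Rabs_minus_sym. eapply Rle_lt_trans; [|apply (HN n m Hn H0)]. apply (Re_le_Cmod' (u m - u n)).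
    - eapply Rle_lt_trans; [|apply (HN m n Hm H0)]. apply (Re_le_Cmod' (u n - u m)). }
  assert (HI : ex_finite_lim_seq (fun n => Im (u n))).
  { apply ex_lim_seq_cauchy_corr. intros eps. destruct (H eps (cond_pos eps)) as [N HN]. exists N.
    intros n m Hn Hm. destruct (Nat.le_ge_cases n m).
    - rewrite Rabs_minus_sym. eapply Rle_lt_trans; [|apply (HN n m Hn H0)]. apply (Im_le_Cmod (u m - u n)).
    - eapply Rle_lt_trans; [|apply (HN m n Hm H0)]. apply (Im_le_Cmod (u n - u m)). }
  destruct HR as [x Hx], HI as [y Hy]. exists (x, y). apply is_Clim_components. now split.
Qed.

Lemma is_Clim_Cmod_sub_le (u : nat -> C) (l a : C) (M : R) (N : nat) :
  is_Clim u l -> (forall n, (N <= n)%nat -> Cmod (u n - a) <= M) -> Cmod (l - a) <= M.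
Proof.
  intros H HM. apply le_epsilon. intros e He. destruct (H e He) as [N' HN'].
  specialize (HM (max N N') ltac:(lia)). specialize (HN' (max N N') ltac:(lia)).
  pose proof (Cmod_sub_triangle l (u (max N N')) a). rewrite Cmod_sub_sym in HN'. lra.
Qed.

(** Sums of inverse squares telescope against this bound, so the infinite products below get
    explicit error terms. *)
Lemma inv_sqr_le_telescope (x : R) : 0 < x -> / (x + 1) ^ 2 <= / x - / (x + 1).
Proof.
  intros Hx. replace (/ x - / (x + 1)) with (/ (x * (x + 1))) by (field; lra).
  apply Rinv_le_contravar; nra.
Qed.

(** Each step multiplies the modulus by at most 1 + K/(n+1)^2 <= exp (K (1/n - 1/(n+1))), and the
    exponents telescope. Stating the increments relative to P n allows P to vanish. *)
Lemma product_bound (P : nat -> C) (K : R) (m : nat) :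
  0 <= K -> (1 <= m)%nat ->
  (forall n, (m <= n)%nat -> Cmod (P (S n) - P n) <= K / (INR n + 1) ^ 2 * Cmod (P n)) ->
  forall n, (m <= n)%nat -> Cmod (P n) <= exp (K * (/ INR m - / INR n)) * Cmod (P m).
Proof.
  intros HK Hm H n Hn. induction Hn as [|n Hn IH].
  - replace (K * (/ INR m - / INR m)) with 0 by ring. rewrite exp_0. lra.
  - assert (Hn0 : 0 < INR n) by (apply lt_0_INR; lia).
    pose proof (inv_sqr_le_telescope _ Hn0).
    apply Rle_trans with ((1 + K / (INR n + 1) ^ 2) * Cmod (P n)).
    + replace (P (S n)) with (P n + (P (S n) - P n))%C by ring.
      eapply Rle_trans; [apply Cmod_triangle|]. specialize (H n Hn). lra.
    + apply Rle_trans with (exp (K / (INR n + 1) ^ 2) * (exp (K * (/ INR m - / INR n)) * Cmod (P m))).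
      * apply Rmult_le_compat; try assumption; [|apply Cmod_ge_0|apply exp_ineq1_le].
        assert (0 < / (INR n + 1) ^ 2) by (apply Rinv_0_lt_compat; nra). unfold Rdiv. nra.
      * rewrite <- Rmult_assoc, <- exp_plus. apply Rmult_le_compat_r; [apply Cmod_ge_0|].
        apply exp_le. rewrite S_INR. unfold Rdiv. nra.
Qed.

(** The error is proportional to |P m|. This yields uniform convergence when P depends on a
    parameter, and a nonzero limit as soon as m is so large that the error at n = m is less than |P
    m|. *)
Lemma product_converges (P : nat -> C) (K : R) (m : nat) :
  0 <= K -> (1 <= m)%nat ->
  (forall n, (m <= n)%nat -> Cmod (P (S n) - P n) <= K / (INR n + 1) ^ 2 * Cmod (P n)) ->
  exists l, is_Clim P l /\
    forall n, (m <= n)%nat -> Cmod (P n - l) <= K * exp K * Cmod (P m) / INR n.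
Proof.
  intros HK Hm H.
  assert (Hb : forall n, (m <= n)%nat -> Cmod (P n) <= exp K * Cmod (P m)).
  { intros n Hn. eapply Rle_trans; [apply (product_bound P K m); assumption|].
    apply Rmult_le_compat_r; [apply Cmod_ge_0|]. apply exp_le.
    assert (0 < / INR n) by (apply Rinv_0_lt_compat, lt_0_INR; lia).
    assert (/ INR m <= / 1).
    { apply Rinv_le_contravar; [lra|]. apply (le_INR 1). lia. }
    rewrite Rinv_1 in H1. nra. }
  set (B := K * exp K * Cmod (P m)).
  assert (HB : 0 <= B).
  { unfold B. pose proof (exp_pos K). pose proof (Cmod_ge_0 (P m)).
    apply Rmult_le_pos; [nra|assumption]. }
  assert (Hd : forall n k, (m <= n)%nat -> Cmod (P (n + k)%nat - P n) <= B * (/ INR n - / INR (n + k))).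
  { intros n k Hn. induction k as [|k IH].
    - rewrite Nat.add_0_r. replace (P n - P n)%C with (RtoC 0) by ring. rewrite Cmod_0. lra.
    - eapply Rle_trans; [apply (Cmod_sub_triangle _ (P (n + k)%nat))|].
      rewrite Nat.add_succ_r. specialize (H (n + k)%nat ltac:(lia)).
      assert (Hn0 : 0 < INR (n + k)) by (apply lt_0_INR; lia).
      pose proof (inv_sqr_le_telescope _ Hn0). rewrite S_INR.
      assert (K / (INR (n + k) + 1) ^ 2 * Cmod (P (n + k)%nat) <= B * (/ INR (n + k) - / (INR (n + k) + 1))).
      { apply Rle_trans with (K / (INR (n + k) + 1) ^ 2 * (exp K * Cmod (P m))).
        - apply Rmult_le_compat_l; [|apply Hb; lia].
          assert (0 < / (INR (n + k) + 1) ^ 2) by (apply Rinv_0_lt_compat; nra). unfold Rdiv. nra.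
        - replace (K / (INR (n + k) + 1) ^ 2 * (exp K * Cmod (P m))) with (B * / (INR (n + k) + 1) ^ 2)
            by (unfold B, Rdiv; ring).
          now apply Rmult_le_compat_l. }
      lra. }
  assert (Hd' : forall n k, (m <= n)%nat -> Cmod (P (n + k)%nat - P n) <= B / INR n).
  { intros n k Hn. eapply Rle_trans; [now apply Hd|]. unfold Rdiv. apply Rmult_le_compat_l; [assumption|].
    assert (0 < / INR (n + k)) by (apply Rinv_0_lt_compat, lt_0_INR; lia). lra. }
  destruct (is_Clim_cauchy P) as [l Hl].
  - intros eps He.
    destruct (INR_unbounded (B / eps)) as [N HN]. exists (max m N). intros n k Hn Hk.
    replace k with (n + (k - n))%nat by lia. eapply Rle_lt_trans; [apply Hd'; lia|].
    assert (Hn0 : 0 < INR n) by (apply lt_0_INR; lia).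
    assert (INR N <= INR n) by (apply le_INR; lia).
    apply Rmult_lt_reg_r with (INR n); [assumption|]. unfold Rdiv. rewrite Rmult_assoc, Rinv_l, Rmult_1_r by lra.
    assert (HN2 : B / eps < INR n) by lra.
    apply Rmult_lt_compat_r with (r := eps) in HN2; [|assumption]. unfold Rdiv in HN2.
    rewrite Rmult_assoc, Rinv_l, Rmult_1_r in HN2 by lra. lra.
  - exists l; split; [assumption|]. intros n Hn. rewrite Cmod_sub_sym.
    apply (is_Clim_Cmod_sub_le P l (P n) _ n Hl). intros k Hk.
    replace k with (n + (k - n))%nat by lia. now apply Hd'.
Qed.

(** * Quotients of Gamma functions *)

Lemma ln_le_sub_1 (x : R) : 0 < x -> ln x <= x - 1.
Proof.
  intros Hx. pose proof (exp_ineq1_le (ln x)). rewrite exp_ln in H by assumption. lra.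
Qed.

Lemma ln_succ_bounds (n : nat) : (1 <= n)%nat ->
  / (INR n + 1) <= ln (INR (S n)) - ln (INR n) <= / INR n.
Proof.
  intros Hn. assert (H : 1 <= INR n) by (apply (le_INR 1); lia).
  rewrite S_INR. split.
  - pose proof (ln_le_sub_1 (INR n / (INR n + 1)) ltac:(apply Rdiv_lt_0_compat; lra)).
    rewrite ln_div in H0 by lra.
    replace (INR n / (INR n + 1) - 1) with (- / (INR n + 1)) in H0 by (field; lra). lra.
  - pose proof (ln_le_sub_1 ((INR n + 1) / INR n) ltac:(apply Rdiv_lt_0_compat; lra)).
    rewrite ln_div in H0 by lra.
    replace ((INR n + 1) / INR n - 1) with (/ INR n) in H0 by (field; lra). lra.
Qed.

Lemma Rcpow_add (x : R) (a b : C) : Rcpow x (a + b) = (Rcpow x a * Rcpow x b)%C.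
Proof. unfold Rcpow. rewrite <- Cexp_add. f_equal. ring. Qed.

Lemma Rcpow_opp (x : R) (a : C) : Rcpow x (- a) = (/ Rcpow x a)%C.
Proof. unfold Rcpow. rewrite <- Cexp_opp. f_equal. ring. Qed.

Lemma Rcpow_1 (x : R) : 0 < x -> Rcpow x 1 = RtoC x.
Proof. intros. unfold Rcpow. rewrite Cmult_1_l, Cexp_R, exp_ln by assumption. reflexivity. Qed.

Lemma Rcpow_neq_0 (x : R) (a : C) : Rcpow x a <> 0%C.
Proof. apply Cexp_neq_0. Qed.

(* Quotient of Gauss's partial products for Gamma (s) and Gamma (s + b); rational in [s]. *)
Definition gauss_ratio (b : C) (n : nat) (s : C) : C :=
  (Rcpow (INR n) (- b) * (rising (s + b) n / rising s n))%C.

Definition nonpole (s : C) : Prop := forall k : nat, s <> RtoC (- INR k).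

Lemma gauss_ratio_succ (b s : C) (n : nat) :
  gauss_ratio b (S n) s =
  (gauss_ratio b n s * (Cexp (- b * RtoC (ln (INR (S n)) - ln (INR n)))
     * ((s + b + RtoC (INR (S n))) / (s + RtoC (INR (S n))))))%C.
Proof.
  unfold gauss_ratio, Rcpow.
  replace (- b * RtoC (ln (INR (S n))))%C with
    (- b * RtoC (ln (INR n)) + - b * RtoC (ln (INR (S n)) - ln (INR n)))%C
    by (rewrite RtoC_minus; ring).
  rewrite Cexp_add. unfold Cdiv. cbn [rising]. rewrite !Cinv_mult_total. ring.
Qed.

(** Consecutive terms have the quotient exp w (1 + b/(s+n+1)) with w = -b ln ((n+1)/n). The
    first-order parts -b/n and b/n cancel and leave O(1/n^2), uniformly for |s| <= Rad. *)
Lemma gauss_ratio_step (b : C) (Rad : R) : 0 <= Rad ->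
  exists K m, 0 <= K /\ (1 <= m)%nat /\ forall s n, Cmod s <= Rad -> (m <= n)%nat ->
   Cmod (gauss_ratio b (S n) s - gauss_ratio b n s) <=
   K / (INR n + 1) ^ 2 * Cmod (gauss_ratio b n s).
Proof.
  intros HR. set (B := Cmod b). set (D := 1 + Rad + B).
  pose proof (Cmod_ge_0 b) as HB. fold B in HB.
  set (E := B ^ 2 * exp B).
  assert (HE : 0 <= E) by (unfold E; pose proof (exp_pos B); nra).
  (* For n >= 2 Rad the denominator s + n + 1 has modulus at least (n + 1)/2. *)
  destruct (INR_unbounded (2 * Rad)) as [m Hm].
  exists (8 * (D * E + B * D)), (S m). split; [unfold D; nra|]. split; [lia|].
  intros s n Hs Hn. set (N := INR n).
  assert (HN1 : 1 <= N) by (apply (le_INR 1); lia).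
  assert (HN2 : 2 * Rad <= N) by (assert (INR m <= N) by (apply le_INR; lia); lra).
  set (v := ln (INR (S n)) - ln (INR n)).
  assert (Hv : / (N + 1) <= v <= / N) by (apply ln_succ_bounds; lia).
  assert (Hi1 : 0 < / (N + 1)) by (apply Rinv_0_lt_compat; lra).
  assert (Hi2 : / N <= 1) by (rewrite <- Rinv_1; apply Rinv_le_contravar; lra).
  rewrite gauss_ratio_succ. fold v. rewrite S_INR. fold N.
  set (den := (s + RtoC (N + 1))%C).
  assert (Hden : (N + 1) / 2 <= Cmod den).
  { unfold den. replace (s + RtoC (N + 1))%C with (RtoC (N + 1) + s)%C by ring.
    pose proof (Cmod_add_ge (RtoC (N + 1)) s). rewrite Cmod_R, Rabs_pos_eq in H by lra. lra. }
  assert (Hden0 : den <> 0%C) by (intros E0; rewrite E0, Cmod_0 in Hden; lra).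
  set (w := (- b * RtoC v)%C).
  assert (Hw : Cmod w <= B * / N).
  { unfold w. rewrite Cmod_mult, Cmod_opp, Cmod_R, Rabs_pos_eq by lra. fold B. apply Rmult_le_compat_l; lra. }
  assert (HwB : Cmod w <= B) by nra.
  (* Write exp w = 1 + w + (exp w - 1 - w) in the numerator. The part with 1 + w reduces to b (1 -
     (N+1) v) - b v (s + b). Both parts are O(1/N), and the denominator contributes another 1/N. *)
  replace (gauss_ratio b n s * (Cexp w * ((s + b + RtoC (N + 1)) / den)) - gauss_ratio b n s)%C
    with (((s + b + RtoC (N + 1)) * (Cexp w - 1 - w) + (b * RtoC (1 - (N + 1) * v) - b * RtoC v * (s + b))) / den * gauss_ratio b n s)%C.
  2:{ unfold w, den in *. rewrite RtoC_minus, RtoC_mult, !RtoC_plus in *. field. assumption. }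
  rewrite Cmod_mult. apply Rmult_le_compat_r; [apply Cmod_ge_0|].
  rewrite Cmod_div by assumption.
  assert (H1 : Cmod ((s + b + RtoC (N + 1)) * (Cexp w - 1 - w)) <= (N + 1) * D * (E * (/ N * / N))).
  { rewrite Cmod_mult. apply Rmult_le_compat; try apply Cmod_ge_0.
    - eapply Rle_trans; [apply Cmod_triangle|]. rewrite Cmod_R, Rabs_pos_eq by lra.
      pose proof (Cmod_triangle s b). fold B in H. unfold D. nra.
    - eapply Rle_trans; [apply Cexp_sub_1_sub_le|]. unfold E.
      apply Rle_trans with ((B * / N) ^ 2 * exp B).
      + apply Rmult_le_compat; [apply pow2_ge_0|left; apply exp_pos| |now apply exp_le].
        apply pow_incr. split; [apply Cmod_ge_0|assumption].
      + right; ring. }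
  assert (H2 : Cmod (b * RtoC (1 - (N + 1) * v) - b * RtoC v * (s + b)) <= B * D * / N).
  { unfold Cminus. eapply Rle_trans; [apply Cmod_triangle|]. rewrite Cmod_opp, !Cmod_mult, !Cmod_R. fold B.
    assert (Rabs (1 - (N + 1) * v) <= / N).
    { assert (1 <= (N + 1) * v).
      { rewrite <- (Rinv_r (N + 1)) at 1 by lra. apply Rmult_le_compat_l; lra. }
      assert ((N + 1) * v <= 1 + / N).
      { replace (1 + / N) with ((N + 1) * / N) by (field; lra). apply Rmult_le_compat_l; lra. }
      rewrite Rabs_left1; lra. }
    rewrite (Rabs_pos_eq v) by lra. pose proof (Cmod_triangle s b). fold B in H0.
    pose proof (Cmod_ge_0 (s + b)).
    assert (v * Cmod (s + b) <= / N * (Rad + B)) by (apply Rmult_le_compat; lra).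
    replace (B * Rabs (1 - (N + 1) * v) + B * v * Cmod (s + b)) with (B * (Rabs (1 - (N + 1) * v) + v * Cmod (s + b))) by ring.
    rewrite Rmult_assoc. apply Rmult_le_compat_l; [assumption|]. unfold D. lra. }
  pose proof (Cmod_triangle ((s + b + RtoC (N + 1)) * (Cexp w - 1 - w)) (b * RtoC (1 - (N + 1) * v) - b * RtoC v * (s + b))) as H3.
  set (X := Cmod (_ + _)) in *.
  assert (HNN : / N <= 2 * / (N + 1)).
  { replace (2 * / (N + 1)) with (/ ((N + 1) / 2)) by (field; lra). apply Rinv_le_contravar; lra. }
  set (i := / (N + 1)) in *.
  assert (Hi : (N + 1) * i = 1) by (unfold i; field; lra).
  assert (HX : X <= (D * E * 4 + B * D * 2) * i).
  { assert (HjN : / N * / N <= 4 * (i * i)).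
    { assert (0 < / N) by (apply Rinv_0_lt_compat; lra). nra. }
    assert (0 <= D) by (unfold D; lra).
    assert (0 <= D * E) by nra. assert (0 <= B * D) by nra.
    assert ((N + 1) * D * (E * (/ N * / N)) <= D * E * 4 * i).
    { replace ((N + 1) * D * (E * (/ N * / N))) with (D * E * ((N + 1) * (/ N * / N))) by ring.
      replace (D * E * 4 * i) with (D * E * (4 * i)) by ring.
      apply Rmult_le_compat_l; [assumption|].
      apply Rle_trans with ((N + 1) * (4 * (i * i))); [apply Rmult_le_compat_l; lra|].
      right. replace ((N + 1) * (4 * (i * i))) with (4 * i * ((N + 1) * i)) by ring. rewrite Hi. ring. }
    assert (B * D * / N <= B * D * 2 * i).
    { replace (B * D * 2 * i) with (B * D * (2 * i)) by ring. now apply Rmult_le_compat_l. }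
    lra. }
  apply Rle_trans with (X * (2 * i)).
  - unfold Rdiv. apply Rmult_le_compat_l; [apply Cmod_ge_0|].
    replace (2 * i) with (/ ((N + 1) / 2)) by (unfold i; field; lra). apply Rinv_le_contravar; lra.
  - replace (8 * (D * E + B * D) / (N + 1) ^ 2) with (8 * (D * E + B * D) * i * i) by (unfold i; field; lra).
    assert (0 <= D * E) by (unfold D; nra). assert (0 <= B * D) by (unfold D; nra).
    apply Rle_trans with ((D * E * 4 + B * D * 2) * i * (2 * i)).
    + apply Rmult_le_compat_r; lra.
    + nra.
Qed.

Lemma rising_neq_0 (s : C) (n : nat) : nonpole s -> rising s n <> 0%C.
Proof.
  intros H. induction n as [|n IH]; cbn [rising].
  - intros E. apply (H 0%nat). rewrite E. simpl. f_equal. ring.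
  - apply Cmult_neq_0; [assumption|]. intros E. apply (H (S n)).
    rewrite RtoC_opp. replace s with ((s + RtoC (INR (S n))) - RtoC (INR (S n)))%C by ring. rewrite E. ring.
Qed.

Lemma rising_pole (k n : nat) : (k <= n)%nat -> rising (RtoC (- INR k)) n = 0%C.
Proof.
  induction n as [|n IH]; intros Hk; cbn [rising].
  - replace k with 0%nat by lia. simpl. f_equal. ring.
  - destruct (Nat.eq_dec k (S n)) as [->|Hne].
    + rewrite RtoC_opp. ring.
    + rewrite IH by lia. ring.
Qed.

Lemma nonpole_dec (s : C) : nonpole s \/ exists k : nat, s = RtoC (- INR k).
Proof.
  destruct (Classical_Prop.classic (exists k : nat, s = RtoC (- INR k))) as [H|H]; [now right|left].
  intros k E. apply H. now exists k.
Qed.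

Lemma gauss_ratio_neq_0 (b s : C) (n : nat) :
  nonpole s -> nonpole (s + b) -> gauss_ratio b n s <> 0%C.
Proof.
  intros H1 H2. unfold gauss_ratio. apply Cmult_neq_0; [apply Rcpow_neq_0|].
  apply Cmult_neq_0; [now apply rising_neq_0|].
  intros E. apply (rising_neq_0 s n H1). rewrite <- (Cinv_inv_total (rising s n)), E. apply Cinv_0.
Qed.

Lemma gauss_ratio_converges (b s : C) : exists l, is_Clim (fun n => gauss_ratio b n s) l.
Proof.
  destruct (gauss_ratio_step b (Cmod s) (Cmod_ge_0 s)) as [K [m [HK [Hm H]]]].
  destruct (product_converges (fun n => gauss_ratio b n s) K m HK Hm) as [l [Hl _]].
  - intros n Hn. apply H; [apply Rle_refl|assumption].
  - now exists l.
Qed.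

(** The product is started at an index n > K exp K, where the error bound K exp K |P n| / n is less
    than |P n|. Off the poles of both Gamma functions P n is nonzero. *)
Lemma gauss_ratio_limit_neq_0 (b s l : C) :
  nonpole s -> nonpole (s + b) -> is_Clim (fun n => gauss_ratio b n s) l -> l <> 0%C.
Proof.
  intros H1 H2 Hl E.
  destruct (gauss_ratio_step b (Cmod s) (Cmod_ge_0 s)) as [K [m [HK [Hm H]]]].
  destruct (INR_unbounded (K * exp K)) as [M HM].
  set (n := max M m).
  destruct (product_converges (fun n => gauss_ratio b n s) K n HK ltac:(lia)) as [l' [Hl' Hb]].
  - intros k Hk. apply H; [apply Rle_refl|lia].
  - assert (l' = l) by (rewrite <- (is_Clim_unique _ _ Hl); symmetry; now apply is_Clim_unique).
    subst l'. specialize (Hb n ltac:(lia)). rewrite E in Hb.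
    replace (gauss_ratio b n s - 0)%C with (gauss_ratio b n s) in Hb by ring.
    assert (0 < Cmod (gauss_ratio b n s)) by (apply Cmod_gt_0; now apply gauss_ratio_neq_0).
    assert (INR M <= INR n) by (apply le_INR; lia).
    assert (0 < INR n) by (apply lt_0_INR; lia).
    unfold Rdiv in Hb.
    assert (K * exp K * / INR n < 1).
    { apply Rmult_lt_reg_r with (INR n); [assumption|]. rewrite Rmult_assoc, Rinv_l; lra. }
    nra.
Qed.

Definition gauss_product (s : C) (n : nat) : C :=
  (RtoC (INR (fact n)) * Rcpow (INR n) s / rising s n)%C.

Lemma RtoC_neq_0 (x : R) : x <> 0 -> RtoC x <> 0%C.
Proof. intros H E. apply H. now inversion E. Qed.

Lemma rising_1 (n : nat) : rising 1 n = RtoC (INR (fact (S n))).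
Proof.
  induction n as [|n IH]; [reflexivity|].
  cbn [rising]. rewrite IH, <- RtoC_plus, <- RtoC_mult. f_equal.
  rewrite (fact_simpl (S n)), mult_INR, (S_INR (S n)). ring.
Qed.

(** Since [rising] 1 n is (n+1)!, Gamma (s) is the special case Gamma (s) / Gamma (1) of the
    quotients, up to a factor tending to 1. Convergence of Gauss's product thus follows from that of
    [gauss_ratio]. *)
Lemma gauss_product_ratio (s : C) (n : nat) : (1 <= n)%nat ->
  gauss_product s n = (RtoC (INR n / (INR n + 1)) * gauss_ratio (1 - s) n s)%C.
Proof.
  intros Hn. assert (H : 1 <= INR n) by (apply (le_INR 1); lia).
  unfold gauss_product, gauss_ratio.
  replace (s + (1 - s))%C with (RtoC 1) by ring. rewrite rising_1.
  replace (- (1 - s))%C with (s + - (RtoC 1))%C by ring.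
  rewrite Rcpow_add, Rcpow_opp, Rcpow_1 by lra.
  rewrite fact_simpl, mult_INR, S_INR, RtoC_mult, RtoC_div by lra.
  rewrite (RtoC_plus (INR n) 1). unfold Cdiv.
  assert (RtoC (INR n) <> 0)%C by (apply RtoC_neq_0; lra).
  assert (RtoC (INR n) + 1 <> 0)%C by (rewrite <- RtoC_plus; apply RtoC_neq_0; lra).
  generalize (/ rising s n)%C; intros ir. field. split; assumption.
Qed.

Lemma is_Clim_inv_INR (a b : C) (B : R) (u : nat -> C) (l : C) :
  (forall n, (1 <= n)%nat -> Cmod (u n - l) <= B / INR n) -> is_Clim u l.
Proof.
  intros H eps He.
  destruct (INR_unbounded (Rmax 1 (B / eps))) as [N HN]. exists (max 1 N). intros n Hn.
  assert (INR N <= INR n) by (apply le_INR; lia).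
  pose proof (Rmax_l 1 (B / eps)). pose proof (Rmax_r 1 (B / eps)).
  eapply Rle_lt_trans; [apply H; lia|].
  apply Rmult_lt_reg_r with (INR n); [lra|]. unfold Rdiv. rewrite Rmult_assoc, Rinv_l, Rmult_1_r by lra.
  assert (HN2 : B / eps < INR n) by lra.
  apply Rmult_lt_compat_r with (r := eps) in HN2; [|assumption]. unfold Rdiv in HN2.
  rewrite Rmult_assoc, Rinv_l, Rmult_1_r in HN2 by lra. lra.
Qed.

Lemma is_Clim_INR_ratio (c : R) : 0 <= c ->
  is_Clim (fun n => RtoC (INR n / (INR n + c))) 1.
Proof.
  intros Hc. apply (is_Clim_inv_INR 0 0 c). intros n Hn.
  assert (H : 1 <= INR n) by (apply (le_INR 1); lia).
  rewrite <- RtoC_minus, Cmod_R.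
  replace (INR n / (INR n + c) - 1) with (- (c / (INR n + c))) by (field; lra).
  rewrite Rabs_Ropp, Rabs_pos_eq by (apply Rdiv_le_0_compat; lra).
  apply Rmult_le_compat_l; [assumption|]. apply Rinv_le_contravar; lra.
Qed.

Lemma gauss_product_limit (s l : C) :
  is_Clim (fun n => gauss_ratio (1 - s) n s) l -> is_Clim (gauss_product s) l.
Proof.
  intros H. apply (is_Clim_ext_loc (fun n => RtoC (INR n / (INR n + 1)) * gauss_ratio (1 - s) n s)%C _ _ 1).
  - intros n Hn. symmetry. now apply gauss_product_ratio.
  - replace l with (RtoC 1 * l)%C by ring. apply is_Clim_mult; [|assumption].
    apply is_Clim_INR_ratio. lra.
Qed.

Lemma CGamma_limit (s : C) : is_Clim (gauss_product s) (CGamma s).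
Proof.
  destruct (gauss_ratio_converges (1 - s) s) as [l Hl].
  apply gauss_product_limit in Hl. change (CGamma s) with (CLim_seq (gauss_product s)).
  now rewrite (is_Clim_unique (gauss_product s) l Hl).
Qed.

Lemma CGamma_neq_0 (s : C) : nonpole s -> CGamma s <> 0%C.
Proof.
  intros Hs. destruct (gauss_ratio_converges (1 - s) s) as [l Hl].
  assert (l <> 0%C).
  { apply (gauss_ratio_limit_neq_0 (1 - s) s); try assumption.
    replace (s + (1 - s))%C with (RtoC 1) by ring. intros k E. inversion E.
    pose proof (pos_INR k). lra. }
  apply gauss_product_limit in Hl. change (CGamma s) with (CLim_seq (gauss_product s)).
  now rewrite (is_Clim_unique (gauss_product s) l Hl).
Qed.

Lemma CGamma_pole (k : nat) : CGamma (RtoC (- INR k)) = 0%C.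
Proof.
  apply (is_Clim_unique (gauss_product _)). apply (is_Clim_ext_loc (fun _ => RtoC 0) _ _ k).
  - intros n Hn. unfold gauss_product. rewrite rising_pole by assumption. unfold Cdiv. rewrite Cinv_0. ring.
  - apply is_Clim_const.
Qed.

Lemma CGamma_1 : CGamma 1 = 1%C.
Proof.
  apply (is_Clim_unique (gauss_product _)), gauss_product_limit.
  apply (is_Clim_ext_loc (fun _ => RtoC 1) _ _ 0); [|apply is_Clim_const].
  intros n _. unfold gauss_ratio. replace (1 + (1 - 1))%C with (RtoC 1) by ring.
  replace (- (1 - 1))%C with (RtoC 0) by ring. unfold Rcpow. rewrite Cmult_0_l, Cexp_0.
  rewrite rising_1. field. apply RtoC_neq_0. apply INR_fact_neq_0.
Qed.

Lemma CGamma_succ (x : R) : 0 < x -> CGamma (RtoC (x + 1)) = (RtoC x * CGamma (RtoC x))%C.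
Proof.
  intros Hx. apply (is_Clim_unique (gauss_product _)).
  apply (is_Clim_ext_loc (fun n => RtoC x * (RtoC (INR n / (INR n + (x + 1))) * gauss_product (RtoC x) n))%C _ _ 1).
  - intros n Hn. assert (H : 1 <= INR n) by (apply (le_INR 1); lia).
    unfold gauss_product.
    assert (Hnp : nonpole (RtoC x)) by (intros k E; inversion E; pose proof (pos_INR k); lra).
    assert (Hnp1 : nonpole (RtoC (x + 1))) by (intros k E; inversion E; pose proof (pos_INR k); lra).
    pose proof (rising_neq_0 _ n Hnp). pose proof (rising_neq_0 _ n Hnp1).
    (* Both sides are x (x + 1) ... (x + n + 1); the extra last factor is the source of n / (n + x +
       1). *)
    assert (E : (RtoC x * rising (RtoC (x + 1)) n = rising (RtoC x) n * RtoC (INR n + (x + 1)))%C).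
    { clear. induction n as [|n IH].
      - simpl. rewrite !RtoC_plus. ring.
      - cbn [rising]. rewrite Cmult_assoc, IH, S_INR, !RtoC_plus. ring. }
    assert (Hd : RtoC (INR n + (x + 1)) <> 0%C) by (apply RtoC_neq_0; lra).
    replace (Rcpow (INR n) (RtoC (x + 1))) with (Rcpow (INR n) (RtoC x) * RtoC (INR n))%C.
    2:{ rewrite RtoC_plus, Rcpow_add, Rcpow_1 by lra. reflexivity. }
    rewrite RtoC_div by lra.
    replace (rising (RtoC (x + 1)) n) with (rising (RtoC x) n * RtoC (INR n + (x + 1)) / RtoC x)%C.
    2:{ rewrite <- E. field. apply RtoC_neq_0. lra. }
    field. repeat split; try assumption. apply RtoC_neq_0; lra.
  - apply is_Clim_mult; [apply is_Clim_const|].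
    replace (CGamma (RtoC x)) with (1 * CGamma (RtoC x))%C by ring.
    apply is_Clim_mult; [|apply CGamma_limit]. apply is_Clim_INR_ratio. lra.
Qed.

Definition gamma_ratio (b s : C) : C := (CGamma s / CGamma (s + b))%C.

Lemma gamma_ratio_limit (b s : C) : nonpole s ->
  is_Clim (fun n => gauss_ratio b n s) (gamma_ratio b s).
Proof.
  intros Hs. destruct (nonpole_dec (s + b)) as [Hb|[k Hk]].
  - apply (is_Clim_ext_loc (fun n => gauss_product s n * / gauss_product (s + b) n)%C _ _ 0).
    + intros n _. unfold gauss_product, gauss_ratio. rewrite Rcpow_add, Rcpow_opp.
      pose proof (rising_neq_0 _ n Hs). pose proof (rising_neq_0 _ n Hb).
      field. repeat split; try assumption; try apply Rcpow_neq_0.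
      apply RtoC_neq_0, INR_fact_neq_0.
    + apply is_Clim_mult; [apply CGamma_limit|].
      apply is_Clim_inv; [now apply CGamma_neq_0|apply CGamma_limit].
  (* At a pole of Gamma (s + b) the default value 0 of [CGamma] makes the quotient 0, which is the
     true value, and the partial products vanish from index k on. *)
  - unfold gamma_ratio. rewrite Hk, CGamma_pole. unfold Cdiv. rewrite Cinv_0, Cmult_0_r.
    apply (is_Clim_ext_loc (fun _ => RtoC 0) _ _ k); [|apply is_Clim_const].
    intros n Hn. unfold gauss_ratio. rewrite Hk, rising_pole by assumption.
    unfold Cdiv. ring.
Qed.

Lemma rising_Cmod_ge (s : C) (d : R) (n : nat) : 0 < d ->
  (forall k : nat, d <= Cmod (s + RtoC (INR k))) -> d ^ S n <= Cmod (rising s n).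
Proof.
  intros Hd H. induction n as [|n IH]; cbn [rising].
  - specialize (H 0%nat). simpl in *. replace (s + 0)%C with s in H by ring. lra.
  - rewrite Cmod_mult, <- tech_pow_Rmult, Rmult_comm. apply Rmult_le_compat; try lra.
    + apply pow_le; lra.
    + apply H.
Qed.

Lemma rising_Cmod_le (s : C) (n : nat) :
  Cmod (rising s n) <= (Cmod s + INR n) ^ S n.
Proof.
  assert (forall m, (m <= n)%nat -> Cmod (rising s m) <= (Cmod s + INR n) ^ S m); [|now apply H].
  pose proof (Cmod_ge_0 s). pose proof (pos_INR n).
  induction m as [|m IH]; cbn [rising]; intros Hm.
  - simpl. lra.
  - rewrite Cmod_mult, <- tech_pow_Rmult, Rmult_comm. apply Rmult_le_compat; try apply Cmod_ge_0.
    + eapply Rle_trans; [apply Cmod_triangle|]. rewrite Cmod_R, Rabs_pos_eq by apply pos_INR.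
      assert (INR (S m) <= INR n) by (apply le_INR; lia). lra.
    + apply IH. lia.
Qed.

Lemma nonpole_of_dist (s : C) (d : R) : 0 < d ->
  (forall k : nat, d <= Cmod (s + RtoC (INR k))) -> nonpole s.
Proof.
  intros Hd H k E. specialize (H k). rewrite E, RtoC_opp in H.
  replace (- RtoC (INR k) + RtoC (INR k))%C with (RtoC 0) in H by ring. rewrite Cmod_0 in H. lra.
Qed.

(** The error in [product_converges] is governed by the m-th partial product alone, and for |s| <=
    Rad at distance d from the poles crude estimates of its factors bound that rational function. *)
Lemma gamma_ratio_uniform (b : C) (Rad d : R) : 0 <= Rad -> 0 < d ->
  exists B m, 0 <= B /\ (1 <= m)%nat /\ forall s, Cmod s <= Rad ->
    (forall k : nat, d <= Cmod (s + RtoC (INR k))) ->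
    forall n, (m <= n)%nat -> Cmod (gauss_ratio b n s - gamma_ratio b s) <= B / INR n.
Proof.
  intros HR Hd. destruct (gauss_ratio_step b Rad HR) as [K [m [HK [Hm H]]]].
  set (M := Cmod (Rcpow (INR m) (- b)) * ((Rad + Cmod b + INR m) ^ S m / d ^ S m)).
  assert (HM : 0 <= M).
  { unfold M. apply Rmult_le_pos; [apply Cmod_ge_0|]. apply Rdiv_le_0_compat; [|now apply pow_lt].
    apply pow_le. pose proof (Cmod_ge_0 b). pose proof (pos_INR m). lra. }
  exists (K * exp K * M), m. split.
  { pose proof (exp_pos K). apply Rmult_le_pos; nra. }
  split; [assumption|]. intros s Hs Hk n Hn.
  destruct (product_converges (fun n => gauss_ratio b n s) K m HK Hm) as [l [Hl Hb]].
  { intros k Hk'. now apply H. }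
  assert (l = gamma_ratio b s).
  { rewrite <- (is_Clim_unique _ _ Hl). apply is_Clim_unique. apply gamma_ratio_limit.
    now apply (nonpole_of_dist s d). }
  subst l. eapply Rle_trans; [now apply Hb|].
  assert (0 < INR n) by (apply lt_0_INR; lia).
  unfold Rdiv. apply Rmult_le_compat_r; [left; now apply Rinv_0_lt_compat|].
  apply Rmult_le_compat_l; [pose proof (exp_pos K); nra|].
  unfold gauss_ratio, M. rewrite Cmod_mult. apply Rmult_le_compat_l; [apply Cmod_ge_0|].
  unfold Cdiv. rewrite Cmod_mult, Cmod_inv_total. apply Rmult_le_compat; try apply Cmod_ge_0.
  - rewrite <- Cmod_inv_total. apply Cmod_ge_0.
  - eapply Rle_trans; [apply rising_Cmod_le|]. apply pow_incr.
    pose proof (Cmod_triangle s b). pose proof (Cmod_ge_0 (s + b)). pose proof (pos_INR m). lra.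
  - apply Rinv_le_contravar; [now apply pow_lt|]. now apply rising_Cmod_ge.
Qed.

(** * Growth of Gamma quotients in a sector *)

(** Apply ln y <= y - 1 to y = 1/(1 + u); the restriction on u gives y <= 4, the constant of the
    quadratic term. *)
Lemma ln_1_add_ge (u : R) : - (3 / 4) <= u -> u - 4 * u ^ 2 <= ln (1 + u).
Proof.
  intros Hu. pose proof (ln_le_sub_1 (/ (1 + u)) ltac:(apply Rinv_0_lt_compat; lra)).
  rewrite ln_Rinv in H by lra.
  assert (/ (1 + u) <= 4).
  { replace 4 with (/ (1 / 4)) by field. apply Rinv_le_contravar; lra. }
  assert (/ (1 + u) = 1 - u + u ^ 2 * / (1 + u)) by (field; lra).
  pose proof (pow2_ge_0 u). nra.
Qed.

Lemma Cmod_1_add_sqr (v : C) : Cmod (1 + v) * Cmod (1 + v) = 1 + (2 * Re v + Cmod v ^ 2).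
Proof.
  rewrite Cmod_sqr. replace (Cmod v ^ 2) with (Re v * Re v + Im v * Im v) by (rewrite <- Cmod_sqr; ring).
  unfold Re, Im; simpl; ring.
Qed.

(** |1 + w|^2 = 1 + u with u = 2 Re w + |w|^2, and ln (1 + u) lies between u - 4 u^2 and u. *)
Lemma ln_Cmod_1_add (w : C) : Cmod w <= 1 / 2 ->
  Rabs (Re w - ln (Cmod (1 + w))) <= 13 * Cmod w ^ 2.
Proof.
  intros Hw. pose proof (Cmod_ge_0 w) as H0.
  assert (H1 : 1 / 2 <= Cmod (1 + w)) by (pose proof (Cmod_add_ge 1 w); rewrite Cmod_1 in H; lra).
  set (u := 2 * Re w + Cmod w ^ 2).
  assert (E : Cmod (1 + w) * Cmod (1 + w) = 1 + u).
  { apply Cmod_1_add_sqr. }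
  assert (EL : 2 * ln (Cmod (1 + w)) = ln (1 + u)).
  { rewrite <- E, ln_mult by lra. ring. }
  assert (Hu : - (3 / 4) <= u) by nra.
  pose proof (ln_1_add_ge u Hu).
  pose proof (ln_le_sub_1 (1 + u) ltac:(lra)).
  pose proof (Re_le_Cmod' w) as HR. apply Rabs_le_between in HR.
  assert (u ^ 2 <= 25 / 4 * Cmod w ^ 2).
  { assert (Rabs u <= 5 / 2 * Cmod w) by (apply Rabs_le; unfold u; split; nra).
    rewrite <- (pow2_abs u). pose proof (Rabs_pos u). nra. }
  apply Rabs_le. unfold u in *. split; nra.
Qed.

(** Up to second order |1 + b w| is exp (Re (b w)), and Re (b w) = Re b Re w - Im b Im w. The first
    part is expressed by ln |1 + w| so that products telescope; the second, only of first order in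
    w, remains as the error |Im w|. *)
Lemma Cmod_1_add_mult_le (b w : C) : Cmod w <= 1 / 2 ->
  Cmod (1 + b * w) <=
  exp (Re b * ln (Cmod (1 + w)) + (Cmod b ^ 2 + 14 * Cmod b) * (Cmod w ^ 2 + Rabs (Im w))).
Proof.
  intros Hw. pose proof (Cmod_ge_0 w) as H0. pose proof (Cmod_ge_0 b) as Hb0.
  set (v := (b * w)%C).
  assert (H1 : Cmod (1 + v) <= exp (Re v + Cmod v ^ 2 / 2)).
  { assert (E : Cmod (1 + v) * Cmod (1 + v) = 1 + (2 * Re v + Cmod v ^ 2)).
    { apply Cmod_1_add_sqr. }
    pose proof (exp_ineq1_le (2 * Re v + Cmod v ^ 2)).
    replace (2 * Re v + Cmod v ^ 2) with ((Re v + Cmod v ^ 2 / 2) + (Re v + Cmod v ^ 2 / 2)) in H at 2 by field.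
    rewrite exp_plus in H. rewrite <- E in H.
    pose proof (exp_pos (Re v + Cmod v ^ 2 / 2)). pose proof (Cmod_ge_0 (1 + v)). nra. }
  eapply Rle_trans; [apply H1|]. apply exp_le.
  assert (E2 : Cmod v = Cmod b * Cmod w) by apply Cmod_mult.
  assert (E3 : Re v = Re b * Re w - Im b * Im w) by reflexivity.
  rewrite E3, E2.
  pose proof (ln_Cmod_1_add w Hw) as H2.
  set (L := ln (Cmod (1 + w))) in *.
  assert (H3 : Re b * (Re w - L) <= Cmod b * (13 * Cmod w ^ 2)).
  { eapply Rle_trans; [apply Rle_abs|]. rewrite Rabs_mult.
    apply Rmult_le_compat; try apply Rabs_pos; [apply Re_le_Cmod'|assumption]. }
  assert (H4 : - (Im b * Im w) <= Cmod b * Rabs (Im w)).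
  { eapply Rle_trans; [apply Rle_abs|]. rewrite Rabs_Ropp, Rabs_mult.
    apply Rmult_le_compat_r; [apply Rabs_pos|apply Im_le_Cmod]. }
  pose proof (Rabs_pos (Im w)). pose proof (pow2_ge_0 (Cmod w)). pose proof (pow2_ge_0 (Cmod b)).
  assert (0 <= Cmod b ^ 2 * Rabs (Im w)) by nra.
  assert (0 <= Cmod b * Rabs (Im w)) by nra.
  assert (0 <= Cmod b * Cmod w ^ 2) by nra.
  assert (0 <= Cmod b ^ 2 * Cmod w ^ 2) by nra.
  nra.
Qed.

(** The second condition is cos (arg s) >= -1/2. The sector extends beyond the right half-plane
    because one of a - beta + i v and a - i v acquires a negative real part far out on a lifted
    contour. *)
Definition in_sector (s : C) : Prop := 4 <= Cmod s /\ - Cmod s / 2 <= Re s.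

(** In the sector |s + k|^2 >= |s|^2 - |s| k + k^2, which exceeds ((|s| + k)/2)^2 by 3/4 (|s| -
    k)^2. *)
Lemma sector_shift (s : C) (k : nat) : in_sector s ->
  (Cmod s + INR k) / 2 <= Cmod (s + RtoC (INR k)).
Proof.
  intros [H1 H2]. pose proof (pos_INR k).
  pose proof (Cmod_sqr (s + RtoC (INR k))) as E. pose proof (Cmod_sqr s) as E'.
  simpl in E. unfold Re, Im in *.
  pose proof (Cmod_ge_0 (s + RtoC (INR k))).
  assert (((Cmod s + INR k) / 2) * ((Cmod s + INR k) / 2) <= Cmod (s + RtoC (INR k)) * Cmod (s + RtoC (INR k))).
  { rewrite E.
    replace ((fst s + INR k) * (fst s + INR k) + (snd s + 0) * (snd s + 0)) with
     (Cmod s * Cmod s + 2 * (INR k * (fst s + Cmod s / 2)) - Cmod s * INR k + INR k * INR k) by (rewrite E'; field).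
    assert (0 <= INR k * (fst s + Cmod s / 2)) by (apply Rmult_le_pos; lra).
    pose proof (Rle_0_sqr (Cmod s - INR k)) as Hsq. unfold Rsqr in Hsq. lra. }
  nra.
Qed.

(** With q = s + k the factor is 1 + b/q, and [Cmod_1_add_mult_le] compares it with (|q + 1| /
    |q|)^(Re b), which telescopes in k. The error telescopes as well, with a total that is bounded
    uniformly in the sector. *)
Lemma sector_factor_le (b s : C) (k : nat) : in_sector s ->
  Cmod (s + b + RtoC (INR k)) / Cmod (s + RtoC (INR k)) <=
  exp (Re b * (ln (Cmod (s + RtoC (INR k) + 1)) - ln (Cmod (s + RtoC (INR k))))
    + (Cmod b ^ 2 + 14 * Cmod b) * (1 + Cmod s) * 4 * (/ (Cmod s + INR k - 1) - / (Cmod s + INR k))).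
Proof.
  intros Hs. pose proof (sector_shift s k Hs) as Hk. destruct Hs as [Hs1 Hs2].
  pose proof (pos_INR k) as Hk0.
  set (q := (s + RtoC (INR k))%C) in *.
  assert (Hq : q <> 0%C) by (apply Cmod_gt_0; lra).
  assert (HN : 0 < Cmod q) by lra.
  set (w := (/ q)%C).
  assert (Hw : Cmod w = / Cmod q) by apply Cmod_inv_total.
  assert (Hw1 : Cmod w <= 2 * / (Cmod s + INR k)).
  { rewrite Hw. replace (2 * / (Cmod s + INR k)) with (/ ((Cmod s + INR k) / 2)) by (field; lra).
    apply Rinv_le_contravar; lra. }
  assert (Hsk : / (Cmod s + INR k) <= 1 / 4).
  { replace (1 / 4) with (/ 4) by field. apply Rinv_le_contravar; lra. }
  replace (s + b + RtoC (INR k))%C with (q * (1 + b * w))%C by (unfold w, q in *; field; assumption).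
  replace (q + 1)%C with (q * (1 + w))%C by (unfold w; field; assumption).
  rewrite !Cmod_mult.
  assert (H1w : 1 / 2 <= Cmod (1 + w)) by (pose proof (Cmod_add_ge 1 w); rewrite Cmod_1 in H; lra).
  rewrite ln_mult by lra.
  replace (Cmod q * Cmod (1 + b * w) / Cmod q) with (Cmod (1 + b * w)) by (field; lra).
  eapply Rle_trans; [apply Cmod_1_add_mult_le; lra|]. apply exp_le.
  replace (ln (Cmod q) + ln (Cmod (1 + w)) - ln (Cmod q)) with (ln (Cmod (1 + w))) by ring.
  apply Rplus_le_compat_l.
  rewrite !Rmult_assoc. apply Rmult_le_compat_l.
  { pose proof (Cmod_ge_0 b). nra. }
  (* w is conj q / |q|^2 and Im q = Im s, so the first-order error |Im w| is at most |s| |w|^2,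
     which is summable in k. *)
  assert (HI : Rabs (Im w) <= Cmod s * Cmod w ^ 2).
  { assert (Im w = - (Im s) * Cmod w ^ 2).
    { rewrite Hw. pose proof (Cmod2_alt q) as E. unfold w, Cinv.
      rewrite pow_inv. rewrite E. unfold q, Re, Im; simpl. rewrite Rplus_0_r. reflexivity. }
    rewrite H, Rabs_mult, Rabs_Ropp, (Rabs_pos_eq (Cmod w ^ 2)) by apply pow2_ge_0.
    apply Rmult_le_compat_r; [apply pow2_ge_0|apply Im_le_Cmod]. }
  assert (HW : Cmod w ^ 2 <= 4 * (/ (Cmod s + INR k - 1) - / (Cmod s + INR k))).
  { pose proof (inv_sqr_le_telescope (Cmod s + INR k - 1) ltac:(lra)) as H.
    replace (Cmod s + INR k - 1 + 1) with (Cmod s + INR k) in H by ring.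
    apply Rle_trans with (4 * / (Cmod s + INR k) ^ 2); [|lra].
    replace (4 * / (Cmod s + INR k) ^ 2) with ((2 * / (Cmod s + INR k)) ^ 2) by (field; lra).
    apply pow_incr. split; [apply Cmod_ge_0|assumption]. }
  pose proof (Cmod_ge_0 s). nra.
Qed.

Lemma gauss_ratio_sector_le (b s : C) (n : nat) : in_sector s ->
  Cmod (rising (s + b) n / rising s n) <=
  exp (Re b * (ln (Cmod (s + RtoC (INR n) + 1)) - ln (Cmod s))
    + (Cmod b ^ 2 + 14 * Cmod b) * (1 + Cmod s) * 4 * (/ (Cmod s - 1) - / (Cmod s + INR n))).
Proof.
  intros Hs. induction n as [|n IH].
  - pose proof (sector_factor_le b s 0 Hs) as H. simpl in *.
    replace (s + 0)%C with s in * by ring. replace (s + b + 0)%C with (s + b)%C in * by ring.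
    rewrite Rplus_0_r in *. unfold Cdiv. rewrite Cmod_mult, Cmod_inv_total. exact H.
  - cbn [rising]. pose proof (sector_factor_le b s (S n) Hs) as H.
    replace (rising (s + b) n * (s + b + RtoC (INR (S n))) / (rising s n * (s + RtoC (INR (S n)))))%C
      with (rising (s + b) n / rising s n * ((s + b + RtoC (INR (S n))) * / (s + RtoC (INR (S n)))))%C
      by (unfold Cdiv; rewrite Cinv_mult_total; ring).
    rewrite Cmod_mult, (Cmod_mult (s + b + RtoC (INR (S n)))), Cmod_inv_total.
    eapply Rle_trans.
    { apply Rmult_le_compat; [apply Cmod_ge_0| |apply IH|apply H].
      rewrite <- Cmod_inv_total, <- Cmod_mult. apply Cmod_ge_0. }
    rewrite <- exp_plus. apply exp_le. right.
    replace (s + RtoC (INR n) + 1)%C with (s + RtoC (INR (S n)))%C by (rewrite S_INR, RtoC_plus; ring).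
    replace (Cmod s + INR (S n) - 1) with (Cmod s + INR n) by (rewrite S_INR; ring).
    ring.
Qed.

(** A bound of Stirling type, read off from the telescoped product: for large n, ln |s + n + 1|
    differs from ln n by at most 1 and cancels against n^(-b), so that only -Re b ln |s| is left. *)
Lemma gamma_ratio_sector (b : C) :
  exists M, 0 < M /\ forall s, in_sector s -> Cmod (gamma_ratio b s) <= M * exp (- Re b * ln (Cmod s)).
Proof.
  set (A := Cmod b ^ 2 + 14 * Cmod b).
  assert (HA : 0 <= A) by (unfold A; pose proof (Cmod_ge_0 b); nra).
  exists (exp (A * 7 + Rabs (Re b))). split; [apply exp_pos|]. intros s Hs.
  assert (Hnp : nonpole s).
  { apply (nonpole_of_dist s 1); [lra|]. intros k. pose proof (sector_shift s k Hs).
    destruct Hs. pose proof (pos_INR k). lra. }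
  replace (gamma_ratio b s) with (gamma_ratio b s - 0)%C by ring.
  destruct (INR_unbounded (2 * (Cmod s + 1))) as [N HN].
  apply (is_Clim_Cmod_sub_le _ _ 0%C _ N (gamma_ratio_limit b s Hnp)).
  intros n Hn. replace (gauss_ratio b n s - 0)%C with (gauss_ratio b n s) by ring.
  assert (HNn : INR N <= INR n) by (apply le_INR; lia).
  pose proof (Cmod_ge_0 s) as Hs0.
  unfold gauss_ratio. rewrite Cmod_mult. unfold Rcpow. rewrite Cmod_Cexp.
  replace (Re (- b * RtoC (ln (INR n)))) with (- Re b * ln (INR n)) by (unfold Re; simpl; ring).
  eapply Rle_trans.
  { apply Rmult_le_compat_l; [left; apply exp_pos|]. now apply gauss_ratio_sector_le. }
  rewrite <- !exp_plus. apply exp_le. fold A.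
  set (T := Cmod (s + RtoC (INR n) + 1)).
  assert (HT : INR n / 2 <= T <= 2 * INR n).
  { unfold T. replace (s + RtoC (INR n) + 1)%C with (RtoC (INR n) + (s + 1))%C by ring.
    pose proof (Cmod_add_ge (RtoC (INR n)) (s + 1)). pose proof (Cmod_triangle (RtoC (INR n)) (s + 1)).
    pose proof (Cmod_triangle s 1). rewrite Cmod_1 in H1. rewrite Cmod_R, Rabs_pos_eq in H, H0 by lra. lra. }
  assert (HL : Rabs (ln T - ln (INR n)) <= 1).
  { assert (Hn0 : 0 < INR n) by lra. pose proof (ln_le_sub_1 2 ltac:(lra)). apply Rabs_le. split.
    - assert (ln (INR n / 2) <= ln T) by (apply Rcomplements.ln_le; lra).
      rewrite ln_div in H0 by lra. lra.
    - assert (ln T <= ln (2 * INR n)) by (apply Rcomplements.ln_le; lra).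
      rewrite ln_mult in H0 by lra. lra. }
  assert (H1 : Re b * (ln T - ln (INR n)) <= Rabs (Re b)).
  { eapply Rle_trans; [apply Rle_abs|]. rewrite Rabs_mult. pose proof (Rabs_pos (Re b)). nra. }
  (* For |s| >= 4 the quotient 4 (1 + |s|) / (|s| - 1) is at most 20/3. *)
  assert (H2 : (1 + Cmod s) * 4 * (/ (Cmod s - 1) - / (Cmod s + INR n)) <= 7).
  { destruct Hs as [Hs1 _].
    assert (0 < / (Cmod s + INR n)) by (apply Rinv_0_lt_compat; lra).
    apply Rle_trans with ((1 + Cmod s) * 4 * / (Cmod s - 1)).
    - apply Rmult_le_compat_l; lra.
    - apply Rmult_le_reg_r with (Cmod s - 1); [lra|]. rewrite Rmult_assoc, Rinv_l by lra. lra. }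
  rewrite (Rmult_assoc A), (Rmult_assoc A).
  assert (A * ((1 + Cmod s) * 4 * (/ (Cmod s - 1) - / (Cmod s + INR n))) <= A * 7) by (now apply Rmult_le_compat_l).
  lra.
Qed.

(** * Path integrals of rational functions *)

(** Induction on the breakpoints: one that lies inside (a, b) is removed by splitting there, and P
    composes across the split. *)
Lemma breakpoint_induction (P : R -> R -> Prop) (l : list R) :
  (forall a b c, a < b -> b < c -> P a b -> P b c -> P a c) ->
  (forall a b, a < b -> (forall c, In c l -> ~ (a < c < b)) -> P a b) ->
  forall a b, a < b -> P a b.
Proof.
  intros Htr. induction l as [|x l IH]; intros H a b Hab.
  - apply H; [assumption|]. intros c [].
  - apply IH; [|assumption]. clear a b Hab. intros a b Hab Hl.
    destruct (Rlt_dec a x) as [H1|H1]; [destruct (Rlt_dec x b) as [H2|H2]|].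
    + apply (Htr a x b H1 H2); apply H; try assumption;
        intros c [->|Hc] Hc'; try lra; apply (Hl c Hc); lra.
    + apply H; [assumption|]. intros c [->|Hc] Hc'; [lra|]. now apply (Hl c Hc).
    + apply H; [assumption|]. intros c [->|Hc] Hc'; [lra|]. now apply (Hl c Hc).
Qed.

Lemma C1_path_derive (h : R -> C) (t : R) : C1_path h -> is_Cderive h t (path_velocity h t).
Proof.
  intros [H _]. destruct (H t) as [d Hd].
  pose proof (proj1 (is_derive_C h t d) Hd) as [H1 H2].
  replace (path_velocity h t) with d; [assumption|].
  apply C_ext; symmetry; [apply (is_derive_unique _ _ _ H1)|apply (is_derive_unique _ _ _ H2)].
Qed.

Lemma C1_path_velocity_continuous (h : R -> C) (t : R) :
  C1_path h -> Ccontinuous (path_velocity h) t.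
Proof. intros (_ & H1 & H2). apply continuous_C. split; [apply H1|apply H2]. Qed.

Lemma path_velocity_ext_loc (g h : R -> C) (t : R) :
  locally t (fun s => g s = h s) -> path_velocity g t = path_velocity h t.
Proof.
  intros H. unfold path_velocity. f_equal; apply Derive_ext_loc;
  apply (filter_imp _ _ (fun s (E : g s = h s) => f_equal _ E) H).
Qed.

Lemma locally_in_interval (a b t : R) (P : R -> Prop) :
  a < t < b -> (forall s, a < s < b -> P s) -> locally t P.
Proof.
  intros Ht H.
  assert (Hd : 0 < Rmin (t - a) (b - t)) by (apply Rmin_pos; lra).
  exists (mkposreal _ Hd). intros s Hs. apply H.
  apply Rabs_lt_between in Hs. simpl in Hs.
  pose proof (Rmin_l (t - a) (b - t)). pose proof (Rmin_r (t - a) (b - t)).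
  unfold minus, plus, opp in Hs; simpl in Hs. lra.
Qed.

Lemma path_velocity_eq (g h : R -> C) (a b t : R) :
  (forall s, a < s < b -> g s = h s) -> a < t < b -> path_velocity g t = path_velocity h t.
Proof. intros H Ht. apply path_velocity_ext_loc. now apply (locally_in_interval a b). Qed.

Lemma continuous_Cmod (f : R -> C) (t : R) :
  Ccontinuous f t -> continuous (fun s => Cmod (f s)) t.
Proof.
  intros H. rewrite continuous_C_eps in H.
  apply (proj2 (filterlim_locally (F := locally t) (fun s => Cmod (f s)) (Cmod (f t)))).
  intros eps. destruct (H eps (cond_pos eps)) as [d [Hd Hs]].
  exists (mkposreal d Hd). intros s Hb. specialize (Hs s Hb).
  apply Rabs_lt_between. unfold minus, plus, opp; simpl.
  pose proof (Cmod_sub_ge (f s) (f t)). pose proof (Cmod_sub_ge (f t) (f s)).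
  rewrite (Cmod_sub_sym (f t)) in H1. lra.
Qed.

Lemma continuous_bounded (f : R -> C) (a b : R) :
  a <= b -> (forall t, a <= t <= b -> Ccontinuous f t) ->
  exists M, 0 <= M /\ forall t, a <= t <= b -> Cmod (f t) <= M.
Proof.
  intros Hab H.
  destruct (continuity_ab_maj (fun t => Cmod (f t)) a b Hab) as [m [Hm _]].
  - intros t Ht. apply continuity_pt_filterlim. apply continuous_Cmod. now apply H.
  - exists (Cmod (f m)). split; [apply Cmod_ge_0|]. exact Hm.
Qed.

Lemma continuous_away_from_0 (f : R -> C) (a b : R) :
  a <= b -> (forall t, a <= t <= b -> Ccontinuous f t) ->
  (forall t, a <= t <= b -> f t <> 0%C) ->
  exists d, 0 < d /\ forall t, a <= t <= b -> d <= Cmod (f t).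
Proof.
  intros Hab H H0.
  destruct (continuity_ab_min (fun t => Cmod (f t)) a b Hab) as [m [Hm Hm']].
  - intros t Ht. apply continuity_pt_filterlim. apply continuous_Cmod. now apply H.
  - exists (Cmod (f m)). split; [|exact Hm]. apply Cmod_gt_0. now apply H0.
Qed.

Lemma velocity_bounded (g : R -> C) (a b : R) : piecewise_C1 g -> a < b ->
  exists V, 0 <= V /\ forall t, a <= t <= b -> Cmod (path_velocity g t) <= V.
Proof.
  intros [_ [l Hl]]. revert a b.
  apply (breakpoint_induction (fun a b => exists V, 0 <= V /\ forall t, a <= t <= b -> Cmod (path_velocity g t) <= V) l).
  - intros a b c Hab Hbc [V1 [HV1 H1]] [V2 [HV2 H2]].
    exists (V1 + V2). split; [lra|]. intros t Ht. destruct (Rle_dec t b).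
    + specialize (H1 t ltac:(lra)). lra.
    + specialize (H2 t ltac:(lra)). lra.
  - intros a b Hab Hn. destruct (Hl a b Hab Hn) as [h [Hh E]].
    destruct (continuous_bounded (path_velocity h) a b ltac:(lra)) as [M [HM HM']].
    { intros t _. now apply C1_path_velocity_continuous. }
    (* At a and b the path may have corners, where [path_velocity] takes values unrelated to h;
       these two values are added to the bound. *)
    exists (M + Cmod (path_velocity g a) + Cmod (path_velocity g b)).
    pose proof (Cmod_ge_0 (path_velocity g a)). pose proof (Cmod_ge_0 (path_velocity g b)).
    split; [lra|]. intros t Ht.
    destruct (Req_dec t a) as [->|]; [lra|]. destruct (Req_dec t b) as [->|]; [lra|].
    rewrite (path_velocity_eq g h a b) by (try lra; intros; apply E; lra).
    specialize (HM' t Ht). lra.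
Qed.

Lemma ex_path_integral (g : R -> C) (f : C -> C) (a b : R) : piecewise_C1 g -> a < b ->
  (forall t, a <= t <= b -> Ccontinuous (fun s => f (g s)) t) ->
  ex_CRInt (along g f) a b.
Proof.
  intros [_ [l Hl]]. revert a b.
  apply (breakpoint_induction (fun a b => (forall t, a <= t <= b -> Ccontinuous (fun s => f (g s)) t) -> ex_CRInt (along g f) a b) l).
  - intros a b c Hab Hbc H1 H2 H. apply (ex_RInt_Chasles (V := C_R_NormedModule) _ a b c).
    + apply H1. intros; apply H; lra.
    + apply H2. intros; apply H; lra.
  - intros a b Hab Hn H. destruct (Hl a b Hab Hn) as [h [Hh E]].
    destruct (ex_CRInt_continuous (fun t => f (g t) * path_velocity h t)%C a b ltac:(lra)) as [I HI].
    { intros t Ht. apply continuous_Cmult; [now apply H|now apply C1_path_velocity_continuous]. }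
    exists I. apply (is_CRInt_ext _ _ _ _ _ (Rlt_le _ _ Hab)) with (2 := HI).
    intros t Ht. unfold along. f_equal. symmetry. apply (path_velocity_eq g h a b); [|lra].
    intros; apply E; lra.
Qed.

(* Complex differentiability of [F] on the trace of [g], expressed through real derivatives along curves. *)
Definition primitive_along (g : R -> C) (a b : R) (F f : C -> C) : Prop :=
  forall (h : R -> C) (t : R) (d : C), a <= t <= b -> h t = g t -> is_Cderive h t d ->
    is_Cderive (fun s => F (h s)) t (f (g t) * d)%C.

Lemma path_integral_primitive (g : R -> C) (F f : C -> C) (a b : R) : piecewise_C1 g -> a < b ->
  (forall t, a <= t <= b -> Ccontinuous (fun s => f (g s)) t) ->
  primitive_along g a b F f ->
  is_CRInt (along g f) a b (F (g b) - F (g a))%C.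
Proof.
  intros [_ [l Hl]]. revert a b.
  apply (breakpoint_induction (fun a b => (forall t, a <= t <= b -> Ccontinuous (fun s => f (g s)) t) ->
    primitive_along g a b F f -> is_CRInt (along g f) a b (F (g b) - F (g a))%C) l).
  - intros a b c Hab Hbc H1 H2 H HF.
    replace (F (g c) - F (g a))%C with ((F (g b) - F (g a)) + (F (g c) - F (g b)))%C by ring.
    apply (is_CRInt_Chasles _ a b c).
    + apply H1; [intros; apply H; lra|]. intros h t d Ht. apply HF; lra.
    + apply H2; [intros; apply H; lra|]. intros h t d Ht. apply HF; lra.
  - intros a b Hab Hn H HF. destruct (Hl a b Hab Hn) as [h [Hh E]].
    apply (is_CRInt_ext (fun t => f (g t) * path_velocity h t)%C _ _ _ _ (Rlt_le _ _ Hab)).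
    { intros t Ht. unfold along. f_equal. symmetry. apply (path_velocity_eq g h a b); [|lra].
      intros; apply E; lra. }
    rewrite !E by lra. apply (is_CRInt_derive (fun s => F (h s))); [lra| |].
    + intros t Ht. apply HF; [assumption|symmetry; now apply E|now apply C1_path_derive].
    + intros t Ht. apply continuous_Cmult; [now apply H|now apply C1_path_velocity_continuous].
Qed.

Lemma path_integral_bound (g : R -> C) (f : C -> C) (a b V m : R) (I : C) : a < b ->
  (forall t, a <= t <= b -> Cmod (path_velocity g t) <= V) ->
  (forall t, a <= t <= b -> Cmod (f (g t)) <= m) ->
  is_CRInt (along g f) a b I -> Cmod I <= (b - a) * (m * V).
Proof.
  intros Hab HV Hf HI. apply (is_CRInt_Cmod_le_const (along g f) a b I); [lra|assumption|].
  intros t Ht. unfold along. rewrite Cmod_mult.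
  apply Rmult_le_compat; try apply Cmod_ge_0; [now apply Hf|now apply HV].
Qed.

Lemma along_plus (g : R -> C) (f1 f2 : C -> C) (a b : R) (I1 I2 : C) :
  is_CRInt (along g f1) a b I1 -> is_CRInt (along g f2) a b I2 ->
  is_CRInt (along g (fun v => f1 v + f2 v)%C) a b (I1 + I2)%C.
Proof.
  intros H1 H2. eapply (is_RInt_ext (V := C_R_NormedModule)); [|apply (is_CRInt_plus _ _ _ _ _ _ H1 H2)].
  intros t _. unfold along. simpl. ring.
Qed.

Lemma along_mult (g : R -> C) (c : C) (f : C -> C) (a b : R) (I : C) :
  is_CRInt (along g f) a b I -> is_CRInt (along g (fun v => c * f v)%C) a b (c * I)%C.
Proof.
  intros H. eapply (is_RInt_ext (V := C_R_NormedModule)); [|apply (is_CRInt_mult c _ _ _ _ H)].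
  intros t _. unfold along. simpl. ring.
Qed.

Lemma along_ext (g : R -> C) (f f' : C -> C) (a b : R) (I : C) : a <= b ->
  (forall t, a <= t <= b -> f (g t) = f' (g t)) ->
  is_CRInt (along g f) a b I -> is_CRInt (along g f') a b I.
Proof.
  intros Hab H. apply is_CRInt_ext; [assumption|]. intros t Ht. unfold along. now rewrite H by lra.
Qed.

(** Equality of the two path integrals, stated through a common value so that existence of both is
    included. *)
Definition balanced (g1 g2 : R -> C) (a b : R) (f : C -> C) : Prop :=
  exists I, is_CRInt (along g1 f) a b I /\ is_CRInt (along g2 f) a b I.

Definition off_path (g : R -> C) (a b : R) (p : C) : Prop :=
  forall t, a <= t <= b -> p <> g t.

Record bipath (g1 g2 : R -> C) (a b : R) : Prop := {
  bi_lt : a < b;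
  bi_1 : piecewise_C1 g1;
  bi_2 : piecewise_C1 g2;
  bi_a : g1 a = g2 a;
  bi_b : g1 b = g2 b }.

Lemma off_path_sub (g : R -> C) (a b : R) (p : C) (t : R) :
  off_path g a b p -> a <= t <= b -> (g t - p)%C <> 0%C.
Proof.
  intros H Ht E. apply (H t Ht). replace p with (g t - (g t - p))%C by ring. rewrite E. ring.
Qed.

Lemma balanced_plus g1 g2 a b f1 f2 :
  balanced g1 g2 a b f1 -> balanced g1 g2 a b f2 ->
  balanced g1 g2 a b (fun v => f1 v + f2 v)%C.
Proof.
  intros [I [H1 H2]] [J [H3 H4]]. exists (I + J)%C. split; now apply along_plus.
Qed.

Lemma balanced_mult g1 g2 a b c f :
  balanced g1 g2 a b f -> balanced g1 g2 a b (fun v => c * f v)%C.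
Proof. intros [I [H1 H2]]. exists (c * I)%C. split; now apply along_mult. Qed.

Lemma balanced_ext g1 g2 a b f f' : a <= b ->
  (forall t, a <= t <= b -> f (g1 t) = f' (g1 t)) ->
  (forall t, a <= t <= b -> f (g2 t) = f' (g2 t)) ->
  balanced g1 g2 a b f -> balanced g1 g2 a b f'.
Proof.
  intros Hab E1 E2 [I [H1 H2]]. exists I.
  split; [now apply (along_ext g1 f)|now apply (along_ext g2 f)].
Qed.

Lemma balanced_primitive g1 g2 a b (F f : C -> C) : bipath g1 g2 a b ->
  (forall t, a <= t <= b -> Ccontinuous (fun s => f (g1 s)) t) ->
  (forall t, a <= t <= b -> Ccontinuous (fun s => f (g2 s)) t) ->
  primitive_along g1 a b F f -> primitive_along g2 a b F f ->
  balanced g1 g2 a b f.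
Proof.
  intros [Hab G1 G2 Ea Eb] C1 C2 P1 P2. exists (F (g1 b) - F (g1 a))%C. split.
  - now apply path_integral_primitive.
  - rewrite Ea, Eb. now apply path_integral_primitive.
Qed.

Lemma balanced_limit g1 g2 a b (f : C -> C) : bipath g1 g2 a b ->
  (forall t, a <= t <= b -> Ccontinuous (fun s => f (g1 s)) t) ->
  (forall t, a <= t <= b -> Ccontinuous (fun s => f (g2 s)) t) ->
  (forall eps, 0 < eps -> exists f', balanced g1 g2 a b f' /\
     forall t, a <= t <= b -> Cmod (f' (g1 t) - f (g1 t)) <= eps /\ Cmod (f' (g2 t) - f (g2 t)) <= eps) ->
  balanced g1 g2 a b f.
Proof.
  intros [Hab G1 G2 Ea Eb] C1 C2 H.
  destruct (ex_path_integral g1 f a b G1 Hab C1) as [I1 HI1].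
  destruct (ex_path_integral g2 f a b G2 Hab C2) as [I2 HI2].
  destruct (velocity_bounded g1 a b G1 Hab) as [V1 [HV1 HV1']].
  destruct (velocity_bounded g2 a b G2 Hab) as [V2 [HV2 HV2']].
  assert (E : I1 = I2).
  { apply C_le_eq. intros e He.
    (* An approximation within e/D changes the two integrals by at most e in total. *)
    set (D := (b - a) * (V1 + V2) + 1). assert (HD : 0 < D) by (unfold D; nra).
    destruct (H (e / D) ltac:(now apply Rdiv_lt_0_compat)) as [f' [[J [HJ1 HJ2]] Hf']].
    assert (B1 : Cmod (J + (- (1)) * I1) <= (b - a) * (e / D * V1)).
    { apply (path_integral_bound g1 (fun v => f' v + (- (1)) * f v)%C); try assumption.
      - intros t Ht. replace (f' (g1 t) + (- (1)) * f (g1 t))%C with (f' (g1 t) - f (g1 t))%C by ring. now apply Hf'.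
      - apply along_plus; [assumption|]. now apply along_mult. }
    assert (B2 : Cmod (J + (- (1)) * I2) <= (b - a) * (e / D * V2)).
    { apply (path_integral_bound g2 (fun v => f' v + (- (1)) * f v)%C); try assumption.
      - intros t Ht. replace (f' (g2 t) + (- (1)) * f (g2 t))%C with (f' (g2 t) - f (g2 t))%C by ring. now apply Hf'.
      - apply along_plus; [assumption|]. now apply along_mult. }
    replace (J + (- (1)) * I1)%C with (J - I1)%C in B1 by ring.
    replace (J + (- (1)) * I2)%C with (J - I2)%C in B2 by ring.
    pose proof (Cmod_sub_triangle I1 J I2) as T. rewrite (Cmod_sub_sym I1 J) in T.
    assert (B3 : (b - a) * (e / D * V1) + (b - a) * (e / D * V2) <= e).
    { replace ((b - a) * (e / D * V1) + (b - a) * (e / D * V2)) with (e * ((b - a) * (V1 + V2) / D)) by (field; lra).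
      rewrite <- (Rmult_1_r e) at 2. apply Rmult_le_compat_l; [lra|].
      apply Rmult_le_reg_r with D; [assumption|]. unfold Rdiv. rewrite Rmult_assoc, Rinv_l by lra.
      unfold D. lra. }
    lra. }
  subst I2. now exists I1.
Qed.

Lemma is_derive_Cpow (f : R -> C) (t : R) (d : C) (n : nat) :
  is_Cderive f t d ->
  is_Cderive (fun s => f s ^ S n)%C t (RtoC (INR (S n)) * f t ^ n * d)%C.
Proof.
  intros H. induction n as [|n IH].
  - replace (RtoC (INR 1) * f t ^ 0 * d)%C with d by (simpl; ring).
    apply (is_derive_ext f); [intros s; change (f s = (f s * 1)%C); ring|assumption].
  - replace (RtoC (INR (S (S n))) * f t ^ S n * d)%C with
     (d * f t ^ S n + f t * (RtoC (INR (S n)) * f t ^ n * d))%C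
     by (rewrite (S_INR (S n)), RtoC_plus; simpl; ring).
    apply (is_derive_Cmult f (fun s => f s ^ S n)%C t); assumption.
Qed.

Lemma is_derive_Cinv (f : R -> C) (t : R) (d : C) :
  is_Cderive f t d -> f t <> 0%C ->
  is_Cderive (fun s => / f s)%C t (- d * (/ f t) ^ 2)%C.
Proof.
  rewrite !is_derive_C. intros [H1 H2] H0.
  assert (Hn : Re (f t) * Re (f t) + Im (f t) * Im (f t) <> 0).
  { rewrite <- Cmod_sqr. apply Cmod_gt_0 in H0. nra. }
  assert (HD : is_derive (fun s => Re (f s) * Re (f s) + Im (f s) * Im (f s)) t
     (2 * Re (f t) * Re d + 2 * Im (f t) * Im d)).
  { evar_last.
    - apply (is_derive_plus (V := R_NormedModule)); apply (is_derive_mult (K := R_AbsRing));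
       try eassumption; intros; apply Rmult_comm.
    - unfold plus, mult; simpl. ring. }
  split.
  - apply (is_derive_ext (fun s => Re (f s) / (Re (f s) * Re (f s) + Im (f s) * Im (f s)))).
    { intros s. unfold Cinv, Re, Im; simpl. now rewrite !Rmult_1_r. }
    evar_last; [apply is_derive_div; eassumption|].
    unfold Cinv, Re, Im in *; simpl. field. exact Hn.
  - apply (is_derive_ext (fun s => - Im (f s) / (Re (f s) * Re (f s) + Im (f s) * Im (f s)))).
    { intros s. unfold Cinv, Re, Im; simpl. now rewrite !Rmult_1_r. }
    evar_last; [apply is_derive_div; [apply (is_derive_opp (V := R_NormedModule)); eassumption|eassumption|assumption]|].
    unfold Cinv, Re, Im, opp in *; simpl. field. exact Hn.
Qed.

Lemma is_derive_Csub_const (f : R -> C) (t : R) (d p : C) :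
  is_Cderive f t d -> is_Cderive (fun s => f s - p)%C t d.
Proof.
  intros H. replace d with (d - 0)%C by ring.
  apply (is_derive_minus (V := C_R_NormedModule) f (fun _ => p) t); [assumption|].
  apply (is_derive_const (V := C_R_NormedModule)).
Qed.

Lemma piecewise_continuous (g : R -> C) (t : R) : piecewise_C1 g -> Ccontinuous g t.
Proof. intros [H _]. apply H. Qed.

Lemma balanced_sub_pow g1 g2 a b (p : C) (k : nat) : bipath g1 g2 a b ->
  balanced g1 g2 a b (fun v => (v - p) ^ k)%C.
Proof.
  intros B. pose proof (bi_1 _ _ _ _ B). pose proof (bi_2 _ _ _ _ B).
  assert (Hk : RtoC (INR (S k)) <> 0%C) by (apply RtoC_neq_0, not_0_INR; lia).
  assert (HP : forall g, primitive_along g a b (fun v => / RtoC (INR (S k)) * (v - p) ^ S k)%C (fun v => (v - p) ^ k)%C).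
  { intros g h t d Ht E Hd. rewrite <- E.
    replace ((h t - p) ^ k * d)%C with (0 * (h t - p) ^ S k + / RtoC (INR (S k)) * (RtoC (INR (S k)) * (h t - p) ^ k * d))%C
      by (field; assumption).
    apply (is_derive_Cmult (fun _ => / RtoC (INR (S k)))%C (fun s => (h s - p) ^ S k)%C).
    - apply (is_derive_const (V := C_R_NormedModule)).
    - apply (is_derive_Cpow (fun s => h s - p)%C). now apply is_derive_Csub_const. }
  apply (balanced_primitive g1 g2 a b (fun v => / RtoC (INR (S k)) * (v - p) ^ S k)%C); try assumption; try apply HP;
  intros t Ht; apply continuous_Cpow, continuous_Cminus; (apply continuous_const || now apply piecewise_continuous).
Qed.

(** Exponents from 2 on have a single-valued primitive. Only the exponent 1 remains for the winding
    number argument. *)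
Lemma balanced_inv_pow_ge_2 g1 g2 a b (p : C) (k : nat) : bipath g1 g2 a b ->
  off_path g1 a b p -> off_path g2 a b p ->
  balanced g1 g2 a b (fun v => (/ (v - p)) ^ (S (S k)))%C.
Proof.
  intros B O1 O2. pose proof (bi_1 _ _ _ _ B). pose proof (bi_2 _ _ _ _ B).
  assert (Hk : RtoC (INR (S k)) <> 0%C) by (apply RtoC_neq_0, not_0_INR; lia).
  assert (HP : forall g, off_path g a b p -> primitive_along g a b (fun v => - / RtoC (INR (S k)) * (/ (v - p)) ^ S k)%C (fun v => (/ (v - p)) ^ (S (S k)))%C).
  { intros g O h t d Ht E Hd. rewrite <- E.
    assert (Hn : (h t - p)%C <> 0%C) by (rewrite E; now apply (off_path_sub _ a b)).
    replace ((/ (h t - p)) ^ (S (S k)) * d)%C with (0 * (/ (h t - p)) ^ S k + - / RtoC (INR (S k)) * (RtoC (INR (S k)) * (/ (h t - p)) ^ k * (- d * (/ (h t - p)) ^ 2)))%C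
      by (cbn [Cpow]; field; split; assumption).
    apply (is_derive_Cmult (fun _ => - / RtoC (INR (S k)))%C (fun s => (/ (h s - p)) ^ S k)%C).
    - apply (is_derive_const (V := C_R_NormedModule)).
    - apply (is_derive_Cpow (fun s => / (h s - p))%C).
      apply (is_derive_Cinv (fun s => h s - p)%C); [now apply is_derive_Csub_const|assumption]. }
  apply (balanced_primitive g1 g2 a b (fun v => - / RtoC (INR (S k)) * (/ (v - p)) ^ S k)%C); try assumption; try now apply HP.
  - intros t Ht. apply continuous_Cpow, continuous_Cinv; [apply continuous_Cminus|now apply (off_path_sub _ a b)];
      (apply continuous_const || now apply piecewise_continuous).
  - intros t Ht. apply continuous_Cpow, continuous_Cinv; [apply continuous_Cminus|now apply (off_path_sub _ a b)];
      (apply continuous_const || now apply piecewise_continuous).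
Qed.

(** The last condition says that the closed curve formed by the two paths has winding number 0
    around p. *)
Definition balanced_pole (g1 g2 : R -> C) (a b : R) (p : C) : Prop :=
  off_path g1 a b p /\ off_path g2 a b p /\ balanced g1 g2 a b (fun v => / (v - p))%C.

Lemma balanced_inv_pow g1 g2 a b (p : C) (k : nat) : bipath g1 g2 a b ->
  balanced_pole g1 g2 a b p -> balanced g1 g2 a b (fun v => (/ (v - p)) ^ k)%C.
Proof.
  intros B [O1 [O2 H]]. pose proof (bi_lt _ _ _ _ B). destruct k as [|[|k]].
  - apply (balanced_sub_pow g1 g2 a b p 0 B).
  - apply (balanced_ext g1 g2 a b (fun v => / (v - p))%C); try lra; try assumption; intros; simpl; ring.
  - now apply balanced_inv_pow_ge_2.
Qed.

Lemma Cpow_neq_0 (x : C) (n : nat) : x <> 0%C -> (x ^ n)%C <> 0%C.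
Proof.
  intros Hx. induction n as [|n IH]; simpl; [apply RtoC_neq_0, R1_neq_R0|now apply Cmult_neq_0].
Qed.

Definition lin_prod (m : list C) (v : C) : C :=
  fold_right (fun q acc => (v - q) * acc)%C 1%C m.

(** Each linear factor is written as (v - p) + (p - q), which removes it from the product. Keeping
    the two exponents j and k apart postpones all cancellation to the end. *)
Lemma balanced_pow_mul_lin_prod g1 g2 a b (p : C) (m : list C) : bipath g1 g2 a b ->
  balanced_pole g1 g2 a b p ->
  forall j k : nat, balanced g1 g2 a b (fun v => (v - p) ^ j * (/ (v - p)) ^ k * lin_prod m v)%C.
Proof.
  intros B Hp. pose proof (bi_lt _ _ _ _ B) as Hab. pose proof Hp as [O1 [O2 _]].
  assert (Hc : forall x : C, x <> 0%C -> forall n i, (x ^ (n + i) * (/ x) ^ i = x ^ n)%C).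
  { intros x Hx n i. rewrite Cpow_add_r, <- Cpow_inv_total. field. now apply Cpow_neq_0. }
  assert (Hc' : forall x : C, x <> 0%C -> forall n i, (x ^ i * (/ x) ^ (n + i) = (/ x) ^ n)%C).
  { intros x Hx n i. rewrite Cpow_add_r, <- (Cpow_inv_total x i). field. now apply Cpow_neq_0. }
  induction m as [|q m IH]; intros j k.
  - destruct (Nat.le_ge_cases k j) as [Hjk|Hjk].
    + apply (balanced_ext g1 g2 a b (fun v => (v - p) ^ (j - k))%C); [lra| | |now apply balanced_sub_pow];
      intros t Ht; cbn [lin_prod fold_right]; replace j with ((j - k) + k)%nat at 2 by lia;
      rewrite Hc by (now apply (off_path_sub _ a b)); ring.
    + apply (balanced_ext g1 g2 a b (fun v => (/ (v - p)) ^ (k - j))%C); [lra| | |now apply balanced_inv_pow];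
      intros t Ht; cbn [lin_prod fold_right]; replace k with ((k - j) + j)%nat at 2 by lia;
      rewrite Hc' by (now apply (off_path_sub _ a b)); ring.
  - apply (balanced_ext g1 g2 a b (fun v => (v - p) ^ (S j) * (/ (v - p)) ^ k * lin_prod m v + (p - q) * ((v - p) ^ j * (/ (v - p)) ^ k * lin_prod m v))%C).
    + lra.
    + intros; cbn [lin_prod fold_right Cpow]; fold (lin_prod m (g1 t)); ring.
    + intros; cbn [lin_prod fold_right Cpow]; fold (lin_prod m (g2 t)); ring.
    + apply balanced_plus; [apply IH|]. apply balanced_mult, IH.
Qed.

(* Partial fractions: 1/((v-p)^(k+1) (v-r)) = (1/((v-p)^k (v-r)) - 1/(v-p)^(k+1)) / (r-p)
   for r <> p, which lowers either k or the number of remaining factors. *)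
Lemma balanced_rational g1 g2 a b (m l : list C) : bipath g1 g2 a b ->
  (forall p, In p l -> balanced_pole g1 g2 a b p) ->
  forall p k, balanced_pole g1 g2 a b p ->
  balanced g1 g2 a b (fun v => (/ (v - p)) ^ k * lin_prod m v * / lin_prod l v)%C.
Proof.
  intros B Hl. pose proof (bi_lt _ _ _ _ B) as Hab.
  induction l as [|r l IH]; intros p k Hp.
  - apply (balanced_ext g1 g2 a b (fun v => (v - p) ^ 0 * (/ (v - p)) ^ k * lin_prod m v)%C); [lra| | |now apply balanced_pow_mul_lin_prod];
    intros; cbn [lin_prod fold_right Cpow]; field.
  - assert (Hr : balanced_pole g1 g2 a b r) by (apply Hl; now left).
    assert (IH' : forall p k, balanced_pole g1 g2 a b p ->
       balanced g1 g2 a b (fun v => (/ (v - p)) ^ k * lin_prod m v * / lin_prod l v)%C).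
    { apply IH. intros; apply Hl; now right. }
    clear IH.
    destruct (Ceq_dec r p) as [E|Hne].
    + subst r. apply (balanced_ext g1 g2 a b (fun v => (/ (v - p)) ^ (S k) * lin_prod m v * / lin_prod l v)%C); [lra| | |now apply IH'];
      intros t Ht; cbn [lin_prod fold_right Cpow];
      [fold (lin_prod l (g1 t)) | fold (lin_prod l (g2 t))]; rewrite Cinv_mult_total; ring.
    + induction k as [|k IHk].
      * apply (balanced_ext g1 g2 a b (fun v => (/ (v - r)) ^ 1 * lin_prod m v * / lin_prod l v)%C); [lra| | |now apply IH'];
        intros t Ht; cbn [lin_prod fold_right Cpow];
        [fold (lin_prod l (g1 t)) | fold (lin_prod l (g2 t))]; rewrite Cinv_mult_total; ring.
      * assert (Hrp : (r - p)%C <> 0%C).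
        { intros E. apply Hne. replace r with ((r - p) + p)%C by ring. rewrite E. ring. }
        destruct Hp as [O1 [O2 Hp]]. destruct Hr as [O3 [O4 Hr]].
        apply (balanced_ext g1 g2 a b (fun v => / (r - p) * (((/ (v - p)) ^ k * lin_prod m v * / lin_prod (r :: l) v)
                  + (- (1)) * ((/ (v - p)) ^ S k * lin_prod m v * / lin_prod l v)))%C); [lra| | |].
        -- intros t Ht. cbn [lin_prod fold_right Cpow]. fold (lin_prod l (g1 t)).
           rewrite Cinv_mult_total. generalize (/ lin_prod l (g1 t))%C. intros x.
           field. repeat split; try assumption; now apply (off_path_sub _ a b).
        -- intros t Ht. cbn [lin_prod fold_right Cpow]. fold (lin_prod l (g2 t)).
           rewrite Cinv_mult_total. generalize (/ lin_prod l (g2 t))%C. intros x.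
           field. repeat split; try assumption; now apply (off_path_sub _ a b).
        -- apply balanced_mult, balanced_plus; [exact IHk|]. apply balanced_mult, IH'. now split.
Qed.

(** Over N equal subintervals the increments add up to at most N K/N^2 = K/N. *)
Lemma quadratic_increment_constant (phi : R -> C) (K : R) :
  (forall x y, 0 <= x <= 1 -> 0 <= y <= 1 -> Cmod (phi y - phi x) <= K * (y - x) ^ 2) ->
  phi 1 = phi 0.
Proof.
  intros H.
  assert (HK : 0 <= K).
  { specialize (H 0 1 ltac:(lra) ltac:(lra)). pose proof (Cmod_ge_0 (phi 1 - phi 0)). nra. }
  apply C_le_eq. intros e He.
  destruct (INR_unbounded (Rmax 1 (K / e))) as [N HN].
  pose proof (Rmax_l 1 (K / e)). pose proof (Rmax_r 1 (K / e)).
  assert (HNK : K <= e * INR N).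
  { assert (H2 : K / e <= INR N) by lra. apply Rmult_le_compat_r with (r := e) in H2; [|lra].
    unfold Rdiv in H2. rewrite Rmult_assoc, Rinv_l, Rmult_1_r in H2 by lra. lra. }
  assert (Hi : forall i, (i <= N)%nat -> Cmod (phi (INR i / INR N) - phi 0) <= INR i * (K / INR N ^ 2)).
  { induction i as [|i IH]; intros Hi.
    - simpl. replace (0 / INR N) with 0 by (field; lra). replace (phi 0 - phi 0)%C with (RtoC 0) by ring.
      rewrite Cmod_0. lra.
    - eapply Rle_trans; [apply (Cmod_sub_triangle _ (phi (INR i / INR N)))|].
      specialize (IH ltac:(lia)).
      assert (B1 : 0 <= INR i / INR N <= 1).
      { split; [apply Rdiv_le_0_compat; [apply pos_INR|lra]|].
        apply Rmult_le_reg_r with (INR N); [lra|]. unfold Rdiv. rewrite Rmult_assoc, Rinv_l, Rmult_1_r, Rmult_1_l by lra. apply le_INR; lia. }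
      assert (B2 : 0 <= INR (S i) / INR N <= 1).
      { split; [apply Rdiv_le_0_compat; [apply pos_INR|lra]|].
        apply Rmult_le_reg_r with (INR N); [lra|]. unfold Rdiv. rewrite Rmult_assoc, Rinv_l, Rmult_1_r, Rmult_1_l by lra. apply le_INR; lia. }
      specialize (H _ _ B1 B2). rewrite S_INR in *.
      replace ((INR i + 1) / INR N - INR i / INR N) with (/ INR N) in H by (field; lra).
      replace (K * (/ INR N) ^ 2) with (K / INR N ^ 2) in H by (field; lra). lra. }
  specialize (Hi N ltac:(lia)). replace (INR N / INR N) with 1 in Hi by (field; lra).
  eapply Rle_trans; [apply Hi|]. replace (INR N * (K / INR N ^ 2)) with (K / INR N) by (field; lra).
  apply Rmult_le_reg_r with (INR N); [lra|]. unfold Rdiv. rewrite Rmult_assoc, Rinv_l by lra. lra.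
Qed.

(** * Winding numbers *)

Definition cauchy_integral (g : R -> C) (a b : R) (q : C) : C :=
  RInt (V := C_R_CompleteNormedModule) (along g (fun v => / (v - q))%C) a b.

Lemma continuous_inv_sub (g : R -> C) (a b : R) (q : C) (t : R) : piecewise_C1 g ->
  off_path g a b q -> a <= t <= b -> Ccontinuous (fun s => / (g s - q))%C t.
Proof.
  intros G O Ht. apply continuous_Cinv; [|now apply (off_path_sub _ a b)].
  apply continuous_Cminus; [now apply piecewise_continuous|apply continuous_const].
Qed.

Lemma cauchy_integral_correct (g : R -> C) (a b : R) (q : C) : piecewise_C1 g -> a < b ->
  off_path g a b q ->
  is_CRInt (along g (fun v => / (v - q))%C) a b (cauchy_integral g a b q).
Proof.
  intros G Hab O. apply (RInt_correct (V := C_R_CompleteNormedModule)).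
  apply ex_path_integral; try assumption. intros t Ht. now apply (continuous_inv_sub g a b).
Qed.

(* 2 pi i times the difference of winding numbers: locally constant in [q], and zero far away. *)
Definition winding_diff (g1 g2 : R -> C) (a b : R) (q : C) : C :=
  (cauchy_integral g1 a b q - cauchy_integral g2 a b q)%C.

Definition far_from (g : R -> C) (a b r : R) (q : C) : Prop :=
  forall t, a <= t <= b -> r <= Cmod (g t - q).

Lemma far_off_path g a b r q : 0 < r -> far_from g a b r q -> off_path g a b q.
Proof.
  intros Hr H t Ht E. specialize (H t Ht). rewrite E in H.
  replace (g t - g t)%C with (RtoC 0) in H by ring. rewrite Cmod_0 in H. lra.
Qed.

(** 1/(v-q') - 1/(v-q) - (q'-q)/(v-q)^2 = (q'-q)^2 / ((v-q)^2 (v-q')), integrated along g. S is the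
    derivative of the Cauchy integral at q. *)
Lemma cauchy_integral_increment (g : R -> C) (a b r V : R) (q q' S : C) :
  piecewise_C1 g -> a < b -> 0 < r ->
  (forall t, a <= t <= b -> Cmod (path_velocity g t) <= V) ->
  far_from g a b r q -> far_from g a b r q' ->
  is_CRInt (along g (fun v => (/ (v - q)) ^ 2)%C) a b S ->
  Cmod (cauchy_integral g a b q' - cauchy_integral g a b q - (q' - q) * S) <=
  (b - a) * V / r ^ 3 * Cmod (q' - q) ^ 2.
Proof.
  intros G Hab Hr HV F F' HS.
  pose proof (far_off_path _ _ _ _ _ Hr F) as O. pose proof (far_off_path _ _ _ _ _ Hr F') as O'.
  pose proof (cauchy_integral_correct g a b q G Hab O) as I.
  pose proof (cauchy_integral_correct g a b q' G Hab O') as I'.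
  replace ((b - a) * V / r ^ 3 * Cmod (q' - q) ^ 2) with ((b - a) * ((Cmod (q' - q) ^ 2 / r ^ 3) * V)) by (field; lra).
  apply (path_integral_bound g (fun v => (q' - q) ^ 2 * ((/ (v - q)) ^ 2 * / (v - q')))%C a b V); try assumption.
  - intros t Ht. rewrite !Cmod_mult, !Cmod_pow, !Cmod_inv_total.
    unfold Rdiv. apply Rmult_le_compat_l; [apply pow2_ge_0|].
    replace (/ r ^ 3) with ((/ r) ^ 2 * / r) by (field; lra).
    specialize (F t Ht). specialize (F' t Ht).
    apply Rmult_le_compat.
    + apply pow_le. left; apply Rinv_0_lt_compat; lra.
    + left; apply Rinv_0_lt_compat; lra.
    + apply pow_incr. split; [left; apply Rinv_0_lt_compat; lra|apply Rinv_le_contravar; lra].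
    + apply Rinv_le_contravar; lra.
  - replace (cauchy_integral g a b q' - cauchy_integral g a b q - (q' - q) * S)%C with
      (cauchy_integral g a b q' + ((- (1)) * cauchy_integral g a b q + (- (q' - q)) * S))%C by ring.
    apply (along_ext g (fun v => / (v - q') + ((- (1)) * / (v - q) + (- (q' - q)) * (/ (v - q)) ^ 2))%C); [lra| |].
    + intros t Ht. cbn [Cpow]. field. split; now apply (off_path_sub _ a b).
    + apply along_plus; [assumption|]. apply along_plus; now apply along_mult.
Qed.

(** The derivatives of the two Cauchy integrals agree, being integrals of (v-q)^(-2). Hence
    first-order terms cancel in the difference, its increments along the segment are quadratic, and
    it is constant there. The distance 2 r leaves r for every point of the segment. *)
Lemma winding_diff_local (g1 g2 : R -> C) (a b r : R) (q q' : C) : bipath g1 g2 a b ->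
  0 < r -> far_from g1 a b (2 * r) q -> far_from g2 a b (2 * r) q ->
  Cmod (q' - q) <= r -> winding_diff g1 g2 a b q' = winding_diff g1 g2 a b q.
Proof.
  intros B Hr F1 F2 Hq. pose proof B as [Hab G1 G2 Ea Eb].
  destruct (velocity_bounded g1 a b G1 Hab) as [V1 [HV1 HV1']].
  destruct (velocity_bounded g2 a b G2 Hab) as [V2 [HV2 HV2']].
  set (z := fun x : R => (q + RtoC x * (q' - q))%C).
  assert (Hz : forall g, far_from g a b (2 * r) q -> forall x, 0 <= x <= 1 -> far_from g a b r (z x)).
  { intros g F x Hx t Ht. specialize (F t Ht). unfold z.
    replace (g t - (q + x * (q' - q)))%C with ((g t - q) - x * (q' - q))%C by ring.
    pose proof (Cmod_sub_ge (g t - q) (x * (q' - q))) as H1.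
    pose proof (Cmod_sub_triangle (g t - q) (x * (q' - q)) 0).
    assert (Cmod (x * (q' - q)) <= r).
    { rewrite Cmod_mult, Cmod_R, Rabs_pos_eq by lra. pose proof (Cmod_ge_0 (q' - q)). nra. }
    lra. }
  assert (E1 : z 1 = q') by (unfold z; ring).
  assert (E0 : z 0 = q) by (unfold z; ring).
  transitivity (winding_diff g1 g2 a b (z 1)); [now rewrite E1|].
  transitivity (winding_diff g1 g2 a b (z 0)); [|now rewrite E0].
  apply (quadratic_increment_constant (fun x => winding_diff g1 g2 a b (z x)) (((b - a) * V1 / r ^ 3 + (b - a) * V2 / r ^ 3) * Cmod (q' - q) ^ 2)).
  intros x y Hx Hy.
  pose proof (Hz g1 F1 x Hx) as F1x. pose proof (Hz g1 F1 y Hy) as F1y.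
  pose proof (Hz g2 F2 x Hx) as F2x. pose proof (Hz g2 F2 y Hy) as F2y.
  destruct (balanced_inv_pow_ge_2 g1 g2 a b (z x) 0 B) as [S [S1 S2]].
  { now apply (far_off_path _ _ _ r). } { now apply (far_off_path _ _ _ r). }
  pose proof (cauchy_integral_increment g1 a b r V1 (z x) (z y) S G1 Hab Hr HV1' F1x F1y S1) as I1.
  pose proof (cauchy_integral_increment g2 a b r V2 (z x) (z y) S G2 Hab Hr HV2' F2x F2y S2) as I2.
  replace (winding_diff g1 g2 a b (z y) - winding_diff g1 g2 a b (z x))%C with
   ((cauchy_integral g1 a b (z y) - cauchy_integral g1 a b (z x) - (z y - z x) * S) -
    (cauchy_integral g2 a b (z y) - cauchy_integral g2 a b (z x) - (z y - z x) * S))%C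
   by (unfold winding_diff; ring).
  eapply Rle_trans; [unfold Cminus at 1; apply Cmod_triangle|]. rewrite Cmod_opp.
  replace (z y - z x)%C with (RtoC (y - x) * (q' - q))%C in * by (unfold z; rewrite RtoC_minus; ring).
  assert (E : Cmod (RtoC (y - x) * (q' - q)) ^ 2 = (y - x) ^ 2 * Cmod (q' - q) ^ 2).
  { rewrite Cmod_mult, Cmod_R, Rpow_mult_distr, pow2_abs. reflexivity. }
  rewrite E in I1, I2. lra.
Qed.

Lemma off_path_far (g : R -> C) (a b : R) (q : C) : piecewise_C1 g -> a < b -> off_path g a b q ->
  exists r, 0 < r /\ far_from g a b r q.
Proof.
  intros G Hab O. apply (continuous_away_from_0 (fun t => g t - q)%C a b); [lra| |].
  - intros t _. apply continuous_Cminus; [now apply piecewise_continuous|apply continuous_const].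
  - intros t Ht. now apply (off_path_sub _ a b).
Qed.

(** By [winding_diff_local] and continuity of s, the function of u is locally constant, so its
    derivative vanishes on [0, 1]. *)
Lemma winding_diff_path (g1 g2 : R -> C) (a b : R) (s : R -> C) : bipath g1 g2 a b ->
  (forall u, Ccontinuous s u) ->
  (forall u, 0 <= u <= 1 -> off_path g1 a b (s u) /\ off_path g2 a b (s u)) ->
  winding_diff g1 g2 a b (s 0) = winding_diff g1 g2 a b (s 1).
Proof.
  intros B Hs HO. pose proof B as [Hab G1 G2 _ _].
  apply (eq_is_derive (V := C_R_NormedModule) (fun u => winding_diff g1 g2 a b (s u)) 0 1); [|lra].
  intros u Hu. destruct (HO u Hu) as [O1 O2].
  destruct (off_path_far g1 a b _ G1 Hab O1) as [r1 [Hr1 F1]].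
  destruct (off_path_far g2 a b _ G2 Hab O2) as [r2 [Hr2 F2]].
  set (r := Rmin r1 r2 / 2). pose proof (Rmin_l r1 r2). pose proof (Rmin_r r1 r2).
  pose proof (Rmin_pos r1 r2 Hr1 Hr2). assert (Hr : 0 < r) by (unfold r; lra).
  destruct (proj1 (continuous_C_eps s u) (Hs u) r Hr) as [d [Hd Hsd]].
  apply (is_derive_ext_loc (K := R_AbsRing) (V := C_R_NormedModule) (fun _ => winding_diff g1 g2 a b (s u))); [|apply (is_derive_const (V := C_R_NormedModule))].
  exists (mkposreal d Hd). intros v Hv. symmetry. apply (winding_diff_local g1 g2 a b r); try assumption.
  - intros t Ht. specialize (F1 t Ht). unfold r. lra.
  - intros t Ht. specialize (F2 t Ht). unfold r. lra.
  - left. apply Hsd. exact Hv.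
Qed.

(* [sg] = 1 or -1 selects the side of the paths to which [p] is connected. *)
Lemma winding_diff_zero (g1 g2 : R -> C) (a b sg y : R) (p : C) (s : R -> C) : bipath g1 g2 a b ->
  sg * sg = 1 ->
  (forall t, a <= t <= b -> sg * Im (g1 t) < sg * y /\ sg * Im (g2 t) < sg * y) ->
  (forall u, Ccontinuous s u) -> s 0 = p -> s 1 = (0, y) ->
  (forall u, 0 <= u <= 1 -> off_path g1 a b (s u) /\ off_path g2 a b (s u)) ->
  balanced_pole g1 g2 a b p.
Proof.
  intros B Hsg Hy Hs Hs0 Hs1 HO. pose proof B as [Hab G1 G2 _ _].
  destruct (HO 0 ltac:(lra)) as [O1 O2]. rewrite Hs0 in O1, O2.
  (* A vertical ray away from both paths. At [pt k] the distance to them exceeds k, so the Cauchy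
     integrals are O(1/k) there, while their difference remains that at p. *)
  set (pt := fun k : R => ((0, (y + sg * k)%R) : C)).
  assert (Hup : forall k t, 0 <= k -> a <= t <= b ->
      k < Cmod (g1 t - (pt k)) /\ k < Cmod (g2 t - (pt k))).
  { intros k t Hk Ht. destruct (Hy t Ht) as [H1 H2].
    assert (Hg : forall w : C, sg * Im w < sg * y -> k < Cmod (w - (pt k))).
    { intros w Hw. eapply Rlt_le_trans; [|apply Im_le_Cmod].
      replace (Im (w - pt k)%C) with (Im w - (y + sg * k)) by reflexivity.
      assert (Hc : sg = 1 \/ sg = -1) by (assert ((sg - 1) * (sg + 1) = 0) by lra; apply Rmult_integral in H; lra).
      destruct Hc as [-> | ->].
      - rewrite Rabs_left; lra.
      - rewrite Rabs_right; lra. }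
    split; now apply Hg. }
  assert (HD : forall k, 0 <= k -> winding_diff g1 g2 a b p = winding_diff g1 g2 a b (pt k)).
  { intros k Hk. rewrite <- Hs0. rewrite (winding_diff_path g1 g2 a b s B Hs HO), Hs1.
    replace (0, y) with ((fun u => pt (k * u)) 0) by (unfold pt; f_equal; ring).
    replace (pt k) with ((fun u => pt (k * u)) 1) by (unfold pt; f_equal; ring).
    apply (winding_diff_path g1 g2 a b (fun u => pt (k * u)) B).
    - intros u. apply continuous_C. split; simpl; [apply continuous_const|].
      apply (ex_derive_continuous (V := R_NormedModule)). auto_derive. exact I.
    - intros u Hu. assert (Hku : 0 <= k * u) by nra.
      split; intros t Ht E; destruct (Hup (k * u) t Hku Ht) as [H1 H2].
      + rewrite E in H1. replace (g1 t - g1 t)%C with (RtoC 0) in H1 by ring. rewrite Cmod_0 in H1. lra.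
      + rewrite E in H2. replace (g2 t - g2 t)%C with (RtoC 0) in H2 by ring. rewrite Cmod_0 in H2. lra. }
  split; [assumption|]. split; [assumption|].
  exists (cauchy_integral g1 a b p). split; [now apply cauchy_integral_correct|].
  replace (cauchy_integral g1 a b p) with (cauchy_integral g2 a b p); [now apply cauchy_integral_correct|].
  symmetry. apply C_le_eq. intros e He.
  change (cauchy_integral g1 a b p - cauchy_integral g2 a b p)%C with (winding_diff g1 g2 a b p).
  destruct (velocity_bounded g1 a b G1 Hab) as [V1 [HV1 HV1']].
  destruct (velocity_bounded g2 a b G2 Hab) as [V2 [HV2 HV2']].
  set (k := (b - a) * (V1 + V2) / e + 1).
  assert (Hk : 1 <= k).
  { unfold k. assert (0 <= (b - a) * (V1 + V2) / e); [|lra]. apply Rdiv_le_0_compat; [nra|lra]. }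
  rewrite (HD k ltac:(lra)). unfold winding_diff.
  assert (Hb : forall g V, piecewise_C1 g -> (forall t, a <= t <= b -> Cmod (path_velocity g t) <= V) ->
     (forall t, a <= t <= b -> k < Cmod (g t - (pt k))) ->
     Cmod (cauchy_integral g a b (pt k)) <= (b - a) * (/ k * V)).
  { intros g V G HV HF. apply (path_integral_bound g (fun v => / (v - (pt k)))%C); try assumption.
    - intros t Ht. rewrite Cmod_inv_total. apply Rinv_le_contravar; [lra|]. left. now apply HF.
    - apply cauchy_integral_correct; try assumption. apply (far_off_path _ _ _ k); [lra|]. intros t Ht. left; now apply HF. }
  pose proof (Hb g1 V1 G1 HV1' (fun t Ht => proj1 (Hup k t ltac:(lra) Ht))).
  pose proof (Hb g2 V2 G2 HV2' (fun t Ht => proj2 (Hup k t ltac:(lra) Ht))).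
  eapply Rle_trans; [unfold Cminus at 1; apply Cmod_triangle|]. rewrite Cmod_opp.
  apply Rle_trans with ((b - a) * (V1 + V2) / k); [unfold Rdiv; lra|].
  apply Rmult_le_reg_r with k; [lra|]. unfold Rdiv. rewrite Rmult_assoc, Rinv_l by lra.
  unfold k. replace (e * ((b - a) * (V1 + V2) / e + 1)) with ((b - a) * (V1 + V2) + e) by (field; lra).
  lra.
Qed.

(** * Comparison of contours *)

Definition piecewise_affine (phi : R -> R) : Prop :=
  (forall t, continuous phi t) /\
  exists l : list R, forall a b : R, a < b ->
    (forall c, In c l -> ~ (a < c < b)) ->
    exists x y, forall t, a <= t <= b -> phi t = x * t + y.

Lemma piecewise_affine_scal (x : R) (phi : R -> R) :
  piecewise_affine phi -> piecewise_affine (fun t => x * phi t).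
Proof.
  intros [H [l Hl]]. split.
  - intros t. apply (continuous_scal_r (V := R_NormedModule) x phi t (H t)).
  - exists l. intros a b Hab Hn. destruct (Hl a b Hab Hn) as [u [v E]].
    exists (x * u), (x * v). intros t Ht. rewrite E by assumption. ring.
Qed.

Lemma lipschitz_continuous (phi : R -> R) (K : R) :
  (forall s t, Rabs (phi s - phi t) <= K * Rabs (s - t)) -> forall t, continuous phi t.
Proof.
  intros H t. apply (proj2 (filterlim_locally (F := locally t) phi (phi t))). intros eps.
  assert (Hd : 0 < eps / (Rabs K + 1)).
  { apply Rdiv_lt_0_compat; [apply cond_pos|]. pose proof (Rabs_pos K). lra. }
  exists (mkposreal _ Hd). intros s Hs.
  change (Rabs (phi s - phi t) < eps). change (Rabs (s - t) < eps / (Rabs K + 1)) in Hs.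
  pose proof (Rabs_pos K). pose proof (Rle_abs K). pose proof (Rabs_pos (s - t)).
  apply Rmult_lt_compat_r with (r := Rabs K + 1) in Hs; [|lra].
  unfold Rdiv in Hs. rewrite Rmult_assoc, Rinv_l, Rmult_1_r in Hs by lra.
  specialize (H s t). nra.
Qed.

Definition tent (c W t : R) : R := Rmax 0 (W - Rabs (t - c)).

Lemma tent_lipschitz (c W s t : R) : Rabs (tent c W s - tent c W t) <= Rabs (s - t).
Proof.
  unfold tent.
  assert (H : Rabs (Rabs (s - c) - Rabs (t - c)) <= Rabs (s - t)).
  { eapply Rle_trans; [apply Rabs_triang_inv2|]. right. f_equal. ring. }
  apply Rabs_le_between in H.
  unfold Rmax. destruct (Rle_dec 0 (W - Rabs (s - c))), (Rle_dec 0 (W - Rabs (t - c)));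
  apply Rabs_le; pose proof (Rabs_pos (s - t)); lra.
Qed.

Lemma tent_nonneg c W t : 0 <= tent c W t.
Proof. apply Rmax_l. Qed.

Lemma tent_inside c W t : Rabs (t - c) <= W -> tent c W t = W - Rabs (t - c).
Proof. intros. apply Rmax_right. lra. Qed.

Lemma tent_outside c W t : W <= Rabs (t - c) -> tent c W t = 0.
Proof. intros. apply Rmax_left. lra. Qed.

Lemma piecewise_affine_tent (c W : R) : 0 <= W -> piecewise_affine (tent c W).
Proof.
  intros HW. split.
  - apply (lipschitz_continuous _ 1). intros s t. rewrite Rmult_1_l. apply tent_lipschitz.
  - exists (c - W :: c :: c + W :: nil). intros a b Hab Hn.
    assert (H1 := Hn (c - W) ltac:(simpl; tauto)).
    assert (H2 := Hn c ltac:(simpl; tauto)).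
    assert (H3 := Hn (c + W) ltac:(simpl; tauto)).
    destruct (Rle_dec b (c - W)).
    { exists 0, 0. intros t Ht. rewrite tent_outside; [ring|]. rewrite Rabs_left1; lra. }
    destruct (Rle_dec b c).
    { exists 1, (W - c). intros t Ht. rewrite tent_inside; rewrite Rabs_left1; lra. }
    destruct (Rle_dec b (c + W)).
    { exists (-1), (W + c). intros t Ht. rewrite tent_inside; rewrite Rabs_pos_eq; lra. }
    exists 0, 0. intros t Ht. rewrite tent_outside; [ring|]. rewrite Rabs_pos_eq; lra.
Qed.

Lemma piecewise_affine_glue (phi psi : R -> R) (c : R) :
  piecewise_affine phi -> piecewise_affine psi -> phi c = psi c ->
  piecewise_affine (fun t => if Rle_dec t c then phi t else psi t).
Proof.
  intros [H1 [l1 Hl1]] [H2 [l2 Hl2]] E. split.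
  - intros t. destruct (Rtotal_order t c) as [Ht|[Ht|Ht]].
    + apply (continuous_ext_loc _ phi); [|apply H1].
      apply (locally_in_interval (t - 1) c); [lra|]. intros s Hs. destruct (Rle_dec s c); [reflexivity|lra].
    + subst t. apply (proj2 (filterlim_locally (F := locally c) _ _)). intros eps.
      destruct (proj1 (filterlim_locally (F := locally c) _ _) (H1 c) eps) as [d1 Hd1].
      destruct (proj1 (filterlim_locally (F := locally c) _ _) (H2 c) eps) as [d2 Hd2].
      assert (Hd : 0 < Rmin d1 d2) by (apply Rmin_pos; apply cond_pos).
      exists (mkposreal _ Hd). intros s Hs. change (Rabs (s - c) < Rmin d1 d2) in Hs.
      pose proof (Rmin_l d1 d2). pose proof (Rmin_r d1 d2).
      destruct (Rle_dec c c); [|lra]. destruct (Rle_dec s c).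
      * apply Hd1. change (Rabs (s - c) < d1). lra.
      * rewrite E. apply Hd2. change (Rabs (s - c) < d2). lra.
    + apply (continuous_ext_loc _ psi); [|apply H2].
      apply (locally_in_interval c (t + 1)); [lra|]. intros s Hs. destruct (Rle_dec s c); [lra|reflexivity].
  - exists (c :: l1 ++ l2). intros a b Hab Hn.
    assert (Hc := Hn c ltac:(now left)).
    assert (Hn1 : forall x, In x l1 -> ~ (a < x < b)) by (intros; apply Hn; right; apply in_or_app; now left).
    assert (Hn2 : forall x, In x l2 -> ~ (a < x < b)) by (intros; apply Hn; right; apply in_or_app; now right).
    destruct (Rle_dec b c).
    + destruct (Hl1 a b Hab Hn1) as [x [y Exy]]. exists x, y. intros t Ht.
      destruct (Rle_dec t c); [now apply Exy|lra].
    + destruct (Hl2 a b Hab Hn2) as [x [y Exy]]. exists x, y. intros t Ht.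
      destruct (Rle_dec t c); [|now apply Exy]. replace t with c in * by lra. rewrite E. now apply Exy.
Qed.

Definition lift_path (g : R -> C) (phi : R -> R) (t : R) : C := (g t + Ci * RtoC (phi t))%C.

Lemma piecewise_C1_lift (g : R -> C) (phi : R -> R) :
  piecewise_C1 g -> piecewise_affine phi -> piecewise_C1 (lift_path g phi).
Proof.
  intros [H1 [l1 Hl1]] [H2 [l2 Hl2]]. split.
  - intros t. apply continuous_Cplus; [apply H1|]. apply continuous_Cmult; [apply continuous_const|].
    apply continuous_C. split; simpl; [apply H2|apply continuous_const].
  - exists (l1 ++ l2). intros a b Hab Hn.
    assert (Hn1 : forall x, In x l1 -> ~ (a < x < b)) by (intros; apply Hn; apply in_or_app; now left).
    assert (Hn2 : forall x, In x l2 -> ~ (a < x < b)) by (intros; apply Hn; apply in_or_app; now right).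
    destruct (Hl1 a b Hab Hn1) as [h [Hh E]]. destruct (Hl2 a b Hab Hn2) as [x [y E']].
    exists (fun t => h t + Ci * RtoC (x * t + y))%C. split.
    + assert (Hd : forall t, is_Cderive (fun t => h t + Ci * RtoC (x * t + y))%C t (path_velocity h t + Ci * RtoC x)%C).
      { intros t. apply (is_derive_plus (V := C_R_NormedModule)); [now apply C1_path_derive|].
        apply is_derive_C; split; simpl; auto_derive; trivial; ring. }
      pose proof (fun t => C1_path_velocity_continuous h t Hh) as Hc.
      split; [intros t; eexists; apply Hd|].
      split; intros t.
      * apply (continuous_ext (fun t => Re (path_velocity h t + Ci * RtoC x)%C)).
        { intros s. symmetry. apply is_derive_unique. apply (proj1 (is_derive_C _ _ _) (Hd s)). }
        pose proof (proj1 (continuous_C _ t) (Hc t)) as [Hc1 _]. simpl.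
        apply (continuous_plus (V := R_NormedModule)); [exact Hc1|apply continuous_const].
      * apply (continuous_ext (fun t => Im (path_velocity h t + Ci * RtoC x)%C)).
        { intros s. symmetry. apply is_derive_unique. apply (proj1 (is_derive_C _ _ _) (Hd s)). }
        pose proof (proj1 (continuous_C _ t) (Hc t)) as [_ Hc1]. simpl.
        apply (continuous_plus (V := R_NormedModule)); [exact Hc1|apply continuous_const].
    + intros t Ht. unfold lift_path. now rewrite E, E' by assumption.
Qed.

Lemma piecewise_C1_line : piecewise_C1 RtoC.
Proof.
  split.
  - intros t. apply continuous_C; split; simpl; [apply continuous_id|apply continuous_const].
  - exists nil. intros a b _ _. exists RtoC. split; [|reflexivity]. split; [|split]; intros t.
    + exists (RtoC 1). apply is_derive_C; split; simpl; [apply (is_derive_id (K := R_AbsRing))|apply (is_derive_const (V := R_NormedModule))].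
    + apply (continuous_ext (fun _ => 1)); [|apply continuous_const].
      intros s. symmetry. simpl. apply Derive_id.
    + apply (continuous_ext (fun _ => 0)); [|apply continuous_const].
      intros s. symmetry. simpl. apply Derive_const.
Qed.

Definition lies_side (sg : R) (g : R -> C) (p : C) : Prop :=
  exists y : R, (forall t, sg * Im (g t) < sg * y) /\ joined_off g p (0, y).

Lemma lies_above_side g p : lies_above g p <-> lies_side 1 g p.
Proof.
  split; intros [y [H1 H2]]; exists y; split; try assumption; intros t; specialize (H1 t); lra.
Qed.

Lemma lies_below_side g p : lies_below g p <-> lies_side (-1) g p.
Proof.
  split; intros [y [H1 H2]]; exists y; split; try assumption; intros t; specialize (H1 t); lra.
Qed.

Lemma lies_side_off sg g p t : lies_side sg g p -> p <> g t.
Proof.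
  intros [y [_ [s [_ [H0 [_ H]]]]]]. rewrite <- H0. apply H. lra.
Qed.

Definition real_beyond (g : R -> C) (M : R) : Prop := forall t, M <= Rabs t -> g t = RtoC t.

(* One tent-shaped path, far on the other side of the pole, is the reference for all contours. *)
Lemma balanced_pole_reference (g : R -> C) (sg M : R) (p : C) :
  piecewise_C1 g -> sg * sg = 1 -> real_beyond g M -> lies_side sg g p ->
  exists T0, forall T, T0 <= T ->
    balanced_pole g (lift_path RtoC (fun t => - sg * tent 0 T t)) (- T) T p.
Proof.
  intros G Hsg HM [y [Hy [s [Hs [Hs0 [Hs1 Hoff]]]]]].
  destruct (continuous_bounded s 0 1 ltac:(lra) (fun t _ => Hs t)) as [B [HB HB']].
  (* The escape route s lies in |v| <= B. Over |t| <= B the tent has height T - |t| >= T - B > B, so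
     the route does not meet it. *)
  exists (Rmax M (2 * B + 1)). intros T HT.
  pose proof (Rmax_l M (2 * B + 1)). pose proof (Rmax_r M (2 * B + 1)).
  assert (Hy0 : 0 < sg * y).
  { specialize (Hy T). rewrite HM in Hy by (rewrite Rabs_pos_eq; lra). simpl in Hy. lra. }
  apply (winding_diff_zero _ _ _ _ sg y p s); try assumption.
  - split.
    + lra.
    + assumption.
    + apply piecewise_C1_lift; [apply piecewise_C1_line|]. apply piecewise_affine_scal, piecewise_affine_tent. lra.
    + unfold lift_path. rewrite tent_outside by (rewrite Rminus_0_r, Rabs_Ropp, Rabs_pos_eq; lra).
      rewrite HM by (rewrite Rabs_Ropp, Rabs_pos_eq; lra). rewrite Rmult_0_r. ring.
    + unfold lift_path. rewrite tent_outside by (rewrite Rminus_0_r, Rabs_pos_eq; lra).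
      rewrite HM by (rewrite Rabs_pos_eq; lra). rewrite Rmult_0_r. ring.
  - intros t Ht. split; [apply Hy|]. simpl. pose proof (tent_nonneg 0 T t).
    replace (sg * (0 + (0 * 0 + 1 * (- sg * tent 0 T t)))) with (- (sg * sg) * tent 0 T t) by ring. nra.
  - intros u Hu. split; intros t Ht.
    + now apply Hoff.
    + intros E. specialize (HB' u Hu).
      assert (Et : t = Re (s u)) by (rewrite E; simpl; ring).
      assert (Ei : - sg * tent 0 T t = Im (s u)) by (rewrite E; simpl; ring).
      pose proof (Re_le_Cmod' (s u)) as H1. pose proof (Im_le_Cmod (s u)) as H2.
      rewrite <- Et in H1. rewrite <- Ei in H2.
      rewrite tent_inside in H2 by (rewrite Rminus_0_r; lra). rewrite Rminus_0_r in H2.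
      rewrite Rabs_mult, Rabs_Ropp in H2.
      assert (Rabs sg = 1) by (rewrite <- sqrt_Rsqr_abs; unfold Rsqr; rewrite Hsg; apply sqrt_1).
      rewrite H3, Rmult_1_l in H2. pose proof (Rle_abs (T - Rabs t)). lra.
Qed.

Lemma path_velocity_real_beyond (g1 g2 : R -> C) (M t : R) :
  real_beyond g1 M -> real_beyond g2 M -> M < Rabs t -> path_velocity g1 t = path_velocity g2 t.
Proof.
  intros H1 H2 Ht. apply path_velocity_ext_loc.
  exists (mkposreal (Rabs t - M) ltac:(lra)). intros s Hs. change (Rabs (s - t) < Rabs t - M) in Hs.
  rewrite H1, H2; [reflexivity| |]; pose proof (Rabs_triang_inv t (s));
  rewrite Rabs_minus_sym in Hs; lra.
Qed.

Lemma along_real_beyond (g1 g2 : R -> C) (f : C -> C) (M a b : R) (I : C) :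
  real_beyond g1 M -> real_beyond g2 M -> a <= b -> b <= - M \/ M <= a ->
  is_CRInt (along g1 f) a b I -> is_CRInt (along g2 f) a b I.
Proof.
  intros H1 H2 Hab Hs. apply is_CRInt_ext; [assumption|]. intros t Ht. unfold along.
  assert (HMt : M < Rabs t).
  { destruct Hs; [pose proof (Rle_abs (- t)); rewrite Rabs_Ropp in *; lra|pose proof (Rle_abs t); lra]. }
  rewrite H1, H2 by lra. f_equal. now apply (path_velocity_real_beyond g1 g2 M).
Qed.

Lemma is_CRInt_split (f : R -> C) (a b c : R) (I : C) : a <= b -> b <= c -> is_CRInt f a c I ->
  exists I1 I2, is_CRInt f a b I1 /\ is_CRInt f b c I2 /\ I = (I1 + I2)%C.
Proof.
  intros Hab Hbc H. assert (E : ex_CRInt f a c) by (now exists I).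
  destruct (ex_RInt_Chasles_1 (V := C_R_CompleteNormedModule) f a b c (conj Hab Hbc) E) as [I1 H1].
  destruct (ex_RInt_Chasles_2 (V := C_R_CompleteNormedModule) f a b c (conj Hab Hbc) E) as [I2 H2].
  exists I1, I2. split; [assumption|]. split; [assumption|].
  apply (is_CRInt_unique f a c); [assumption|]. now apply (is_CRInt_Chasles f a b c).
Qed.

Lemma Cplus_cancel_middle (a x y b : C) : (a + (x + b) = a + (y + b))%C -> x = y.
Proof. intros E. replace x with (a + (x + b) - a - b)%C by ring. rewrite E. ring. Qed.

(** The escape route of p from g1 may cross g2 and conversely, so the contours are not compared
    directly. Both are compared with the same tent on a large [-T, T]; the common real tails are
    then cut off. *)
Lemma balanced_pole_contours (g1 g2 : R -> C) (sg M a b : R) (p : C) :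
  bipath g1 g2 a b -> sg * sg = 1 -> real_beyond g1 M -> real_beyond g2 M ->
  a <= - M -> M <= b -> lies_side sg g1 p -> lies_side sg g2 p ->
  balanced_pole g1 g2 a b p.
Proof.
  intros B Hsg HM1 HM2 Ha Hb S1 S2. destruct B as [Hab G1 G2 Ea Eb].
  assert (O1 : off_path g1 a b p) by (intros t _; now apply (lies_side_off sg)).
  assert (O2 : off_path g2 a b p) by (intros t _; now apply (lies_side_off sg)).
  split; [assumption|]. split; [assumption|].
  destruct (balanced_pole_reference g1 sg M p G1 Hsg HM1 S1) as [T1 HT1].
  destruct (balanced_pole_reference g2 sg M p G2 Hsg HM2 S2) as [T2 HT2].
  set (T := Rmax (Rmax T1 T2) (Rmax (- a) b)).
  pose proof (Rmax_l (Rmax T1 T2) (Rmax (- a) b)). pose proof (Rmax_r (Rmax T1 T2) (Rmax (- a) b)).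
  pose proof (Rmax_l T1 T2). pose proof (Rmax_r T1 T2). pose proof (Rmax_l (- a) b). pose proof (Rmax_r (- a) b).
  fold T in H, H0.
  destruct (HT1 T ltac:(lra)) as [_ [_ [I [HI1 HI1']]]].
  destruct (HT2 T ltac:(lra)) as [_ [_ [J [HJ2 HJ2']]]].
  rewrite (is_CRInt_unique _ _ _ _ _ HJ2' HI1') in HJ2. clear J HJ2'.
  destruct (is_CRInt_split _ (- T) a T I ltac:(lra) ltac:(lra) HI1) as [A [I1 [HA [HI1a EI1]]]].
  destruct (is_CRInt_split _ a b T I1 ltac:(lra) ltac:(lra) HI1a) as [X [Z [HX [HZ EX]]]].
  destruct (is_CRInt_split _ (- T) a T I ltac:(lra) ltac:(lra) HJ2) as [A' [I2 [HA' [HI2a EI2]]]].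
  destruct (is_CRInt_split _ a b T I2 ltac:(lra) ltac:(lra) HI2a) as [X' [Z' [HX' [HZ' EX']]]].
  assert (A = A').
  { apply (is_CRInt_unique (along g2 (fun v => / (v - p))%C) (- T) a); [|assumption].
    apply (along_real_beyond g1 g2 _ M); try assumption; [lra|now left]. }
  assert (Z = Z').
  { apply (is_CRInt_unique (along g2 (fun v => / (v - p))%C) b T); [|assumption].
    apply (along_real_beyond g1 g2 _ M); try assumption; [lra|now right]. }
  exists X. split; [assumption|]. replace X with X'; [assumption|].
  subst A' Z'. rewrite EX in EI1. rewrite EX' in EI2. rewrite EI1 in EI2.
  symmetry. exact (Cplus_cancel_middle A X X' Z EI2).
Qed.

(** * Rational functions with prescribed poles *)

Definition rational_with (S : C -> Prop) (f : C -> C) : Prop :=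
  exists c m l, (forall p, In p l -> S p) /\ forall v, f v = (c * lin_prod m v * / lin_prod l v)%C.

Lemma lin_prod_app (m m' : list C) (v : C) : lin_prod (m ++ m') v = (lin_prod m v * lin_prod m' v)%C.
Proof.
  induction m as [|q m IH]; simpl; [ring|]. fold (lin_prod (m ++ m') v). rewrite IH.
  fold (lin_prod m v). ring.
Qed.

Lemma rational_const S (c : C) : rational_with S (fun _ => c).
Proof. exists c, nil, nil. split; [intros p []|]. intros v. simpl. field. Qed.

Lemma rational_mult S f g : rational_with S f -> rational_with S g -> rational_with S (fun v => f v * g v)%C.
Proof.
  intros [c [m [l [H E]]]] [c' [m' [l' [H' E']]]]. exists (c * c')%C, (m ++ m'), (l ++ l').
  split; [intros p Hp; apply in_app_or in Hp; destruct Hp; auto|].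
  intros v. rewrite E, E', !lin_prod_app, Cinv_mult_total. ring.
Qed.

Lemma rational_pow S f n : rational_with S f -> rational_with S (fun v => f v ^ n)%C.
Proof.
  intros H. induction n as [|n IH]; simpl; [apply rational_const|now apply rational_mult].
Qed.

Lemma rational_ext S f g : (forall v, f v = g v) -> rational_with S f -> rational_with S g.
Proof.
  intros E [c [m [l [H E']]]]. exists c, m, l. split; [assumption|]. intros v. now rewrite <- E.
Qed.

Lemma rational_linear S (x y : C) : x <> 0%C -> rational_with S (fun v => y + x * v)%C.
Proof.
  intros Hx. exists x, ((- (y / x))%C :: nil), nil. split; [intros p []|].
  intros v. simpl. field. assumption.
Qed.

Lemma rational_inv_linear (S : C -> Prop) (x p : C) : S p -> rational_with S (fun v => / (x * (v - p)))%C.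
Proof.
  intros Hp. exists (/ x)%C, nil, (p :: nil). split; [intros q [<-|[]]; assumption|].
  intros v. simpl. rewrite !Cinv_mult_total. replace (/ 1)%C with (RtoC 1) by field. ring.
Qed.

Lemma rational_rising S (x y : C) (n : nat) : x <> 0%C -> rational_with S (fun v => rising (y + x * v) n).
Proof.
  intros Hx. induction n as [|n IH]; cbn [rising]; [now apply rational_linear|].
  apply rational_mult; [assumption|].
  apply (rational_ext S (fun v => (y + RtoC (INR (Datatypes.S n))) + x * v)%C); [intros; ring|].
  now apply rational_linear.
Qed.

Lemma rational_inv_rising (S : C -> Prop) (x y : C) (n : nat) : x <> 0%C ->
  (forall k : nat, S (- ((y + RtoC (INR k)) / x))%C) -> rational_with S (fun v => / rising (y + x * v) n)%C.
Proof.
  intros Hx H.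
  assert (Hk : forall k, rational_with S (fun v => / (y + x * v + RtoC (INR k)))%C).
  { intros k. apply (rational_ext S (fun v => / (x * (v - - ((y + RtoC (INR k)) / x))))%C).
    - intros v. f_equal. field. assumption.
    - now apply rational_inv_linear. }
  induction n as [|n IH]; cbn [rising].
  - apply (rational_ext S (fun v => / (y + x * v + RtoC (INR 0)))%C); [intros; f_equal; simpl; ring|apply Hk].
  - apply (rational_ext S (fun v => / rising (y + x * v) n * / (y + x * v + RtoC (INR (Datatypes.S n))))%C).
    + intros v. now rewrite Cinv_mult_total.
    + now apply rational_mult.
Qed.

Lemma balanced_rational_with g1 g2 a b (S : C -> Prop) (p0 : C) f : bipath g1 g2 a b ->
  S p0 -> (forall p, S p -> balanced_pole g1 g2 a b p) -> rational_with S f -> balanced g1 g2 a b f.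
Proof.
  intros B H0 H [c [m [l [Hl E]]]]. pose proof (bi_lt _ _ _ _ B).
  apply (balanced_ext g1 g2 a b (fun v => c * ((/ (v - p0)) ^ 0 * lin_prod m v * / lin_prod l v))%C); [lra| | |].
  - intros; rewrite E; simpl; ring.
  - intros; rewrite E; simpl; ring.
  - apply balanced_mult, balanced_rational; auto.
Qed.

(** * Uniform convergence on an interval *)

Definition uconv (u : nat -> R -> C) (f : R -> C) (a b : R) : Prop :=
  forall eps, 0 < eps -> exists N, forall n, (N <= n)%nat -> forall t, a <= t <= b -> Cmod (u n t - f t) <= eps.

Lemma uconv_const (f : R -> C) a b : uconv (fun _ => f) f a b.
Proof.
  intros e He. exists 0%nat. intros. replace (f t - f t)%C with (RtoC 0) by ring. rewrite Cmod_0. lra.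
Qed.

Lemma uconv_mult u v f g a b Mf Mg :
  (forall t, a <= t <= b -> Cmod (f t) <= Mf) -> (forall t, a <= t <= b -> Cmod (g t) <= Mg) ->
  uconv u f a b -> uconv v g a b -> uconv (fun n t => u n t * v n t)%C (fun t => f t * g t)%C a b.
Proof.
  intros Bf Bg Hu Hv e He.
  set (D := Rabs Mf + Rabs Mg + 1).
  assert (HD : 1 <= D) by (unfold D; pose proof (Rabs_pos Mf); pose proof (Rabs_pos Mg); lra).
  set (d := Rmin 1 (e / D)).
  assert (Hd : 0 < d) by (apply Rmin_pos; [lra|]; apply Rdiv_lt_0_compat; lra).
  pose proof (Rmin_l 1 (e / D)) as Hd1. pose proof (Rmin_r 1 (e / D)) as Hd2. fold d in Hd1, Hd2.
  assert (HdD : d * D <= e).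
  { apply Rmult_le_compat_r with (r := D) in Hd2; [|lra]. unfold Rdiv in Hd2.
    rewrite Rmult_assoc, Rinv_l, Rmult_1_r in Hd2 by lra. assumption. }
  destruct (Hu d Hd) as [N1 H1]. destruct (Hv d Hd) as [N2 H2]. exists (max N1 N2).
  intros n Hn t Ht. specialize (H1 n ltac:(lia) t Ht). specialize (H2 n ltac:(lia) t Ht).
  specialize (Bf t Ht). specialize (Bg t Ht).
  pose proof (Rle_abs Mf). pose proof (Rle_abs Mg).
  replace (u n t * v n t - f t * g t)%C with ((u n t - f t) * ((v n t - g t) + g t) + f t * (v n t - g t))%C by ring.
  eapply Rle_trans; [apply Cmod_triangle|]. rewrite !Cmod_mult.
  pose proof (Cmod_triangle (v n t - g t) (g t)).
  assert (Cmod (u n t - f t) * Cmod (v n t - g t + g t) <= d * (1 + Rabs Mg)).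
  { apply Rmult_le_compat; try apply Cmod_ge_0; lra. }
  assert (Cmod (f t) * Cmod (v n t - g t) <= Rabs Mf * d).
  { apply Rmult_le_compat; try apply Cmod_ge_0; lra. }
  eapply Rle_trans; [apply Rplus_le_compat; eassumption|].
  eapply Rle_trans; [|apply HdD]. right. unfold D. ring.
Qed.

Lemma uconv_pow u f a b M k : (forall t, a <= t <= b -> Cmod (f t) <= M) ->
  uconv u f a b -> uconv (fun n t => u n t ^ k)%C (fun t => f t ^ k)%C a b.
Proof.
  intros HM H. induction k as [|k IH]; simpl; [apply uconv_const|].
  apply (uconv_mult _ _ _ _ _ _ M (M ^ k)); try assumption.
  intros t Ht. rewrite Cmod_pow. apply pow_incr. split; [apply Cmod_ge_0|auto].
Qed.

Lemma uconv_continuous u f a b t : a < t < b -> uconv u f a b ->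
  (forall n, Ccontinuous (u n) t) -> Ccontinuous f t.
Proof.
  intros Ht H Hc. apply continuous_C_eps. intros e He.
  destruct (H (e / 4) ltac:(lra)) as [N HN]. specialize (HN N (le_n _)).
  destruct (proj1 (continuous_C_eps _ _) (Hc N) (e / 4) ltac:(lra)) as [d [Hd Hs]].
  exists (Rmin d (Rmin (t - a) (b - t))). split; [repeat apply Rmin_pos; lra|].
  intros s Hst.
  pose proof (Rmin_l d (Rmin (t - a) (b - t))). pose proof (Rmin_r d (Rmin (t - a) (b - t))).
  pose proof (Rmin_l (t - a) (b - t)). pose proof (Rmin_r (t - a) (b - t)).
  assert (Hsab : a <= s <= b) by (apply Rabs_lt_between in Hst; lra).
  specialize (Hs s ltac:(lra)). pose proof (HN s Hsab) as B1. pose proof (HN t ltac:(lra)) as B2.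
  pose proof (Cmod_sub_triangle (f s) (u N s) (f t)) as T1.
  pose proof (Cmod_sub_triangle (u N s) (u N t) (f t)) as T2.
  rewrite (Cmod_sub_sym (f s) (u N s)) in T1. lra.
Qed.

Lemma continuous_rising (s : R -> C) (n : nat) (t : R) : Ccontinuous s t -> Ccontinuous (fun x => rising (s x) n) t.
Proof.
  intros H. induction n as [|n IH]; cbn [rising]; [assumption|].
  apply continuous_Cmult; [assumption|]. apply continuous_Cplus; [assumption|apply continuous_const].
Qed.

Lemma continuous_gauss_ratio (b : C) (s : R -> C) (n : nat) (t : R) : Ccontinuous s t -> nonpole (s t) ->
  Ccontinuous (fun x => gauss_ratio b n (s x)) t.
Proof.
  intros H Hn. unfold gauss_ratio. apply continuous_Cmult; [apply continuous_const|].
  apply continuous_Cmult; [apply continuous_rising, continuous_Cplus; [assumption|apply continuous_const]|].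
  apply continuous_Cinv; [now apply continuous_rising|now apply rising_neq_0].
Qed.

(** On a bounded piece of the path only finitely many of the points -k are near; each of these has a
    positive distance by compactness, and all others are at distance at least 1. *)
Lemma nonpole_path_dist (s : R -> C) (a b : R) : a <= b -> (forall t, Ccontinuous s t) ->
  (forall t, nonpole (s t)) ->
  exists d, 0 < d /\ forall t, a <= t <= b -> forall k : nat, d <= Cmod (s t + RtoC (INR k)).
Proof.
  intros Hab Hs Hn.
  destruct (continuous_bounded s a b Hab (fun t _ => Hs t)) as [M [HM HM']].
  assert (Hfin : forall K : nat, exists d, 0 < d /\ forall t, a <= t <= b -> forall k : nat, (k < K)%nat -> d <= Cmod (s t + RtoC (INR k))).
  { induction K as [|K [d [Hd IH]]].
    - exists 1. split; [lra|]. intros; lia.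
    - destruct (continuous_away_from_0 (fun t => s t + RtoC (INR K))%C a b Hab) as [d' [Hd' H']].
      + intros t _. apply continuous_Cplus; [apply Hs|apply continuous_const].
      + intros t _ E. apply (Hn t K). rewrite RtoC_opp. replace (s t) with ((s t + RtoC (INR K)) - RtoC (INR K))%C by ring.
        rewrite E. ring.
      + exists (Rmin d d'). split; [now apply Rmin_pos|]. intros t Ht k Hk.
        pose proof (Rmin_l d d'). pose proof (Rmin_r d d').
        destruct (Nat.eq_dec k K) as [->|]; [specialize (H' t Ht); lra|].
        specialize (IH t Ht k ltac:(lia)). lra. }
  destruct (INR_unbounded (M + 1)) as [K HK]. destruct (Hfin K) as [d [Hd H]].
  exists (Rmin d 1). split; [apply Rmin_pos; lra|]. intros t Ht k.
  pose proof (Rmin_l d 1). pose proof (Rmin_r d 1).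
  destruct (Nat.lt_ge_cases k K) as [Hk|Hk]; [specialize (H t Ht k Hk); lra|].
  assert (INR K <= INR k) by (now apply le_INR). specialize (HM' t Ht).
  pose proof (Cmod_add_ge (RtoC (INR k)) (s t)). rewrite Cmod_R, Rabs_pos_eq in H3 by apply pos_INR.
  replace (s t + RtoC (INR k))%C with (RtoC (INR k) + s t)%C by ring. lra.
Qed.

Lemma uconv_inv_INR (u : nat -> R -> C) f a b B m : (1 <= m)%nat ->
  (forall n, (m <= n)%nat -> forall t, a <= t <= b -> Cmod (u n t - f t) <= B / INR n) -> uconv u f a b.
Proof.
  intros Hm H e He. destruct (INR_unbounded (B / e)) as [N HN]. exists (max m N). intros n Hn t Ht.
  eapply Rle_trans; [apply H; [lia|assumption]|].
  assert (1 <= INR n) by (apply (le_INR 1); lia). assert (INR N <= INR n) by (apply le_INR; lia).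
  apply Rmult_le_reg_r with (INR n); [lra|]. unfold Rdiv. rewrite Rmult_assoc, Rinv_l, Rmult_1_r by lra.
  assert (H2 : B / e <= INR n) by lra. apply Rmult_le_compat_r with (r := e) in H2; [|lra].
  unfold Rdiv in H2. rewrite Rmult_assoc, Rinv_l, Rmult_1_r in H2 by lra. lra.
Qed.

Lemma uconv_gauss_ratio (b : C) (s : R -> C) (x y : R) : x <= y -> (forall t, Ccontinuous s t) ->
  (forall t, nonpole (s t)) ->
  uconv (fun n t => gauss_ratio b n (s t)) (fun t => gamma_ratio b (s t)) x y.
Proof.
  intros Hxy Hs Hn.
  destruct (continuous_bounded s x y Hxy (fun t _ => Hs t)) as [M [HM HM']].
  destruct (nonpole_path_dist s x y Hxy Hs Hn) as [d [Hd Hd']].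
  destruct (gamma_ratio_uniform b M d HM Hd) as [B [m [HB [Hm H]]]].
  apply (uconv_inv_INR _ _ _ _ B m Hm). intros n Hn' t Ht. apply H; auto.
Qed.

Lemma continuous_gamma_ratio (b : C) (s : R -> C) (t : R) : (forall t, Ccontinuous s t) ->
  (forall t, nonpole (s t)) -> Ccontinuous (fun x => gamma_ratio b (s x)) t.
Proof.
  intros Hs Hn. apply (uconv_continuous (fun n t => gauss_ratio b n (s t)) _ (t - 1) (t + 1)); [lra| |].
  - apply uconv_gauss_ratio; [lra|assumption|assumption].
  - intros n. now apply continuous_gauss_ratio.
Qed.

Lemma uconv_Cexp (w : R -> C) (a b M : R) : (forall t, a <= t <= b -> Cmod (w t) <= M) -> 0 <= M ->
  uconv (fun n t => Cpow (1 + w t / RtoC (INR (S n))) (S n))%C (fun t => Cexp (w t)) a b.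
Proof.
  intros HM HM0. apply (uconv_inv_INR _ _ _ _ (M ^ 2 * exp (2 * M)) 1 (le_n _)).
  intros n Hn t Ht. eapply Rle_trans; [apply Cexp_limit|]. specialize (HM t Ht).
  pose proof (Cmod_ge_0 (w t)).
  assert (0 < INR n) by (apply lt_0_INR; lia).
  unfold Rdiv. apply Rmult_le_compat.
  - apply Rmult_le_pos; [apply pow2_ge_0|left; apply exp_pos].
  - left. apply Rinv_0_lt_compat. rewrite S_INR. lra.
  - apply Rmult_le_compat; [apply pow2_ge_0|left; apply exp_pos|apply pow_incr; lra|apply exp_le; lra].
  - apply Rinv_le_contravar; [assumption|]. rewrite S_INR. lra.
Qed.

(** * The integrand, its poles and its rational approximations *)

Definition upper_pole (beta : C) (a : R) (k : nat) : C := (Ci * (RtoC a - beta) + Ci * RtoC (INR k))%C.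

Definition lower_pole (a : R) (k : nat) : C := (- (Ci * RtoC a) - Ci * RtoC (INR k))%C.

(** With a = (lambda + n + 1)/2 the four Gamma factors of 1/tau regroup into two quotients Gamma (s)
    / Gamma (s + beta), at s = a - beta + i v and s = a - i v. Their poles are the [upper_pole] and
    the [lower_pole] points. *)
Definition inv_tau_pow (beta : C) (L : nat) (a : R) (v : C) : C :=
  ((/ Rcpow 4 beta * gamma_ratio beta (RtoC a - beta + Ci * v)
    * gamma_ratio beta (RtoC a - Ci * v)) ^ (L + 1))%C.

Lemma inv_tau (beta : C) (lambda : R) (n L : nat) (v : C) :
  (/ Cpow (tau beta lambda n v) (L + 1))%C = inv_tau_pow beta L ((lambda + INR n + 1) / 2) v.
Proof.
  rewrite Cpow_inv_total. unfold inv_tau_pow, tau, gamma_ratio. f_equal.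
  generalize (RtoC ((lambda + INR n + 1) / 2)). intros a.
  unfold Cdiv. rewrite !Cinv_mult_total, !Cinv_inv_total.
  replace (a - beta + Ci * v + beta)%C with (a + Ci * v)%C by ring.
  replace (a - Ci * v + beta)%C with (a + beta - Ci * v)%C by ring.
  ring.
Qed.

(* With l = ln (z zbar), the j-th derivative in l is i^j times the case [j]. *)
Definition ladder_kernel (beta : C) (L : nat) (a l : R) (j : nat) (v : C) : C :=
  (v ^ j * (Cexp (RtoC l * (Ci * v)) * inv_tau_pow beta L a v))%C.

Definition avoids_poles (beta : C) (a : R) (g : R -> C) : Prop :=
  forall t k, g t <> upper_pole beta a k /\ g t <> lower_pole a k.

Lemma Ci_sqr : (Ci * Ci)%C = (- (1))%C.
Proof. apply C_ext; simpl; ring. Qed.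

Lemma Ci_neq_0 : Ci <> 0%C.
Proof. intros E. inversion E. lra. Qed.

Lemma avoids_nonpole_upper beta a g t : avoids_poles beta a g -> nonpole (RtoC a - beta + Ci * g t)%C.
Proof.
  intros H k E. destruct (H t k) as [H1 _]. apply H1. unfold upper_pole.
  replace (g t) with (- (Ci * (Ci * g t)))%C by (rewrite Cmult_assoc, Ci_sqr; ring).
  replace (Ci * g t)%C with ((RtoC a - beta + Ci * g t) - (RtoC a - beta))%C by ring.
  rewrite E, RtoC_opp. ring.
Qed.

Lemma avoids_nonpole_lower beta a g t : avoids_poles beta a g -> nonpole (RtoC a - Ci * g t)%C.
Proof.
  intros H k E. destruct (H t k) as [_ H1]. apply H1. unfold lower_pole.
  replace (g t) with (- (Ci * (Ci * g t)))%C by (rewrite Cmult_assoc, Ci_sqr; ring).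
  replace (Ci * g t)%C with (RtoC a - (RtoC a - Ci * g t))%C by ring.
  rewrite E, RtoC_opp. ring.
Qed.

Section KernelAlongPath.

Variables (beta : C) (L : nat) (a : R).

Lemma continuous_upper_arg g t : piecewise_C1 g -> Ccontinuous (fun s => RtoC a - beta + Ci * g s)%C t.
Proof.
  intros G. apply continuous_Cplus; [apply continuous_const|]. apply continuous_Cmult; [apply continuous_const|].
  now apply piecewise_continuous.
Qed.

Lemma continuous_lower_arg g t : piecewise_C1 g -> Ccontinuous (fun s => RtoC a - Ci * g s)%C t.
Proof.
  intros G. apply continuous_Cminus; [apply continuous_const|]. apply continuous_Cmult; [apply continuous_const|].
  now apply piecewise_continuous.
Qed.

Lemma continuous_inv_tau_pow g t : piecewise_C1 g -> avoids_poles beta a g ->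
  Ccontinuous (fun s => inv_tau_pow beta L a (g s)) t.
Proof.
  intros G H. apply continuous_Cpow. apply continuous_Cmult; [apply continuous_Cmult; [apply continuous_const|]|].
  - apply (continuous_gamma_ratio beta (fun s => RtoC a - beta + Ci * g s)%C).
    + intros. now apply continuous_upper_arg.
    + intros. now apply avoids_nonpole_upper.
  - apply (continuous_gamma_ratio beta (fun s => RtoC a - Ci * g s)%C).
    + intros. now apply continuous_lower_arg.
    + intros. now apply (avoids_nonpole_lower beta).
Qed.

Lemma continuous_exponent g l t : piecewise_C1 g -> Ccontinuous (fun s => RtoC l * (Ci * g s))%C t.
Proof.
  intros G. apply continuous_Cmult; [apply continuous_const|].
  apply continuous_Cmult; [apply continuous_const|]. now apply piecewise_continuous.
Qed.

Lemma continuous_ladder_kernel g l j t : piecewise_C1 g -> avoids_poles beta a g ->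
  Ccontinuous (fun s => ladder_kernel beta L a l j (g s)) t.
Proof.
  intros G H. apply continuous_Cmult; [now apply continuous_Cpow, piecewise_continuous|].
  apply continuous_Cmult; [now apply continuous_Cexp, continuous_exponent|now apply continuous_inv_tau_pow].
Qed.

(* Rational in [v]: (1 + x/N)^N replaces exp x, Gauss's partial products replace Gamma. *)
Definition ladder_kernel_approx (l : R) (j n : nat) (v : C) : C :=
  (v ^ j * ((1 + RtoC l * (Ci * v) / RtoC (INR (S n))) ^ S n *
    (/ Rcpow 4 beta * gauss_ratio beta n (RtoC a - beta + Ci * v)
      * gauss_ratio beta n (RtoC a - Ci * v)) ^ (L + 1)))%C.

Lemma uconv_ladder_kernel g l j x y : x <= y -> piecewise_C1 g -> avoids_poles beta a g ->
  uconv (fun n t => ladder_kernel_approx l j n (g t)) (fun t => ladder_kernel beta L a l j (g t)) x y.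
Proof.
  intros Hxy G H. unfold ladder_kernel_approx, ladder_kernel, inv_tau_pow.
  assert (Bd : forall f : R -> C, (forall t, Ccontinuous f t) -> exists M, 0 <= M /\ forall t, x <= t <= y -> Cmod (f t) <= M).
  { intros f Hf. apply continuous_bounded; auto. }
  pose proof (fun t => continuous_upper_arg g t G) as Cu.
  pose proof (fun t => continuous_lower_arg g t G) as Cl.
  pose proof (fun t => continuous_gamma_ratio beta _ t Cu (fun t => avoids_nonpole_upper beta a g t H)) as Gu.
  pose proof (fun t => continuous_gamma_ratio beta _ t Cl (fun t => avoids_nonpole_lower beta a g t H)) as Gl.
  assert (C0 : forall t, Ccontinuous (fun s => / Rcpow 4 beta * gamma_ratio beta (RtoC a - beta + Ci * g s))%C t).
  { intros t. apply continuous_Cmult; [apply continuous_const|apply Gu]. }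
  assert (C1 : forall t, Ccontinuous (fun s => / Rcpow 4 beta * gamma_ratio beta (RtoC a - beta + Ci * g s) * gamma_ratio beta (RtoC a - Ci * g s))%C t).
  { intros t. apply continuous_Cmult; [apply C0|apply Gl]. }
  assert (C2 : forall t, Ccontinuous (fun s => Cexp (RtoC l * (Ci * g s)))%C t).
  { intros t. now apply continuous_Cexp, continuous_exponent. }
  destruct (Bd _ (fun t => continuous_exponent g l t G)) as [Me [HMe0 HMe]].
  destruct (Bd _ C0) as [M0 [_ HM0]]. destruct (Bd _ C1) as [M1 [_ HM1]]. destruct (Bd _ C2) as [M2 [_ HM2]].
  destruct (Bd _ Gu) as [Mu [_ HMu]]. destruct (Bd _ Gl) as [Ml [_ HMl]].
  destruct (Bd _ (fun t => continuous_Cpow g j t (piecewise_continuous g t G))) as [Mj [_ HMj]].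
  destruct (Bd _ (fun t => continuous_Cpow _ (L + 1) t (C1 t))) as [Mp [_ HMp]].
  destruct (Bd _ (fun t => continuous_Cmult _ _ t (C2 t) (continuous_Cpow _ (L + 1) t (C1 t)))) as [Mq [_ HMq]].
  apply (uconv_mult _ _ _ _ _ _ Mj Mq HMj HMq); [apply uconv_const|].
  apply (uconv_mult _ _ _ _ _ _ M2 Mp HM2 HMp).
  - now apply (uconv_Cexp _ _ _ Me).
  - apply (uconv_pow _ _ _ _ M1 _ HM1).
    apply (uconv_mult _ _ _ _ _ _ M0 Ml HM0 HMl).
    + apply (uconv_mult _ _ _ _ _ _ (Cmod (/ Rcpow 4 beta)) Mu); [intros; apply Rle_refl|assumption|apply uconv_const|].
      apply (uconv_gauss_ratio beta (fun t => RtoC a - beta + Ci * g t)%C); auto. intros. now apply avoids_nonpole_upper.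
    + apply (uconv_gauss_ratio beta (fun t => RtoC a - Ci * g t)%C); auto. intros. now apply (avoids_nonpole_lower beta).
Qed.

Definition kernel_pole (p : C) : Prop :=
  (exists k, p = upper_pole beta a k) \/ (exists k, p = lower_pole a k).

(** Only the denominators [rising] produce poles, at the zeros of a - beta + i v + k and a - i v +
    k. The condition l <> 0 makes 1 + i l v / N a nonconstant linear factor. *)
Lemma rational_ladder_kernel_approx l j n : l <> 0 ->
  rational_with kernel_pole (ladder_kernel_approx l j n).
Proof.
  intros Hl. unfold ladder_kernel_approx.
  assert (HN : RtoC (INR (S n)) <> 0%C) by (apply RtoC_neq_0, not_0_INR; lia).
  assert (Hl' : RtoC l <> 0%C) by now apply RtoC_neq_0.
  assert (Hopp : (- Ci)%C <> 0%C).
  { intros E. apply Ci_neq_0. replace Ci with (- - Ci)%C by ring. rewrite E. ring. }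
  assert (HI : forall z : C, (z / Ci = - (Ci * z))%C).
  { intros z. replace z with (- (Ci * Ci) * z)%C at 1 by (rewrite Ci_sqr; ring). field. apply Ci_neq_0. }
  apply rational_mult; [|apply rational_mult].
  - apply rational_pow, (rational_ext _ (fun v => 0 + 1 * v)%C); [intros; ring|].
    apply rational_linear. apply RtoC_neq_0. lra.
  - apply rational_pow, (rational_ext _ (fun v => 1 + RtoC l * Ci / RtoC (INR (S n)) * v)%C); [intros; field; assumption|].
    apply rational_linear. intros E. apply (Cmult_neq_0 (RtoC l) Ci Hl' Ci_neq_0).
    replace (RtoC l * Ci)%C with (RtoC l * Ci / RtoC (INR (S n)) * RtoC (INR (S n)))%C by (field; assumption).
    rewrite E. ring.
  - apply rational_pow. unfold gauss_ratio.
    apply rational_mult; [apply rational_mult; [apply rational_const|]|];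
    (apply rational_mult; [apply rational_const|]); apply rational_mult.
    + apply (rational_ext _ (fun v => rising (RtoC a + Ci * v) n)); [intros; f_equal; ring|].
      apply rational_rising, Ci_neq_0.
    + apply rational_inv_rising; [apply Ci_neq_0|]. intros k. left. exists k. rewrite HI. unfold upper_pole. ring.
    + apply (rational_ext _ (fun v => rising (RtoC a + beta + (- Ci) * v) n)); [intros; f_equal; ring|].
      now apply rational_rising.
    + apply (rational_ext _ (fun v => / rising (RtoC a + (- Ci) * v) n)%C); [intros; do 2 f_equal; ring|].
      apply rational_inv_rising; [assumption|]. intros k. right. exists k.
      replace ((RtoC a + RtoC (INR k)) / (- Ci))%C with (- ((RtoC a + RtoC (INR k)) / Ci))%C
       by (field; split; [apply Ci_neq_0|assumption] || (field; apply Ci_neq_0)).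
      rewrite HI. unfold lower_pole. ring.
Qed.

Lemma balanced_ladder_kernel g1 g2 x y l j : bipath g1 g2 x y -> l <> 0 ->
  avoids_poles beta a g1 -> avoids_poles beta a g2 ->
  (forall p, kernel_pole p -> balanced_pole g1 g2 x y p) ->
  balanced g1 g2 x y (ladder_kernel beta L a l j).
Proof.
  intros B Hl A1 A2 HP. pose proof (bi_lt _ _ _ _ B). pose proof (bi_1 _ _ _ _ B). pose proof (bi_2 _ _ _ _ B).
  apply balanced_limit; [assumption| | |].
  - intros. now apply continuous_ladder_kernel.
  - intros. now apply continuous_ladder_kernel.
  - intros e He.
    destruct (uconv_ladder_kernel g1 l j x y ltac:(lra) ltac:(assumption) A1 e He) as [N1 H1'].
    destruct (uconv_ladder_kernel g2 l j x y ltac:(lra) ltac:(assumption) A2 e He) as [N2 H2'].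
    (* The same rational function has to approximate the kernel on both paths, hence the common
       index. *)
    exists (ladder_kernel_approx l j (max N1 N2)). split.
    (* Partial fractions start from a pole with exponent 0; any balanced pole serves. *)
    + apply (balanced_rational_with g1 g2 x y kernel_pole (lower_pole a 0)); try assumption.
      * right. now exists 0%nat.
      * now apply rational_ladder_kernel_approx.
    + intros t Ht. split; [apply H1'|apply H2']; (lia || assumption).
Qed.

End KernelAlongPath.

(** * Tilting the contour *)

(* Lifting a contour by [eps * tilt q] turns the oscillation of exp (i l v) into exponential
   decay when eps l = |l|. *)
Definition tilt (q t : R) : R := Rmax 0 (q + Rabs t) / 4.

(* Equals [tilt q] on [-T1, T2] and returns to 0 with slope 1/4 outside. *)
Definition cut_tilt (q T1 T2 t : R) : R :=
  / 4 * (if Rle_dec t 0 then tent (- T1) (q + T1) t else tent T2 (q + T2) t).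

Lemma cut_tilt_piecewise_affine q T1 T2 : 0 <= q + T1 -> 0 <= q + T2 -> 0 <= T1 -> 0 <= T2 ->
  piecewise_affine (cut_tilt q T1 T2).
Proof.
  intros H1 H2 H3 H4. apply piecewise_affine_scal, piecewise_affine_glue.
  - now apply piecewise_affine_tent.
  - now apply piecewise_affine_tent.
  - unfold tent. replace (0 - - T1) with T1 by ring. replace (0 - T2) with (- T2) by ring.
    rewrite Rabs_Ropp, !Rabs_pos_eq by assumption. f_equal. ring.
Qed.

Lemma cut_tilt_nonneg q T1 T2 t : 0 <= cut_tilt q T1 T2 t.
Proof.
  unfold cut_tilt. destruct (Rle_dec t 0); apply Rmult_le_pos; try lra; apply tent_nonneg.
Qed.

Lemma cut_tilt_eq q T1 T2 t : - T1 <= t <= T2 -> cut_tilt q T1 T2 t = tilt q t.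
Proof.
  intros Ht. unfold cut_tilt, tilt, tent, Rdiv. rewrite (Rmult_comm _ (/ 4)). f_equal.
  destruct (Rle_dec t 0).
  - rewrite (Rabs_left1 t), (Rabs_pos_eq (t - - T1)) by lra. f_equal. ring.
  - rewrite (Rabs_pos_eq t), (Rabs_left1 (t - T2)) by lra. f_equal. ring.
Qed.

Lemma cut_tilt_le q T1 T2 t : cut_tilt q T1 T2 t <= tilt q t.
Proof.
  unfold cut_tilt, tilt, tent, Rdiv. rewrite (Rmult_comm _ (/ 4)). apply Rmult_le_compat_l; [lra|].
  destruct (Rle_dec t 0); apply Rle_max_compat_l.
  - rewrite (Rabs_left1 t) by lra. pose proof (Rle_abs (t - - T1)). pose proof (Rle_abs (- (t - - T1))).
    rewrite Rabs_Ropp in H0. lra.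
  - rewrite (Rabs_pos_eq t) by lra. pose proof (Rle_abs (t - T2)). pose proof (Rle_abs (- (t - T2))).
    rewrite Rabs_Ropp in H0. lra.
Qed.

Lemma cut_tilt_right q T1 T2 t : 0 <= T2 -> T2 < t <= 2 * T2 + q ->
  cut_tilt q T1 T2 t = (2 * T2 + q - t) / 4.
Proof.
  intros H0 Ht. unfold cut_tilt. destruct (Rle_dec t 0); [lra|].
  rewrite tent_inside; rewrite Rabs_pos_eq; lra.
Qed.

Lemma cut_tilt_left q T1 T2 t : 0 <= T1 -> T1 < - t <= 2 * T1 + q ->
  cut_tilt q T1 T2 t = (2 * T1 + q - (- t)) / 4.
Proof.
  intros H0 Ht. unfold cut_tilt. destruct (Rle_dec t 0); [|lra].
  rewrite tent_inside; rewrite Rabs_left1; lra.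
Qed.

Lemma cut_tilt_zero q T1 T2 t : 0 <= T1 -> 0 <= T2 -> 0 <= q + T1 -> 0 <= q + T2 ->
  t <= - (2 * T1 + q) \/ 2 * T2 + q <= t ->
  cut_tilt q T1 T2 t = 0.
Proof.
  intros H1 H2 H3 H4 Ht. unfold cut_tilt. destruct (Rle_dec t 0); rewrite tent_outside; try ring.
  - destruct Ht.
    + rewrite Rabs_left1; lra.
    + pose proof (Rle_abs (t - - T1)). replace t with 0 in * by lra. replace (0 - - T1) with T1 by ring.
      rewrite Rabs_pos_eq; lra.
  - destruct Ht.
    + pose proof (Rle_abs (t - T2)). lra.
    + rewrite Rabs_pos_eq; lra.
Qed.

Lemma tilt_lipschitz q s t : Rabs (tilt q s - tilt q t) <= / 4 * Rabs (s - t).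
Proof.
  unfold tilt. pose proof (Rabs_triang_inv2 s t) as H. apply Rabs_le_between in H.
  unfold Rmax. destruct (Rle_dec 0 (q + Rabs s)), (Rle_dec 0 (q + Rabs t));
  apply Rabs_le; pose proof (Rabs_pos (s - t)); lra.
Qed.

Lemma cut_tilt_lipschitz q T1 T2 s t : 0 <= T1 -> 0 <= T2 ->
  Rabs (cut_tilt q T1 T2 s - cut_tilt q T1 T2 t) <= / 4 * Rabs (s - t).
Proof.
  intros H1 H2.
  assert (K : forall s t, s <= t -> Rabs (cut_tilt q T1 T2 s - cut_tilt q T1 T2 t) <= / 4 * Rabs (s - t)).
  { clear s t. intros s t Hst. unfold cut_tilt. rewrite <- Rmult_minus_distr_l, Rabs_mult, (Rabs_pos_eq (/ 4)) by lra.
    apply Rmult_le_compat_l; [lra|].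
    destruct (Rle_dec s 0), (Rle_dec t 0); try lra; try apply tent_lipschitz.
    pose proof (tent_lipschitz (- T1) (q + T1) s 0) as A. pose proof (tent_lipschitz T2 (q + T2) 0 t) as B.
    assert (E : tent (- T1) (q + T1) 0 = tent T2 (q + T2) 0).
    { unfold tent. replace (0 - - T1) with T1 by ring. replace (0 - T2) with (- T2) by ring.
      rewrite Rabs_Ropp, !Rabs_pos_eq by assumption. f_equal. ring. }
    rewrite E in A. rewrite (Rabs_left1 (s - t)) by lra.
    rewrite (Rabs_left1 (s - 0)) in A by lra. rewrite (Rabs_left1 (0 - t)) in B by lra.
    replace (tent (- T1) (q + T1) s - tent T2 (q + T2) t) with
      ((tent (- T1) (q + T1) s - tent T2 (q + T2) 0) + (tent T2 (q + T2) 0 - tent T2 (q + T2) t)) by ring.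
    eapply Rle_trans; [apply Rabs_triang|]. lra. }
  destruct (Rle_dec s t); [now apply K|].
  rewrite Rabs_minus_sym, (Rabs_minus_sym s). apply K. lra.
Qed.

(** [Derive] is the total limit [Lim_seq] of difference quotients in [-K, K], so its value lies
    there even at a corner of phi. *)
Lemma Derive_lipschitz (phi : R -> R) (K t : R) :
  (forall s, Rabs (phi s - phi t) <= K * Rabs (s - t)) -> Rabs (Derive phi t) <= K.
Proof.
  intros H. unfold Derive, Lim.
  set (u := fun n => (phi (t + Rbar_loc_seq 0 n) - phi t) / Rbar_loc_seq 0 n).
  assert (Hu : forall n, - K <= u n <= K).
  { intros n. apply Rabs_le_between. unfold u, Rbar_loc_seq.
    assert (Hn : 0 < / (INR n + 1)) by (apply Rinv_0_lt_compat; pose proof (pos_INR n); lra).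
    rewrite Rplus_0_l. unfold Rdiv. rewrite Rabs_mult, Rabs_inv, (Rabs_pos_eq (/ (INR n + 1))) by lra.
    specialize (H (t + / (INR n + 1))). replace (t + / (INR n + 1) - t) with (/ (INR n + 1)) in H by ring.
    rewrite (Rabs_pos_eq (/ (INR n + 1))) in H by lra.
    apply Rmult_le_reg_r with (/ (INR n + 1)); [assumption|].
    rewrite Rmult_assoc, Rinv_l by lra. lra. }
  assert (H1 : Rbar_le (Lim_seq u) K).
  { rewrite <- (Lim_seq_const K). apply Lim_seq_le_loc. exists 0%nat. intros. apply Hu. }
  assert (H2 : Rbar_le (- K) (Lim_seq u)).
  { rewrite <- (Lim_seq_const (- K)). apply Lim_seq_le_loc. exists 0%nat. intros. apply Hu. }
  fold u. destruct (Lim_seq u) as [x| |]; simpl in *; try contradiction. now apply Rabs_le.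
Qed.

Lemma path_velocity_lift_line (phi : R -> R) (t K : R) :
  (forall s, Rabs (phi s - phi t) <= K * Rabs (s - t)) ->
  Cmod (path_velocity (lift_path RtoC phi) t) <= 1 + K.
Proof.
  intros H. eapply Rle_trans; [apply Cmod_le_abs|].
  apply Derive_lipschitz in H. unfold path_velocity. simpl.
  rewrite (Derive_ext (fun s => s + (0 * phi s - 1 * 0)) (fun s => s)) by (intros; ring).
  rewrite Derive_id, (Derive_ext (fun s => 0 + (0 * 0 + 1 * phi s)) phi) by (intros; ring).
  rewrite Rabs_R1. lra.
Qed.

(** * Sides of a lifted contour *)

Lemma joined_off_trans g p q r : joined_off g p q -> joined_off g q r -> joined_off g p r.
Proof.
  intros [s1 [C1 [E10 [E11 H1]]]] [s2 [C2 [E20 [E21 H2]]]].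
  (* Concatenation written as a sum: at every u one of the two summands is q, and continuity needs
     no case distinction. *)
  exists (fun u => s1 (Rmin 1 (2 * u)) + s2 (Rmax 0 (2 * u - 1)) - q)%C.
  split; [|split; [|split]].
  - assert (L1 : forall u, continuous (fun u => Rmin 1 (2 * u)) u).
    { apply (lipschitz_continuous _ 2). intros s t. unfold Rmin.
      assert (Hr : - Rabs (s - t) <= s - t <= Rabs (s - t)) by (apply Rabs_le_between, Rle_refl).
      destruct (Rle_dec 1 (2 * s)), (Rle_dec 1 (2 * t)); apply Rabs_le; lra. }
    assert (L2 : forall u, continuous (fun u => Rmax 0 (2 * u - 1)) u).
    { apply (lipschitz_continuous _ 2). intros s t. unfold Rmax.
      assert (Hr : - Rabs (s - t) <= s - t <= Rabs (s - t)) by (apply Rabs_le_between, Rle_refl).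
      destruct (Rle_dec 0 (2 * s - 1)), (Rle_dec 0 (2 * t - 1)); apply Rabs_le; lra. }
    intros u. apply continuous_Cminus; [|apply continuous_const]. apply continuous_Cplus.
    + apply (continuous_comp (fun u => Rmin 1 (2 * u)) s1); [apply L1|apply C1].
    + apply (continuous_comp (fun u => Rmax 0 (2 * u - 1)) s2); [apply L2|apply C2].
  - rewrite Rmin_right, Rmax_left by lra. rewrite Rmult_0_r, E10, E20. ring.
  - rewrite Rmin_left, Rmax_right by lra. replace (2 * 1 - 1) with 1 by ring. rewrite E11, E21. ring.
  - intros u t Hu E. destruct (Rle_dec u (1 / 2)).
    + rewrite Rmin_right, Rmax_left in E by lra. apply (H1 (2 * u) t); [lra|].
      rewrite <- E, E20. ring.
    + rewrite Rmin_left, Rmax_right in E by lra. apply (H2 (2 * u - 1) t); [lra|].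
      rewrite <- E, E11. ring.
Qed.

(** On the segment from p to a high point of the imaginary axis the abscissa shrinks towards 0, so
    only the values of phi on |x| <= |Re p| can get in the way. *)
Lemma lies_side_lift_line (phi : R -> R) (sg B : R) (p : C) : sg * sg = 1 ->
  (forall t, sg * phi t <= B) ->
  (forall x, Rabs x <= Rabs (Re p) -> sg * phi x < sg * Im p) ->
  lies_side sg (lift_path RtoC phi) p.
Proof.
  intros Hsg HB Hp. set (y := Rmax B (sg * Im p) + 1).
  pose proof (Rmax_l B (sg * Im p)) as H1. pose proof (Rmax_r B (sg * Im p)) as H2.
  exists (sg * y). rewrite <- Rmult_assoc, Hsg, Rmult_1_l. split.
  - intros t. simpl. specialize (HB t). unfold y. rewrite !Rmult_0_l, Rmult_1_l, !Rplus_0_l. lra.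
  - exists (fun u => ((1 - u) * Re p, (1 - u) * Im p + u * (sg * y))). split; [|split; [|split]].
    + intros u. apply continuous_C. split; simpl; apply (ex_derive_continuous (V := R_NormedModule)); auto_derive; exact I.
    + apply C_ext; simpl; ring.
    + apply C_ext; simpl; ring.
    + intros u t Hu E.
      assert (Et : t = (1 - u) * Re p).
      { apply (f_equal Re) in E. simpl in E. lra. }
      assert (Ei : phi t = (1 - u) * Im p + u * (sg * y)).
      { apply (f_equal Im) in E. simpl in E. lra. }
      assert (Hx : Rabs t <= Rabs (Re p)).
      { rewrite Et, Rabs_mult, (Rabs_pos_eq (1 - u)) by lra. pose proof (Rabs_pos (Re p)). nra. }
      specialize (Hp t Hx). rewrite Ei in Hp.
      replace (sg * ((1 - u) * Im p + u * (sg * y))) with ((1 - u) * (sg * Im p) + u * (sg * sg) * y) in Hp by ring.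
      rewrite Hsg in Hp. unfold y in *. nra.
Qed.

(** The shear (x, y) -> (x, y + phi (x)) carries g to its lift, because phi vanishes wherever g is
    not real, and it fixes p and the imaginary axis. It therefore carries the escape route of p to
    one avoiding the lift; a vertical segment then reaches the required height. *)
Lemma lies_side_lift (g : R -> C) (phi : R -> R) (sg B M : R) (p : C) : sg * sg = 1 ->
  (forall t, continuous phi t) -> (forall t, sg * phi t <= B) -> 0 <= B ->
  (forall t, Rabs t <= M -> phi t = 0) -> 0 <= M ->
  real_beyond g M -> (forall t, Rabs t <= M -> Rabs (Re (g t)) <= M) ->
  Rabs (Re p) <= M -> lies_side sg g p -> lies_side sg (lift_path g phi) p.
Proof.
  intros Hsg Hc HB HB0 H0 HM0 HM Hg Hp [y [Hy [s [Hs [Hs0 [Hs1 Hoff]]]]]].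
  assert (Hpg : forall t, phi (Re (g t)) = phi t).
  { intros t. destruct (Rle_dec (Rabs t) M).
    - rewrite H0 by now apply Hg. symmetry. now apply H0.
    - rewrite HM by lra. reflexivity. }
  exists (y + sg * B). split.
  - intros t. specialize (Hy t). specialize (HB t).
    replace (sg * (y + sg * B)) with (sg * y + sg * sg * B) by ring. rewrite Hsg.
    replace (Im (lift_path g phi t)) with (Im (g t) + phi t) by (unfold lift_path, Im; simpl; ring). lra.
  - apply (joined_off_trans _ _ (0, y)).
    + exists (fun u => s u + Ci * RtoC (phi (Re (s u))))%C. split; [|split; [|split]].
      * intros u. apply continuous_Cplus; [apply Hs|]. apply continuous_Cmult; [apply continuous_const|].
        apply continuous_C. split; simpl; [|apply continuous_const].
        apply (continuous_comp (fun u => Re (s u)) phi); [|apply Hc]. apply (proj1 (continuous_C s u) (Hs u)).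
      * rewrite Hs0, H0 by assumption. ring.
      * rewrite Hs1, H0 by (simpl; rewrite Rabs_R0; assumption). ring.
      * intros u t Hu E. unfold lift_path in E.
        assert (ER : Re (s u) = Re (g t)).
        { apply (f_equal Re) in E. simpl in E. unfold Re. lra. }
        rewrite ER, Hpg in E. apply (Hoff u t Hu).
        replace (s u) with (s u + Ci * RtoC (phi t) - Ci * RtoC (phi t))%C by ring. rewrite E. ring.
    + exists (fun u => (0, y + u * (sg * B))). split; [|split; [|split]].
      * intros u. apply continuous_C. split; simpl; [apply continuous_const|].
        apply (ex_derive_continuous (V := R_NormedModule)); auto_derive; exact I.
      * apply C_ext; simpl; ring.
      * apply C_ext; simpl; ring.
      * intros u t Hu E.
        assert (ER : Re (g t) = 0).
        { apply (f_equal Re) in E. unfold lift_path in E. simpl in E. unfold Re. lra. }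
        assert (EI : Im (g t) + phi t = y + u * (sg * B)).
        { apply (f_equal Im) in E. unfold lift_path in E. simpl in E. unfold Im. lra. }
        rewrite <- Hpg, ER, H0 in EI by (rewrite Rabs_R0; assumption).
        specialize (Hy t). assert (sg * (Im (g t) + 0) = sg * y + u * (sg * sg) * B) by (rewrite EI; ring).
        rewrite Hsg in H. nra.
Qed.

(** * Tail estimates and improper integrals *)

Lemma is_CRInt_Cmod_le_open (f : R -> C) (g : R -> R) (a b : R) (l : C) (m : R) :
  a <= b -> is_CRInt f a b l -> is_RInt g a b m ->
  (forall t, a <= t <= b -> 0 <= g t) ->
  (forall t, a < t < b -> Cmod (f t) <= g t) -> Cmod l <= m.
Proof.
  intros Hab Hf Hg Hg0 Hle.
  (* Nothing is assumed at the ends, where a path may have a corner; setting the integrand to 0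
     there leaves the integral unchanged. *)
  apply (is_CRInt_Cmod_le (fun t => if Rlt_dec a t then if Rlt_dec t b then f t else 0%C else 0%C) g a b l m Hab).
  - revert Hf. apply is_CRInt_ext; [assumption|]. intros t Ht.
    destruct (Rlt_dec a t); [|lra]. destruct (Rlt_dec t b); [reflexivity|lra].
  - assumption.
  - intros t Ht. destruct (Rlt_dec a t).
    + destruct (Rlt_dec t b); [apply Hle; lra|]. rewrite Cmod_0. now apply Hg0.
    + rewrite Cmod_0. now apply Hg0.
Qed.

Lemma is_RInt_exp_line (D k m x y : R) : k <> 0 -> x <= y ->
  is_RInt (fun t => D * exp (k * t + m)) x y (D * ((exp (k * y + m) - exp (k * x + m)) / k)).
Proof.
  intros Hk Hxy. apply (is_RInt_scal (V := R_NormedModule)).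
  evar_last.
  - apply (is_RInt_derive (V := R_CompleteNormedModule) (fun t => exp (k * t + m) / k)).
    + intros t _. auto_derive; [trivial|]. field. assumption.
    + intros t _. apply (ex_derive_continuous (V := R_NormedModule)). auto_derive. trivial.
  - unfold minus, plus, opp; simpl. field. assumption.
Qed.

(* The disjunction treats the tails at +oo and at -oo at once. *)
Lemma tail_integral_bound (f : R -> C) (D k m x y : R) (I : C) : k <> 0 -> 0 <= D -> 0 <= x -> x <= y ->
  (is_CRInt f x y I /\ (forall t, x < t < y -> Cmod (f t) <= D * exp (k * t + m))) \/
  (is_CRInt f (- y) (- x) I /\ (forall t, x < t < y -> Cmod (f (- t)) <= D * exp (k * t + m))) ->
  Cmod I <= D * ((exp (k * y + m) - exp (k * x + m)) / k).
Proof.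
  intros Hk HD Hx Hxy [[HI H]|[HI H]].
  - apply (is_CRInt_Cmod_le_open f (fun t => D * exp (k * t + m)) x y I); try assumption.
    + now apply is_RInt_exp_line.
    + intros. apply Rmult_le_pos; [assumption|left; apply exp_pos].
  - apply (is_CRInt_Cmod_le_open f (fun t => D * exp (- k * t + m)) (- y) (- x) I); try assumption; [lra| | |].
    + replace (D * ((exp (k * y + m) - exp (k * x + m)) / k)) with
        (D * ((exp (- k * - x + m) - exp (- k * - y + m)) / - k)).
      * apply is_RInt_exp_line; lra.
      * replace (- k * - x) with (k * x) by ring. replace (- k * - y) with (k * y) by ring. field. assumption.
    + intros. apply Rmult_le_pos; [assumption|left; apply exp_pos].
    + intros t Ht. replace (f t) with (f (- - t)) by (f_equal; ring).
      eapply Rle_trans; [apply H; lra|]. right. do 3 f_equal. ring.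
Qed.

(* Vacuous if the integrals do not exist. *)
Definition lim2 (phi : R -> C) (J : C) : Prop :=
  forall e, 0 < e -> exists T0, forall T1 T2, T0 <= T1 -> T0 <= T2 ->
    forall I, is_CRInt phi (- T1) T2 I -> Cmod (I - J) <= e.

Lemma exp_tail_small (D c e : R) : 0 <= D -> 0 < c -> 0 < e ->
  exists T0, forall T, T0 <= T -> D * exp (- c * T) <= e.
Proof.
  intros HD Hc He. exists (D / (c * e)). intros T HT.
  pose proof (exp_ineq1_le (c * T)) as H1.
  assert (H2 : D <= e * (c * T)).
  { apply Rmult_le_compat_r with (r := c * e) in HT; [|nra]. unfold Rdiv in HT.
    rewrite Rmult_assoc, Rinv_l, Rmult_1_r in HT by nra. lra. }
  replace (- c * T) with (- (c * T)) by ring. rewrite exp_Ropp.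
  pose proof (exp_pos (c * T)). apply Rmult_le_reg_r with (exp (c * T)); [assumption|].
  rewrite Rmult_assoc, Rinv_l by lra. nra.
Qed.

Section Improper.

Variables (phi : R -> C) (M D c : R).
Hypotheses (HM : 0 <= M) (HD : 0 <= D) (Hc : 0 < c).
Hypothesis Hex : forall T1 T2, M <= T1 -> M <= T2 -> ex_CRInt phi (- T1) T2.
Hypothesis Hphi : forall t, M < Rabs t -> Cmod (phi t) <= D * exp (- c * Rabs t).

Lemma improper_increment T1 T2 T1' T2' I I' : M <= T1 -> M <= T2 -> T1 <= T1' -> T2 <= T2' ->
  is_CRInt phi (- T1) T2 I -> is_CRInt phi (- T1') T2' I' ->
  Cmod (I' - I) <= D / c * exp (- c * T1) + D / c * exp (- c * T2).
Proof.
  intros H1 H2 H3 H4 HI HI'.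
  destruct (is_CRInt_split phi (- T1') (- T1) T2' I' ltac:(lra) ltac:(lra) HI') as [A [X [HA [HX EX]]]].
  destruct (is_CRInt_split phi (- T1) T2 T2' X ltac:(lra) ltac:(lra) HX) as [I2 [B [HI2 [HB EB]]]].
  rewrite (is_CRInt_unique _ _ _ _ _ HI2 HI) in EB.
  assert (E : (I' - I)%C = (A + B)%C).
  { rewrite EX, EB. change ((A + (I + B) - I)%C = (A + B)%C). ring. }
  rewrite E. eapply Rle_trans; [apply Cmod_triangle|].
  assert (Hk : forall x y Z, M <= x -> x <= y ->
    (is_CRInt phi x y Z) \/ (is_CRInt phi (- y) (- x) Z) -> Cmod Z <= D / c * exp (- c * x)).
  { intros x y Z Hx Hxy HZ.
    eapply Rle_trans; [apply (tail_integral_bound phi D (- c) 0 x y Z); try lra|].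
    - destruct HZ as [HZ|HZ]; [left|right]; (split; [assumption|]); intros t Ht;
        (eapply Rle_trans; [apply Hphi; rewrite ?Rabs_Ropp, Rabs_pos_eq; lra|]);
        rewrite ?Rabs_Ropp, Rabs_pos_eq, Rplus_0_r by lra; apply Rle_refl.
    - rewrite !Rplus_0_r. pose proof (exp_pos (- c * y)).
      replace (D * ((exp (- c * y) - exp (- c * x)) / - c)) with (D / c * exp (- c * x) - D / c * exp (- c * y)) by (field; lra).
      assert (0 <= D / c) by (apply Rdiv_le_0_compat; lra). nra. }
  apply Rplus_le_compat.
  - apply (Hk T1 T1'); try assumption. now right.
  - apply (Hk T2 T2'); try assumption. now left.
Qed.

(** The limit is taken along symmetric intervals and compared with other bounds by the tails. The
    second claim isolates the part over [-M, M], the only one that depends on the shape of the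
    contour, from tails of total size 2 D/c. *)
Lemma improper_converges :
  exists J, lim2 phi J /\ forall I, is_CRInt phi (- M) M I -> Cmod (J - I) <= 2 * (D / c).
Proof.
  assert (HDc : 0 <= D / c) by (apply Rdiv_le_0_compat; lra).
  assert (Hmon : forall T T', T <= T' -> D / c * exp (- c * T') <= D / c * exp (- c * T)).
  { intros. apply Rmult_le_compat_l; [assumption|]. apply exp_le. nra. }
  set (u := fun n : nat => RInt (V := C_R_CompleteNormedModule) phi (- (M + INR n)) (M + INR n)).
  assert (Hu : forall n, is_CRInt phi (- (M + INR n)) (M + INR n) (u n)).
  { intros n. apply (RInt_correct (V := C_R_CompleteNormedModule)). apply Hex; pose proof (pos_INR n); lra. }
  destruct (is_Clim_cauchy u) as [J HJ].
  - intros e He. destruct (exp_tail_small (D / c) c (e / 4) HDc Hc ltac:(lra)) as [T0 HT0].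
    destruct (INR_unbounded T0) as [N HN]. exists N. intros n m Hn Hm.
    assert (INR N <= INR n) by (apply le_INR; lia). assert (INR n <= INR m) by (apply le_INR; lia).
    pose proof (pos_INR n).
    pose proof (improper_increment (M + INR n) (M + INR n) (M + INR m) (M + INR m) _ _ ltac:(lra) ltac:(lra) ltac:(lra) ltac:(lra) (Hu n) (Hu m)).
    specialize (HT0 (M + INR n) ltac:(lra)). lra.
  - assert (HJ' : forall T1 T2 I, M <= T1 -> M <= T2 -> is_CRInt phi (- T1) T2 I ->
       Cmod (J - I) <= D / c * exp (- c * T1) + D / c * exp (- c * T2)).
    { intros T1 T2 I H1 H2 HI. destruct (INR_unbounded (Rmax T1 T2)) as [N HN].
      pose proof (Rmax_l T1 T2). pose proof (Rmax_r T1 T2).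
      apply (is_Clim_Cmod_sub_le u J I _ N HJ). intros n Hn.
      assert (INR N <= INR n) by (apply le_INR; lia).
      apply (improper_increment T1 T2 (M + INR n) (M + INR n)); try assumption; try lra. apply Hu. }
    exists J. split.
    + intros e He. destruct (exp_tail_small (D / c) c (e / 2) HDc Hc ltac:(lra)) as [T0 HT0].
      exists (Rmax M T0). intros T1 T2 H1 H2 I HI. pose proof (Rmax_l M T0). pose proof (Rmax_r M T0).
      rewrite Cmod_sub_sym. eapply Rle_trans; [apply (HJ' T1 T2 I); try assumption; lra|].
      pose proof (HT0 T1 ltac:(lra)). pose proof (HT0 T2 ltac:(lra)). lra.
    + intros I HI. eapply Rle_trans; [apply (HJ' M M I); try assumption; lra|].
      assert (exp (- c * M) <= 1) by (rewrite <- exp_0; apply exp_le; nra). nra.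
Qed.

End Improper.

Lemma is_RInt_gen_of_lim2 (phi : R -> C) (J : C) (T0 : R) :
  (forall T1 T2, T0 <= T1 -> T0 <= T2 -> ex_CRInt phi (- T1) T2) -> lim2 phi J ->
  is_RInt_gen (V := C_R_NormedModule) phi (Rbar_locally m_infty) (Rbar_locally p_infty) J.
Proof.
  intros Hex HJ P [eps HP].
  destruct (HJ (eps / 2) ltac:(pose proof (cond_pos eps); lra)) as [T1 HT1].
  set (T := Rmax T0 T1). pose proof (Rmax_l T0 T1). pose proof (Rmax_r T0 T1). fold T in H, H0.
  apply (Filter_prod _ _ _ (fun x => x < - T) (fun y => T < y)).
  - exists (- T). auto.
  - exists T. auto.
  - intros x y Hx Hy. simpl.
    destruct (Hex (- x) y ltac:(lra) ltac:(lra)) as [I HI]. rewrite Ropp_involutive in HI.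
    exists I. split; [assumption|]. apply HP.
    assert (Hle : Cmod (I - J) <= eps / 2).
    { apply (HT1 (- x) y ltac:(lra) ltac:(lra)). now rewrite Ropp_involutive. }
    pose proof (cond_pos eps). apply (norm_compat1 (V := C_R_NormedModule)).
    rewrite norm_Cmod. change (Cmod (I - J) < eps). lra.
Qed.

(** * Growth of the integrand, and contours that can be lifted *)

Lemma Cmod_ge_half_sum (s : C) : (Rabs (Re s) + Rabs (Im s)) / 2 <= Cmod s.
Proof. pose proof (Re_le_Cmod' s). pose proof (Im_le_Cmod s). lra. Qed.

(** The region |y| <= (a + |t|)/4 is the one swept by the lifts, and there both Gamma arguments stay
    in the sector. The power decay is kept for one of the 2 (L + 1) factors only, which suffices. K
    and B do not depend on a, hence not on n. *)
Lemma inv_tau_pow_bound (beta : C) (L : nat) : 0 < Re beta ->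
  exists K B, 0 < K /\ 32 <= B /\ forall a t y, 0 <= a -> Rabs y <= (a + Rabs t) / 4 -> B <= a + Rabs t ->
    Cmod (inv_tau_pow beta L a (t, y)) <= K * exp (- Re beta * ln ((a + Rabs t) / 4)).
Proof.
  intros Hb. destruct (gamma_ratio_sector beta) as [m [Hm H]].
  set (N := Cmod (/ Rcpow 4 beta) * m * m).
  assert (H4 : 0 < Cmod (/ Rcpow 4 beta)).
  { rewrite Cmod_inv_total. apply Rinv_0_lt_compat, Cmod_gt_0, Rcpow_neq_0. }
  assert (HN : 0 < N) by (unfold N; apply Rmult_lt_0_compat; [apply Rmult_lt_0_compat|]; assumption).
  set (bb := Rabs (Re beta) + Rabs (Im beta)).
  assert (Hbb : 0 <= bb) by (unfold bb; pose proof (Rabs_pos (Re beta)); pose proof (Rabs_pos (Im beta)); lra).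
  (* This size of a + |t| outweighs the shift by beta, so that both Gamma arguments have modulus at
     least 4 and the logarithms are nonnegative. *)
  exists (N ^ (L + 1)), (4 * bb + 32). split; [now apply pow_lt|]. split; [lra|].
  intros a t y Ha Hy HB. set (X := a + Rabs t) in *.
  apply Rabs_le_between in Hy. pose proof (Rabs_pos t) as Ht0.
  pose proof (Rle_abs (Re beta)) as Hb1. pose proof (Rle_abs (Im beta)) as Hb2.
  pose proof (Rle_abs (- Im beta)) as Hb3. rewrite Rabs_Ropp in Hb3.
  set (s1 := (RtoC a - beta + Ci * (t, y))%C). set (s2 := (RtoC a - Ci * (t, y))%C).
  assert (R1 : Re s1 = a - Re beta - y) by (unfold s1, Re; simpl; ring).
  assert (I1 : Im s1 = t - Im beta) by (unfold s1, Im; simpl; ring).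
  assert (R2 : Re s2 = a + y) by (unfold s2, Re; simpl; ring).
  assert (I2 : Im s2 = - t) by (unfold s2, Im; simpl; ring).
  pose proof (Cmod_ge_half_sum s1) as G1. pose proof (Cmod_ge_half_sum s2) as G2.
  pose proof (Im_le_Cmod s1) as J1. pose proof (Im_le_Cmod s2) as J2.
  rewrite I2, Rabs_Ropp in J2, G2. rewrite R2 in G2. rewrite R1, I1 in G1. rewrite I1 in J1.
  pose proof (Rabs_triang_inv t (Im beta)) as K1.
  pose proof (Rle_abs (a - Re beta - y)) as K2. pose proof (Rle_abs (a + y)) as K3.
  unfold X, bb in *.
  assert (S1 : in_sector s1) by (split; [lra|rewrite R1; lra]).
  assert (S2 : in_sector s2) by (split; [lra|rewrite R2; lra]).
  assert (Q2 : X / 4 <= Cmod s2) by (unfold X; lra).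
  unfold inv_tau_pow. fold s1 s2. rewrite Cmod_pow.
  set (e := exp (- Re beta * ln ((a + Rabs t) / 4))).
  assert (He : 0 < e <= 1).
  { split; [apply exp_pos|]. unfold e. rewrite <- exp_0. apply exp_le.
    assert (0 <= ln ((a + Rabs t) / 4)) by (rewrite <- ln_1; apply Rcomplements.ln_le; lra). nra. }
  assert (B1 : Cmod (gamma_ratio beta s1) <= m).
  { eapply Rle_trans; [now apply H|]. rewrite <- (Rmult_1_r m) at 2. apply Rmult_le_compat_l; [lra|].
    rewrite <- exp_0. apply exp_le.
    assert (0 <= ln (Cmod s1)) by (rewrite <- ln_1; apply Rcomplements.ln_le; [lra|destruct S1; lra]). nra. }
  assert (B2 : Cmod (gamma_ratio beta s2) <= m * e).
  { eapply Rle_trans; [now apply H|]. apply Rmult_le_compat_l; [lra|]. apply exp_le.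
    assert (ln ((a + Rabs t) / 4) <= ln (Cmod s2)) by (apply Rcomplements.ln_le; unfold X in Q2; lra). nra. }
  assert (B : Cmod (/ Rcpow 4 beta * gamma_ratio beta s1 * gamma_ratio beta s2) <= N * e).
  { rewrite !Cmod_mult. unfold N. rewrite Rmult_assoc, Rmult_assoc, Rmult_assoc.
    apply Rmult_le_compat_l; [lra|]. apply Rmult_le_compat; try apply Cmod_ge_0; assumption. }
  eapply Rle_trans; [apply pow_incr; split; [apply Cmod_ge_0|exact B]|].
  rewrite Rpow_mult_distr. apply Rmult_le_compat_l; [apply pow_le; lra|].
  rewrite Nat.add_1_r. simpl. rewrite <- (Rmult_1_r e) at 3. apply Rmult_le_compat_l; [lra|].
  rewrite <- (pow1 L). apply pow_incr. lra.
Qed.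

Definition poles_separated (beta : C) (a : R) (g : R -> C) : Prop :=
  (forall k, lies_side 1 g (upper_pole beta a k)) /\ (forall k, lies_side (-1) g (lower_pole a k)).

Lemma separated_avoids beta a g : poles_separated beta a g -> avoids_poles beta a g.
Proof.
  intros [H1 H2] t k. split; intros E; symmetry in E; revert E; eapply lies_side_off; [apply H1|apply H2].
Qed.

Lemma balanced_restrict g1 g2 a b a' b' f : a <= a' -> a' <= b' -> b' <= b ->
  (forall t, a < t < a' \/ b' < t < b -> along g1 f t = along g2 f t) ->
  balanced g1 g2 a b f -> balanced g1 g2 a' b' f.
Proof.
  intros H1 H2 H3 E [I [HI HJ]].
  destruct (is_CRInt_split _ a a' b I ltac:(lra) ltac:(lra) HI) as [A [I1 [HA [HI1 E1]]]].
  destruct (is_CRInt_split _ a' b' b I1 ltac:(lra) ltac:(lra) HI1) as [X [Z [HX [HZ EX]]]].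
  destruct (is_CRInt_split _ a a' b I ltac:(lra) ltac:(lra) HJ) as [A' [I2 [HA' [HI2 E2]]]].
  destruct (is_CRInt_split _ a' b' b I2 ltac:(lra) ltac:(lra) HI2) as [X' [Z' [HX' [HZ' EX']]]].
  assert (A = A').
  { apply (is_CRInt_unique (along g2 f) a a'); [|assumption].
    revert HA. apply is_CRInt_ext; [assumption|]. intros t Ht. apply E. now left. }
  assert (Z = Z').
  { apply (is_CRInt_unique (along g2 f) b' b); [|assumption].
    revert HZ. apply is_CRInt_ext; [assumption|]. intros t Ht. apply E. now right. }
  subst A' Z'. exists X. split; [assumption|]. replace X with X'; [assumption|].
  rewrite EX in E1. rewrite EX' in E2. rewrite E1 in E2. symmetry. exact (Cplus_cancel_middle A X X' Z E2).
Qed.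

Lemma balanced_kernel_separated (beta : C) (L : nat) (a l M : R) (j : nat) g1 g2 :
  0 < M -> piecewise_C1 g1 -> piecewise_C1 g2 -> real_beyond g1 M -> real_beyond g2 M ->
  poles_separated beta a g1 -> poles_separated beta a g2 -> l <> 0 ->
  balanced g1 g2 (- M) M (ladder_kernel beta L a l j).
Proof.
  intros HM G1 G2 R1 R2 S1 S2 Hl.
  assert (B : bipath g1 g2 (- M) M).
  { split; try assumption; [lra| |]; rewrite R1, R2; try reflexivity; rewrite ?Rabs_Ropp, Rabs_pos_eq; lra. }
  apply balanced_ladder_kernel; try assumption; try now apply separated_avoids.
  intros p [[k ->]|[k ->]].
  - apply (balanced_pole_contours g1 g2 1 M); try assumption; try lra; [apply S1|apply S2].
  - apply (balanced_pole_contours g1 g2 (-1) M); try assumption; try lra; [apply S1|apply S2].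
Qed.

(** Two kinds of contours are lifted: an arbitrary one with q = -M, raised only where it is real,
    and the real line with q = a and M = 0, raised by a/4 already at the origin. The last field says
    that the cut lifts still separate the poles. *)
Record tiltable (beta : C) (a eps q M : R) (g : R -> C) : Prop := {
  tl_path : piecewise_C1 g;
  tl_M : 0 <= M;
  tl_q : - q <= M;
  tl_qa : q <= a;
  tl_real : real_beyond g M;
  tl_sep : poles_separated beta a g;
  tl_cut : forall T1 T2, M + Rabs q <= T1 -> M + Rabs q <= T2 ->
    poles_separated beta a (lift_path g (fun t => eps * cut_tilt q T1 T2 t)) }.

Lemma upper_pole_Re beta a k : Re (upper_pole beta a k) = Im beta.
Proof. unfold upper_pole, Re, Im; simpl. ring. Qed.

Lemma upper_pole_Im beta a k : Im (upper_pole beta a k) = a - Re beta + INR k.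
Proof. unfold upper_pole, Re, Im; simpl. ring. Qed.

Lemma lower_pole_Re a k : Re (lower_pole a k) = 0.
Proof. unfold lower_pole, Re; simpl. ring. Qed.

Lemma lower_pole_Im a k : Im (lower_pole a k) = - a - INR k.
Proof. unfold lower_pole, Im; simpl. ring. Qed.

Lemma tilt_bounded_cut q T1 T2 t : 0 <= T1 -> 0 <= T2 -> cut_tilt q T1 T2 t <= (Rabs q + T1 + T2) / 4.
Proof.
  intros H1 H2. unfold cut_tilt, tent. pose proof (Rle_abs q). pose proof (Rabs_pos q).
  destruct (Rle_dec t 0).
  - pose proof (Rabs_pos (t - - T1)). assert (Rmax 0 (q + T1 - Rabs (t - - T1)) <= Rabs q + T1 + T2) by (apply Rmax_lub; lra). lra.
  - pose proof (Rabs_pos (t - T2)). assert (Rmax 0 (q + T2 - Rabs (t - T2)) <= Rabs q + T1 + T2) by (apply Rmax_lub; lra). lra.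
Qed.

Lemma sg_scal_le (sg eps x B : R) : sg * sg = 1 -> eps * eps = 1 -> 0 <= x <= B -> sg * (eps * x) <= B.
Proof.
  intros H1 H2 Hx.
  assert (H : (sg * eps - 1) * (sg * eps + 1) = 0).
  { replace ((sg * eps - 1) * (sg * eps + 1)) with (sg * sg * (eps * eps) - 1) by ring. rewrite H1, H2. ring. }
  apply Rmult_integral in H. replace (sg * (eps * x)) with ((sg * eps) * x) by ring.
  destruct H; [replace (sg * eps) with 1 by lra|replace (sg * eps) with (-1) by lra]; lra.
Qed.

Lemma tiltable_contour (beta : C) (a eps M0 B : R) (g : R -> C) : eps * eps = 1 -> 0 <= a ->
  piecewise_C1 g -> real_beyond g M0 -> poles_separated beta a g ->
  exists M, B <= M /\ tiltable beta a eps (- M) M g.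
Proof.
  intros He Ha G HM0 S.
  set (M1 := Rmax M0 0). pose proof (Rmax_l M0 0). pose proof (Rmax_r M0 0). fold M1 in H, H0.
  destruct (continuous_bounded g (- M1) M1 ltac:(lra) (fun t _ => piecewise_continuous g t G)) as [V [HV HV']].
  (* The summand V keeps the nonreal part of g over [-M, M], |Im beta| does so for the upper poles,
     whose real part is Im beta, and |B| makes M as large as required. *)
  set (M := M1 + V + Rabs B + Rabs (Im beta)).
  pose proof (Rabs_pos B). pose proof (Rabs_pos (Im beta)). pose proof (Rle_abs B).
  assert (HMM : M1 <= M) by (unfold M; lra).
  exists M. split; [unfold M; lra|]. split; try assumption; try lra.
  - intros t Ht. apply HM0. lra.
  - intros T1 T2 HT1 HT2. rewrite Rabs_Ropp, Rabs_pos_eq in HT1, HT2 by lra.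
    assert (Hg : forall t, Rabs t <= M -> Rabs (Re (g t)) <= M).
    { intros t Ht. destruct (Rle_dec (Rabs t) M1).
      - eapply Rle_trans; [apply Re_le_Cmod'|]. eapply Rle_trans; [apply HV'; now apply Rabs_le_between|].
        unfold M; lra.
      - rewrite HM0 by lra. exact Ht. }
    assert (Hlift : forall sg p, sg * sg = 1 -> Rabs (Re p) <= M -> lies_side sg g p ->
       lies_side sg (lift_path g (fun t => eps * cut_tilt (- M) T1 T2 t)) p).
    { intros sg p Hsg Hp Hs.
      apply (lies_side_lift g _ sg ((Rabs (- M) + T1 + T2) / 4) M p); try assumption; try lra.
      - intros t. apply (continuous_scal_r (V := R_NormedModule) eps (cut_tilt (- M) T1 T2)).
        apply (lipschitz_continuous _ (/ 4)). intros. apply cut_tilt_lipschitz; lra.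
      - intros t. apply sg_scal_le; try assumption. split; [apply cut_tilt_nonneg|apply tilt_bounded_cut; lra].
      - pose proof (Rabs_pos (- M)). lra.
      - intros t Ht. rewrite cut_tilt_eq by (apply Rabs_le_between in Ht; lra).
        unfold tilt. rewrite Rmax_left by lra. field.
      - intros t Ht. apply HM0. lra. }
    split; intros k; apply Hlift; try lra; try apply S.
    + rewrite upper_pole_Re. unfold M. lra.
    + rewrite lower_pole_Re, Rabs_R0. lra.
Qed.

Lemma tiltable_line (beta : C) (eps : R) : eps * eps = 1 ->
  exists B, forall a, B <= a -> tiltable beta a eps a 0 RtoC.
Proof.
  (* For such a, the lift is at most (a + |Im beta|)/4 high over the abscissas of the poles, which
     is below both a - Re beta and a. *)
  intros He. exists (1 + 2 * Rabs (Re beta) + Rabs (Im beta)). intros a Ha.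
  pose proof (Rabs_pos (Re beta)). pose proof (Rabs_pos (Im beta)). pose proof (Rle_abs (Re beta)).
  assert (Hsep : forall phi B, (forall t, 0 <= phi t <= B) -> (forall t, phi t <= (a + Rabs t) / 4) ->
     poles_separated beta a (lift_path RtoC (fun t => eps * phi t))).
  { intros phi B HB Hphi.
    assert (Hs : forall sg t x, sg * sg = 1 -> (a + Rabs t) / 4 < x -> sg * (eps * phi t) < x).
    { intros sg t x Hsg Hx. eapply Rle_lt_trans; [|apply Hx]. apply sg_scal_le; try assumption.
      split; [apply HB|apply Hphi]. }
    split; intros k; pose proof (pos_INR k).
    - apply (lies_side_lift_line _ 1 B); [lra| |].
      + intros t. apply sg_scal_le; [lra|assumption|apply HB].
      + intros x Hx. rewrite upper_pole_Re in Hx. rewrite upper_pole_Im. apply Hs; lra.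
    - apply (lies_side_lift_line _ (-1) B); [lra| |].
      + intros t. apply sg_scal_le; [lra|assumption|apply HB].
      + intros x Hx. rewrite lower_pole_Re, Rabs_R0 in Hx. rewrite lower_pole_Im. apply Hs; lra. }
  split; try lra.
  - apply piecewise_C1_line.
  - intros t _. reflexivity.
  - replace RtoC with (lift_path RtoC (fun t => eps * 0)).
    + apply (Hsep (fun _ => 0) 0); intros; [lra|]. pose proof (Rabs_pos t). lra.
    + apply functional_extensionality. intros t. unfold lift_path. rewrite Rmult_0_r. ring.
  - intros T1 T2 HT1 HT2. rewrite Rabs_pos_eq in HT1, HT2 by lra.
    apply (Hsep _ ((Rabs a + T1 + T2) / 4)).
    + intros t. split; [apply cut_tilt_nonneg|apply tilt_bounded_cut; lra].
    + intros t. eapply Rle_trans; [apply cut_tilt_le|]. unfold tilt. pose proof (Rabs_pos t).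
      rewrite Rmax_right; lra.
Qed.

(** * Comparison of a contour with its lift *)

Definition tilted (g : R -> C) (eps q : R) : R -> C := lift_path g (fun t => eps * tilt q t).

Definition cut_tilted (g : R -> C) (eps q T1 T2 : R) : R -> C :=
  lift_path g (fun t => eps * cut_tilt q T1 T2 t).

Lemma lift_path_real (g : R -> C) phi M t : real_beyond g M -> M <= Rabs t ->
  lift_path g phi t = (t, phi t).
Proof.
  intros H Ht. unfold lift_path. rewrite H by assumption. apply C_ext; simpl; ring.
Qed.

Lemma lift_path_velocity_real (g : R -> C) phi M K t : real_beyond g M -> M < Rabs t ->
  (forall s, Rabs (phi s - phi t) <= K * Rabs (s - t)) ->
  Cmod (path_velocity (lift_path g phi) t) <= 1 + K.
Proof.
  intros H Ht HK.
  rewrite (path_velocity_ext_loc (lift_path g phi) (lift_path RtoC phi)).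
  - now apply path_velocity_lift_line.
  - exists (mkposreal (Rabs t - M) ltac:(lra)). intros s Hs. change (Rabs (s - t) < Rabs t - M) in Hs.
    unfold lift_path. rewrite H; [reflexivity|].
    pose proof (Rabs_triang_inv t s). rewrite Rabs_minus_sym in Hs. lra.
Qed.

Lemma eps_scal_lipschitz (eps K : R) (phi : R -> R) : eps * eps = 1 ->
  (forall s t, Rabs (phi s - phi t) <= K * Rabs (s - t)) ->
  forall s t, Rabs (eps * phi s - eps * phi t) <= K * Rabs (s - t).
Proof.
  intros He H s t. rewrite <- Rmult_minus_distr_l, Rabs_mult.
  assert (Rabs eps = 1) by (rewrite <- sqrt_Rsqr_abs; unfold Rsqr; rewrite He; apply sqrt_1).
  rewrite H0, Rmult_1_l. apply H.
Qed.

Lemma Cmod_exponential (l : R) (v : C) : Cmod (Cexp (RtoC l * (Ci * v))) = exp (- (l * Im v)).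
Proof. rewrite Cmod_Cexp. f_equal. unfold Re, Im; simpl. ring. Qed.

Section Tilted.

Variables (beta : C) (L : nat) (a eps q M : R) (g : R -> C).
Hypothesis He : eps * eps = 1.
Hypothesis TL : tiltable beta a eps q M g.

Let Tmin := M + Rabs q.

Lemma Tmin_facts : 0 <= M /\ - q <= M /\ q <= a /\ 0 <= Rabs q /\ q <= Rabs q /\ - q <= Rabs q.
Proof.
  pose proof (Rle_abs q). pose proof (Rle_abs (- q)). rewrite Rabs_Ropp in H0.
  pose proof (Rabs_pos q). pose proof (tl_M _ _ _ _ _ _ TL). pose proof (tl_q _ _ _ _ _ _ TL).
  pose proof (tl_qa _ _ _ _ _ _ TL). repeat split; lra.
Qed.

Lemma cut_tilted_path T1 T2 : Tmin <= T1 -> Tmin <= T2 -> piecewise_C1 (cut_tilted g eps q T1 T2).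
Proof.
  intros H1 H2. pose proof Tmin_facts. unfold Tmin in *.
  apply piecewise_C1_lift; [apply (tl_path _ _ _ _ _ _ TL)|].
  apply piecewise_affine_scal, cut_tilt_piecewise_affine; lra.
Qed.

Lemma cut_tilted_outside T1 T2 t : Tmin <= T1 -> Tmin <= T2 -> t <= - (2 * T1 + q) \/ 2 * T2 + q <= t ->
  cut_tilted g eps q T1 T2 t = g t.
Proof.
  intros H1 H2 Ht. pose proof Tmin_facts. unfold Tmin in *. unfold cut_tilted, lift_path.
  rewrite cut_tilt_zero by (lra || assumption). rewrite Rmult_0_r. ring.
Qed.

Lemma tilted_eq_cut T1 T2 t : - T1 <= t <= T2 -> tilted g eps q t = cut_tilted g eps q T1 T2 t.
Proof. intros Ht. unfold tilted, cut_tilted, lift_path. now rewrite cut_tilt_eq. Qed.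

Lemma along_tilted_eq_cut f T1 T2 t : - T1 < t < T2 ->
  along (tilted g eps q) f t = along (cut_tilted g eps q T1 T2) f t.
Proof.
  intros Ht. unfold along. rewrite (tilted_eq_cut T1 T2) by lra. f_equal.
  apply (path_velocity_eq _ _ (- T1) T2); [|assumption]. intros. apply tilted_eq_cut. lra.
Qed.

Lemma ex_along_cut l j T1 T2 x y : Tmin <= T1 -> Tmin <= T2 -> x <= y ->
  ex_CRInt (along (cut_tilted g eps q T1 T2) (ladder_kernel beta L a l j)) x y.
Proof.
  intros H1 H2 Hxy. destruct Hxy as [Hxy| ->]; [|exists (RtoC 0); apply is_CRInt_point].
  apply ex_path_integral; [now apply cut_tilted_path|assumption|].
  intros t _. apply continuous_ladder_kernel; [now apply cut_tilted_path|].
  apply separated_avoids. now apply (tl_cut _ _ _ _ _ _ TL).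
Qed.

Lemma ex_along_tilted l j T1 T2 : Tmin <= T1 -> Tmin <= T2 ->
  ex_CRInt (along (tilted g eps q) (ladder_kernel beta L a l j)) (- T1) T2.
Proof.
  intros H1 H2. pose proof Tmin_facts. unfold Tmin in *.
  destruct (ex_along_cut l j T1 T2 (- T1) T2 H1 H2 ltac:(lra)) as [I HI]. exists I.
  revert HI. apply is_CRInt_ext; [lra|]. intros t Ht. symmetry. now apply along_tilted_eq_cut.
Qed.

Lemma ex_along_original l j x y : x <= y ->
  ex_CRInt (along g (ladder_kernel beta L a l j)) x y.
Proof.
  intros [Hxy| ->]; [|exists (RtoC 0); apply is_CRInt_point].
  apply ex_path_integral; [apply (tl_path _ _ _ _ _ _ TL)|assumption|].
  intros t _. apply continuous_ladder_kernel; [apply (tl_path _ _ _ _ _ _ TL)|].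
  apply separated_avoids, (tl_sep _ _ _ _ _ _ TL).
Qed.

(** The cut lift returns to g at -(2 T1 + q) and 2 T2 + q. Both contours separate the same poles, so
    they are balanced on a larger symmetric interval, from which the common ends are removed. *)
Lemma cut_integral_eq l j T1 T2 I : Tmin <= T1 -> Tmin <= T2 -> l <> 0 ->
  is_CRInt (along g (ladder_kernel beta L a l j)) (- (2 * T1 + q)) (2 * T2 + q) I ->
  is_CRInt (along (cut_tilted g eps q T1 T2) (ladder_kernel beta L a l j)) (- (2 * T1 + q)) (2 * T2 + q) I.
Proof.
  intros H1 H2 Hl HI. pose proof Tmin_facts. unfold Tmin in *.
  set (N := 1 + M + 2 * T1 + 2 * T2 + Rabs q).
  assert (B : balanced g (cut_tilted g eps q T1 T2) (- N) N (ladder_kernel beta L a l j)).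
  { apply balanced_kernel_separated; try assumption.
    - unfold N; lra.
    - apply (tl_path _ _ _ _ _ _ TL).
    - now apply cut_tilted_path.
    - intros t Ht. apply (tl_real _ _ _ _ _ _ TL). unfold N in Ht; lra.
    - intros t Ht. rewrite cut_tilted_outside; try assumption.
      + apply (tl_real _ _ _ _ _ _ TL). unfold N in Ht; lra.
      + unfold N in Ht. destruct (Rle_dec 0 t); [rewrite (Rabs_pos_eq t) in Ht by lra; right; lra|].
        rewrite (Rabs_left1 t) in Ht by lra. left; lra.
    - apply (tl_sep _ _ _ _ _ _ TL).
    - now apply (tl_cut _ _ _ _ _ _ TL). }
  apply (balanced_restrict _ _ _ _ (- (2 * T1 + q)) (2 * T2 + q)) in B.
  - destruct B as [J [J1 J2]]. now rewrite (is_CRInt_unique _ _ _ _ _ HI J1).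
  - unfold N; lra.
  - lra.
  - unfold N; lra.
  - intros t Ht. unfold along. rewrite cut_tilted_outside by (try assumption; lra).
    f_equal. destruct Ht as [Ht|Ht].
    + apply (path_velocity_eq _ _ (- N) (- (2 * T1 + q))); [|assumption].
      intros. symmetry. apply cut_tilted_outside; try assumption. lra.
    + apply (path_velocity_eq _ _ (2 * T2 + q) N); [|assumption].
      intros. symmetry. apply cut_tilted_outside; try assumption. lra.
Qed.

Variables (K B : R).
Hypothesis HK : 0 < K.
Hypothesis HB : 32 <= B.
Hypothesis Hbeta : 0 < Re beta.
Hypothesis Hbound : forall t y, Rabs y <= (a + Rabs t) / 4 -> B <= a + Rabs t ->
    Cmod (inv_tau_pow beta L a (t, y)) <= K * exp (- Re beta * ln ((a + Rabs t) / 4)).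
Hypothesis HaM : B <= a + M.
Hypothesis Ha : 0 <= a.

Lemma abs_eps_mult y : Rabs (eps * y) = Rabs y.
Proof.
  rewrite Rabs_mult.
  assert (Rabs eps = 1) by (rewrite <- sqrt_Rsqr_abs; unfold Rsqr; rewrite He; apply sqrt_1).
  rewrite H. ring.
Qed.

Lemma inv_tau_pow_bound_const t y : Rabs y <= (a + Rabs t) / 4 -> B <= a + Rabs t ->
    Cmod (inv_tau_pow beta L a (t, y)) <= K.
Proof.
  intros H1 H2. eapply Rle_trans; [now apply Hbound|].
  rewrite <- (Rmult_1_r K) at 2. apply Rmult_le_compat_l; [lra|]. rewrite <- exp_0. apply exp_le.
  assert (0 <= ln ((a + Rabs t) / 4)) by (rewrite <- ln_1; apply Rcomplements.ln_le; lra). nra.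
Qed.

(** On the descent from T2 to 2 T2 + q the height y falls with slope 1/4 to 0. The exponential exp
    (-|l| y) keeps the integral bounded although the path becomes longer, and the Gamma quotients
    supply the factor T2^(-Re beta) that makes it vanish in the limit. *)
Lemma descent_bound l T1 T2 t : Tmin <= T1 -> Tmin <= T2 -> eps * l = Rabs l ->
  T2 < t < 2 * T2 + q ->
  Cmod (along (cut_tilted g eps q T1 T2) (ladder_kernel beta L a l 0) t) <=
  5 / 4 * K * exp (- Re beta * ln ((a + T2) / 4)) * exp (Rabs l / 4 * t + - (Rabs l / 4 * (2 * T2 + q))).
Proof.
  intros H1 H2 Hl Ht. pose proof Tmin_facts as F. unfold Tmin in *.
  assert (Hta : Rabs t = t) by (apply Rabs_pos_eq; lra).
  unfold along. rewrite Cmod_mult.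
  (* Horizontal speed 1 and vertical speed at most 1/4 give the factor 5/4. *)
  assert (V : Cmod (path_velocity (cut_tilted g eps q T1 T2) t) <= 1 + / 4).
  { apply (lift_path_velocity_real g _ M); [apply (tl_real _ _ _ _ _ _ TL)|lra|].
    intros s. apply eps_scal_lipschitz; [assumption|]. intros. apply cut_tilt_lipschitz; lra. }
  unfold cut_tilted at 1. rewrite (lift_path_real g _ M) by (try apply (tl_real _ _ _ _ _ _ TL); lra).
  rewrite cut_tilt_right by lra. set (y := (2 * T2 + q - t) / 4).
  unfold ladder_kernel. cbn [Cpow]. rewrite Cmult_1_l, Cmod_mult, Cmod_exponential.
  replace (l * Im (t, eps * y)) with (Rabs l * y) by (rewrite <- Hl; simpl; ring).
  assert (Y : Rabs (eps * y) <= (a + Rabs t) / 4).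
  { rewrite abs_eps_mult. unfold y. rewrite Hta. rewrite Rabs_pos_eq; lra. }
  assert (F1 : Cmod (inv_tau_pow beta L a (t, eps * y)) <= K * exp (- Re beta * ln ((a + T2) / 4))).
  { eapply Rle_trans; [apply Hbound; [assumption|lra]|]. apply Rmult_le_compat_l; [lra|]. apply exp_le.
    assert (ln ((a + T2) / 4) <= ln ((a + Rabs t) / 4)) by (apply Rcomplements.ln_le; lra). nra. }
  replace (- (Rabs l * y)) with (Rabs l / 4 * t + - (Rabs l / 4 * (2 * T2 + q))) by (unfold y; field).
  set (E := exp (Rabs l / 4 * t + - (Rabs l / 4 * (2 * T2 + q)))).
  assert (0 < E) by apply exp_pos.
  replace (5 / 4 * K * exp (- Re beta * ln ((a + T2) / 4)) * E) with
    ((E * (K * exp (- Re beta * ln ((a + T2) / 4)))) * (1 + / 4)) by field.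
  apply Rmult_le_compat; [|apply Cmod_ge_0| |assumption].
  - apply Rmult_le_pos; [lra|apply Cmod_ge_0].
  - apply Rmult_le_compat_l; [lra|assumption].
Qed.

Lemma descent_bound_left l T1 T2 t : Tmin <= T1 -> Tmin <= T2 -> eps * l = Rabs l ->
  T1 < t < 2 * T1 + q ->
  Cmod (along (cut_tilted g eps q T1 T2) (ladder_kernel beta L a l 0) (- t)) <=
  5 / 4 * K * exp (- Re beta * ln ((a + T1) / 4)) * exp (Rabs l / 4 * t + - (Rabs l / 4 * (2 * T1 + q))).
Proof.
  intros H1 H2 Hl Ht. pose proof Tmin_facts as F. unfold Tmin in *.
  assert (Hta : Rabs (- t) = t) by (rewrite Rabs_Ropp; apply Rabs_pos_eq; lra).
  unfold along. rewrite Cmod_mult.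
  assert (V : Cmod (path_velocity (cut_tilted g eps q T1 T2) (- t)) <= 1 + / 4).
  { apply (lift_path_velocity_real g _ M); [apply (tl_real _ _ _ _ _ _ TL)|lra|].
    intros s. apply eps_scal_lipschitz; [assumption|]. intros. apply cut_tilt_lipschitz; lra. }
  unfold cut_tilted at 1. rewrite (lift_path_real g _ M) by (try apply (tl_real _ _ _ _ _ _ TL); lra).
  rewrite cut_tilt_left by lra. rewrite Ropp_involutive. set (y := (2 * T1 + q - t) / 4).
  unfold ladder_kernel. cbn [Cpow]. rewrite Cmult_1_l, Cmod_mult, Cmod_exponential.
  replace (l * Im (- t, eps * y)) with (Rabs l * y) by (rewrite <- Hl; simpl; ring).
  assert (Y : Rabs (eps * y) <= (a + Rabs (- t)) / 4).
  { rewrite abs_eps_mult. unfold y. rewrite Hta. rewrite Rabs_pos_eq; lra. }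
  assert (F1 : Cmod (inv_tau_pow beta L a (- t, eps * y)) <= K * exp (- Re beta * ln ((a + T1) / 4))).
  { eapply Rle_trans; [apply Hbound; [assumption|lra]|]. apply Rmult_le_compat_l; [lra|]. apply exp_le.
    assert (ln ((a + T1) / 4) <= ln ((a + Rabs (- t)) / 4)) by (apply Rcomplements.ln_le; lra). nra. }
  replace (- (Rabs l * y)) with (Rabs l / 4 * t + - (Rabs l / 4 * (2 * T1 + q))) by (unfold y; field).
  set (E := exp (Rabs l / 4 * t + - (Rabs l / 4 * (2 * T1 + q)))).
  assert (0 < E) by apply exp_pos.
  replace (5 / 4 * K * exp (- Re beta * ln ((a + T1) / 4)) * E) with
    ((E * (K * exp (- Re beta * ln ((a + T1) / 4)))) * (1 + / 4)) by field.
  apply Rmult_le_compat; [|apply Cmod_ge_0| |assumption].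
  - apply Rmult_le_pos; [lra|apply Cmod_ge_0].
  - apply Rmult_le_compat_l; [lra|assumption].
Qed.

(** The difference consists of the two descents. On each, exp (-|l| y) has integral at most 4/|l|,
    and 5/4 times 4 is the constant 5. *)
Lemma original_minus_tilted l T1 T2 I I' : Tmin <= T1 -> Tmin <= T2 -> l <> 0 -> eps * l = Rabs l ->
  is_CRInt (along g (ladder_kernel beta L a l 0)) (- (2 * T1 + q)) (2 * T2 + q) I ->
  is_CRInt (along (tilted g eps q) (ladder_kernel beta L a l 0)) (- T1) T2 I' ->
  Cmod (I - I') <= 5 * K / Rabs l * (exp (- Re beta * ln ((a + T1) / 4)) + exp (- Re beta * ln ((a + T2) / 4))).
Proof.
  intros H1 H2 Hl0 Hl HI HI'. pose proof Tmin_facts as F.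
  apply (cut_integral_eq l 0 T1 T2 I H1 H2 Hl0) in HI. unfold Tmin in *.
  assert (Hl1 : 0 < Rabs l) by now apply Rabs_pos_lt.
  destruct (is_CRInt_split _ (- (2 * T1 + q)) (- T1) (2 * T2 + q) I ltac:(lra) ltac:(lra) HI) as [A [X [HA [HX EX]]]].
  destruct (is_CRInt_split _ (- T1) T2 (2 * T2 + q) X ltac:(lra) ltac:(lra) HX) as [J [Z [HJ [HZ EZ]]]].
  assert (EJ : J = I').
  { apply (is_CRInt_unique (along (tilted g eps q) (ladder_kernel beta L a l 0)) (- T1) T2); [|assumption].
    revert HJ. apply is_CRInt_ext; [lra|]. intros t Ht. symmetry. now apply along_tilted_eq_cut. }
  assert (E : (I - I')%C = (A + Z)%C).
  { rewrite EX, EZ, EJ. change ((A + (I' + Z) - I')%C = (A + Z)%C). ring. }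
  rewrite E. eapply Rle_trans; [apply Cmod_triangle|]. rewrite Rmult_plus_distr_l.
  assert (Hend : forall D T, 0 <= D -> 0 <= T ->
     D * ((exp (Rabs l / 4 * (2 * T + q) + - (Rabs l / 4 * (2 * T + q))) - exp (Rabs l / 4 * T + - (Rabs l / 4 * (2 * T + q)))) / (Rabs l / 4))
     <= D * (4 / Rabs l)).
  { intros D T HD HT. apply Rmult_le_compat_l; [assumption|]. rewrite Rplus_opp_r, exp_0.
    pose proof (exp_pos (Rabs l / 4 * T + - (Rabs l / 4 * (2 * T + q)))) as Hp.
    set (x := exp _) in *. replace ((1 - x) / (Rabs l / 4)) with ((1 - x) * (4 / Rabs l)) by (field; lra).
    assert (0 < 4 / Rabs l) by (apply Rdiv_lt_0_compat; lra). nra. }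
  assert (P : forall T, 0 <= 5 / 4 * K * exp (- Re beta * ln ((a + T) / 4))).
  { intros T. apply Rmult_le_pos; [lra|left; apply exp_pos]. }
  apply Rplus_le_compat.
  - eapply Rle_trans.
    + apply (tail_integral_bound (along (cut_tilted g eps q T1 T2) (ladder_kernel beta L a l 0)) (5 / 4 * K * exp (- Re beta * ln ((a + T1) / 4))) (Rabs l / 4) (- (Rabs l / 4 * (2 * T1 + q))) T1 (2 * T1 + q) A); try lra; [apply P|].
      right. split; [exact HA|]. intros t Ht. now apply descent_bound_left.
    + eapply Rle_trans; [apply Hend; [apply P|lra]|]. right. field. lra.
  - eapply Rle_trans.
    + apply (tail_integral_bound (along (cut_tilted g eps q T1 T2) (ladder_kernel beta L a l 0)) (5 / 4 * K * exp (- Re beta * ln ((a + T2) / 4))) (Rabs l / 4) (- (Rabs l / 4 * (2 * T2 + q))) T2 (2 * T2 + q) Z); try lra; [apply P|].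
      left. split; [exact HZ|]. intros t Ht. now apply descent_bound.
    + eapply Rle_trans; [apply Hend; [apply P|lra]|]. right. field. lra.
Qed.

(** Bounds b of the original integral correspond to the points T = (b - q)/2 at which the descents
    start. As the descents vanish in the limit, the exponentially convergent integral over the lift
    determines the possibly conditional one over g. *)
Lemma lim2_original l J : l <> 0 -> eps * l = Rabs l ->
  lim2 (along (tilted g eps q) (ladder_kernel beta L a l 0)) J ->
  lim2 (along g (ladder_kernel beta L a l 0)) J.
Proof.
  intros Hl0 Hl HJ e He0. pose proof Tmin_facts as F.
  assert (Hl1 : 0 < Rabs l) by now apply Rabs_pos_lt.
  destruct (HJ (e / 2) ltac:(lra)) as [T0 HT0].
  destruct (exp_tail_small (5 * K / Rabs l) (Re beta) (e / 4) ltac:(apply Rdiv_le_0_compat; lra) Hbeta ltac:(lra)) as [U HU].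
  (* Ensures ln ((a + S)/4) >= U for S >= T, so that the power decay is an instance of
     [exp_tail_small]. *)
  set (T := Rmax (Rmax T0 Tmin) (4 * exp U)).
  pose proof (Rmax_l (Rmax T0 Tmin) (4 * exp U)). pose proof (Rmax_r (Rmax T0 Tmin) (4 * exp U)).
  pose proof (Rmax_l T0 Tmin). pose proof (Rmax_r T0 Tmin). fold T in H, H0.
  exists (2 * T + q). intros b1 b2 Hb1 Hb2 I HI.
  set (T1 := (b1 - q) / 2). set (T2 := (b2 - q) / 2).
  replace b1 with (2 * T1 + q) in HI by (unfold T1; field). replace b2 with (2 * T2 + q) in HI by (unfold T2; field).
  assert (HT1 : T <= T1) by (unfold T1; lra). assert (HT2 : T <= T2) by (unfold T2; lra).
  destruct (ex_along_tilted l 0 T1 T2 ltac:(lra) ltac:(lra)) as [I' HI'].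
  pose proof (original_minus_tilted l T1 T2 I I' ltac:(lra) ltac:(lra) Hl0 Hl HI HI') as D1.
  pose proof (HT0 T1 T2 ltac:(lra) ltac:(lra) I' HI') as D2.
  assert (Hs : forall S, T <= S -> 5 * K / Rabs l * exp (- Re beta * ln ((a + S) / 4)) <= e / 4).
  { intros S HS. apply HU. rewrite <- (ln_exp U). apply Rcomplements.ln_le; [apply exp_pos|].
    pose proof (exp_pos U). lra. }
  pose proof (Hs T1 HT1). pose proof (Hs T2 HT2). rewrite Rmult_plus_distr_l in D1.
  eapply Rle_trans; [apply (Cmod_sub_triangle I I' J)|]. lra.
Qed.

Lemma tilted_point t : M < Rabs t ->
  tilted g eps q t = (t, eps * ((q + Rabs t) / 4)) /\
  Cmod (path_velocity (tilted g eps q) t) <= 5 / 4 /\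
  Cmod (inv_tau_pow beta L a (tilted g eps q t)) <= K /\
  Cmod (tilted g eps q t) <= 2 * (a + Rabs t).
Proof.
  intros Ht. pose proof Tmin_facts as F.
  assert (E : tilted g eps q t = (t, eps * ((q + Rabs t) / 4))).
  { unfold tilted. rewrite (lift_path_real g _ M) by (try apply (tl_real _ _ _ _ _ _ TL); lra).
    unfold tilt. rewrite Rmax_right by lra. reflexivity. }
  split; [exact E|]. rewrite E.
  assert (Y : Rabs (eps * ((q + Rabs t) / 4)) <= (a + Rabs t) / 4).
  { rewrite abs_eps_mult. rewrite Rabs_pos_eq; lra. }
  split; [|split].
  - replace (5 / 4) with (1 + / 4) by field.
    apply (lift_path_velocity_real g _ M); [apply (tl_real _ _ _ _ _ _ TL)|lra|].
    intros s. apply eps_scal_lipschitz; [assumption|]. intros. apply tilt_lipschitz.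
  - apply inv_tau_pow_bound_const; [assumption|lra].
  - eapply Rle_trans; [apply Cmod_le_abs|]. simpl. lra.
Qed.

Lemma along_tilted_bound (f : C -> C) (m : R) t : M < Rabs t ->
  Cmod (f (tilted g eps q t)) <= m ->
  Cmod (along (tilted g eps q) (fun v => f v * inv_tau_pow beta L a v)%C t) <= 5 / 4 * K * m.
Proof.
  intros Ht Hm. destruct (tilted_point t Ht) as [_ [H1 [H2 _]]]. unfold along. rewrite !Cmod_mult.
  replace (5 / 4 * K * m) with (m * K * (5 / 4)) by ring.
  apply Rmult_le_compat; try assumption; try apply Cmod_ge_0.
  - apply Rmult_le_pos; apply Cmod_ge_0.
  - apply Rmult_le_compat; try assumption; apply Cmod_ge_0.
Qed.

End Tilted.

Lemma ex_CRInt_sub (f : R -> C) (a b c d : R) : a <= b -> b <= c -> c <= d ->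
  ex_CRInt f a d -> ex_CRInt f b c.
Proof.
  intros H1 H2 H3 [I HI].
  destruct (is_CRInt_split f a b d I ltac:(lra) ltac:(lra) HI) as [A [X [_ [HX _]]]].
  destruct (is_CRInt_split f b c d X ltac:(lra) ltac:(lra) HX) as [J [Z [HJ _]]]. now exists J.
Qed.

Lemma lim2_unique (phi : R -> C) (J J' : C) (T0 : R) :
  (forall T1 T2, T0 <= T1 -> T0 <= T2 -> ex_CRInt phi (- T1) T2) ->
  lim2 phi J -> lim2 phi J' -> J = J'.
Proof.
  intros Hex H H'. apply C_le_eq. intros e He.
  destruct (H (e / 2) ltac:(lra)) as [T1 HT1]. destruct (H' (e / 2) ltac:(lra)) as [T2 HT2].
  set (T := Rmax T0 (Rmax T1 T2)).
  pose proof (Rmax_l T0 (Rmax T1 T2)). pose proof (Rmax_r T0 (Rmax T1 T2)).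
  pose proof (Rmax_l T1 T2). pose proof (Rmax_r T1 T2). fold T in H0, H1.
  destruct (Hex T T H0 H0) as [I HI].
  pose proof (HT1 T T ltac:(lra) ltac:(lra) I HI) as A. pose proof (HT2 T T ltac:(lra) ltac:(lra) I HI) as B.
  pose proof (Cmod_sub_triangle J I J'). rewrite (Cmod_sub_sym J I) in H4. lra.
Qed.

Lemma lim2_mult (phi : R -> C) (c J : C) (T0 : R) :
  (forall T1 T2, T0 <= T1 -> T0 <= T2 -> ex_CRInt phi (- T1) T2) ->
  lim2 phi J -> lim2 (fun t => c * phi t)%C (c * J)%C.
Proof.
  intros Hex H e He. pose proof (Cmod_ge_0 c).
  destruct (H (e / (Cmod c + 1)) ltac:(apply Rdiv_lt_0_compat; lra)) as [T1 HT1].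
  exists (Rmax T0 T1). intros S1 S2 H1 H2 I HI. pose proof (Rmax_l T0 T1). pose proof (Rmax_r T0 T1).
  destruct (Hex S1 S2 ltac:(lra) ltac:(lra)) as [X HX].
  rewrite (is_CRInt_unique _ _ _ _ _ HI (is_CRInt_mult c _ _ _ _ HX)).
  replace (c * X - c * J)%C with (c * (X - J))%C by ring. rewrite Cmod_mult.
  pose proof (HT1 S1 S2 ltac:(lra) ltac:(lra) X HX) as B.
  apply Rle_trans with (Cmod c * (e / (Cmod c + 1))); [now apply Rmult_le_compat_l|].
  replace (Cmod c * (e / (Cmod c + 1))) with (e - e / (Cmod c + 1)) by (field; lra).
  assert (0 < e / (Cmod c + 1)) by (apply Rdiv_lt_0_compat; lra). lra.
Qed.

Lemma lim2_minus (phi psi : R -> C) (J J' : C) (T0 : R) :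
  (forall T1 T2, T0 <= T1 -> T0 <= T2 -> ex_CRInt phi (- T1) T2) ->
  (forall T1 T2, T0 <= T1 -> T0 <= T2 -> ex_CRInt psi (- T1) T2) ->
  lim2 phi J -> lim2 psi J' -> lim2 (fun t => phi t - psi t)%C (J - J')%C.
Proof.
  intros Hex Hex' H H' e He.
  destruct (H (e / 2) ltac:(lra)) as [T1 HT1]. destruct (H' (e / 2) ltac:(lra)) as [T2 HT2].
  exists (Rmax T0 (Rmax T1 T2)). intros S1 S2 H1 H2 I HI.
  pose proof (Rmax_l T0 (Rmax T1 T2)). pose proof (Rmax_r T0 (Rmax T1 T2)).
  pose proof (Rmax_l T1 T2). pose proof (Rmax_r T1 T2).
  destruct (Hex S1 S2 ltac:(lra) ltac:(lra)) as [X HX]. destruct (Hex' S1 S2 ltac:(lra) ltac:(lra)) as [Y HY].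
  rewrite (is_CRInt_unique _ _ _ _ _ HI (is_CRInt_minus _ _ _ _ _ _ HX HY)).
  pose proof (HT1 S1 S2 ltac:(lra) ltac:(lra) X HX) as B1. pose proof (HT2 S1 S2 ltac:(lra) ltac:(lra) Y HY) as B2.
  replace (X - Y - (J - J'))%C with ((X - J) + - (Y - J'))%C by ring.
  eapply Rle_trans; [apply Cmod_triangle|]. rewrite Cmod_opp. lra.
Qed.

(** * Expansion of the contour integral in l = ln (z zbar) *)

Lemma exp_ge_sqr (x : R) : 0 <= x -> x ^ 2 <= 4 * exp x.
Proof.
  intros Hx. pose proof (exp_ineq1_le (x / 2)). replace x with (x / 2 + x / 2) at 2 by field.
  rewrite exp_plus. nra.
Qed.

(* Second-order Taylor remainder of the exponential, with the polynomial factors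
   absorbed into half of the exponential decay. *)
Lemma exponential_bounds (A a q s l l0 : R) (v : C) :
  0 < A -> Rabs l0 = A -> Rabs (l - l0) <= A / 32 -> 32 <= a + s -> 0 <= s ->
  Cmod v <= 2 * (a + s) ->
  Cmod (Cexp (RtoC l0 * (Ci * v))) <= exp (- (A * ((q + s) / 4))) ->
  let P := 1 + 32 / A + 16 * (16 / A) ^ 2 in
  let D := P * exp (A * ((a - q) / 4 - a / 8)) * exp (- (A / 8) * s) in
  Cmod (Cexp (RtoC l0 * (Ci * v))) <= D /\
  Cmod (v * Cexp (RtoC l0 * (Ci * v))) <= D /\
  Cmod (Cexp (RtoC l * (Ci * v)) - Cexp (RtoC l0 * (Ci * v))
     - RtoC (l - l0) * Ci * (v * Cexp (RtoC l0 * (Ci * v)))) <= (l - l0) ^ 2 * D.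
Proof.
  intros HA Hl0 Hl HX Hs Hv HE P D.
  set (X := a + s) in *. set (E0 := Cexp (RtoC l0 * (Ci * v))) in *.
  set (U := exp (A * ((a - q) / 4 - a / 8)) * exp (- (A / 8) * s)).
  (* G^2 = exp (A (a + s)/8) uses half of the decay in s. One factor G absorbs the powers of |v|,
     the other the factor exp |w| of the Taylor remainder, where |w| <= (A/32) 2 X = A X/16. The
     three summands of P serve the three claims. *)
  set (G := exp (A * X / 16)).
  assert (HG1 : 1 <= G) by (unfold G; rewrite <- exp_0; apply exp_le; apply Rmult_le_pos; nra).
  assert (HU : 0 < U) by (unfold U; apply Rmult_lt_0_compat; apply exp_pos).
  assert (EQ : exp (- (A * ((q + s) / 4))) * G * G = U).
  { unfold U, G. rewrite <- !exp_plus. f_equal. unfold X. field. }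
  set (H := exp (- (A * ((q + s) / 4)))) in *. assert (HH : 0 < H) by apply exp_pos.
  assert (Hr : 0 < 16 / A) by (apply Rdiv_lt_0_compat; lra).
  assert (X1 : X <= 16 / A * G).
  { pose proof (exp_ineq1_le (A * X / 16)). fold G in H0.
    replace X with (16 / A * (A * X / 16)) at 1 by (field; lra). apply Rmult_le_compat_l; lra. }
  assert (X2 : X ^ 2 <= 4 * (16 / A) ^ 2 * G).
  { pose proof (exp_ge_sqr (A * X / 16) ltac:(apply Rmult_le_pos; nra)) as H1. fold G in H1.
    replace (X ^ 2) with ((16 / A) ^ 2 * (A * X / 16) ^ 2) by (field; lra).
    pose proof (pow2_ge_0 (16 / A)). nra. }
  assert (HD : D = P * U) by (unfold D, U; ring).
  assert (P1 : 1 <= P) by (unfold P; assert (0 < 32 / A) by (apply Rdiv_lt_0_compat; lra); pose proof (pow2_ge_0 (16 / A)); lra).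
  pose proof (Cmod_ge_0 v) as Hv0. pose proof (Cmod_ge_0 E0) as HE00.
  assert (HHU : H * G <= U) by (rewrite <- EQ; nra).
  assert (HHU' : H <= U) by nra.
  rewrite HD. split; [|split].
  - nra.
  - rewrite Cmod_mult. apply Rle_trans with (2 * X * H); [apply Rmult_le_compat; assumption|].
    apply Rle_trans with (2 * (16 / A * G) * H); [nra|].
    replace (2 * (16 / A * G) * H) with (32 / A * (H * G)) by (field; lra).
    assert (0 < 32 / A) by (apply Rdiv_lt_0_compat; lra). pose proof (pow2_ge_0 (16 / A)).
    apply Rle_trans with (32 / A * U); [apply Rmult_le_compat_l; lra|].
    apply Rmult_le_compat_r; [lra|]. unfold P. lra.
  - set (w := (RtoC (l - l0) * (Ci * v))%C).
    assert (Ew : Cexp (RtoC l * (Ci * v)) = (E0 * Cexp w)%C).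
    { unfold E0, w. rewrite <- Cexp_add. f_equal. rewrite RtoC_minus. ring. }
    rewrite Ew. replace (E0 * Cexp w - E0 - RtoC (l - l0) * Ci * (v * E0))%C with (E0 * (Cexp w - 1 - w))%C by (unfold w; ring).
    rewrite Cmod_mult.
    assert (Hw : Cmod w = Rabs (l - l0) * Cmod v).
    { unfold w. rewrite !Cmod_mult, Cmod_R, Cmod_Ci. ring. }
    pose proof (Rabs_pos (l - l0)) as Hll.
    assert (Hw1 : Cmod w <= A * X / 16) by (rewrite Hw; nra).
    assert (Hw2 : Cmod w ^ 2 <= (l - l0) ^ 2 * (4 * X ^ 2)).
    { rewrite Hw, Rpow_mult_distr, pow2_abs. apply Rmult_le_compat_l; [apply pow2_ge_0|].
      replace (4 * X ^ 2) with ((2 * X) ^ 2) by ring. apply pow_incr. lra. }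
    assert (Hw3 : exp (Cmod w) <= G) by (now apply exp_le).
    pose proof (pow2_ge_0 (l - l0)) as Hl2. pose proof (pow2_ge_0 (16 / A)) as Hr2.
    apply Rle_trans with (H * ((l - l0) ^ 2 * (4 * (4 * (16 / A) ^ 2 * G)) * G)).
    + apply Rmult_le_compat; try assumption; [apply Cmod_ge_0|].
      eapply Rle_trans; [apply Cexp_sub_1_sub_le|].
      apply Rmult_le_compat; try assumption; [apply pow2_ge_0|left; apply exp_pos|].
      eapply Rle_trans; [apply Hw2|]. apply Rmult_le_compat_l; [assumption|]. lra.
    + replace (H * ((l - l0) ^ 2 * (4 * (4 * (16 / A) ^ 2 * G)) * G)) with ((l - l0) ^ 2 * (16 * (16 / A) ^ 2 * (H * G * G))) by ring.
      rewrite EQ. apply Rmult_le_compat_l; [assumption|]. apply Rmult_le_compat_r; [lra|].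
      unfold P. assert (0 < 32 / A) by (apply Rdiv_lt_0_compat; lra). lra.
Qed.

Definition ladder_integral (beta : C) (L : nat) (a : R) (g : R -> C) (l : R) : C :=
  contour_integral g (ladder_kernel beta L a l 0).

(** In Bd the term mid M is the part over [-M, M], with constants depending on the contour; the
    other term bounds the tails with K independent of a and g. For the real line M = 0 and q = a, so
    that Bd = K exp (-|l0| a/8). *)
Lemma ladder_integral_expansion (beta : C) (L : nat) (l0 : R) : 0 < Re beta -> l0 <> 0 ->
  exists K B, 0 <= K /\ forall a eps q M g, 0 <= a -> B <= a + M -> eps * eps = 1 -> eps * l0 = Rabs l0 ->
    tiltable beta a eps q M g ->
    exists J1 mid, 0 <= mid /\
      let Bd := mid * M + K * exp (Rabs l0 * ((a - q) / 4 - a / 8)) in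
      Cmod (ladder_integral beta L a g l0) <= Bd /\ Cmod J1 <= Bd /\
      forall l, Rabs (l - l0) <= Rabs l0 / 32 ->
        is_RInt_gen (V := C_R_NormedModule) (along g (ladder_kernel beta L a l 0))
          (Rbar_locally m_infty) (Rbar_locally p_infty) (ladder_integral beta L a g l) /\
        Cmod (ladder_integral beta L a g l - ladder_integral beta L a g l0 - RtoC (l - l0) * J1) <= Bd * (l - l0) ^ 2.
Proof.
  intros Hb Hl0. destruct (inv_tau_pow_bound beta L Hb) as [K [B [HK [HB Hbound]]]].
  set (A := Rabs l0). assert (HA : 0 < A) by now apply Rabs_pos_lt.
  set (P := 1 + 32 / A + 16 * (16 / A) ^ 2).
  assert (HP : 1 <= P) by (unfold P; assert (0 < 32 / A) by (apply Rdiv_lt_0_compat; lra); pose proof (pow2_ge_0 (16 / A)); lra).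
  exists (20 * K * P / A), B. split; [apply Rdiv_le_0_compat; nra|].
  intros a eps q M g Ha HaM He Hel TL.
  pose proof (Tmin_facts _ _ _ _ _ _ TL) as F.
  specialize (fun t y => Hbound a t y Ha).
  set (h := tilted g eps q).
  set (W := exp (A * ((a - q) / 4 - a / 8))). assert (HW : 0 < W) by apply exp_pos.
  (* All l near l0 have its sign, so one lift provides decay for all of them. *)
  assert (Hsign : forall l, Rabs (l - l0) <= A / 32 -> l <> 0 /\ eps * l = Rabs l /\ A / 2 <= Rabs l).
  { intros l Hl. apply Rabs_le_between in Hl. unfold A in *.
    assert (Hc : eps = 1 \/ eps = -1) by (assert (E : (eps - 1) * (eps + 1) = 0) by lra; apply Rmult_integral in E; lra).
    destruct Hc as [-> | ->].
    - rewrite Rmult_1_l in Hel. rewrite <- Hel in *. rewrite Rabs_pos_eq by lra. repeat split; lra.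
    - replace (Rabs l0) with (- l0) in * by lra. rewrite Rabs_left1 by lra. repeat split; lra. }
  assert (Hexk : forall l j T1 T2, M <= T1 -> M <= T2 -> ex_CRInt (along h (ladder_kernel beta L a l j)) (- T1) T2).
  { intros l j T1 T2 H1 H2. apply (ex_CRInt_sub _ (- (T1 + Rabs q)) _ _ (T2 + Rabs q)); try lra.
    apply (ex_along_tilted beta L a eps q M g TL); lra. }
  assert (Hdecay : forall l t, eps * l = Rabs l -> M < Rabs t ->
     Cmod (Cexp (RtoC l * (Ci * h t))) = exp (- (Rabs l * ((q + Rabs t) / 4)))).
  { intros l t Hl Ht. destruct (tilted_point beta L a eps q M g He TL K B HK HB Hb Hbound HaM Ha t Ht) as [E _].
    fold h in E. rewrite Cmod_exponential, E. f_equal. simpl. rewrite <- Hl. ring. }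
  assert (Hal : forall f m t, M < Rabs t -> Cmod (f (h t)) <= m ->
     Cmod (along h (fun v => f v * inv_tau_pow beta L a v)%C t) <= 5 / 4 * K * m).
  { intros f m t Ht Hm. apply (along_tilted_bound beta L a eps q M g He TL K B HK HB Hb Hbound HaM Ha); assumption. }
  assert (Hpt : forall l t, Rabs (l - l0) <= A / 32 -> M < Rabs t ->
    let D := P * W * exp (- (A / 8) * Rabs t) in
    Cmod (Cexp (RtoC l0 * (Ci * h t))) <= D /\
    Cmod (h t * Cexp (RtoC l0 * (Ci * h t))) <= D /\
    Cmod (Cexp (RtoC l * (Ci * h t)) - Cexp (RtoC l0 * (Ci * h t))
      - RtoC (l - l0) * Ci * (h t * Cexp (RtoC l0 * (Ci * h t)))) <= (l - l0) ^ 2 * D).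
  { intros l t Hl Ht. destruct (tilted_point beta L a eps q M g He TL K B HK HB Hb Hbound HaM Ha t Ht) as [_ [_ [_ Hv]]].
    apply (exponential_bounds A a q (Rabs t) l l0 (h t) HA eq_refl Hl); try assumption; [lra|apply Rabs_pos|].
    rewrite Hdecay by assumption. fold A. apply Rle_refl. }
  (* On [-M, M] the lift coincides with a cut lift, which is known to be piecewise C^1 and off the
     poles, so compactness bounds the integrand there. *)
  set (T := M + Rabs q + 1). set (hc := cut_tilted g eps q T T).
  assert (Ghc : piecewise_C1 hc) by (apply (cut_tilted_path beta a eps q M g TL); unfold T; lra).
  assert (Ahc : avoids_poles beta a hc) by (apply separated_avoids, (tl_cut _ _ _ _ _ _ TL); unfold T; lra).
  destruct (velocity_bounded hc (- T) T Ghc ltac:(unfold T; lra)) as [V [HV HV']].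
  destruct (continuous_bounded hc (- T) T ltac:(unfold T; lra) (fun t _ => piecewise_continuous hc t Ghc)) as [N [HN HN']].
  destruct (continuous_bounded _ (- T) T ltac:(unfold T; lra) (fun t _ => continuous_inv_tau_pow beta L a hc t Ghc Ahc)) as [Q [HQ HQ']].
  set (E2 := exp (2 * A * N)). assert (HE2 : 0 < E2) by apply exp_pos.
  assert (Hmid : forall f m I, (forall v, Cmod v <= N -> Cmod (f v) <= m) ->
     is_CRInt (along h (fun v => f v * inv_tau_pow beta L a v)%C) (- M) M I -> Cmod I <= 2 * M * (m * Q * V)).
  { intros f m I Hf HI. replace (2 * M) with (M - - M) by ring.
    apply (is_CRInt_Cmod_le_const _ (- M) M I _ ltac:(lra) HI). intros t Ht.
    unfold h. rewrite (along_tilted_eq_cut eps q g _ T T) by (unfold T; lra). fold hc.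
    assert (HtT : - T <= t <= T) by (unfold T; lra).
    unfold along. rewrite !Cmod_mult. apply Rmult_le_compat; try apply Cmod_ge_0; [| |apply HV'; assumption].
    - apply Rmult_le_pos; apply Cmod_ge_0.
    - apply Rmult_le_compat; try apply Cmod_ge_0; [apply Hf; now apply HN'|now apply HQ']. }
  assert (Hexp : forall l v, Rabs l <= A -> Cmod v <= N -> Cmod (Cexp (RtoC l * (Ci * v))) <= exp (A * N)).
  { intros l v Hl Hv. rewrite Cmod_Cexp. apply exp_le. eapply Rle_trans; [apply Rle_abs|].
    eapply Rle_trans; [apply Re_le_Cmod'|]. rewrite !Cmod_mult, Cmod_R, Cmod_Ci, Rmult_1_l.
    apply Rmult_le_compat; try apply Rabs_pos; try apply Cmod_ge_0; assumption. }
  assert (HEE : exp (A * N) * exp (A * N) = E2) by (unfold E2; rewrite <- exp_plus; f_equal; ring).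
  assert (HEE1 : 1 <= exp (A * N)) by (rewrite <- exp_0; apply exp_le; nra).
  set (mid := 2 * (E2 * (1 + N + N ^ 2) * Q * V)).
  assert (Hmid0 : 0 <= mid).
  { unfold mid. apply Rmult_le_pos; [lra|]. repeat (apply Rmult_le_pos; try assumption); [lra|nra]. }
  assert (HAl : A <= A) by lra.
  set (D := 5 / 4 * K * (P * W)).
  assert (HD : 0 <= D) by (unfold D; apply Rmult_le_pos; [lra|]; nra).
  assert (HDc : 2 * (D / (A / 8)) = 20 * K * P / A * W) by (unfold D; field; lra).
  set (k := fun l j => along h (ladder_kernel beta L a l j)).
  assert (Ek : forall l j t, k l j t = along h (fun v => (v ^ j * Cexp (RtoC l * (Ci * v))) * inv_tau_pow beta L a v)%C t).
  { intros l j t. unfold k, along, ladder_kernel. ring. }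
  assert (Ek' : forall l j x y I, x <= y -> is_CRInt (k l j) x y I -> is_CRInt (along h (fun v => (v ^ j * Cexp (RtoC l * (Ci * v))) * inv_tau_pow beta L a v)%C) x y I).
  { intros l j x y I Hxy. apply is_CRInt_ext; [assumption|]. intros t _. apply Ek. }
  (* Only existence for each single l is needed here; |l| >= A/2 gives the rate A/8. *)
  assert (HJl : forall l, Rabs (l - l0) <= A / 32 -> exists J, lim2 (k l 0%nat) J).
  { intros l Hl. destruct (Hsign l Hl) as [Hl1 [Hl2 Hl3]].
    destruct (improper_converges (k l 0%nat) M (5 / 4 * K * exp (- (A / 8) * q)) (A / 8)) as [J [HJ _]]; try lra.
    - apply Rmult_le_pos; [lra|left; apply exp_pos].
    - intros. now apply Hexk.
    - intros t Ht. rewrite Ek.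
      replace (5 / 4 * K * exp (- (A / 8) * q) * exp (- (A / 8) * Rabs t)) with (5 / 4 * K * (exp (- (A / 8) * q) * exp (- (A / 8) * Rabs t))) by ring.
      apply (Hal (fun v => v ^ 0 * Cexp (RtoC l * (Ci * v)))%C); [assumption|].
      cbn [Cpow]. rewrite Cmult_1_l, Hdecay, <- exp_plus by assumption. apply exp_le. nra.
    - now exists J. }
  assert (Hgen : forall l J, Rabs (l - l0) <= A / 32 -> lim2 (k l 0%nat) J ->
     is_RInt_gen (V := C_R_NormedModule) (along g (ladder_kernel beta L a l 0)) (Rbar_locally m_infty) (Rbar_locally p_infty) J
     /\ ladder_integral beta L a g l = J).
  { intros l J Hl HJ. destruct (Hsign l Hl) as [Hl1 [Hl2 Hl3]].
    assert (G : is_RInt_gen (V := C_R_NormedModule) (along g (ladder_kernel beta L a l 0)) (Rbar_locally m_infty) (Rbar_locally p_infty) J).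
    { apply (is_RInt_gen_of_lim2 _ _ 0).
      - intros T1 T2 H1 H2. apply (ex_along_original beta L a eps q M g TL). lra.
      - apply (lim2_original beta L a eps q M g He TL K B HK HB Hb Hbound HaM Ha); assumption. }
    split; [exact G|]. unfold ladder_integral, contour_integral.
    exact (is_RInt_gen_unique (V := C_R_CompleteNormedModule) (Fa := Rbar_locally m_infty) (Fb := Rbar_locally p_infty) (along g (ladder_kernel beta L a l 0)) J G). }
  assert (Hl00 : Rabs (l0 - l0) <= A / 32) by (rewrite Rminus_eq_0, Rabs_R0; lra).
  assert (HexM : forall l j, exists I, is_CRInt (k l j) (- M) M I) by (intros; apply Hexk; lra).
  assert (HNN : 0 <= N ^ 2) by apply pow2_ge_0.
  destruct (improper_converges (k l0 0%nat) M D (A / 8)) as [J0 [HJ0 BJ0]]; try lra.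
  { intros. now apply Hexk. }
  { intros t Ht. rewrite Ek. replace (D * exp (- (A / 8) * Rabs t)) with (5 / 4 * K * (P * W * exp (- (A / 8) * Rabs t))) by (unfold D; ring).
    apply (Hal (fun v => v ^ 0 * Cexp (RtoC l0 * (Ci * v)))%C); [assumption|].
    cbn [Cpow]. rewrite Cmult_1_l. now apply (Hpt l0 t Hl00 Ht). }
  destruct (improper_converges (k l0 1%nat) M D (A / 8)) as [J1 [HJ1 BJ1]]; try lra.
  { intros. now apply Hexk. }
  { intros t Ht. rewrite Ek. replace (D * exp (- (A / 8) * Rabs t)) with (5 / 4 * K * (P * W * exp (- (A / 8) * Rabs t))) by (unfold D; ring).
    apply (Hal (fun v => v ^ 1 * Cexp (RtoC l0 * (Ci * v)))%C); [assumption|].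
    cbn [Cpow]. rewrite Cmult_1_r. now apply (Hpt l0 t Hl00 Ht). }
  (* The l-derivative of exp (i l v) is i v exp (i l v), and J1 is the integral with the factor
     v. *)
  exists (Ci * J1)%C, mid. split; [assumption|]. cbv zeta. fold W.
  replace (ladder_integral beta L a g l0) with J0 by (symmetry; now apply Hgen).
  assert (Hfin : forall J I m, Cmod I <= 2 * M * (m * Q * V) -> m <= E2 * (1 + N + N ^ 2) ->
     Cmod (J - I) <= 2 * (D / (A / 8)) -> Cmod J <= mid * M + 20 * K * P / A * W).
  { intros J I m H1 H2 H3. rewrite HDc in H3.
    replace J with ((J - I) + I)%C by ring. eapply Rle_trans; [apply Cmod_triangle|].
    assert (2 * M * (m * Q * V) <= mid * M).
    { unfold mid. replace (2 * (E2 * (1 + N + N ^ 2) * Q * V) * M) with (2 * M * (E2 * (1 + N + N ^ 2) * Q * V)) by ring.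
      apply Rmult_le_compat_l; [lra|]. apply Rmult_le_compat_r; [assumption|]. now apply Rmult_le_compat_r. }
    lra. }
  assert (HEn : exp (A * N) <= E2) by nra.
  split; [|split].
  - destruct (HexM l0 0%nat) as [I HI]. apply (Hfin J0 I (exp (A * N))).
    + apply (Hmid (fun v => v ^ 0 * Cexp (RtoC l0 * (Ci * v)))%C); [|apply Ek'; [lra|exact HI]].
      intros v Hv. cbn [Cpow]. rewrite Cmult_1_l. now apply Hexp.
    + nra.
    + now apply BJ0.
  - rewrite Cmod_mult, Cmod_Ci, Rmult_1_l.
    destruct (HexM l0 1%nat) as [I HI]. apply (Hfin J1 I (N * exp (A * N))).
    + apply (Hmid (fun v => v ^ 1 * Cexp (RtoC l0 * (Ci * v)))%C); [|apply Ek'; [lra|exact HI]].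
      intros v Hv. cbn [Cpow]. rewrite Cmult_1_r, Cmod_mult.
      apply Rmult_le_compat; try apply Cmod_ge_0; [assumption|now apply Hexp].
    + nra.
    + now apply BJ1.
  - intros l Hl. destruct (HJl l Hl) as [J HJ]. destruct (Hgen l J Hl HJ) as [G EJ]. rewrite EJ.
    split; [exact G|].
    set (c := (RtoC (l - l0) * Ci)%C).
    set (rem := fun v => (Cexp (RtoC l * (Ci * v)) - Cexp (RtoC l0 * (Ci * v)) - c * (v * Cexp (RtoC l0 * (Ci * v))))%C).
    set (phi := fun t => (k l 0%nat t - k l0 0%nat t - c * k l0 1%nat t)%C).
    assert (Ephi : forall t, phi t = along h (fun v => rem v * inv_tau_pow beta L a v)%C t).
    { intros t. unfold phi. rewrite !Ek. unfold along, rem. cbn [Cpow]. ring. }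
    assert (Exphi : forall T1 T2, M <= T1 -> M <= T2 -> ex_CRInt phi (- T1) T2).
    { intros T1 T2 H1 H2. destruct (Hexk l 0%nat T1 T2 H1 H2) as [X1 HX1].
      destruct (Hexk l0 0%nat T1 T2 H1 H2) as [X2 HX2]. destruct (Hexk l0 1%nat T1 T2 H1 H2) as [X3 HX3].
      exists (X1 - X2 - c * X3)%C. apply is_CRInt_minus; [now apply is_CRInt_minus|]. now apply is_CRInt_mult. }
    destruct (improper_converges phi M ((l - l0) ^ 2 * D) (A / 8)) as [JR [HJR BJR]]; try lra; try assumption.
    { apply Rmult_le_pos; [apply pow2_ge_0|assumption]. }
    { intros t Ht. rewrite Ephi.
      replace ((l - l0) ^ 2 * D * exp (- (A / 8) * Rabs t)) with (5 / 4 * K * ((l - l0) ^ 2 * (P * W * exp (- (A / 8) * Rabs t)))) by (unfold D; ring).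
      apply (Hal rem); [assumption|]. now apply (Hpt l t Hl Ht). }
    (* The remainder has its own absolutely convergent integral, whose bound carries the factor (l -
       l0)^2; uniqueness of limits identifies it with the remainder of the integrals. *)
    assert (EJR : JR = (J - J0 - c * J1)%C).
    { apply (lim2_unique phi _ _ M); try assumption. apply (lim2_minus _ _ _ _ M).
      - intros T1 T2 H1 H2. destruct (Hexk l 0%nat T1 T2 H1 H2) as [X1 HX1].
        destruct (Hexk l0 0%nat T1 T2 H1 H2) as [X2 HX2]. exists (X1 - X2)%C. now apply is_CRInt_minus.
      - intros T1 T2 H1 H2. destruct (Hexk l0 1%nat T1 T2 H1 H2) as [X3 HX3]. exists (c * X3)%C. now apply is_CRInt_mult.
      - apply (lim2_minus _ _ _ _ M); try assumption; intros; now apply Hexk.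
      - apply (lim2_mult _ _ _ M); try assumption; intros; now apply Hexk. }
    replace (J - J0 - RtoC (l - l0) * (Ci * J1))%C with JR by (rewrite EJR; unfold c; ring).
    destruct (Exphi M M ltac:(lra) ltac:(lra)) as [I HI].
    assert (BI : Cmod I <= 2 * M * ((l - l0) ^ 2 * (N ^ 2 * E2) * Q * V)).
    { apply (Hmid rem).
      - intros v Hv. set (w := (RtoC (l - l0) * (Ci * v))%C).
        assert (Ew : Cexp (RtoC l * (Ci * v)) = (Cexp (RtoC l0 * (Ci * v)) * Cexp w)%C).
        { unfold w. rewrite <- Cexp_add. f_equal. rewrite RtoC_minus. ring. }
        unfold rem. rewrite Ew. set (E0 := Cexp (RtoC l0 * (Ci * v))).
        replace (E0 * Cexp w - E0 - c * (v * E0))%C with (E0 * (Cexp w - 1 - w))%C by (unfold w, c; ring).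
        rewrite Cmod_mult.
        assert (Hw : Cmod w = Rabs (l - l0) * Cmod v).
        { unfold w. rewrite !Cmod_mult, Cmod_R, Cmod_Ci. ring. }
        pose proof (Rabs_pos (l - l0)) as Hll. pose proof (Cmod_ge_0 v) as Hv0.
        apply Rle_trans with (exp (A * N) * ((l - l0) ^ 2 * N ^ 2 * exp (A * N))).
        + apply Rmult_le_compat; try apply Cmod_ge_0; [apply Hexp; [fold A; lra|assumption]|].
          eapply Rle_trans; [apply Cexp_sub_1_sub_le|].
          apply Rmult_le_compat; [apply pow2_ge_0|left; apply exp_pos| |].
          * rewrite Hw, Rpow_mult_distr, pow2_abs. apply Rmult_le_compat_l; [apply pow2_ge_0|]. apply pow_incr. lra.
          * apply exp_le. rewrite Hw. apply Rmult_le_compat; lra.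
        + rewrite <- HEE. right; ring.
      - revert HI. apply is_CRInt_ext; [lra|]. intros t _. apply Ephi. }
    specialize (BJR I HI).
    replace (2 * ((l - l0) ^ 2 * D / (A / 8))) with ((l - l0) ^ 2 * (2 * (D / (A / 8)))) in BJR by (field; lra).
    rewrite HDc in BJR.
    replace JR with ((JR - I) + I)%C by ring. eapply Rle_trans; [apply Cmod_triangle|].
    assert (HX : 2 * M * ((l - l0) ^ 2 * (N ^ 2 * E2) * Q * V) <= (l - l0) ^ 2 * (mid * M)).
    { unfold mid. replace (2 * M * ((l - l0) ^ 2 * (N ^ 2 * E2) * Q * V)) with ((l - l0) ^ 2 * (2 * (N ^ 2 * E2 * Q * V) * M)) by ring.
      apply Rmult_le_compat_l; [apply pow2_ge_0|]. apply Rmult_le_compat_r; [lra|]. apply Rmult_le_compat_l; [lra|].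
      apply Rmult_le_compat_r; [assumption|]. apply Rmult_le_compat_r; [assumption|]. nra. }
    lra.
Qed.

(** * Independence of the contour and uniformity in n *)

Lemma admissible_separated beta lambda n g : admissible beta lambda n g ->
  poles_separated beta ((lambda + INR n + 1) / 2) g.
Proof.
  intros [_ [H1 H2]]. split; intros k.
  - apply lies_above_side, H1.
  - apply lies_below_side, H2.
Qed.

Lemma is_RInt_gen_contour (beta : C) (L : nat) (a l M : R) (g1 g2 : R -> C) (J : C) :
  piecewise_C1 g1 -> piecewise_C1 g2 -> real_beyond g1 M -> real_beyond g2 M ->
  poles_separated beta a g1 -> poles_separated beta a g2 -> l <> 0 ->
  is_RInt_gen (V := C_R_NormedModule) (along g1 (ladder_kernel beta L a l 0))
    (Rbar_locally m_infty) (Rbar_locally p_infty) J ->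
  is_RInt_gen (V := C_R_NormedModule) (along g2 (ladder_kernel beta L a l 0))
    (Rbar_locally m_infty) (Rbar_locally p_infty) J.
Proof.
  intros G1 G2 R1 R2 S1 S2 Hl H P HP.
  destruct (H P HP) as [Q1 Q2 [N1 HN1] [N2 HN2] HQ].
  set (M' := Rabs M + 1). pose proof (Rle_abs M). pose proof (Rabs_pos M).
  apply (Filter_prod _ _ _ (fun x => Q1 x /\ x < - M') (fun y => Q2 y /\ M' < y)).
  - exists (Rmin N1 (- M')). intros x Hx. pose proof (Rmin_l N1 (- M')). pose proof (Rmin_r N1 (- M')).
    split; [apply HN1|]; lra.
  - exists (Rmax N2 M'). intros x Hx. pose proof (Rmax_l N2 M'). pose proof (Rmax_r N2 M').
    split; [apply HN2|]; lra.
  - intros x y [Hx1 Hx2] [Hy1 Hy2]. simpl. destruct (HQ x y Hx1 Hy1) as [I [HI PI]]. simpl in HI.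
    exists I. split; [|assumption].
    set (N := - x + y).
    assert (B : balanced g1 g2 (- N) N (ladder_kernel beta L a l 0)).
    { unfold N, M' in *. apply balanced_kernel_separated; try assumption; try lra.
      - intros t Ht. apply R1. lra.
      - intros t Ht. apply R2. lra. }
    apply (balanced_restrict _ _ _ _ x y) in B; try (unfold N, M' in *; lra).
    + destruct B as [I' [B1 B2]]. now rewrite (is_CRInt_unique _ _ _ _ _ HI B1).
    + intros t Ht.
      assert (HMt : M < Rabs t).
      { unfold M', N in *. destruct Ht; [rewrite Rabs_left1 by lra|rewrite Rabs_pos_eq by lra]; lra. }
      unfold along. rewrite R1, R2 by lra. f_equal. now apply (path_velocity_real_beyond g1 g2 M).
Qed.

Definition expansion_bound (beta : C) (L : nat) (a l0 : R) (g : R -> C) (J1 : C) (Bd : R) : Prop :=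
  Cmod (ladder_integral beta L a g l0) <= Bd /\ Cmod J1 <= Bd /\
  forall l, Rabs (l - l0) <= Rabs l0 / 32 ->
    is_RInt_gen (V := C_R_NormedModule) (along g (ladder_kernel beta L a l 0))
      (Rbar_locally m_infty) (Rbar_locally p_infty) (ladder_integral beta L a g l) /\
    Cmod (ladder_integral beta L a g l - ladder_integral beta L a g l0 - RtoC (l - l0) * J1) <= Bd * (l - l0) ^ 2.

Lemma expansion_bound_mono beta L a l0 g J1 Bd Bd' : Bd <= Bd' ->
  expansion_bound beta L a l0 g J1 Bd -> expansion_bound beta L a l0 g J1 Bd'.
Proof.
  intros H [H1 [H2 H3]]. split; [lra|]. split; [lra|]. intros l Hl. destruct (H3 l Hl) as [G B].
  split; [exact G|]. pose proof (pow2_ge_0 (l - l0)). nra.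
Qed.

Lemma ladder_integral_contour (beta : C) (L : nat) (a l : R) (g1 g2 : R -> C) (J : C) :
  is_contour g1 -> is_contour g2 ->
  poles_separated beta a g1 -> poles_separated beta a g2 -> l <> 0 ->
  is_RInt_gen (V := C_R_NormedModule) (along g1 (ladder_kernel beta L a l 0))
    (Rbar_locally m_infty) (Rbar_locally p_infty) J ->
  is_RInt_gen (V := C_R_NormedModule) (along g2 (ladder_kernel beta L a l 0))
    (Rbar_locally m_infty) (Rbar_locally p_infty) J /\ ladder_integral beta L a g2 l = J.
Proof.
  intros [G1 [M1 R1]] [G2 [M2 R2]] S1 S2 Hl H.
  assert (G : is_RInt_gen (V := C_R_NormedModule) (along g2 (ladder_kernel beta L a l 0))
    (Rbar_locally m_infty) (Rbar_locally p_infty) J).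
  { apply (is_RInt_gen_contour beta L a l (Rmax M1 M2) g1 g2); try assumption.
    - intros t Ht. apply R1. pose proof (Rmax_l M1 M2). lra.
    - intros t Ht. apply R2. pose proof (Rmax_r M1 M2). lra. }
  split; [exact G|]. unfold ladder_integral, contour_integral.
  exact (is_RInt_gen_unique (V := C_R_CompleteNormedModule) (Fa := Rbar_locally m_infty) (Fb := Rbar_locally p_infty)
    (along g2 (ladder_kernel beta L a l 0)) J G).
Qed.

(** Finitely many n are absorbed by enlarging the constant, so their individual bounds may be
    arbitrary. *)
Lemma geometric_bound_of_eventual (P : nat -> R -> Prop) (K r : R) (n0 : nat) : 0 < r ->
  (forall n B B', B <= B' -> P n B -> P n B') ->
  (forall n, exists B, P n B) ->
  (forall n, (n0 <= n)%nat -> P n (K * r ^ n)) ->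
  exists K', 0 <= K' /\ forall n, P n (K' * r ^ n).
Proof.
  intros Hr Hmono Hex H.
  assert (Hfin : forall m, exists K', 0 <= K' /\ forall n, (n < m)%nat -> P n (K' * r ^ n)).
  { induction m as [|m [K' [HK' IH]]].
    - exists 0. split; [lra|]. intros; lia.
    - destruct (Hex m) as [B HB]. exists (K' + Rabs B / r ^ m).
      assert (Hrm : 0 < r ^ m) by now apply pow_lt.
      assert (HB0 : 0 <= Rabs B / r ^ m) by (apply Rdiv_le_0_compat; [apply Rabs_pos|assumption]).
      split; [lra|]. intros n Hn. assert (Hrn : 0 < r ^ n) by now apply pow_lt.
      destruct (Nat.eq_dec n m) as [->|].
      + apply (Hmono m B); [|assumption]. rewrite Rmult_plus_distr_r.
        replace (Rabs B / r ^ m * r ^ m) with (Rabs B) by (field; lra). pose proof (Rle_abs B). nra.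
      + apply (Hmono n (K' * r ^ n)); [|apply IH; lia]. nra. }
  destruct (Hfin n0) as [K' [HK' H']]. exists (K' + Rabs K).
  pose proof (Rabs_pos K). pose proof (Rle_abs K). split; [lra|]. intros n.
  assert (Hrn : 0 < r ^ n) by now apply pow_lt.
  destruct (Nat.lt_ge_cases n n0).
  - apply (Hmono n (K' * r ^ n)); [nra|now apply H'].
  - apply (Hmono n (K * r ^ n)); [nra|now apply H].
Qed.

(** For n >= n0 the real line is itself a separating contour and gives geometric decay; for smaller
    n the given contour supplies some bound, however bad. *)
Lemma ladder_integral_family (beta : C) (L : nat) (lambda l0 : R) (c : nat -> R -> C) :
  0 <= lambda -> 0 < Re beta -> l0 <> 0 -> (forall n, admissible beta lambda n (c n)) ->
  exists (J1 : nat -> C) (K r : R), 0 <= K /\ 0 < r < 1 /\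
    forall n, expansion_bound beta L ((lambda + INR n + 1) / 2) l0 (c n) (J1 n) (K * r ^ n).
Proof.
  intros Hlam Hb Hl0 Hadm.
  destruct (ladder_integral_expansion beta L l0 Hb Hl0) as [K [B [HK Hexp]]].
  set (A := Rabs l0) in *. assert (HA : 0 < A) by now apply Rabs_pos_lt.
  set (eps := l0 / A).
  assert (He : eps * eps = 1).
  { unfold eps, A. unfold Rabs. destruct (Rcase_abs l0); field; lra. }
  assert (Hel : eps * l0 = A).
  { unfold eps. replace (l0 / A * l0) with ((l0 / A * (l0 / A)) * A) by (field; lra).
    fold eps. rewrite He. ring. }
  set (a := fun n : nat => (lambda + INR n + 1) / 2).
  assert (Ha : forall n, 0 <= a n) by (intros n; unfold a; pose proof (pos_INR n); lra).
  assert (Hn0 : forall l, Rabs (l - l0) <= A / 32 -> l <> 0).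
  { intros l Hl E. rewrite E in Hl. replace (0 - l0) with (- l0) in Hl by ring.
    rewrite Rabs_Ropp in Hl. fold A in Hl. lra. }
  (* From exp (-A a/8) with a >= n/2. *)
  set (r := exp (- (A / 16))).
  assert (Hr : 0 < r < 1).
  { split; [apply exp_pos|]. unfold r; rewrite <- exp_0. apply exp_increasing. lra. }
  destruct (tiltable_line beta eps He) as [B' HB'].
  destruct (INR_unbounded (2 * Rabs B + 2 * Rabs B')) as [n0 Hn0'].
  destruct (geometric_bound_of_eventual (fun n Bd => exists J1, expansion_bound beta L (a n) l0 (c n) J1 Bd) K r n0) as [K' [HK' H]].
  - lra.
  - intros n B1 B2 H12 [J1 HJ1]. exists J1. now apply (expansion_bound_mono _ _ _ _ _ _ B1).
  - intros n. destruct (Hadm n) as [[G [M0 R0]] _].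
    destruct (tiltable_contour beta (a n) eps M0 B (c n) He (Ha n) G R0 (admissible_separated _ _ _ _ (Hadm n))) as [M [HM TL]].
    destruct (Hexp (a n) eps (- M) M (c n) (Ha n) ltac:(specialize (Ha n); lra) He Hel TL) as [J1 [mid [_ HJ]]].
    eexists. exists J1. exact HJ.
  - intros n Hn. pose proof (Rle_abs B). pose proof (Rle_abs B').
    assert (HnN : INR n0 <= INR n) by now apply le_INR.
    pose proof (Rabs_pos B). pose proof (Rabs_pos B').
    destruct (Hexp (a n) eps (a n) 0 RtoC (Ha n) ltac:(unfold a; lra) He Hel (HB' (a n) ltac:(unfold a; lra))) as [J1 [mid [_ HJ]]].
    exists J1.
    (* The bound over the real line is transferred to c n, whose own shape may be arbitrarily bad as
       n grows. The equality is needed for all l near l0 because the expansion involves them. *)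
    assert (Hc : forall l, Rabs (l - l0) <= A / 32 ->
      is_RInt_gen (V := C_R_NormedModule) (along (c n) (ladder_kernel beta L (a n) l 0))
        (Rbar_locally m_infty) (Rbar_locally p_infty) (ladder_integral beta L (a n) RtoC l) /\
      ladder_integral beta L (a n) (c n) l = ladder_integral beta L (a n) RtoC l).
    { intros l Hl. destruct HJ as [_ [_ HJ]]. destruct (HJ l Hl) as [G _].
      apply (ladder_integral_contour beta L (a n) l RtoC (c n)); try assumption.
      - split; [apply piecewise_C1_line|]. exists 0. reflexivity.
      - apply Hadm.
      - apply (tl_sep _ _ _ _ _ _ (HB' (a n) ltac:(unfold a; lra))).
      - apply admissible_separated, Hadm.
      - now apply Hn0. }
    apply (expansion_bound_mono _ _ _ _ _ _ (mid * 0 + K * exp (A * ((a n - a n) / 4 - a n / 8)))).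
    + rewrite Rmult_0_r, Rplus_0_l. apply Rmult_le_compat_l; [assumption|].
      unfold r. rewrite exp_pow_INR. apply exp_le. unfold a. pose proof (pos_INR n). nra.
    + destruct HJ as [H3 [H4 H5]].
      assert (E0 : ladder_integral beta L (a n) (c n) l0 = ladder_integral beta L (a n) RtoC l0).
      { apply Hc. rewrite Rminus_eq_0, Rabs_R0. lra. }
      split; [now rewrite E0|]. split; [assumption|]. intros l Hl.
      destruct (Hc l Hl) as [G E]. destruct (H5 l Hl) as [_ H6]. rewrite E, E0. now split.
  - destruct (functional_choice (fun n J1 => expansion_bound beta L (a n) l0 (c n) J1 (K' * r ^ n)) H) as [J1 HJ1].
    exists J1, K', r. split; [assumption|]. split; [assumption|]. exact HJ1.
Qed.

(** * Gegenbauer polynomials *)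

Fixpoint csum (f : nat -> C) (n : nat) : C :=
  match n with O => 0%C | S m => (csum f m + f m)%C end.

Lemma csum_ext f g n : (forall k, (k < n)%nat -> f k = g k) -> csum f n = csum g n.
Proof.
  induction n as [|n IH]; intros H; simpl; [reflexivity|]. rewrite IH, H; auto.
Qed.

Lemma csum_plus f g n : csum (fun k => f k + g k)%C n = (csum f n + csum g n)%C.
Proof. induction n as [|n IH]; simpl; [ring|]. rewrite IH. ring. Qed.

Lemma csum_mult c f n : csum (fun k => c * f k)%C n = (c * csum f n)%C.
Proof. induction n as [|n IH]; simpl; [ring|]. rewrite IH. ring. Qed.

Lemma csum_first f n : csum f (S n) = (f O + csum (fun k => f (S k)) n)%C.
Proof.
  induction n as [|n IH]; [simpl; ring|].
  change (csum f (S (S n))) with (csum f (S n) + f (S n))%C. rewrite IH. simpl. ring.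
Qed.

Lemma csum_rev f n : csum f (S n) = csum (fun k => f (n - k)%nat) (S n).
Proof.
  revert f. induction n as [|n IH]; intros f; [reflexivity|].
  rewrite csum_first, IH.
  change (csum (fun k => f (S n - k)%nat) (S (S n))) with (csum (fun k => f (S n - k)%nat) (S n) + f (S n - S n)%nat)%C.
  rewrite Nat.sub_diag. rewrite (csum_ext (fun k => f (S (n - k))) (fun k => f (S n - k)%nat)).
  - ring.
  - intros k Hk. f_equal. lia.
Qed.

Lemma Cmod_csum_le f (B : R) n : (forall k, (k < n)%nat -> Cmod (f k) <= B) -> Cmod (csum f n) <= INR n * B.
Proof.
  induction n as [|n IH]; intros H.
  - simpl. rewrite Cmod_0. lra.
  - cbn [csum]. rewrite S_INR. eapply Rle_trans; [apply Cmod_triangle|].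
    specialize (IH (fun k Hk => H k (Nat.lt_lt_succ_r _ _ Hk))). specialize (H n (Nat.lt_succ_diag_r n)). lra.
Qed.

Definition conv (x y : nat -> C) (n : nat) : C := csum (fun k => x k * y (n - k)%nat)%C (S n).

Lemma conv_comm x y n : conv x y n = conv y x n.
Proof.
  unfold conv. rewrite csum_rev. apply csum_ext. intros k Hk.
  replace (n - (n - k))%nat with k by lia. ring.
Qed.

Lemma conv_ext x x' y y' n : (forall k, x k = x' k) -> (forall k, y k = y' k) -> conv x y n = conv x' y' n.
Proof. intros H1 H2. apply csum_ext. intros. now rewrite H1, H2. Qed.

Lemma conv_mult_l c x y n : conv (fun k => c * x k)%C y n = (c * conv x y n)%C.
Proof. unfold conv. rewrite <- csum_mult. apply csum_ext. intros. ring. Qed.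

Lemma conv_plus_l x x' y n : conv (fun k => x k + x' k)%C y n = (conv x y n + conv x' y n)%C.
Proof. unfold conv. rewrite <- csum_plus. apply csum_ext. intros. ring. Qed.

(* (lambda)_k / k!, the coefficient of t^k in (1 - t)^(-lambda) *)
Fixpoint gcoef (lambda : R) (k : nat) : R :=
  match k with O => 1 | S m => gcoef lambda m * ((lambda + INR m) / INR (S m)) end.

Lemma gcoef_shift lambda k : (lambda + INR k) * gcoef lambda k = lambda * gcoef (lambda + 1) k.
Proof.
  induction k as [|k IH]; [simpl; ring|].
  cbn [gcoef]. rewrite S_INR. pose proof (pos_INR k).
  transitivity ((lambda + INR k) * gcoef lambda k * ((lambda + 1 + INR k) / (INR k + 1))).
  - field. lra.
  - rewrite IH. field. lra.
Qed.

(** Coefficients in (1 - t)^(-lambda) = (1 - t) (1 - t)^(-lambda-1). *)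
Lemma gcoef_diff lambda k : gcoef lambda (S k) = gcoef (lambda + 1) (S k) - gcoef (lambda + 1) k.
Proof.
  cbn [gcoef]. rewrite S_INR. pose proof (pos_INR k).
  transitivity ((lambda + INR k) * gcoef lambda k / (INR k + 1)); [field; lra|].
  rewrite gcoef_shift. field. lra.
Qed.

(** Coefficients in the derivative lambda (1 - t)^(-lambda-1) of (1 - t)^(-lambda). *)
Lemma gcoef_succ lambda k : INR (S k) * gcoef lambda (S k) = lambda * gcoef (lambda + 1) k.
Proof.
  rewrite <- gcoef_shift. cbn [gcoef]. field. apply not_0_INR. lia.
Qed.

(** The coefficient of t^k in (1 - t w)^(-lambda). *)
Definition gpow (lambda : R) (w : C) (k : nat) : C := (RtoC (gcoef lambda k) * w ^ k)%C.

Lemma gpow_succ lambda w k :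
  (RtoC (INR (S k)) * gpow lambda w (S k))%C = (RtoC lambda * w * gpow (lambda + 1) w k)%C.
Proof.
  unfold gpow. simpl Cpow. rewrite !Cmult_assoc, <- RtoC_mult, gcoef_succ, RtoC_mult. ring.
Qed.

Lemma gpow_succ' lambda w k :
  (RtoC (INR (S k)) * gpow lambda w (S k))%C = (w * (RtoC lambda * gpow lambda w k + RtoC (INR k) * gpow lambda w k))%C.
Proof.
  rewrite gpow_succ. unfold gpow.
  replace (RtoC lambda * w * (RtoC (gcoef (lambda + 1) k) * w ^ k))%C with (w * (RtoC (lambda * gcoef (lambda + 1) k) * w ^ k))%C
    by (rewrite RtoC_mult; ring).
  rewrite <- gcoef_shift, RtoC_mult, RtoC_plus. ring.
Qed.

Lemma gpow_diff lambda w k :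
  gpow lambda w (S k) = (gpow (lambda + 1) w (S k) - w * gpow (lambda + 1) w k)%C.
Proof. unfold gpow. rewrite gcoef_diff, RtoC_minus. simpl Cpow. ring. Qed.

(* The coefficient of t^n in (1 - t w)^(-lambda) (1 - t w')^(-lambda). *)
Definition gegenbauer_form (lambda : R) (w w' : C) (n : nat) : C := conv (gpow lambda w) (gpow lambda w') n.

(* w d/dw applied to [gegenbauer_form lambda w w' n]. *)
Definition euler_form (lambda : R) (w w' : C) (n : nat) : C :=
  conv (fun k => RtoC (INR k) * gpow lambda w k)%C (gpow lambda w') n.

Lemma conv_first x y n : conv x y (S n) = (x O * y (S n) + conv (fun k => x (S k)) y n)%C.
Proof. unfold conv. rewrite csum_first. reflexivity. Qed.

(** For F = (1 - t w)^(-lambda) (1 - t w')^(-lambda) and E = w dF/dw one has (1 - t w) E = lambda t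
    w F, that is E = t w (lambda F + E). *)
Lemma euler_form_succ lambda w w' n :
  euler_form lambda w w' (S n) = (w * (RtoC lambda * gegenbauer_form lambda w w' n + euler_form lambda w w' n))%C.
Proof.
  unfold euler_form at 1. rewrite conv_first.
  rewrite (conv_ext (fun k => RtoC (INR (S k)) * gpow lambda w (S k))%C
     (fun k => w * (RtoC lambda * gpow lambda w k + RtoC (INR k) * gpow lambda w k))%C _ (gpow lambda w'))
   by (intros; [apply gpow_succ'|reflexivity] || apply gpow_succ' || reflexivity).
  rewrite conv_mult_l, conv_plus_l, conv_mult_l. unfold gegenbauer_form, euler_form. simpl INR. ring.
Qed.

(** The solved form E = lambda t w (1 - t w)^(-lambda-1) (1 - t w')^(-lambda) of the same
    equation. *)
Lemma euler_form_succ' lambda w w' n :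
  euler_form lambda w w' (S n) = (RtoC lambda * w * conv (gpow (lambda + 1) w) (gpow lambda w') n)%C.
Proof.
  unfold euler_form at 1. rewrite conv_first.
  rewrite (conv_ext (fun k => RtoC (INR (S k)) * gpow lambda w (S k))%C
     (fun k => RtoC lambda * w * gpow (lambda + 1) w k)%C _ (gpow lambda w'))
   by (intros; apply gpow_succ || reflexivity).
  rewrite conv_mult_l. simpl INR. ring.
Qed.

(** Euler's identity: the form is homogeneous of degree n in w and w'. *)
Lemma euler_form_sum lambda w w' n :
  (RtoC (INR n) * gegenbauer_form lambda w w' n)%C = (euler_form lambda w w' n + euler_form lambda w' w n)%C.
Proof.
  unfold euler_form. rewrite (conv_comm _ (gpow lambda w)). unfold gegenbauer_form, conv.
  rewrite <- csum_mult, <- csum_plus. apply csum_ext. intros k Hk.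
  replace (INR n) with (INR k + INR (n - k)) by (rewrite <- plus_INR; f_equal; lia).
  rewrite RtoC_plus. ring.
Qed.

Lemma gegenbauer_form_comm lambda w w' n : gegenbauer_form lambda w w' n = gegenbauer_form lambda w' w n.
Proof. apply conv_comm. Qed.

(** The three-term recurrence of the Gegenbauer polynomials in homogeneous form, with w + w' for 2 r
    and w w' for 1. It follows from Euler's identity in three consecutive degrees together with
    [euler_form_succ]. *)
Lemma gegenbauer_form_rec lambda w w' n :
  (RtoC (INR (S (S n))) * gegenbauer_form lambda w w' (S (S n)))%C =
  (RtoC (lambda + INR (S n)) * (w + w') * gegenbauer_form lambda w w' (S n)
   - RtoC (2 * lambda + INR n) * (w * w') * gegenbauer_form lambda w w' n)%C.
Proof.
  pose proof (euler_form_sum lambda w w' (S n)) as E1. pose proof (euler_form_sum lambda w w' n) as E0.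
  rewrite euler_form_sum, !(euler_form_succ _ _ _ (S n)), (gegenbauer_form_comm lambda w' w (S n)).
  rewrite (RtoC_plus lambda), (RtoC_plus (2 * lambda)), RtoC_mult.
  replace ((RtoC lambda + RtoC (INR (S n))) * (w + w') * gegenbauer_form lambda w w' (S n))%C with
   (RtoC lambda * (w + w') * gegenbauer_form lambda w w' (S n) + (w + w') * (RtoC (INR (S n)) * gegenbauer_form lambda w w' (S n)))%C by ring.
  rewrite E1.
  replace ((2 * RtoC lambda + RtoC (INR n)) * (w * w') * gegenbauer_form lambda w w' n)%C with
   (2 * RtoC lambda * (w * w') * gegenbauer_form lambda w w' n + (w * w') * (RtoC (INR n) * gegenbauer_form lambda w w' n))%C by ring.
  rewrite E0, !euler_form_succ, (gegenbauer_form_comm lambda w' w n). ring.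
Qed.

Lemma gpow_0 lambda w : gpow lambda w 0 = 1%C.
Proof. unfold gpow. simpl. ring. Qed.

(** Multiplication of the generating function by 1 - t w. *)
Lemma conv_gpow_lower lambda x w n :
  conv x (gpow lambda w) n =
  (conv x (gpow (lambda + 1) w) n - match n with O => 0 | S m => w * conv x (gpow (lambda + 1) w) m end)%C.
Proof.
  destruct n as [|n].
  - unfold conv. simpl. unfold gpow. simpl. ring.
  - unfold conv.
    change (csum (fun k => x k * gpow lambda w (S n - k)%nat)%C (S (S n))) with
      (csum (fun k => x k * gpow lambda w (S n - k)%nat)%C (S n) + x (S n) * gpow lambda w (S n - S n)%nat)%C.
    change (csum (fun k => x k * gpow (lambda + 1) w (S n - k)%nat)%C (S (S n))) with
      (csum (fun k => x k * gpow (lambda + 1) w (S n - k)%nat)%C (S n) + x (S n) * gpow (lambda + 1) w (S n - S n)%nat)%C.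
    rewrite Nat.sub_diag.
    rewrite (csum_ext _ (fun k => x k * gpow (lambda + 1) w (S n - k)%nat + (- w) * (x k * gpow (lambda + 1) w (n - k)%nat))%C).
    + rewrite csum_plus, csum_mult, !gpow_0. ring.
    + intros k Hk. replace (S n - k)%nat with (S (n - k)) by lia. rewrite gpow_diff. ring.
Qed.

(** The identity behind the passage from lambda to lambda + 1. By [euler_form_succ'] the difference
    is lambda t times w (1 - t w') - w' (1 - t w) = w - w', multiplied by the generating function
    for lambda + 1. *)
Lemma euler_form_diff lambda w w' n :
  (euler_form lambda w w' (S n) - euler_form lambda w' w (S n))%C =
  (RtoC lambda * (w - w') * gegenbauer_form (lambda + 1) w w' n)%C.
Proof.
  rewrite !euler_form_succ', (conv_gpow_lower lambda (gpow (lambda + 1) w) w' n),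
    (conv_gpow_lower lambda (gpow (lambda + 1) w') w n). unfold gegenbauer_form.
  rewrite (conv_comm (gpow (lambda + 1) w') (gpow (lambda + 1) w)).
  destruct n as [|n]; [ring|].
  rewrite (conv_comm (gpow (lambda + 1) w') (gpow (lambda + 1) w)). ring.
Qed.

Lemma gcoef_1 k : gcoef 1 k = 1.
Proof.
  induction k as [|k IH]; [reflexivity|]. cbn [gcoef]. rewrite IH, S_INR. field. pose proof (pos_INR k). lra.
Qed.

(** The counterpart of [euler_form_diff] for lambda = 0; all coefficients of the form with parameter
    1 are 1, so it is the sum of the w^k w'^(n-k). *)
Lemma pow_diff_form w w' n : (w ^ S n - w' ^ S n)%C = ((w - w') * gegenbauer_form 1 w w' n)%C.
Proof.
  assert (G : forall x k, gpow 1 x k = (x ^ k)%C) by (intros; unfold gpow; rewrite gcoef_1; ring).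
  unfold gegenbauer_form. rewrite (conv_ext _ (fun k => w ^ k)%C _ (fun k => w' ^ k)%C) by (intros; apply G).
  induction n as [|n IH].
  - unfold conv. simpl. ring.
  - rewrite conv_first.
    rewrite (conv_ext (fun k => w ^ S k)%C (fun k => w * w ^ k)%C _ (fun k => w' ^ k)%C) by (intros; reflexivity).
    rewrite conv_mult_l. set (X := conv _ _ n) in *.
    replace ((w - w') * (w ^ 0 * w' ^ S n + w * X))%C with
     ((w - w') * w' ^ S n + w * ((w - w') * X))%C by (simpl; ring).
    rewrite <- IH. simpl. ring.
Qed.

Lemma gcoef_nonneg lambda k : 0 <= lambda -> 0 <= gcoef lambda k.
Proof.
  intros H. induction k as [|k IH]; cbn [gcoef]; [lra|].
  apply Rmult_le_pos; [assumption|]. apply Rdiv_le_0_compat; [pose proof (pos_INR k); lra|apply lt_0_INR; lia].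
Qed.

(** The ratio (lambda + n)/(n + 1) of consecutive coefficients is at most s once n >= lambda/(s -
    1). As s > 1 is arbitrary, this is subexponential growth. *)
Lemma gcoef_geometric lambda s : 0 <= lambda -> 1 < s -> exists K, 0 <= K /\ forall k, gcoef lambda k <= K * s ^ k.
Proof.
  intros Hlam Hs. destruct (INR_unbounded (lambda / (s - 1))) as [n0 Hn0].
  assert (Hs0 : 0 < s ^ n0) by (apply pow_lt; lra).
  apply (geometric_bound_of_eventual (fun k B => gcoef lambda k <= B) (gcoef lambda n0 / s ^ n0) s n0); try lra.
  - intros; lra.
  - intros n. exists (gcoef lambda n). lra.
  - intros n Hn. induction Hn as [|n Hn IH].
    + right. field. lra.
    + cbn [gcoef pow]. assert (INR n0 <= INR n) by now apply le_INR.
      assert (Hr : (lambda + INR n) / INR (S n) <= s).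
      { rewrite S_INR. pose proof (pos_INR n). apply Rmult_le_reg_r with (INR n + 1); [lra|].
        unfold Rdiv. rewrite Rmult_assoc, Rinv_l, Rmult_1_r by lra.
        assert (H2 : lambda / (s - 1) <= INR n) by lra.
        apply Rmult_le_compat_r with (r := s - 1) in H2; [|lra]. unfold Rdiv in H2.
        rewrite Rmult_assoc, Rinv_l, Rmult_1_r in H2 by lra. nra. }
      pose proof (gcoef_nonneg lambda n Hlam).
      assert (0 <= (lambda + INR n) / INR (S n)) by (apply Rdiv_le_0_compat; [pose proof (pos_INR n); lra|apply lt_0_INR; lia]).
      apply Rle_trans with (gcoef lambda n0 / s ^ n0 * s ^ n * s); [|right; ring].
      apply Rmult_le_compat; assumption.
Qed.

Lemma Cmod_gegenbauer_form_le lambda w w' n K s : 0 <= K -> 1 < s -> 0 <= lambda ->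
  (forall k, gcoef lambda k <= K * s ^ k) -> Cmod w = 1 -> Cmod w' = 1 ->
  Cmod (gegenbauer_form lambda w w' n) <= INR (S n) * (K ^ 2 * s ^ n).
Proof.
  intros HK Hs Hlam Hg Hw Hw'. apply Cmod_csum_le. intros k Hk. unfold gpow.
  rewrite !Cmod_mult, !Cmod_pow, Hw, Hw', !pow1, !Rmult_1_r, !Cmod_R, !Rabs_pos_eq by now apply gcoef_nonneg.
  replace (K ^ 2 * s ^ n) with ((K * s ^ k) * (K * s ^ (n - k))).
  - apply Rmult_le_compat; try apply Hg; now apply gcoef_nonneg.
  - replace n with (k + (n - k))%nat at 2 by lia. rewrite pow_add. ring.
Qed.

(** * Agreement with the Taylor coefficients of the generating function *)

Section GegenbauerSeries.

Variables (lambda : R) (u : C).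
Hypothesis Hlam : 0 <= lambda.
Hypothesis Hu : Cmod u = 1.

Let r := Re u.
Let a (n : nat) : R := Re (gegenbauer_form lambda u (Cconj u) n).

Lemma unit_sum : (u + Cconj u)%C = RtoC (2 * r).
Proof. apply C_ext; unfold r, Re, Im; simpl; ring. Qed.

Lemma unit_prod : (u * Cconj u)%C = 1%C.
Proof. rewrite <- Cmod2_conj, Hu. apply C_ext; simpl; ring. Qed.

Lemma gegenbauer_form_real n : gegenbauer_form lambda u (Cconj u) n = RtoC (a n).
Proof.
  assert (H : gegenbauer_form lambda u (Cconj u) n = RtoC (a n) /\ gegenbauer_form lambda u (Cconj u) (S n) = RtoC (a (S n))); [|apply H].
  induction n as [|n [IH1 IH2]].
  - split; apply C_ext; try reflexivity.
    + unfold gegenbauer_form, conv. simpl. ring.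
    + unfold gegenbauer_form, conv, Im; simpl. ring.
  - split; [assumption|].
    pose proof (gegenbauer_form_rec lambda u (Cconj u) n) as E.
    rewrite IH1, IH2, unit_sum, unit_prod in E.
    assert (HN : RtoC (INR (S (S n))) <> 0%C) by (apply RtoC_neq_0, not_0_INR; lia).
    assert (E' : gegenbauer_form lambda u (Cconj u) (S (S n)) =
      RtoC (((lambda + INR (S n)) * (2 * r) * a (S n) - (2 * lambda + INR n) * a n) / INR (S (S n)))).
    { rewrite RtoC_div by (apply not_0_INR; lia). rewrite RtoC_minus, !RtoC_mult, <- (Cmult_1_r (RtoC (2 * lambda + INR n))).
      rewrite <- RtoC_mult, <- E. field. exact HN. }
    unfold a at 1. rewrite E'. reflexivity.
Qed.

Lemma gegenbauer_coef_rec n :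
  INR (S (S n)) * a (S (S n)) = 2 * (lambda + INR (S n)) * r * a (S n) - (2 * lambda + INR n) * a n.
Proof.
  pose proof (gegenbauer_form_rec lambda u (Cconj u) n) as E.
  rewrite !gegenbauer_form_real, unit_sum, unit_prod, Cmult_1_r, <- !RtoC_mult, <- RtoC_minus in E.
  apply (f_equal Re) in E. change (INR (S (S n)) * a (S (S n)) = (lambda + INR (S n)) * (2 * r) * a (S n) - (2 * lambda + INR n) * a n) in E.
  rewrite E. ring.
Qed.

Lemma gegenbauer_coef_0 : a 0 = 1.
Proof. unfold a, gegenbauer_form, conv, Re; simpl. ring. Qed.

Lemma gegenbauer_coef_1 : a 1 = 2 * lambda * r.
Proof. unfold a, r, gegenbauer_form, conv, Re; simpl. field. Qed.

Lemma abs_r_le_1 : Rabs r <= 1.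
Proof. rewrite <- Hu. apply Re_le_Cmod'. Qed.

Lemma gegenbauer_CV_radius : Rbar_lt 0 (CV_radius a).
Proof.
  (* With s = 2 and n + 1 <= 2^n the coefficients are at most K^2 4^n. Any positive radius suffices,
     since [gegenbauer] only uses derivatives at 0. *)
  destruct (gcoef_geometric lambda 2 Hlam ltac:(lra)) as [K [HK Hg]].
  destruct (CV_radius_bounded a) as [H _].
  apply Rbar_lt_le_trans with (/ 4); [simpl; lra|]. apply H.
  exists (K ^ 2). intros n.
  assert (Ha : Rabs (a n) <= INR (S n) * (K ^ 2 * 2 ^ n)).
  { eapply Rle_trans; [apply Re_le_Cmod'|].
    apply Cmod_gegenbauer_form_le; try assumption; [lra|]. now rewrite Cmod_conj. }
  rewrite Rabs_mult, <- RPow_abs, (Rabs_pos_eq (/ 4)) by lra.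
  assert (Hn : INR (S n) <= 2 ^ n).
  { clear. induction n as [|n IH]; [simpl; lra|]. rewrite !S_INR in *. simpl pow. pose proof (pos_INR n).
    assert (1 <= 2 ^ n) by (apply pow_R1_Rle; lra). lra. }
  assert (H4 : (/ 4) ^ n * (2 ^ n * 2 ^ n) = 1).
  { rewrite <- Rpow_mult_distr, <- Rpow_mult_distr. replace (/ 4 * (2 * 2)) with 1 by field. apply pow1. }
  assert (0 < 2 ^ n) by (apply pow_lt; lra). assert (0 < (/ 4) ^ n) by (apply pow_lt; lra).
  pose proof (pow2_ge_0 K).
  apply Rle_trans with (2 ^ n * (K ^ 2 * 2 ^ n) * (/ 4) ^ n).
  - apply Rmult_le_compat_r; [lra|]. eapply Rle_trans; [apply Ha|]. apply Rmult_le_compat_r; nra.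
  - right. replace (2 ^ n * (K ^ 2 * 2 ^ n) * (/ 4) ^ n) with (K ^ 2 * ((/ 4) ^ n * (2 ^ n * 2 ^ n))) by ring. rewrite H4. ring.
Qed.

Let Q (t : R) := 1 - 2 * r * t + t ^ 2.

(** Compared coefficient by coefficient, this differential equation is the recurrence
    [gegenbauer_coef_rec] together with the first two coefficients. *)
Lemma gegenbauer_ode t : Rbar_lt (Rabs t) (CV_radius a) ->
  Q t * PSeries (PS_derive a) t = 2 * lambda * (r - t) * PSeries a t.
Proof.
  intros Ht.
  assert (Ea : is_pseries a t (PSeries a t)) by (apply PSeries_correct, CV_radius_inside, Ht).
  assert (Ec : is_pseries (PS_derive a) t (PSeries (PS_derive a) t)) by (apply PSeries_correct, ex_pseries_derive, Ht).
  set (A := PSeries a t) in *. set (D := PSeries (PS_derive a) t) in *.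
  assert (Hcomm : forall x : R, mult t x = mult x t) by (intros; apply Rmult_comm).
  pose proof (is_pseries_incr_1 _ _ _ Ec) as E1. pose proof (is_pseries_incr_1 _ _ _ E1) as E2.
  pose proof (is_pseries_incr_1 _ _ _ Ea) as F1.
  pose proof (is_pseries_plus _ _ _ _ _ (is_pseries_plus _ _ _ _ _ Ec (is_pseries_scal (- (2 * r)) _ _ _ (Hcomm _) E1)) E2) as L.
  pose proof (is_pseries_plus _ _ _ _ _ (is_pseries_scal (2 * lambda * r) _ _ _ (Hcomm _) Ea) (is_pseries_scal (- (2 * lambda)) _ _ _ (Hcomm _) F1)) as Rr.
  assert (EE : forall n, PS_plus (PS_plus (PS_derive a) (PS_scal (- (2 * r)) (PS_incr_1 (PS_derive a)))) (PS_incr_1 (PS_incr_1 (PS_derive a))) n =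
     PS_plus (PS_scal (2 * lambda * r) a) (PS_scal (- (2 * lambda)) (PS_incr_1 a)) n).
  { intros n. unfold PS_plus, PS_scal, PS_incr_1, PS_derive, plus, scal, zero; simpl. unfold mult; simpl.
    destruct n as [|[|n]].
    - rewrite gegenbauer_coef_1, gegenbauer_coef_0. simpl. ring.
    - pose proof (gegenbauer_coef_rec 0) as R0. rewrite gegenbauer_coef_1, gegenbauer_coef_0 in *. simpl INR in *. simpl. lra.
    - pose proof (gegenbauer_coef_rec (S n)) as R0. rewrite !S_INR in *. simpl.
      replace (match n with 0%nat => 1 | S _ => INR n + 1 end) with (INR n + 1) by (destruct n; simpl; ring). lra. }
  pose proof (is_pseries_unique _ _ _ L) as U1. pose proof (is_pseries_unique _ _ _ Rr) as U2.
  rewrite (PSeries_ext _ _ t EE), U2 in U1.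
  unfold plus, scal in U1; simpl in U1; unfold mult in U1; simpl in U1.
  unfold Q. rewrite <- (Rplus_0_r (_ * D)).
  etransitivity; [|symmetry; etransitivity; [|exact U1]]; ring.
Qed.

Lemma Q_pos t : Rabs t < / 2 -> 0 < Q t.
Proof.
  intros Ht. unfold Q. pose proof abs_r_le_1 as H.
  assert (Rabs (r * t) <= Rabs t).
  { rewrite Rabs_mult. pose proof (Rabs_pos t). nra. }
  pose proof (Rle_abs (r * t)). pose proof (pow2_ge_0 t). lra.
Qed.

(** By [gegenbauer_ode] the product of the series with Q^lambda has derivative 0 and equals 1 at 0.
    For |t| < 1/2 the base Q is positive, so [Rpower] behaves as a power. *)
Lemma gegenbauer_generating t : Rabs t < / 2 -> Rbar_lt (Rabs t) (CV_radius a) ->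
  PSeries a t = Rpower (Q t) (- lambda).
Proof.
  intros Ht Hc.
  set (Y := fun s => PSeries a s * Rpower (Q s) lambda).
  assert (HY : forall s, Rabs s <= Rabs t -> is_derive Y s 0).
  { intros s Hs.
    assert (Hs1 : Rabs s < / 2) by lra.
    assert (Hs2 : Rbar_lt (Rabs s) (CV_radius a)) by (apply Rbar_le_lt_trans with (Rabs t); assumption).
    pose proof (Q_pos s Hs1) as HQ.
    assert (DQ : is_derive (fun s => Rpower (Q s) lambda) s (lambda * (- 2 * r + 2 * s) / Q s * Rpower (Q s) lambda)).
    { unfold Rpower, Q. auto_derive.
      - fold (Q s). unfold Q in HQ. simpl in HQ. lra.
      - unfold Q in HQ. simpl in *. unfold Rminus in *. field. lra. }
    evar_last.
    - apply (is_derive_mult (K := R_AbsRing) (PSeries a) (fun s => Rpower (Q s) lambda)); [apply is_derive_PSeries, Hs2|exact DQ|intros; apply Rmult_comm].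
    - unfold plus, mult; simpl.
      assert (E : PSeries (PS_derive a) s = 2 * lambda * (r - s) * PSeries a s / Q s).
      { apply (Rmult_eq_reg_l (Q s)); [|lra]. rewrite gegenbauer_ode by assumption. field. lra. }
      rewrite E. field. lra. }
  assert (EY : Y t = Y 0).
  { destruct (Rtotal_order t 0) as [H|[H|H]].
    - apply (eq_is_derive (V := R_NormedModule) Y t 0); [|assumption].
      intros s Hs. apply HY. rewrite (Rabs_left1 t), (Rabs_left1 s); lra.
    - now rewrite H.
    - symmetry. apply (eq_is_derive (V := R_NormedModule) Y 0 t); [|assumption].
      intros s Hs. apply HY. rewrite (Rabs_pos_eq t), (Rabs_pos_eq s); lra. }
  unfold Y in EY. rewrite PSeries_0, gegenbauer_coef_0 in EY.
  replace (Q 0) with 1 in EY by (unfold Q; ring).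
  unfold Rpower in EY at 2. rewrite ln_1, Rmult_0_r, exp_0 in EY.
  rewrite Rpower_Ropp. assert (0 < Rpower (Q t) lambda) by apply exp_pos.
  apply (Rmult_eq_reg_r (Rpower (Q t) lambda)); [|lra]. rewrite EY. field. lra.
Qed.

Lemma gegenbauer_eq n : RtoC (gegenbauer lambda n r) = gegenbauer_form lambda u (Cconj u) n.
Proof.
  rewrite gegenbauer_form_real. f_equal. unfold gegenbauer.
  rewrite (Derive_n_ext_loc _ (PSeries a)).
  - rewrite Derive_n_coef by apply gegenbauer_CV_radius. field. apply INR_fact_neq_0.
  - pose proof gegenbauer_CV_radius as HR.
    assert (Hd : exists d : posreal, d <= / 2 /\ Rbar_le d (CV_radius a)).
    { destruct (CV_radius a) as [x| |]; simpl in *.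
      - assert (Hm : 0 < Rmin x (/ 2)) by (apply Rmin_pos; lra). exists (mkposreal _ Hm). simpl.
        split; [apply Rmin_r|apply Rmin_l].
      - exists (mkposreal (/ 2) ltac:(lra)). simpl. split; [lra|exact I].
      - contradiction. }
    destruct Hd as [d [Hd1 Hd2]]. exists d. intros t Ht. change (Rabs (t - 0) < d) in Ht.
    rewrite Rminus_0_r in Ht. symmetry. apply gegenbauer_generating; [lra|].
    apply Rbar_lt_le_trans with d; [exact Ht|assumption].
Qed.

End GegenbauerSeries.

(** * Expansions to second order *)

(* [F s = F 0 + s F' + O(s^2)] for [|s| <= d], with one constant [A] bounding the
   value, the derivative and the remainder, so that it survives summation. *)
Definition quad_at (d A : R) (F : R -> C) (F' : C) : Prop :=
  Cmod (F 0) <= A /\ Cmod F' <= A /\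
  forall s, Rabs s <= d -> Cmod (F s - F 0 - RtoC s * F') <= A * s ^ 2.

Lemma quad_at_nonneg d A F F' : quad_at d A F F' -> 0 <= A.
Proof. intros [H _]. pose proof (Cmod_ge_0 (F 0)). lra. Qed.

Lemma quad_at_mono d A B F F' : A <= B -> quad_at d A F F' -> quad_at d B F F'.
Proof.
  intros H [H1 [H2 H3]]. split; [lra|]. split; [lra|]. intros s Hs. specialize (H3 s Hs).
  pose proof (pow2_ge_0 s). nra.
Qed.

Lemma quad_at_ext d A F G F' : (forall s, Rabs s <= d -> F s = G s) -> 0 <= d -> quad_at d A F F' -> quad_at d A G F'.
Proof.
  intros E Hd [H1 [H2 H3]]. assert (E0 : F 0 = G 0) by (apply E; rewrite Rabs_R0; assumption).
  split; [now rewrite <- E0|]. split; [assumption|]. intros s Hs. rewrite <- E0, <- E by assumption. auto.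
Qed.

Lemma quad_at_increment d A F F' s : d <= 1 -> quad_at d A F F' -> Rabs s <= d ->
  Cmod (F s - F 0) <= 2 * A * Rabs s.
Proof.
  intros Hd HF Hs. pose proof (quad_at_nonneg _ _ _ _ HF). destruct HF as [H1 [H2 H3]]. specialize (H3 s Hs).
  pose proof (Cmod_sub_triangle (F s - F 0) (RtoC s * F') 0) as T.
  replace (F s - F 0 - 0)%C with (F s - F 0)%C in T by ring.
  replace (RtoC s * F' - 0)%C with (RtoC s * F')%C in T by ring.
  rewrite Cmod_mult, Cmod_R in T. pose proof (Rabs_pos s). rewrite <- pow2_abs in H3.
  assert (Rabs s * Cmod F' <= Rabs s * A) by (apply Rmult_le_compat_l; assumption).
  assert (A * Rabs s ^ 2 <= A * Rabs s) by (apply Rmult_le_compat_l; [assumption|nra]). lra.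
Qed.

Lemma quad_at_bound d A F F' s : d <= 1 -> quad_at d A F F' -> Rabs s <= d -> Cmod (F s) <= 3 * A.
Proof.
  intros Hd HF Hs. pose proof (quad_at_increment d A F F' s Hd HF Hs). pose proof (quad_at_nonneg _ _ _ _ HF).
  destruct HF as [H1 _]. replace (F s) with ((F s - F 0) + F 0)%C by ring.
  eapply Rle_trans; [apply Cmod_triangle|]. pose proof (Rabs_pos s). nra.
Qed.

Lemma quad_at_linear d (z0 x : C) : quad_at d (Cmod z0 + Cmod x) (fun s => z0 + RtoC s * x)%C x.
Proof.
  pose proof (Cmod_ge_0 z0). pose proof (Cmod_ge_0 x). split; [|split].
  - replace (z0 + 0 * x)%C with z0 by ring. lra.
  - lra.
  - intros s Hs. replace (z0 + s * x - (z0 + 0 * x) - s * x)%C with (RtoC 0) by ring. rewrite Cmod_0.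
    pose proof (pow2_ge_0 s). nra.
Qed.

Lemma quad_at_plus d A B F G F' G' : quad_at d A F F' -> quad_at d B G G' ->
  quad_at d (A + B) (fun s => F s + G s)%C (F' + G')%C.
Proof.
  intros [H1 [H2 H3]] [H4 [H5 H6]]. split; [|split].
  - eapply Rle_trans; [apply Cmod_triangle|lra].
  - eapply Rle_trans; [apply Cmod_triangle|lra].
  - intros s Hs. replace (F s + G s - (F 0 + G 0) - s * (F' + G'))%C with
      ((F s - F 0 - s * F') + (G s - G 0 - s * G'))%C by ring.
    eapply Rle_trans; [apply Cmod_triangle|]. specialize (H3 s Hs). specialize (H6 s Hs). lra.
Qed.

Lemma quad_at_scal d A c F F' : quad_at d A F F' -> quad_at d (Cmod c * A) (fun s => c * F s)%C (c * F')%C.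
Proof.
  intros [H1 [H2 H3]]. pose proof (Cmod_ge_0 c). split; [|split].
  - rewrite Cmod_mult. now apply Rmult_le_compat_l.
  - rewrite Cmod_mult. now apply Rmult_le_compat_l.
  - intros s Hs. replace (c * F s - c * F 0 - s * (c * F'))%C with (c * (F s - F 0 - s * F'))%C by ring.
    rewrite Cmod_mult, Rmult_assoc. apply Rmult_le_compat_l; auto.
Qed.

(** 6 = 1 + 1 + 4: the two remainders, and the product of two increments of size 2 A |s| and 2 B
    |s|. *)
Lemma quad_at_mult d A B F G F' G' : d <= 1 -> quad_at d A F F' -> quad_at d B G G' ->
  quad_at d (6 * A * B) (fun s => F s * G s)%C (F' * G 0%R + F 0%R * G')%C.
Proof.
  intros Hd HF HG. pose proof (quad_at_nonneg _ _ _ _ HF) as HA. pose proof (quad_at_nonneg _ _ _ _ HG) as HB.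
  pose proof (fun s => quad_at_increment d A F F' s Hd HF) as IF.
  pose proof (fun s => quad_at_increment d B G G' s Hd HG) as IG.
  destruct HF as [H1 [H2 H3]]. destruct HG as [H4 [H5 H6]].
  assert (P : forall x y (X Y : C), Cmod X <= x -> Cmod Y <= y -> Cmod (X * Y) <= x * y).
  { intros. rewrite Cmod_mult. apply Rmult_le_compat; try apply Cmod_ge_0; assumption. }
  assert (0 <= A * B) by (now apply Rmult_le_pos).
  split; [|split].
  - eapply Rle_trans; [apply (P A B); assumption|]. lra.
  - eapply Rle_trans; [apply Cmod_triangle|].
    pose proof (P A B _ _ H2 H4). pose proof (P A B _ _ H1 H5). lra.
  - intros s Hs. specialize (H3 s Hs). specialize (H6 s Hs). specialize (IF s Hs). specialize (IG s Hs).
    replace (F s * G s - F 0%R * G 0%R - s * (F' * G 0%R + F 0%R * G'))%C with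
      ((F s - F 0%R - s * F') * G 0%R + F 0%R * (G s - G 0%R - s * G') + (F s - F 0%R) * (G s - G 0%R))%C by ring.
    eapply Rle_trans; [apply Cmod_triangle|]. eapply Rle_trans; [apply Rplus_le_compat_r, Cmod_triangle|].
    pose proof (P _ _ _ _ H3 H4). pose proof (P _ _ _ _ H1 H6). pose proof (P _ _ _ _ IF IG).
    replace (2 * A * Rabs s * (2 * B * Rabs s)) with (4 * A * B * Rabs s ^ 2) in H8 by ring.
    rewrite pow2_abs in H8. lra.
Qed.

Lemma quad_at_csum d A (F : nat -> R -> C) (F' : nat -> C) n : 0 <= A ->
  (forall k, (k < n)%nat -> quad_at d A (F k) (F' k)) ->
  quad_at d (INR n * A) (fun s => csum (fun k => F k s) n) (csum F' n).
Proof.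
  intros HA H. induction n as [|n IH].
  - simpl. split; [|split]; intros; rewrite ?Cmod_0; try lra.
    replace (0 - 0 - s * 0)%C with (RtoC 0) by ring. rewrite Cmod_0. lra.
  - rewrite S_INR. replace ((INR n + 1) * A) with (INR n * A + A) by ring. cbn [csum].
    apply quad_at_plus; [apply IH; intros; apply H; lia|apply H; lia].
Qed.

Lemma quad_at_conj d A F F' : quad_at d A F F' -> quad_at d A (fun s => Cconj (F s)) (Cconj F').
Proof.
  intros [H1 [H2 H3]]. split; [|split]; rewrite ?Cmod_conj; try assumption.
  intros s Hs. replace (Cconj (F s) - Cconj (F 0) - s * Cconj F')%C with (Cconj (F s - F 0 - s * F')).
  - rewrite Cmod_conj. auto.
  - apply C_ext; unfold Re, Im; simpl; ring.
Qed.

(** The derivative is given logarithmically as w u. Since |u| = 1, powers of u do not grow, and the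
    constant is only quadratic in n where [quad_at_mult] would give an exponential one. *)
Lemma quad_at_unit_pow d A u w n : d <= 1 -> quad_at d A u (w * u 0%R)%C ->
  (forall s, Rabs s <= d -> Cmod (u s) = 1) -> Cmod (u 0) = 1 ->
  quad_at d (INR (S n) ^ 2 * (1 + A + 2 * A ^ 2)) (fun s => u s ^ n)%C (w * (RtoC (INR n) * u 0%R ^ n))%C.
Proof.
  intros Hd Hu Hunit Hu0. pose proof (quad_at_nonneg _ _ _ _ Hu) as HA.
  pose proof (fun s => quad_at_increment d A u _ s Hd Hu) as IU. destruct Hu as [H1 [H2 H3]].
  assert (Hw : Cmod w <= A) by (rewrite Cmod_mult, Hu0 in H2; lra).
  pose proof (Cmod_ge_0 w). pose proof (pos_INR n). rewrite S_INR.
  assert (HA2 : 0 <= A ^ 2) by apply pow2_ge_0.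
  assert (Hn2 : 1 <= (INR n + 1) ^ 2) by nra.
  split; [|split].
  - rewrite Cmod_pow, Hu0, pow1. nra.
  - rewrite !Cmod_mult, Cmod_pow, Hu0, pow1, Cmod_R, Rabs_pos_eq by assumption.
    apply Rle_trans with (A * INR n); [nra|].
    assert (INR n <= (INR n + 1) ^ 2) by nra.
    apply Rle_trans with ((INR n + 1) ^ 2 * A); [nra|]. apply Rmult_le_compat_l; lra.
  - intros s Hs.
    assert (E : Cmod (u s ^ n - u 0%R ^ n - s * (w * (RtoC (INR n) * u 0%R ^ n))) <= INR n ^ 2 * (A + 2 * A ^ 2) * s ^ 2).
    { clear Hn2 H0. induction n as [|n IH].
      - simpl. replace (1 - 1 - s * (w * (0 * 1)))%C with (RtoC 0) by ring. rewrite Cmod_0. lra.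
      - rewrite S_INR, RtoC_plus. cbn [Cpow].
        replace (u s * u s ^ n - u 0%R * u 0%R ^ n - s * (w * ((RtoC (INR n) + 1) * (u 0%R * u 0%R ^ n))))%C with
         (u s * (u s ^ n - u 0%R ^ n - s * (w * (RtoC (INR n) * u 0%R ^ n)))
          + u 0%R ^ n * (u s - u 0%R - s * (w * u 0%R))
          + s * (w * (RtoC (INR n) * u 0%R ^ n)) * (u s - u 0%R))%C by ring.
        eapply Rle_trans; [apply Cmod_triangle|]. eapply Rle_trans; [apply Rplus_le_compat_r, Cmod_triangle|].
        rewrite !Cmod_mult, !Cmod_pow, Hu0, pow1, !Cmod_R, Hunit by assumption.
        pose proof (pos_INR n) as Hn. rewrite (Rabs_pos_eq (INR n)) by assumption.
        specialize (H3 s Hs). specialize (IU s Hs). rewrite !Rmult_1_l, Rmult_1_r.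
        assert (B : Rabs s * (Cmod w * INR n) * Cmod (u s - u 0) <= Rabs s * (A * INR n) * (2 * A * Rabs s)).
        { pose proof (Rabs_pos s). apply Rmult_le_compat; try apply Cmod_ge_0; [| | assumption].
          - apply Rmult_le_pos; [assumption|]. now apply Rmult_le_pos.
          - apply Rmult_le_compat_l; [assumption|]. now apply Rmult_le_compat_r. }
        replace (Rabs s * (A * INR n) * (2 * A * Rabs s)) with (INR n * (2 * A ^ 2) * Rabs s ^ 2) in B by ring.
        rewrite pow2_abs in B. pose proof (pow2_ge_0 s).
        assert (0 <= A * s ^ 2) by (now apply Rmult_le_pos). assert (0 <= 2 * A ^ 2 * s ^ 2) by nra.
        replace ((INR n + 1) ^ 2 * (A + 2 * A ^ 2) * s ^ 2) with
         (INR n ^ 2 * (A + 2 * A ^ 2) * s ^ 2 + (2 * INR n + 1) * (A * s ^ 2) + (2 * INR n + 1) * (2 * A ^ 2 * s ^ 2)) by ring.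
        nra. }
    eapply Rle_trans; [apply E|]. apply Rmult_le_compat_r; [apply pow2_ge_0|].
    apply Rmult_le_compat; nra.
Qed.

(** Chain rule with constants. J need only expand within rho of l 0; the increment |l s - l 0| <= 2
    Al |s| accounts for 4 Al^2. *)
Lemma quad_at_comp d (l : R -> R) (l' Al Bd rho : R) (J : R -> C) (J1 : C) :
  d <= 1 -> 0 <= Al -> Rabs l' <= Al ->
  (forall s, Rabs s <= d -> Rabs (l s - l 0 - s * l') <= Al * s ^ 2 /\ Rabs (l s - l 0) <= rho) ->
  Cmod (J (l 0)) <= Bd -> Cmod J1 <= Bd ->
  (forall x, Rabs (x - l 0) <= rho -> Cmod (J x - J (l 0) - RtoC (x - l 0) * J1) <= Bd * (x - l 0) ^ 2) ->
  quad_at d (Bd * (1 + Al + 4 * Al ^ 2)) (fun s => J (l s)) (RtoC l' * J1)%C.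
Proof.
  intros Hd HAl Hl' Hl HJ0 HJ1 HJ.
  assert (HB : 0 <= Bd) by (pose proof (Cmod_ge_0 J1); lra). pose proof (pow2_ge_0 Al) as HA2.
  split; [|split].
  - nra.
  - rewrite Cmod_mult, Cmod_R. pose proof (Rabs_pos l'). pose proof (Cmod_ge_0 J1).
    apply Rle_trans with (Al * Bd); [apply Rmult_le_compat; assumption|]. nra.
  - intros s Hs. destruct (Hl s Hs) as [L1 L2]. specialize (HJ (l s) L2).
    replace (J (l s) - J (l 0) - s * (RtoC l' * J1))%C with
      ((J (l s) - J (l 0) - RtoC (l s - l 0) * J1) + RtoC (l s - l 0 - s * l') * J1)%C.
    2:{ rewrite !RtoC_minus, RtoC_mult. ring. }
    eapply Rle_trans; [apply Cmod_triangle|]. rewrite Cmod_mult, Cmod_R.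
    assert (L3 : Rabs (l s - l 0) <= 2 * Al * Rabs s).
    { replace (l s - l 0) with ((l s - l 0 - s * l') + s * l') by ring.
      eapply Rle_trans; [apply Rabs_triang|]. rewrite Rabs_mult. pose proof (Rabs_pos s). rewrite <- pow2_abs in L1.
      assert (Rabs s * Rabs l' <= Rabs s * Al) by (now apply Rmult_le_compat_l).
      assert (Al * Rabs s ^ 2 <= Al * Rabs s) by (apply Rmult_le_compat_l; nra). lra. }
    assert (L4 : (l s - l 0) ^ 2 <= 4 * Al ^ 2 * s ^ 2).
    { rewrite <- (pow2_abs (l s - l 0)), <- (pow2_abs s).
      replace (4 * Al ^ 2 * Rabs s ^ 2) with ((2 * Al * Rabs s) ^ 2) by ring. apply pow_incr. split; [apply Rabs_pos|assumption]. }
    assert (Rabs (l s - l 0 - s * l') * Cmod J1 <= Al * s ^ 2 * Bd).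
    { apply Rmult_le_compat; try assumption; [apply Rabs_pos|apply Cmod_ge_0]. }
    assert (Bd * (l s - l 0) ^ 2 <= Bd * (4 * Al ^ 2 * s ^ 2)) by (now apply Rmult_le_compat_l).
    pose proof (pow2_ge_0 s). assert (0 <= Bd * s ^ 2) by (now apply Rmult_le_pos). nra.
Qed.

Lemma exp_expansion (k l0 rho : R) : exists Bd, 0 <= Bd /\
  Cmod (RtoC (exp (k * l0))) <= Bd /\ Cmod (RtoC (k * exp (k * l0))) <= Bd /\
  forall x, Rabs (x - l0) <= rho ->
    Cmod (RtoC (exp (k * x)) - RtoC (exp (k * l0)) - RtoC (x - l0) * RtoC (k * exp (k * l0))) <= Bd * (x - l0) ^ 2.
Proof.
  set (E := exp (k * l0)). assert (HE : 0 < E) by apply exp_pos.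
  exists (E * (1 + Rabs k + k ^ 2 * exp (Rabs k * rho))).
  pose proof (Rabs_pos k). pose proof (exp_pos (Rabs k * rho)). pose proof (pow2_ge_0 k).
  assert (0 <= k ^ 2 * exp (Rabs k * rho)) by nra.
  split; [nra|]. split; [rewrite Cmod_R, Rabs_pos_eq; nra|].
  split; [rewrite Cmod_R, Rabs_mult, (Rabs_pos_eq E); nra|].
  intros x Hx. set (w := RtoC (k * (x - l0))).
  replace (RtoC (exp (k * x)) - RtoC E - RtoC (x - l0) * RtoC (k * E))%C with (RtoC E * (Cexp w - 1 - w))%C.
  2:{ unfold w. rewrite Cexp_R. replace (exp (k * x)) with (E * exp (k * (x - l0))) by (unfold E; rewrite <- exp_plus; f_equal; ring).
      rewrite !RtoC_mult, !RtoC_minus. ring. }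
  rewrite Cmod_mult, Cmod_R, (Rabs_pos_eq E), Rmult_assoc by lra. apply Rmult_le_compat_l; [lra|].
  eapply Rle_trans; [apply Cexp_sub_1_sub_le|]. unfold w. rewrite Cmod_R, Rabs_mult, Rpow_mult_distr, !pow2_abs.
  apply Rle_trans with (k ^ 2 * (x - l0) ^ 2 * exp (Rabs k * rho)).
  - apply Rmult_le_compat_l; [apply Rmult_le_pos; apply pow2_ge_0|]. apply exp_le. now apply Rmult_le_compat_l.
  - pose proof (pow2_ge_0 (x - l0)). nra.
Qed.

(** * Expansions along a line through z *)

Lemma zzbar_Cmod z : zzbar z = Cmod z ^ 2.
Proof. unfold zzbar. rewrite <- Cmod2_conj. reflexivity. Qed.

Definition line_at (z0 x : C) (s : R) : C := (z0 + RtoC s * x)%C.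

Lemma log_expansion (z0 x : C) : z0 <> 0%C ->
  exists d A, 0 < d <= 1 /\ 0 <= A /\ Rabs (2 * Re (x / z0)) <= A /\
   forall s, Rabs s <= d -> line_at z0 x s <> 0%C /\
     Rabs (ln (zzbar (line_at z0 x s)) - ln (zzbar z0) - s * (2 * Re (x / z0))) <= A * s ^ 2.
Proof.
  intros Hz. set (q := (x / z0)%C). pose proof (Cmod_ge_0 q) as Hq.
  (* This d gives |s q| <= 1/4. With p = 2 s Re q + |s q|^2 and |p| <= 3 |s q|, [ln_1_add_ge] yields
     the error 1 + 4 * 9 = 37 times |s q|^2; the term 2 |q| covers the first derivative. *)
  exists (/ (4 * (Cmod q + 1))), (37 * Cmod q ^ 2 + 2 * Cmod q).
  assert (Hd : 0 < / (4 * (Cmod q + 1)) <= 1).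
  { split; [apply Rinv_0_lt_compat; lra|]. rewrite <- Rinv_1. apply Rinv_le_contravar; lra. }
  split; [exact Hd|]. split; [nra|]. split.
  { rewrite Rabs_mult, (Rabs_pos_eq 2) by lra. pose proof (Re_le_Cmod' q). nra. }
  intros s Hs.
  assert (Hsq : Rabs s * Cmod q <= 1 / 4).
  { apply Rle_trans with (/ (4 * (Cmod q + 1)) * (Cmod q + 1)); [pose proof (Rabs_pos s); nra|]. right. field. lra. }
  set (v := (RtoC s * q)%C).
  assert (Hv : Cmod v = Rabs s * Cmod q) by (unfold v; now rewrite Cmod_mult, Cmod_R).
  assert (E : line_at z0 x s = (z0 * (1 + v))%C) by (unfold line_at, v, q; field; assumption).
  assert (H1 : 3 / 4 <= Cmod (1 + v)) by (pose proof (Cmod_add_ge 1 v); rewrite Cmod_1 in H; lra).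
  assert (Hz0 : 0 < Cmod z0) by now apply Cmod_gt_0.
  assert (H1v : (1 + v)%C <> 0%C) by (apply Cmod_gt_0; lra).
  split; [rewrite E; now apply Cmult_neq_0|].
  rewrite E, !zzbar_Cmod, Cmod_mult, Rpow_mult_distr, ln_mult by nra.
  assert (E2 : Cmod (1 + v) ^ 2 = 1 + (2 * Re v + Cmod v ^ 2)) by (rewrite <- Cmod_1_add_sqr; ring).
  rewrite E2. set (p := 2 * Re v + Cmod v ^ 2).
  assert (ER : Re v = s * Re q) by (unfold v, Re; simpl; ring).
  pose proof (Re_le_Cmod' v) as HRv. pose proof (Cmod_ge_0 v) as Hv0.
  apply Rabs_le_between in HRv.
  assert (Hp : Rabs p <= 3 * Cmod v) by (unfold p; apply Rabs_le; split; nra).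
  pose proof (proj1 (Rabs_le_between _ _) Hp) as Hp'.
  pose proof (ln_1_add_ge p ltac:(lra)) as L1. pose proof (ln_le_sub_1 (1 + p) ltac:(lra)) as L2.
  assert (Hp2 : p ^ 2 <= 9 * Cmod v ^ 2).
  { rewrite <- (pow2_abs p). pose proof (Rabs_pos p). nra. }
  assert (Hv2 : Cmod v ^ 2 = s ^ 2 * Cmod q ^ 2) by (rewrite Hv, Rpow_mult_distr, pow2_abs; reflexivity).
  pose proof (pow2_ge_0 s). assert (0 <= s ^ 2 * Cmod q) by (now apply Rmult_le_pos).
  assert (0 <= s ^ 2 * Cmod q ^ 2) by (rewrite <- Hv2; apply pow2_ge_0).
  unfold p in *. rewrite ER in *. apply Rabs_le. split; nra.
Qed.

(** This is z/|z| for z <> 0 by [exp_half_log]; written through ln (z zbar) it can be expanded by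
    [quad_at_comp]. *)
Definition unit_of (z : C) : C := (z * RtoC (exp (- / 2 * ln (zzbar z))))%C.

Lemma exp_half_log (z : C) : z <> 0%C -> exp (- / 2 * ln (zzbar z)) = / Cmod z.
Proof.
  intros Hz. apply Cmod_gt_0 in Hz. rewrite zzbar_Cmod.
  replace (Cmod z ^ 2) with (Cmod z * Cmod z) by ring. rewrite ln_mult by assumption.
  replace (- / 2 * (ln (Cmod z) + ln (Cmod z))) with (- ln (Cmod z)) by field.
  now rewrite exp_Ropp, exp_ln.
Qed.

Lemma unit_of_Cmod (z : C) : z <> 0%C -> Cmod (unit_of z) = 1.
Proof.
  intros Hz. unfold unit_of. rewrite Cmod_mult, exp_half_log, Cmod_R by assumption.
  apply Cmod_gt_0 in Hz. rewrite Rabs_pos_eq by (left; now apply Rinv_0_lt_compat). field. lra.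
Qed.

Lemma line_at_0 z0 x : line_at z0 x 0 = z0.
Proof. unfold line_at. ring. Qed.

Lemma add_conj (q : C) : (q + Cconj q)%C = RtoC (2 * Re q).
Proof. apply C_ext; unfold Re, Im; simpl; ring. Qed.

(* Derivative of the argument along the line, times i. *)
Definition ang_speed (z0 x : C) : C := ((x / z0 - Cconj (x / z0)) / 2)%C.

Lemma ang_speed_conj z0 x : Cconj (ang_speed z0 x) = (- ang_speed z0 x)%C.
Proof. unfold ang_speed. generalize (x / z0)%C. intros q. apply C_ext; unfold Re, Im, Cdiv; simpl; field. Qed.

Lemma line_data (z0 x : C) (rho : R) : z0 <> 0%C -> 0 < rho ->
  exists d A Al, 0 < d <= 1 /\ 0 <= Al /\ Rabs (2 * Re (x / z0)) <= Al /\
    (forall s, Rabs s <= d -> line_at z0 x s <> 0%C) /\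
    (forall s, Rabs s <= d ->
      Rabs (ln (zzbar (line_at z0 x s)) - ln (zzbar (line_at z0 x 0)) - s * (2 * Re (x / z0))) <= Al * s ^ 2 /\
      Rabs (ln (zzbar (line_at z0 x s)) - ln (zzbar (line_at z0 x 0))) <= rho) /\
    quad_at d A (fun s => unit_of (line_at z0 x s)) (ang_speed z0 x * unit_of (line_at z0 x 0))%C.
Proof.
  intros Hz Hrho. destruct (log_expansion z0 x Hz) as [d [Al [Hd [HAl [Hl' H]]]]].
  set (l := fun s => ln (zzbar (line_at z0 x s))).
  (* Since |l s - l 0| <= 2 Al |s|, the logarithm stays within rho, the range in which the contour
     integrals are expanded. *)
  set (d' := Rmin d (rho / (2 * Al + 1))).
  assert (Hr : 0 < rho / (2 * Al + 1)) by (apply Rdiv_lt_0_compat; lra).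
  pose proof (Rmin_l d (rho / (2 * Al + 1))) as Hd1. pose proof (Rmin_r d (rho / (2 * Al + 1))) as Hd2.
  fold d' in Hd1, Hd2. assert (Hd' : 0 < d') by (apply Rmin_pos; lra).
  assert (Hl : forall s, Rabs s <= d' -> Rabs (l s - l 0 - s * (2 * Re (x / z0))) <= Al * s ^ 2 /\ Rabs (l s - l 0) <= rho).
  { intros s Hs. destruct (H s ltac:(lra)) as [_ L1]. unfold l. rewrite line_at_0. split; [assumption|].
    replace (ln (zzbar (line_at z0 x s)) - ln (zzbar z0)) with
      ((ln (zzbar (line_at z0 x s)) - ln (zzbar z0) - s * (2 * Re (x / z0))) + s * (2 * Re (x / z0))) by ring.
    eapply Rle_trans; [apply Rabs_triang|]. rewrite Rabs_mult. pose proof (Rabs_pos s) as Hs0.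
    rewrite <- pow2_abs in L1.
    assert (Rabs s * Rabs (2 * Re (x / z0)) <= Rabs s * Al) by (now apply Rmult_le_compat_l).
    assert (Al * Rabs s ^ 2 <= Al * Rabs s) by (apply Rmult_le_compat_l; nra).
    assert (Rabs s * (2 * Al + 1) <= rho).
    { apply Rmult_le_compat_r with (r := 2 * Al + 1) in Hd2; [|lra].
      replace (rho / (2 * Al + 1) * (2 * Al + 1)) with rho in Hd2 by (field; lra). nra. }
    lra. }
  destruct (exp_expansion (- / 2) (l 0) rho) as [Bd [HBd [B1 [B2 B3]]]].
  pose proof (quad_at_comp d' l (2 * Re (x / z0)) Al Bd rho (fun y => RtoC (exp (- / 2 * y)))
    (RtoC (- / 2 * exp (- / 2 * l 0))) ltac:(lra) HAl Hl' Hl B1 B2 B3) as QE.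
  pose proof (quad_at_mult d' _ _ _ _ _ _ ltac:(lra) (quad_at_linear d' z0 x) QE) as Q.
  exists d'. eexists. exists Al. split; [lra|]. split; [assumption|]. split; [assumption|].
  split; [intros s Hs; apply H; lra|]. split; [exact Hl|].
  replace (ang_speed z0 x * unit_of (line_at z0 x 0))%C with
    (x * RtoC (exp (- / 2 * l 0)) + (z0 + 0 * x) * (RtoC (2 * Re (x / z0)) * RtoC (- / 2 * exp (- / 2 * l 0))))%C.
  - exact Q.
  - rewrite <- add_conj, line_at_0. unfold unit_of, l. rewrite line_at_0, RtoC_mult.
    replace (RtoC (- / 2)) with (- (1 / 2))%C by (apply C_ext; simpl; field).
    unfold ang_speed. set (e := RtoC (exp _)). set (q' := Cconj (x / z0)). field. assumption.
Qed.

(* The factor of the n-th ladder term that depends on u = z/|z|, and its image under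
   u d/du - ubar d/dubar. *)
Definition ang (lambda : R) (n : nat) (u : C) : C :=
  if Req_EM_T lambda 0 then match n with O => 1%C | S _ => (u ^ n + Cconj u ^ n)%C end
  else (RtoC (INR n + lambda) * gegenbauer_form lambda u (Cconj u) n)%C.

Definition dang (lambda : R) (n : nat) (u : C) : C :=
  if Req_EM_T lambda 0 then (RtoC (INR n) * (u ^ n - Cconj u ^ n))%C
  else (RtoC (INR n + lambda) * (euler_form lambda u (Cconj u) n - euler_form lambda (Cconj u) u n))%C.

Lemma gcoef_2 n : gcoef 2 n = INR n + 1.
Proof.
  induction n as [|n IH]; [simpl; ring|]. cbn [gcoef]. rewrite IH, S_INR. pose proof (pos_INR n). field. lra.
Qed.

(** Of the three factors s^k, one bounds the coefficient [gcoef] and two bound the square (k+1)^2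
    coming from [quad_at_unit_pow]. *)
Lemma quad_at_gpow d A u w lambda K s k : d <= 1 -> 0 <= lambda -> quad_at d A u (w * u 0%R)%C ->
  (forall x, Rabs x <= d -> Cmod (u x) = 1) -> Cmod (u 0) = 1 ->
  (forall k, gcoef lambda k <= K * s ^ k) -> (forall k, INR k + 1 <= K * s ^ k) -> 0 <= K -> 1 < s ->
  quad_at d (K ^ 3 * (1 + A + 2 * A ^ 2) * (s ^ 3) ^ k) (fun x => gpow lambda (u x) k) (w * (RtoC (INR k) * gpow lambda (u 0%R) k))%C.
Proof.
  intros Hd Hlam Hu H1 H2 Hg Hn HK Hs. pose proof (quad_at_nonneg _ _ _ _ Hu) as HA.
  pose proof (quad_at_scal d _ (RtoC (gcoef lambda k)) _ _ (quad_at_unit_pow d A u w k Hd Hu H1 H2)) as Q.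
  unfold gpow.
  replace (w * (RtoC (INR k) * (RtoC (gcoef lambda k) * u 0%R ^ k)))%C with (RtoC (gcoef lambda k) * (w * (RtoC (INR k) * u 0%R ^ k)))%C by ring.
  eapply quad_at_mono; [|exact Q].
  rewrite Cmod_R, Rabs_pos_eq, S_INR by now apply gcoef_nonneg.
  assert (HA1 : 0 <= 1 + A + 2 * A ^ 2) by (pose proof (pow2_ge_0 A); lra).
  assert (Hsk : 0 < s ^ k) by (apply pow_lt; lra).
  replace (K ^ 3 * (1 + A + 2 * A ^ 2) * (s ^ 3) ^ k) with ((K * s ^ k) * ((K * s ^ k) ^ 2 * (1 + A + 2 * A ^ 2))).
  - pose proof (pos_INR k). apply Rmult_le_compat; [now apply gcoef_nonneg| |apply Hg|].
    + apply Rmult_le_pos; [apply pow2_ge_0|assumption].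
    + apply Rmult_le_compat_r; [assumption|]. apply pow_incr. split; [lra|apply Hn].
  - rewrite <- !pow_mult, (Nat.mul_comm 3 k), pow_mult. ring.
Qed.

Lemma quad_at_ang d A u w lambda sigma : d <= 1 -> 0 <= d -> 0 <= lambda -> quad_at d A u (w * u 0%R)%C ->
  (forall x, Rabs x <= d -> Cmod (u x) = 1) -> Cconj w = (- w)%C -> 1 < sigma ->
  exists K, 0 <= K /\ forall n, quad_at d (K * sigma ^ n) (fun s => ang lambda n (u s)) (w * dang lambda n (u 0%R))%C.
Proof.
  intros Hd Hd0 Hlam Hu H1 Hw Hsig.
  assert (H2 : Cmod (u 0) = 1) by (apply H1; rewrite Rabs_R0; assumption).
  pose proof (quad_at_nonneg _ _ _ _ Hu) as HA.
  (* An eighth root of sigma. At most five factors s^n occur: three from [quad_at_gpow], one for n +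
     lambda and one for the n + 1 summands of the convolution. *)
  set (s := exp (ln sigma / 8)).
  assert (Hln : 0 < ln sigma) by (rewrite <- ln_1; apply ln_increasing; lra).
  assert (Hs : 1 < s) by (unfold s; rewrite <- exp_0; apply exp_increasing; lra).
  assert (Es : s ^ 8 = sigma).
  { unfold s. rewrite exp_pow_INR. replace (INR 8 * (ln sigma / 8)) with (ln sigma) by (simpl; field). apply exp_ln. lra. }
  destruct (gcoef_geometric lambda s Hlam Hs) as [K0 [HK0 Hg0]].
  destruct (gcoef_geometric 2 s ltac:(lra) Hs) as [K1 [HK1 Hg1]].
  set (K := K0 + K1).
  assert (Hg : forall k, gcoef lambda k <= K * s ^ k).
  { intros k. eapply Rle_trans; [apply Hg0|]. apply Rmult_le_compat_r; [apply pow_le; lra|unfold K; lra]. }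
  assert (Hn : forall k, INR k + 1 <= K * s ^ k).
  { intros k. rewrite <- gcoef_2. eapply Rle_trans; [apply Hg1|]. apply Rmult_le_compat_r; [apply pow_le; lra|unfold K; lra]. }
  assert (HK : 1 <= K) by (specialize (Hn 0%nat); simpl in Hn; lra).
  (* As w is imaginary, conj u rotates with the opposite speed, so the two Euler forms enter with
     opposite signs. *)
  assert (Hu' : quad_at d A (fun x => Cconj (u x)) (- w * Cconj (u 0%R))%C).
  { rewrite <- Hw. replace (Cconj w * Cconj (u 0%R))%C with (Cconj (w * u 0%R)) by (apply C_ext; unfold Re, Im; simpl; ring).
    now apply quad_at_conj. }
  assert (H1' : forall x, Rabs x <= d -> Cmod (Cconj (u x)) = 1) by (intros; rewrite Cmod_conj; auto).
  set (G := K ^ 3 * (1 + A + 2 * A ^ 2)).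
  assert (HG : 0 <= G).
  { unfold G. apply Rmult_le_pos; [apply pow_le; lra|]. pose proof (pow2_ge_0 A). lra. }
  assert (Hpow : forall m n, (m <= 8)%nat -> (s ^ m) ^ n <= sigma ^ n).
  { intros m n Hm. apply pow_incr. split; [apply pow_le; lra|]. rewrite <- Es. apply Rle_pow; [lra|assumption]. }
  unfold ang, dang. destruct (Req_EM_T lambda 0) as [El|Hl].
  - exists (2 * (K ^ 2 * (1 + A + 2 * A ^ 2))).
    assert (HB : 0 <= K ^ 2 * (1 + A + 2 * A ^ 2)).
    { apply Rmult_le_pos; [apply pow2_ge_0|]. pose proof (pow2_ge_0 A). lra. }
    split; [lra|]. intros n.
    assert (Hc : INR (S n) ^ 2 * (1 + A + 2 * A ^ 2) <= K ^ 2 * (1 + A + 2 * A ^ 2) * sigma ^ n).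
    { replace (K ^ 2 * (1 + A + 2 * A ^ 2) * sigma ^ n) with (K ^ 2 * sigma ^ n * (1 + A + 2 * A ^ 2)) by ring.
      apply Rmult_le_compat_r; [pose proof (pow2_ge_0 A); lra|].
      apply Rle_trans with ((K * s ^ n) ^ 2).
      - apply pow_incr. split; [apply pos_INR|]. rewrite S_INR. apply Hn.
      - rewrite Rpow_mult_distr. apply Rmult_le_compat_l; [apply pow2_ge_0|].
        rewrite <- pow_mult, Nat.mul_comm, pow_mult. apply Hpow. lia. }
    destruct n as [|n].
    + replace (w * (RtoC (INR 0) * (u 0%R ^ 0 - Cconj (u 0%R) ^ 0)))%C with (RtoC 0) by (simpl; ring).
      split; [|split].
      * rewrite Cmod_1. simpl in Hc. pose proof (pow2_ge_0 A). simpl. simpl in HB. nra.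
      * rewrite Cmod_0. simpl. simpl in HB. lra.
      * intros x Hx. replace (1 - 1 - x * 0)%C with (RtoC 0) by ring. rewrite Cmod_0. simpl in *. nra.
    + replace (w * (RtoC (INR (S n)) * (u 0%R ^ S n - Cconj (u 0%R) ^ S n)))%C with
       (w * (RtoC (INR (S n)) * u 0%R ^ S n) + - w * (RtoC (INR (S n)) * Cconj (u 0%R) ^ S n))%C by ring.
      eapply quad_at_mono; [|apply quad_at_plus; [apply (quad_at_unit_pow d A u w (S n)); assumption|
         apply (quad_at_unit_pow d A (fun x => Cconj (u x)) (- w)%C (S n)); try assumption]].
      * lra.
      * rewrite Cmod_conj. assumption.
  - exists ((1 + lambda) * K * (K * (6 * G ^ 2))).
    pose proof (pow2_ge_0 G) as HG2.
    split; [repeat (apply Rmult_le_pos; try lra)|]. intros n.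
    assert (Q : quad_at d (INR (S n) * (6 * G ^ 2 * (s ^ 3) ^ n)) (fun x => gegenbauer_form lambda (u x) (Cconj (u x)) n)
       (w * (euler_form lambda (u 0%R) (Cconj (u 0%R)) n - euler_form lambda (Cconj (u 0%R)) (u 0%R) n))%C).
    { replace (w * (euler_form lambda (u 0%R) (Cconj (u 0%R)) n - euler_form lambda (Cconj (u 0%R)) (u 0%R) n))%C with
       (csum (fun k => w * (RtoC (INR k) * gpow lambda (u 0%R) k) * gpow lambda (Cconj (u 0%R)) (n - k)
           + gpow lambda (u 0%R) k * (- w * (RtoC (INR (n - k)) * gpow lambda (Cconj (u 0%R)) (n - k))))%C (S n)).
      - apply (quad_at_csum d _ (fun k x => gpow lambda (u x) k * gpow lambda (Cconj (u x)) (n - k))%C).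
        + apply Rmult_le_pos; [lra|]. apply pow_le, pow_le. lra.
        + intros k Hk.
          pose proof (quad_at_gpow d A u w lambda K s k Hd Hlam Hu H1 H2 Hg Hn ltac:(lra) Hs) as Q1.
          pose proof (quad_at_gpow d A (fun x => Cconj (u x)) (- w)%C lambda K s (n - k) Hd Hlam Hu' H1' (H1' 0 ltac:(rewrite Rabs_R0; exact Hd0)) Hg Hn ltac:(lra) Hs) as Q2.
          fold G in Q1, Q2. eapply quad_at_mono; [|exact (quad_at_mult d _ _ _ _ _ _ Hd Q1 Q2)].
          right. replace ((s ^ 3) ^ n) with ((s ^ 3) ^ k * (s ^ 3) ^ (n - k)); [ring|].
          rewrite <- pow_add. f_equal. lia.
      - unfold euler_form. rewrite (conv_comm _ (gpow lambda (u 0%R))). unfold conv.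
        set (c := fun k => (RtoC (INR k) * gpow lambda (u 0%R) k * gpow lambda (Cconj (u 0%R)) (n - k))%C).
        set (c' := fun k => (gpow lambda (u 0%R) k * (RtoC (INR (n - k)) * gpow lambda (Cconj (u 0%R)) (n - k)))%C).
        rewrite (csum_ext _ (fun k => w * c k + (- w) * c' k)%C) by (intros; unfold c, c'; ring).
        rewrite csum_plus, !csum_mult. unfold c, c'. ring. }
    pose proof (quad_at_scal d _ (RtoC (INR n + lambda)) _ _ Q) as Q'.
    replace (w * (RtoC (INR n + lambda) * (euler_form lambda (u 0%R) (Cconj (u 0%R)) n - euler_form lambda (Cconj (u 0%R)) (u 0%R) n)))%C with
      (RtoC (INR n + lambda) * (w * (euler_form lambda (u 0%R) (Cconj (u 0%R)) n - euler_form lambda (Cconj (u 0%R)) (u 0%R) n)))%C by ring.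
    eapply quad_at_mono; [|exact Q'].
    pose proof (pos_INR n) as Hn0. rewrite Cmod_R, Rabs_pos_eq by lra.
    assert (Hsn : 0 < s ^ n) by (apply pow_lt; lra).
    assert (Hs3 : 0 < (s ^ 3) ^ n) by (apply pow_lt, pow_lt; lra).
    apply Rle_trans with ((1 + lambda) * (K * s ^ n) * ((K * s ^ n) * (6 * G ^ 2 * (s ^ 3) ^ n))).
    + apply Rmult_le_compat; try lra.
      * apply Rmult_le_pos; [apply pos_INR|]. apply Rmult_le_pos; lra.
      * apply Rle_trans with ((1 + lambda) * (INR n + 1)); [nra|]. apply Rmult_le_compat_l; [lra|apply Hn].
      * apply Rmult_le_compat_r; [apply Rmult_le_pos; lra|]. rewrite S_INR. apply Hn.
    + replace ((1 + lambda) * (K * s ^ n) * (K * s ^ n * (6 * G ^ 2 * (s ^ 3) ^ n))) with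
       ((1 + lambda) * K * (K * (6 * G ^ 2)) * (s ^ n * s ^ n * (s ^ 3) ^ n)) by ring.
      apply Rmult_le_compat_l; [repeat (apply Rmult_le_pos; try lra)|].
      replace (s ^ n * s ^ n * (s ^ 3) ^ n) with ((s ^ 5) ^ n); [apply Hpow; lia|].
      rewrite <- !Rpow_mult_distr. f_equal. ring.
Qed.

Lemma dang_0 lambda u : dang lambda 0 u = 0%C.
Proof.
  unfold dang. destruct (Req_EM_T lambda 0); [simpl; ring|]. unfold euler_form, conv. simpl. ring.
Qed.

(** From [euler_form_diff], or [pow_diff_form] when lambda = 0. The factor lambda, or 1, is the one
    that [ladder_prefactor_succ] accounts for through Gamma (lambda + 1) = lambda Gamma (lambda). *)
Lemma dang_succ lambda n u : 0 <= lambda ->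
  dang lambda (S n) u = ((u - Cconj u) * (RtoC (if Req_EM_T lambda 0 then 1 else lambda) * ang (lambda + 1) n u))%C.
Proof.
  intros Hlam. unfold dang, ang. destruct (Req_EM_T (lambda + 1) 0) as [E|_]; [lra|].
  destruct (Req_EM_T lambda 0) as [->|Hl].
  - rewrite pow_diff_form. replace (0 + 1) with 1 by ring. rewrite S_INR. ring.
  - rewrite euler_form_diff. replace (INR (S n) + lambda) with (INR n + (lambda + 1)) by (rewrite S_INR; ring). ring.
Qed.

(** * The ladder function *)

Definition is_Cseries (a : nat -> C) (l : C) : Prop :=
  is_series (fun n => Re (a n)) (Re l) /\ is_series (fun n => Im (a n)) (Im l).

Lemma is_Cseries_unique a l : is_Cseries a l -> CSeries a = l.
Proof. intros [H1 H2]. apply C_ext; [apply (is_series_unique _ _ H1)|apply (is_series_unique _ _ H2)]. Qed.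

Lemma is_Cseries_plus a b l m : is_Cseries a l -> is_Cseries b m -> is_Cseries (fun n => a n + b n)%C (l + m)%C.
Proof.
  intros [H1 H2] [H3 H4]. split; simpl; apply (is_series_plus (V := R_NormedModule)); assumption.
Qed.

Lemma is_Cseries_mult c a l : is_Cseries a l -> is_Cseries (fun n => c * a n)%C (c * l)%C.
Proof.
  intros [H1 H2]. split; simpl.
  - apply (is_series_minus (V := R_NormedModule)); apply (is_series_scal (V := R_NormedModule)); assumption.
  - apply (is_series_plus (V := R_NormedModule)); apply (is_series_scal (V := R_NormedModule)); assumption.
Qed.

Lemma is_Cseries_ext a b l : (forall n, a n = b n) -> is_Cseries a l -> is_Cseries b l.
Proof.
  intros E [H1 H2]. split; eapply is_series_ext; try eassumption; intros n; simpl; now rewrite E.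
Qed.

Lemma is_Cseries_cons a l : is_Cseries (fun n => a (S n)) l -> is_Cseries a (a O + l)%C.
Proof.
  intros [H1 H2]. split.
  - replace (Re (a O + l)%C) with (plus (Re l) (Re (a O))) by (unfold plus; simpl; apply Rplus_comm).
    apply (is_series_decr_1 (V := R_NormedModule)).
    replace (plus _ _) with (Re l); [exact H1|]. unfold plus, opp; simpl. ring.
  - replace (Im (a O + l)%C) with (plus (Im l) (Im (a O))) by (unfold plus; simpl; apply Rplus_comm).
    apply (is_series_decr_1 (V := R_NormedModule)).
    replace (plus _ _) with (Im l); [exact H2|]. unfold plus, opp; simpl. ring.
Qed.

Lemma geometric_sum_le (a : nat -> C) (K rho : R) n : 0 <= K -> 0 <= rho < 1 ->
  (forall n, Cmod (a n) <= K * rho ^ n) -> Cmod (csum a n) <= K / (1 - rho).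
Proof.
  intros HK Hr H.
  assert (E : Cmod (csum a n) <= K * (1 - rho ^ n) / (1 - rho)).
  { induction n as [|n IH].
    - simpl. rewrite Cmod_0. right. field. lra.
    - cbn [csum]. eapply Rle_trans; [apply Cmod_triangle|]. specialize (H n).
      replace (K * (1 - rho ^ S n) / (1 - rho)) with (K * (1 - rho ^ n) / (1 - rho) + K * rho ^ n); [lra|].
      simpl. field. lra. }
  eapply Rle_trans; [exact E|]. unfold Rdiv. apply Rmult_le_compat_r; [left; apply Rinv_0_lt_compat; lra|].
  assert (0 <= rho ^ n) by (apply pow_le; lra). nra.
Qed.

Lemma geometric_Cseries (a : nat -> C) (K rho : R) : 0 <= K -> 0 <= rho < 1 ->
  (forall n, Cmod (a n) <= K * rho ^ n) ->
  is_Cseries a (CSeries a) /\ ex_series (V := C_R_NormedModule) a /\ Cmod (CSeries a) <= K / (1 - rho).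
Proof.
  intros HK Hr H.
  assert (HG : ex_series (fun n => K * rho ^ n)).
  { apply (ex_series_scal (V := R_NormedModule)). apply ex_series_geom. rewrite Rabs_pos_eq; lra. }
  assert (HR : ex_series (fun n => Re (a n))).
  { apply (ex_series_le (V := R_CompleteNormedModule) _ (fun n => K * rho ^ n)); [|exact HG].
    intros n. eapply Rle_trans; [apply Re_le_Cmod'|apply H]. }
  assert (HI : ex_series (fun n => Im (a n))).
  { apply (ex_series_le (V := R_CompleteNormedModule) _ (fun n => K * rho ^ n)); [|exact HG].
    intros n. eapply Rle_trans; [apply Im_le_Cmod|apply H]. }
  assert (HC : is_Cseries a (CSeries a)) by (split; apply Series_correct; assumption).
  split; [exact HC|]. split.
  - apply (ex_series_le (V := C_R_CompleteNormedModule) _ (fun n => K * rho ^ n)); [|exact HG].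
    intros n. eapply Rle_trans; [|apply H]. right. apply norm_Cmod.
  - replace (CSeries a) with (CSeries a - 0)%C by ring.
    apply (is_Clim_Cmod_sub_le (fun n => csum a (S n)) _ 0 _ 0).
    + apply is_Clim_components. destruct HC as [H1 H2]. split.
      * apply (is_lim_seq_ext (sum_n (fun n => Re (a n)))); [|exact H1].
        intros n. induction n as [|n IH]; [rewrite sum_O; unfold Re; simpl; ring|].
        rewrite sum_Sn, IH. reflexivity.
      * apply (is_lim_seq_ext (sum_n (fun n => Im (a n)))); [|exact H2].
        intros n. induction n as [|n IH]; [rewrite sum_O; unfold Im; simpl; ring|].
        rewrite sum_Sn, IH. reflexivity.
    + intros n _. replace (csum a (S n) - 0)%C with (csum a (S n)) by ring. now apply geometric_sum_le.
Qed.

(** The remainders of the terms are O(s^2) with summable constants, so their sum is again O(s^2).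
    This is termwise differentiation without any uniform convergence of derivatives. *)
Lemma quad_at_CSeries d K rho (F : nat -> R -> C) (F' : nat -> C) : 0 <= d <= 1 -> 0 <= K -> 0 <= rho < 1 ->
  (forall n, quad_at d (K * rho ^ n) (F n) (F' n)) ->
  quad_at d (K / (1 - rho)) (fun s => CSeries (fun n => F n s)) (CSeries F').
Proof.
  intros Hd HK Hr H.
  assert (H0 : forall s, Rabs s <= d -> is_Cseries (fun n => F n s) (CSeries (fun n => F n s))).
  { intros s Hs. apply (geometric_Cseries _ (3 * K) rho); try lra. intros n.
    eapply Rle_trans; [apply (quad_at_bound d _ _ _ s ltac:(lra) (H n) Hs)|]. lra. }
  assert (H' := geometric_Cseries F' K rho HK Hr (fun n => proj1 (proj2 (H n)))).
  split; [|split].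
  - apply (geometric_Cseries _ K rho); try assumption. intros n. apply (H n).
  - apply H'.
  - intros s Hs.
    assert (E : is_Cseries (fun n => (F n s - F n 0%R - s * F' n))%C (CSeries (fun n => F n s) - CSeries (fun n => F n 0%R) - s * CSeries F')%C).
    { apply (is_Cseries_ext (fun n => (F n s + (- (1)) * F n 0%R) + (- RtoC s) * F' n)%C); [intros; ring|].
      replace (CSeries (fun n => F n s) - CSeries (fun n => F n 0%R) - s * CSeries F')%C with
       ((CSeries (fun n => F n s) + (- (1)) * CSeries (fun n => F n 0%R)) + (- RtoC s) * CSeries F')%C by ring.
      apply is_Cseries_plus; [apply is_Cseries_plus; [now apply H0|]|]; apply is_Cseries_mult.
      - apply H0. rewrite Rabs_R0. lra.
      - apply H'. }
    rewrite <- (is_Cseries_unique _ _ E).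
    eapply Rle_trans; [apply (geometric_Cseries _ (K * s ^ 2) rho)|].
    + apply Rmult_le_pos; [assumption|apply pow2_ge_0].
    + assumption.
    + intros n. destruct (H n) as [_ [_ H3]]. specialize (H3 s Hs). lra.
    + right. field. lra.
Qed.

Lemma is_derive_of_quadratic (f : R -> R) (x0 f' d A : R) : 0 < d ->
  (forall x, Rabs (x - x0) <= d -> Rabs (f x - f x0 - (x - x0) * f') <= A * (x - x0) ^ 2) ->
  is_derive f x0 f'.
Proof.
  intros Hd H. apply is_derive_Reals. intros eps He.
  assert (HA : 0 < Rabs A + 1) by (pose proof (Rabs_pos A); lra).
  assert (Hd' : 0 < Rmin d (eps / (Rabs A + 1))) by (apply Rmin_pos; [assumption|apply Rdiv_lt_0_compat; lra]).
  exists (mkposreal _ Hd'). intros h Hh Hhd. simpl in Hhd.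
  pose proof (Rmin_l d (eps / (Rabs A + 1))). pose proof (Rmin_r d (eps / (Rabs A + 1))).
  specialize (H (x0 + h)). replace (x0 + h - x0) with h in H by ring. specialize (H ltac:(lra)).
  pose proof (Rabs_pos_lt h Hh) as Hh0.
  replace ((f (x0 + h) - f x0) / h - f') with ((f (x0 + h) - f x0 - h * f') / h) by (field; assumption).
  unfold Rdiv. rewrite Rabs_mult, Rabs_inv.
  apply Rmult_lt_reg_r with (Rabs h); [assumption|]. rewrite Rmult_assoc, Rinv_l by lra.
  rewrite <- pow2_abs in H. pose proof (Rle_abs A).
  assert (Hhe : Rabs h < eps / (Rabs A + 1)) by lra.
  apply Rmult_lt_compat_r with (r := Rabs A + 1) in Hhe; [|assumption].
  replace (eps / (Rabs A + 1) * (Rabs A + 1)) with eps in Hhe by (field; lra). nra.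
Qed.

Lemma quad_at_is_derive d A F F' (f : R -> C) x0 : 0 < d -> quad_at d A F F' ->
  (forall s, Rabs s <= d -> f (x0 + s) = F s) -> is_Cderive f x0 F'.
Proof.
  intros Hd [_ [_ H]] E.
  assert (E0 : f x0 = F 0) by (rewrite <- (E 0) by (rewrite Rabs_R0; lra); f_equal; ring).
  assert (H' : forall x, Rabs (x - x0) <= d -> Cmod (f x - f x0 - RtoC (x - x0) * F') <= A * (x - x0) ^ 2).
  { intros x Hx. rewrite E0. replace (f x) with (F (x - x0)); [now apply H|].
    rewrite <- E by assumption. f_equal. ring. }
  apply is_derive_C. split; apply (is_derive_of_quadratic _ _ _ d A Hd); intros x Hx;
    (eapply Rle_trans; [|apply (H' x Hx)]).
  - eapply Rle_trans; [|apply Re_le_Cmod']. right. f_equal. unfold Re; simpl. ring.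
  - eapply Rle_trans; [|apply Im_le_Cmod]. right. f_equal. unfold Im; simpl. ring.
Qed.

Definition ladder_prefactor (lambda : R) : C :=
  if Req_EM_T lambda 0 then 1%C else CGamma (RtoC lambda).

(** For lambda = 0 the exponent -n/2 contributes |z|^(-n), which later turns z^n + zbar^n into u^n +
    ubar^n. What remains is the same kernel in both cases. *)
Lemma ladder_integrand_eq beta L lambda n (z v : C) :
  ladder_integrand beta L lambda n z v =
  (RtoC (if Req_EM_T lambda 0 then exp (- / 2 * ln (zzbar z)) ^ n else 1)
   * ladder_kernel beta L ((lambda + INR n + 1) / 2) (ln (zzbar z)) 0 v)%C.
Proof.
  unfold ladder_integrand, ladder_kernel. unfold Cdiv. rewrite inv_tau. cbn [Cpow].
  destruct (Req_EM_T lambda 0).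
  - unfold Rcpow. rewrite exp_pow_INR, <- Cexp_R.
    replace ((Ci * v - RtoC (INR n / 2)) * RtoC (ln (zzbar z)))%C with
     (RtoC (INR n * (- / 2 * ln (zzbar z))) + RtoC (ln (zzbar z)) * (Ci * v))%C.
    + rewrite Cexp_add. ring.
    + replace (INR n * (- / 2 * ln (zzbar z))) with (- (INR n / 2) * ln (zzbar z)) by field.
      rewrite RtoC_mult, RtoC_opp. ring.
  - unfold Rcpow. replace (Ci * v * RtoC (ln (zzbar z)))%C with (RtoC (ln (zzbar z)) * (Ci * v))%C by ring. ring.
Qed.

Lemma scal_Cmult (k : R) (w : C) : scal (V := C_R_NormedModule) k w = (RtoC k * w)%C.
Proof. apply C_ext; [change (k * Re w = k * Re w - 0 * Im w)|change (k * Im w = k * Im w + 0 * Re w)]; ring. Qed.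

Lemma ladder_contour_integral beta L lambda n (z J : C) g :
  is_RInt_gen (V := C_R_NormedModule) (along g (ladder_kernel beta L ((lambda + INR n + 1) / 2) (ln (zzbar z)) 0))
    (Rbar_locally m_infty) (Rbar_locally p_infty) J ->
  let k := if Req_EM_T lambda 0 then exp (- / 2 * ln (zzbar z)) ^ n else 1 in
  ex_contour_integral g (ladder_integrand beta L lambda n z) /\
  contour_integral g (ladder_integrand beta L lambda n z) = (RtoC k * J)%C.
Proof.
  intros H k.
  assert (H1 : is_RInt_gen (V := C_R_NormedModule)
      (fun t => scal (V := C_R_NormedModule) k (along g (ladder_kernel beta L ((lambda + INR n + 1) / 2) (ln (zzbar z)) 0) t))
      (Rbar_locally m_infty) (Rbar_locally p_infty) (scal (V := C_R_NormedModule) k J)).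
  { now apply (is_RInt_gen_scal (V := C_R_NormedModule)). }
  assert (E : (fun t => scal (V := C_R_NormedModule) k (along g (ladder_kernel beta L ((lambda + INR n + 1) / 2) (ln (zzbar z)) 0) t)) =
     along g (ladder_integrand beta L lambda n z)).
  { apply functional_extensionality. intros t. unfold along at 2. rewrite ladder_integrand_eq. fold k.
    unfold along. set (X := (ladder_kernel _ _ _ _ _ _)). set (Y := path_velocity g t).
    rewrite <- Cmult_assoc. apply scal_Cmult. }
  rewrite E in H1.
  rewrite scal_Cmult in H1. split; [now exists (RtoC k * J)%C|].
  exact (is_RInt_gen_unique (V := C_R_CompleteNormedModule) (Fa := Rbar_locally m_infty) (Fb := Rbar_locally p_infty) _ _ H1).
Qed.

Lemma ladder_term_eq beta L lambda n c (z J : C) : 0 <= lambda -> z <> 0%C ->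
  is_RInt_gen (V := C_R_NormedModule) (along (c n) (ladder_kernel beta L ((lambda + INR n + 1) / 2) (ln (zzbar z)) 0))
    (Rbar_locally m_infty) (Rbar_locally p_infty) J ->
  ladder_term beta L lambda c z n = (ang lambda n (unit_of z) * J)%C.
Proof.
  intros Hlam Hz H. apply ladder_contour_integral in H. destruct H as [_ H].
  unfold ladder_term, ang. rewrite H. destruct (Req_EM_T lambda 0) as [E|E].
  - destruct n as [|n]; [simpl; ring|].
    assert (P : forall x : C, ((x * RtoC (exp (- / 2 * ln (zzbar z)))) ^ S n)%C = (x ^ S n * RtoC (exp (- / 2 * ln (zzbar z)) ^ S n))%C).
    { intros x. rewrite Cpow_mult_l, RtoC_pow. reflexivity. }
    assert (EC : Cconj (unit_of z) = (Cconj z * RtoC (exp (- / 2 * ln (zzbar z))))%C).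
    { unfold unit_of. apply C_ext; unfold Re, Im; simpl; ring. }
    rewrite EC. unfold unit_of. rewrite !P. ring.
  - rewrite Cmult_1_l, <- gegenbauer_eq by (try apply unit_of_Cmod; assumption).
    do 4 f_equal. unfold unit_of. rewrite exp_half_log by assumption.
    assert (Hm : 0 < Cmod z) by now apply Cmod_gt_0.
    rewrite zzbar_Cmod, sqrt_pow2 by lra. unfold Re, Im; simpl. field. lra.
Qed.

Lemma ladder_eq beta L lambda c (z S : C) (J : nat -> C) : 0 <= lambda -> z <> 0%C ->
  (forall n, is_RInt_gen (V := C_R_NormedModule) (along (c n) (ladder_kernel beta L ((lambda + INR n + 1) / 2) (ln (zzbar z)) 0))
    (Rbar_locally m_infty) (Rbar_locally p_infty) (J n)) ->
  is_Cseries (fun n => ang lambda n (unit_of z) * J n)%C S ->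
  ladder beta L lambda c z = (ladder_prefactor lambda * (RtoC (exp (- (lambda / 2) * ln (zzbar z))) * S))%C.
Proof.
  intros Hlam Hz HJ HS.
  assert (ET : forall n, (ang lambda n (unit_of z) * J n)%C = ladder_term beta L lambda c z n).
  { intros n. symmetry. now apply ladder_term_eq. }
  apply (is_Cseries_ext _ _ _ ET) in HS.
  unfold ladder, ladder_prefactor. destruct (Req_EM_T lambda 0) as [E|E].
  (* For lambda = 0 the power of z zbar is 1, and [ladder] splits off the term n = 0, which is put
     back into the series. *)
  - subst lambda. replace (- (0 / 2) * ln (zzbar z)) with 0 by field. rewrite exp_0.
    replace (1 * (RtoC 1 * S))%C with S by ring.
    destruct HS as [H1 H2].
    rewrite <- (is_Cseries_unique (ladder_term beta L 0 c z) S) by (now split).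
    apply C_ext; simpl.
    + symmetry. apply (Series_incr_1 (fun n => Re (ladder_term beta L 0 c z n))). now exists (Re S).
    + symmetry. apply (Series_incr_1 (fun n => Im (ladder_term beta L 0 c z n))). now exists (Im S).
  - rewrite (is_Cseries_unique _ _ HS). unfold Rpower, Cdiv. rewrite <- RtoC_inv, <- exp_Ropp by apply Rgt_not_eq, exp_pos.
    replace (- (lambda / 2 * ln (zzbar z))) with (- (lambda / 2) * ln (zzbar z)) by ring. ring.
Qed.

Lemma ladder_prefactor_succ lambda : 0 <= lambda ->
  ladder_prefactor (lambda + 1) = (ladder_prefactor lambda * RtoC (if Req_EM_T lambda 0 then 1 else lambda))%C.
Proof.
  intros Hlam. unfold ladder_prefactor. destruct (Req_EM_T (lambda + 1) 0); [lra|].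
  destruct (Req_EM_T lambda 0) as [->|].
  - rewrite Rplus_0_l, CGamma_1. ring.
  - rewrite CGamma_succ by lra. ring.
Qed.

Lemma ang_geometric (lambda sigma : R) (u : C) : 0 <= lambda -> 1 < sigma -> Cmod u = 1 ->
  exists K, 0 <= K /\ forall n, Cmod (ang lambda n u) <= K * sigma ^ n.
Proof.
  intros Hlam Hs Hu.
  destruct (quad_at_ang 1 1 (fun _ => u) 0%C lambda sigma) as [K [HK H]]; try lra; try assumption.
  - split; [lra|]. split.
    + replace (0 * u)%C with (RtoC 0) by ring. rewrite Cmod_0. lra.
    + intros s _. replace (u - u - s * (0 * u))%C with (RtoC 0) by ring. rewrite Cmod_0. pose proof (pow2_ge_0 s). lra.
  - intros _ _. exact Hu.
  - apply C_ext; unfold Re, Im; simpl; ring.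
  - exists K. split; [assumption|]. intros n. apply (H n).
Qed.

(** sigma = (1 + 1/r)/2 exceeds 1 and thus dominates the subexponential angular factors, while sigma
    r = (1 + r)/2 < 1 keeps the products geometric. *)
Lemma geometric_slack r : 0 < r < 1 -> 1 < (1 + / r) / 2 /\ 0 <= (1 + / r) / 2 * r < 1.
Proof.
  intros Hr. assert (1 < / r) by (rewrite <- Rinv_1; apply Rinv_lt_contravar; lra).
  replace ((1 + / r) / 2 * r) with ((1 + r) / 2) by (field; lra). lra.
Qed.

Lemma ang_series (lambda K r : R) (u : C) (T : nat -> C) : 0 <= lambda -> Cmod u = 1 -> 0 <= K -> 0 < r < 1 ->
  (forall n, Cmod (T n) <= K * r ^ n) ->
  let a := fun n => (ang lambda n u * T n)%C in
  is_Cseries a (CSeries a) /\ ex_series (V := C_R_NormedModule) a.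
Proof.
  intros Hlam Hu HK Hr HT a. destruct (geometric_slack r Hr) as [Hs Hsr].
  destruct (ang_geometric lambda _ u Hlam Hs Hu) as [K1 [HK1 H1]].
  destruct (geometric_Cseries a (K1 * K) ((1 + / r) / 2 * r)) as [E1 [E2 _]]; try assumption; [now apply Rmult_le_pos| |now split].
  intros n. unfold a. rewrite Cmod_mult, Rpow_mult_distr.
  replace (K1 * K * (((1 + / r) / 2) ^ n * r ^ n)) with (K1 * ((1 + / r) / 2) ^ n * (K * r ^ n)) by ring.
  apply Rmult_le_compat; try apply Cmod_ge_0; auto.
Qed.

(** The term n = 0 vanishes, and [dang_succ] turns the others into terms for lambda + 1. The
    integrals are shifted to T (S n), in accordance with lambda + (n + 1) = (lambda + 1) + n. *)
Lemma dang_series (lambda K r : R) (u : C) (T : nat -> C) : 0 <= lambda -> Cmod u = 1 -> 0 <= K -> 0 < r < 1 ->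
  (forall n, Cmod (T n) <= K * r ^ n) ->
  is_Cseries (fun n => dang lambda n u * T n)%C
    ((u - Cconj u) * RtoC (if Req_EM_T lambda 0 then 1 else lambda)
     * CSeries (fun n => ang (lambda + 1) n u * T (S n)))%C.
Proof.
  intros Hlam Hu HK Hr HT.
  destruct (ang_series (lambda + 1) (K * r) r u (fun n => T (S n))) as [H _]; try assumption; try lra; [nra| |].
  - intros n. eapply Rle_trans; [apply HT|]. simpl. lra.
  - apply (is_Cseries_mult ((u - Cconj u) * RtoC (if Req_EM_T lambda 0 then 1 else lambda))%C) in H.
    apply (is_Cseries_ext _ (fun n => dang lambda (S n) u * T (S n))%C) in H.
    2:{ intros n. rewrite dang_succ by assumption. ring. }
    apply (is_Cseries_cons (fun n => dang lambda n u * T n)%C) in H.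
    rewrite dang_0 in H. replace (0 * T O)%C with (RtoC 0) in H by ring. rewrite Cplus_0_l in H. exact H.
Qed.

(** * Directional derivatives of the ladder function at a point *)

Section Ladder_at_a_point.

Variables (beta : C) (L : nat) (lambda : R) (c : nat -> R -> C) (z : C) (J1 : nat -> C) (K r : R).
Let l0 := ln (zzbar z).
Let J (n : nat) (l : R) : C := ladder_integral beta L ((lambda + INR n + 1) / 2) (c n) l.
Hypothesis Hlam : 0 <= lambda.
Hypothesis Hz : z <> 0%C.
Hypothesis HK : 0 <= K.
Hypothesis Hr : 0 < r < 1.
Hypothesis HJ : forall n, expansion_bound beta L ((lambda + INR n + 1) / 2) l0 (c n) (J1 n) (K * r ^ n).

Lemma ladder_integral_is_RInt n l : Rabs (l - l0) <= Rabs l0 / 32 ->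
  is_RInt_gen (V := C_R_NormedModule) (along (c n) (ladder_kernel beta L ((lambda + INR n + 1) / 2) l 0))
      (Rbar_locally m_infty) (Rbar_locally p_infty) (J n l).
Proof. intros Hl. destruct (HJ n) as [_ [_ H]]. now apply H. Qed.

Lemma near_log : Rabs (l0 - l0) <= Rabs l0 / 32.
Proof. rewrite Rminus_eq_0, Rabs_R0. pose proof (Rabs_pos l0). lra. Qed.

Lemma ladder_series : is_Cseries (fun n => ang lambda n (unit_of z) * J n l0)%C
    (CSeries (fun n => ang lambda n (unit_of z) * J n l0)%C) /\
  ex_series (V := C_R_NormedModule) (fun n => ang lambda n (unit_of z) * J n l0)%C.
Proof.
  apply (ang_series lambda K r); try assumption; [now apply unit_of_Cmod|]. intros n. apply (HJ n).
Qed.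

Lemma ladder_converges_at : ladder_converges beta L lambda c z.
Proof.
  split.
  - intros n. refine (proj1 (ladder_contour_integral beta L lambda n z (J n l0) (c n) _)).
    apply ladder_integral_is_RInt, near_log.
  - eapply ex_series_ext; [|apply ladder_series]. intros n. symmetry.
    apply ladder_term_eq; try assumption. apply ladder_integral_is_RInt, near_log.
Qed.

Lemma ladder_value : ladder beta L lambda c z =
  (ladder_prefactor lambda * (RtoC (exp (- (lambda / 2) * l0)) * CSeries (fun n => ang lambda n (unit_of z) * J n l0)))%C.
Proof.
  apply (ladder_eq beta L lambda c z _ (fun n => J n l0)); try assumption; [|apply ladder_series].
  intros n. apply ladder_integral_is_RInt, near_log.
Qed.

(* The derivative in the direction [x] splits into an angular part and a part that depends
   only on the variation of [z zbar]; the latter is annihilated by [Rd]. *)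
Lemma ladder_line_expansion : l0 <> 0 ->
  exists X : C, forall x : C, exists d A, 0 < d /\
  quad_at d A (fun s => ladder beta L lambda c (line_at z x s))
    (ladder_prefactor lambda * RtoC (exp (- (lambda / 2) * l0)) *
      (ang_speed z x * ((unit_of z - Cconj (unit_of z)) * RtoC (if Req_EM_T lambda 0 then 1 else lambda)
        * CSeries (fun n => ang (lambda + 1) n (unit_of z) * J (S n) l0))
       + RtoC (2 * Re (x / z)) * X))%C.
Proof.
  intros Hl0.
  set (Q := CSeries (fun n => ang lambda n (unit_of z) * J1 n)%C).
  set (S0 := CSeries (fun n => ang lambda n (unit_of z) * J n l0)%C).
  set (P := ((unit_of z - Cconj (unit_of z)) * RtoC (if Req_EM_T lambda 0 then 1 else lambda)
        * CSeries (fun n => ang (lambda + 1) n (unit_of z) * J (S n) l0))%C).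
  (* The derivative in l of exp (-lambda l/2) times the series, with u held fixed and the
     exponential divided out. *)
  exists (Q - RtoC (lambda / 2) * S0)%C. intros x.
  set (rho := Rabs l0 / 32).
  assert (Hrho : 0 < rho) by (pose proof (Rabs_pos_lt l0 Hl0); unfold rho; lra).
  destruct (line_data z x rho Hz Hrho) as [d [A [Al [Hd [HAl [Hl' [Hne [Hl Hu]]]]]]]].
  set (l := fun s => ln (zzbar (line_at z x s))). set (u := fun s => unit_of (line_at z x s)).
  set (l' := 2 * Re (x / z)) in *. set (w := ang_speed z x) in *.
  assert (El : l 0 = l0) by (unfold l, l0; now rewrite line_at_0).
  assert (Eu : u 0 = unit_of z) by (unfold u; now rewrite line_at_0).
  destruct (geometric_slack r Hr) as [Hs Hsr]. set (sigma := (1 + / r) / 2) in *.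
  assert (Hu1 : forall s, Rabs s <= d -> Cmod (u s) = 1) by (intros; apply unit_of_Cmod; auto).
  destruct (quad_at_ang d A u w lambda sigma) as [Ka [HKa HA]]; try lra; try assumption; [apply ang_speed_conj|].
  set (M := 1 + Al + 4 * Al ^ 2).
  assert (HM : 0 <= M) by (unfold M; pose proof (pow2_ge_0 Al); lra).
  assert (HQJ : forall n, quad_at d (K * r ^ n * M) (fun s => J n (l s)) (RtoC l' * J1 n)%C).
  { intros n. destruct (HJ n) as [B1 [B2 B3]].
    refine (quad_at_comp d l l' Al (K * r ^ n) rho (J n) (J1 n) (proj2 Hd) HAl Hl' Hl _ B2 _); rewrite El.
    - exact B1.
    - intros y Hy. now apply B3. }
  assert (HF : forall n, quad_at d (6 * Ka * (K * M) * (sigma * r) ^ n) (fun s => ang lambda n (u s) * J n (l s))%C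
      (w * dang lambda n (unit_of z) * J n l0 + ang lambda n (unit_of z) * (RtoC l' * J1 n))%C).
  { intros n. pose proof (quad_at_mult d _ _ _ _ _ _ ltac:(lra) (HA n) (HQJ n)) as H. cbv beta in H.
    rewrite El, Eu in H. eapply quad_at_mono; [|exact H]. right. rewrite Rpow_mult_distr. ring. }
  assert (HS := quad_at_CSeries d (6 * Ka * (K * M)) (sigma * r) _ _ ltac:(lra)
     ltac:(repeat apply Rmult_le_pos; lra) Hsr HF).
  assert (ES : CSeries (fun n => w * dang lambda n (unit_of z) * J n l0 + ang lambda n (unit_of z) * (RtoC l' * J1 n))%C
      = (w * P + RtoC l' * Q)%C).
  { apply is_Cseries_unique.
    apply (is_Cseries_ext (fun n => w * (dang lambda n (unit_of z) * J n l0) + RtoC l' * (ang lambda n (unit_of z) * J1 n))%C); [intros; ring|].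
    apply is_Cseries_plus; apply is_Cseries_mult.
    - apply (dang_series lambda K r _ (fun n => J n l0)); try assumption; [now apply unit_of_Cmod|]. intros n. apply (HJ n).
    - apply (ang_series lambda K r); try assumption; [now apply unit_of_Cmod|]. intros n. apply (HJ n). }
  rewrite ES in HS.
  destruct (exp_expansion (- (lambda / 2)) l0 rho) as [Be [HBe [E1 [E2 E3]]]].
  assert (HE : quad_at d (Be * M) (fun s => RtoC (exp (- (lambda / 2) * l s)))
     (RtoC l' * RtoC (- (lambda / 2) * exp (- (lambda / 2) * l0)))%C).
  { apply (quad_at_comp d l l' Al Be rho (fun y => RtoC (exp (- (lambda / 2) * y)))); try lra; try assumption; rewrite El; assumption. }
  pose proof (quad_at_scal d _ (ladder_prefactor lambda) _ _ (quad_at_mult d _ _ _ _ _ _ ltac:(lra) HE HS)) as H.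
  exists d. eexists. split; [lra|]. cbv beta in H. rewrite El, Eu in H. fold S0 in H.
  replace (ladder_prefactor lambda * RtoC (exp (- (lambda / 2) * l0)) * (w * P + RtoC l' * (Q - RtoC (lambda / 2) * S0)))%C with
    (ladder_prefactor lambda *
       (RtoC l' * RtoC (- (lambda / 2) * exp (- (lambda / 2) * l0)) * S0 +
        RtoC (exp (- (lambda / 2) * l0)) * (w * P + RtoC l' * Q)))%C.
  2:{ rewrite RtoC_mult, RtoC_opp. ring. }
  (* So far only a formula was expanded. It equals [ladder] at the nearby points because their
     logarithms stay within |l0|/32 of l0, where the integrals converge. *)
  eapply quad_at_ext; [|lra|exact H]. intros s Hs'. symmetry.
  apply (ladder_eq beta L lambda c _ _ (fun n => J n (l s))); [assumption|now apply Hne| |].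
  - intros n. apply ladder_integral_is_RInt. destruct (Hl s Hs') as [_ H2]. rewrite line_at_0 in H2. exact H2.
  - apply (geometric_Cseries _ (3 * (6 * Ka * (K * M))) (sigma * r)); [repeat apply Rmult_le_pos; lra|assumption|].
    intros n. eapply Rle_trans; [apply (quad_at_bound d _ _ _ s ltac:(lra) (HF n) Hs')|]. lra.
Qed.

End Ladder_at_a_point.

Lemma is_Cderive_Derive (f : R -> C) (x0 : R) (f' : C) : is_Cderive f x0 f' ->
  (Derive (fun x => Re (f x)) x0, Derive (fun x => Im (f x)) x0) = f'.
Proof.
  intros H. apply is_derive_C in H. destruct H as [H1 H2].
  apply C_ext; apply is_derive_unique; assumption.
Qed.

(* [A] and [B] are the coefficients of [z dz - zbar dzbar] and of the radial derivative;
   only the former survives. *)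
Lemma Rd_of_line_derivatives (f : C -> C) (z A B : C) : z <> 0%C ->
  (forall x : C, exists d K, 0 < d /\
     quad_at d K (fun s => f (line_at z x s)) (ang_speed z x * A + RtoC (2 * Re (x / z)) * B)%C) ->
  ex_partials f z /\ Rd f z = (/ (z - Cconj z) * A)%C.
Proof.
  intros Hz H.
  assert (Hzc : Cconj z <> 0%C).
  { intros E. apply Hz. rewrite <- (Cconj_conj z), E. apply C_ext; unfold Re, Im; simpl; ring. }
  destruct (H 1%C) as [d1 [K1 [Hd1 H1]]]. destruct (H Ci) as [d2 [K2 [Hd2 H2]]].
  assert (D1 : is_Cderive (fun x => f (x, Im z)) (Re z) (ang_speed z 1 * A + RtoC (2 * Re (1 / z)) * B)%C).
  { apply (quad_at_is_derive d1 K1 _ _ _ _ Hd1 H1). intros s _. f_equal.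
    unfold line_at. apply C_ext; unfold Re, Im; simpl; ring. }
  assert (D2 : is_Cderive (fun y => f (Re z, y)) (Im z) (ang_speed z Ci * A + RtoC (2 * Re (Ci / z)) * B)%C).
  { apply (quad_at_is_derive d2 K2 _ _ _ _ Hd2 H2). intros s _. f_equal.
    unfold line_at. apply C_ext; unfold Re, Im; simpl; ring. }
  split; [split; eexists; eassumption|].
  assert (DX : Defs.Dx f z = (ang_speed z 1 * A + RtoC (2 * Re (1 / z)) * B)%C) by exact (is_Cderive_Derive _ _ _ D1).
  assert (DY : Dy f z = (ang_speed z Ci * A + RtoC (2 * Re (Ci / z)) * B)%C) by exact (is_Cderive_Derive _ _ _ D2).
  unfold Rd, wirtinger_z, wirtinger_zbar. rewrite DX, DY. unfold ang_speed.
  rewrite <- !add_conj.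
  assert (E1 : Cconj (1 / z) = (1 / Cconj z)%C).
  { unfold Cdiv. rewrite Cmult_conj, Cinv_conj by assumption. f_equal. apply C_ext; unfold Re, Im; simpl; ring. }
  assert (E2 : Cconj (Ci / z) = (- Ci / Cconj z)%C).
  { unfold Cdiv. rewrite Cmult_conj, Cinv_conj by assumption. f_equal. apply C_ext; unfold Re, Im; simpl; ring. }
  rewrite E1, E2. f_equal. set (zb := Cconj z) in *.
  assert (EC : (Ci * Ci = - (1))%C) by (apply C_ext; unfold Re, Im; simpl; ring).
  (* The Wirtinger derivatives come out as (A/2 + B)/z and (B - A/2)/zbar, so B cancels in the
     difference. *)
  replace (((Ci / z - - Ci / zb) / 2 * A + (Ci / z + - Ci / zb) * B))%C with
    (Ci * ((1 / z + 1 / zb) / 2 * A + (1 / z - 1 / zb) * B))%C by (field; split; assumption).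
  set (X := ((1 / z + 1 / zb) / 2 * A + (1 / z - 1 / zb) * B)%C).
  replace (Ci * (Ci * X))%C with (- X)%C.
  2:{ rewrite Cmult_assoc, EC. ring. }
  unfold X. field. now split.
Qed.

Theorem proposition1 :
  forall (lambda : R) (L : nat) (beta : C),
    0 <= lambda ->
    0 < Re beta ->
    (forall k : nat, beta <> RtoC (lambda + 1 + INR k)) ->
  forall c c' : nat -> R -> C,
    (forall n, admissible beta lambda n (c n)) ->
    (forall n, admissible beta (lambda + 1) n (c' n)) ->
  forall z : C,
    z <> Cconj z ->
    Cmod z <> 1 ->
    ladder_converges beta L lambda c z /\
    ladder_converges beta L (lambda + 1) c' z /\
    ex_partials (ladder beta L lambda c) z /\
    Rd (ladder beta L lambda c) z = ladder beta L (lambda + 1) c' z.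
Proof.
  intros lambda L beta Hlam Hb _ c c' Hc Hc' z Hzz Hz1.
  assert (Hz : z <> 0%C).
  { intros ->. apply Hzz. apply C_ext; unfold Re, Im; simpl; ring. }
  pose proof (proj1 (Cmod_gt_0 z) Hz) as Hm.
  set (l0 := ln (zzbar z)).
  (* |z| <> 1 means l0 <> 0: its sign decides the direction of the lift and its size the rate of
     decay. *)
  assert (Hl0 : l0 <> 0).
  { unfold l0. rewrite zzbar_Cmod. intros E. apply Hz1.
    rewrite <- ln_1 in E. apply ln_inv in E; nra. }
  destruct (ladder_integral_family beta L lambda l0 c Hlam Hb Hl0 Hc) as [J1 [K [r [HK [Hr HJ]]]]].
  assert (Hlam' : 0 <= lambda + 1) by lra.
  destruct (ladder_integral_family beta L (lambda + 1) l0 c' Hlam' Hb Hl0 Hc') as [J1' [K' [r' [HK' [Hr' HJ']]]]].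
  split; [now apply (ladder_converges_at beta L lambda c z J1 K r)|].
  split; [now apply (ladder_converges_at beta L (lambda + 1) c' z J1' K' r')|].
  destruct (ladder_line_expansion beta L lambda c z J1 K r Hlam Hz HK Hr HJ Hl0) as [X HX].
  set (P := ((unit_of z - Cconj (unit_of z)) * RtoC (if Req_EM_T lambda 0 then 1 else lambda)
    * CSeries (fun n => ang (lambda + 1) n (unit_of z)
        * ladder_integral beta L ((lambda + INR (S n) + 1) / 2) (c (S n)) l0))%C).
  set (G := (ladder_prefactor lambda * RtoC (exp (- (lambda / 2) * l0)))%C).
  destruct (Rd_of_line_derivatives (ladder beta L lambda c) z (G * P)%C (G * X)%C Hz) as [H1 H2].
  { intros x. destruct (HX x) as [d [A [Hd H]]]. exists d, A. split; [assumption|].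
    replace (ang_speed z x * (G * P) + RtoC (2 * Re (x / z)) * (G * X))%C with
      (G * (ang_speed z x * P + RtoC (2 * Re (x / z)) * X))%C by ring. exact H. }
  split; [assumption|]. rewrite H2.
  rewrite (ladder_value beta L (lambda + 1) c' z J1' K' r' Hlam' Hz HK' Hr' HJ').
  (* As (lambda + 1) + n = lambda + (n + 1), the contours c' n and c (S n) separate the same poles
     of the same kernel, so independence of the contour identifies the integrals. *)
  assert (EJ : forall n, ladder_integral beta L ((lambda + 1 + INR n + 1) / 2) (c' n) l0
     = ladder_integral beta L ((lambda + INR (S n) + 1) / 2) (c (S n)) l0).
  { intros n. assert (Ea : (lambda + INR (S n) + 1) / 2 = (lambda + 1 + INR n + 1) / 2) by (rewrite S_INR; field).
    rewrite Ea. symmetry.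
    apply (ladder_integral_contour beta L ((lambda + 1 + INR n + 1) / 2) l0 (c' n) (c (S n))); try assumption.
    - apply Hc'.
    - apply Hc.
    - now apply admissible_separated.
    - rewrite <- Ea. now apply admissible_separated.
    - apply (ladder_integral_is_RInt beta L (lambda + 1) c' z J1' K' r' HJ'). apply near_log. }
  fold l0. unfold P.
  replace (fun n => ang (lambda + 1) n (unit_of z) * ladder_integral beta L ((lambda + 1 + INR n + 1) / 2) (c' n) l0)%C with
    (fun n => ang (lambda + 1) n (unit_of z) * ladder_integral beta L ((lambda + INR (S n) + 1) / 2) (c (S n)) l0)%C.
  2:{ apply functional_extensionality. intros n. now rewrite EJ. }
  set (Sig := CSeries _).
  rewrite ladder_prefactor_succ by assumption.
  (* The power of z zbar for lambda + 1 contains an additional 1/|z|, which matches u - ubar = (z -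
     zbar)/|z|; then z - zbar cancels against the denominator of [Rd]. *)
  assert (Ee : RtoC (exp (- ((lambda + 1) / 2) * l0)) = (RtoC (exp (- (lambda / 2) * l0)) * RtoC (exp (- / 2 * l0)))%C).
  { rewrite <- RtoC_mult, <- exp_plus. do 2 f_equal. field. }
  assert (Eu : (unit_of z - Cconj (unit_of z))%C = ((z - Cconj z) * RtoC (exp (- / 2 * l0)))%C).
  { unfold unit_of. fold l0. apply C_ext; unfold Re, Im; simpl; ring. }
  rewrite Ee, Eu. unfold G. field.
  intros E. apply Hzz. replace z with ((z - Cconj z) + Cconj z)%C at 1 by ring. rewrite E. ring.
Qed.
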